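(* Let $d\ge 1$, $0<s<1$, $p>1$, $T_F,T_I>0$, and let $u\in C^{2s+\varepsilon}_{t,x}(\mathbb{R}^d\times(-T_F,+\infty))$ for some $\varepsilon>0$ be a solution of the backward equation $$(-\partial_t-\Delta)^s u=|u|^{p-1}u\quad\text{in }\mathbb{R}^d\times(-T_F,T_I).$$ Let $[0,T]\subset(-T_F,T_I)$ with $T>0$, and suppose that the (backward) extension $U$ of $u$ belongs to the class $\mathcal{U}([0,T])$. For $t\in(0,T)$ put $$\mathcal{J}(t):=\int_{\mathbb{R}^{d+1}_+}x_0^{1-2s}\frac{|\nabla U|^2}{2}\,\mathcal{G}_s\,dX-\frac{\eta_s}{p+1}\int_{\mathbb{R}^d}|u|^{p+1}\,\tilde{\mathcal{G}}_s\,dx+\frac{s}{p-1}\int_{\mathbb{R}^{d+1}_+}x_0^{1-2s}\frac{U^2}{2t}\,\mathcal{G}_s\,dX,$$ where $U,\nabla U,\mathcal{G}_s$ are evaluated at $(X,t)$ and $u,\tilde{\mathcal{G}}_s$ at $(x,t)$. Then $\mathcal{J}$ is non-decreasing in $(0,T)$, and its derivative is given by $$\frac{d}{dt}\mathcal{J}(t)=\int_{\mathbb{R}^{d+1}_+}x_0^{1-2s}\left(\partial_tU+\frac{X}{2t}\cdot\nabla U+\frac{2s}{p-1}\frac{U}{2t}\right)^2\mathcal{G}_s\,dX .$$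
   Context: Notation: $\mathbb{R}^{d+1}_+=\mathbb{R}_+\times\mathbb{R}^d$ with points $X=(x_0,x)$, $x_0>0$; $a:=1-2s$; $\nabla$ is the gradient in the $X$ variables, $\nabla_{(X,t)}$ the gradient in the $(X,t)$ variables. Parabolic Hölder spaces: for $0<\gamma\le1$, $u\in C^\gamma_{t,x}(\Omega)$ means $u\in L^\infty(\Omega)$ and there is $C>0$ with $|u(x,t)-u(z,\tau)|\le C(|x-z|^2+|t-\tau|)^{\gamma/2}$ for all $(x,t),(z,\tau)\in\Omega$. For $1<\gamma\le2$, it means $u\in L^\infty(\Omega)$, $u$ is $\gamma/2$-Hölder continuous in $t$ uniformly in $x$, and $\nabla_xu$ is $(\gamma-1)$-Hölder continuous in $x$ uniformly in $t$. Backward fractional heat operator: $$(-\partial_t-\Delta)^su(x,t)=\int_t^\infty\int_{\mathbb{R}^d}(u(x,t)-u(z,\tau))\,K_s(x-z,\tau-t)\,dz\,d\tau,\qquad K_s(z,\tau)=\frac{1}{(4\pi)^{d/2}|\Gamma(-s)|}\frac{e^{-|z|^2/4\tau}}{\tau^{d/2+1+s}}.$$ Backward extension of $u$: for $x_0>0$, $$U(x_0,x,t)=\int_0^\infty\int_{\mathbb{R}^d}P^s_{x_0}(z,\tau)\,u(x-z,t+\tau)\,dz\,d\tau,\qquad P^s_{x_0}(z,\tau)=\frac{1}{4^{d/2+s}\pi^{d/2}\Gamma(s)}\frac{x_0^{2s}}{\tau^{d/2+1+s}}e^{-(x_0^2+|z|^2)/4\tau},$$ with $U(0,x,t)=u(x,t)$.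 Constant: $\eta_s:=\dfrac{2s|\Gamma(-s)|}{4^s\Gamma(s)}$. Kernels: for $t>0$, $X\in\overline{\mathbb{R}^{d+1}_+}$, $$\mathcal{G}(X,t)=\frac{1}{(4\pi)^{d/2}\Gamma(s)}\frac{e^{-|X|^2/4t}}{t^{d/2+1-s}},\quad \mathcal{G}_s(X,t)=t^{\frac{2s}{p-1}+1}\mathcal{G}(X,t),\quad \tilde{\mathcal{G}}_s(x,t)=t^{\frac{2s}{p-1}+1}\mathcal{G}((0,x),t).$$ Class $\mathcal{U}([0,T])$: $U:\mathbb{R}^{d+1}_+\times[0,T]\to\mathbb{R}$ belongs to $\mathcal{U}([0,T])$ if $U\in C^2(\mathbb{R}^{d+1}_+\times[0,T])\cap C(\overline{\mathbb{R}^{d+1}_+}\times[0,T])$ and: (a) $\lim_{x_0\to0^+}x_0^{1+a}\partial_tU(x_0,x,t)=0$ for $(x,t)\in\mathbb{R}^d\times[0,T]$, and $x_0^a\partial_{x_0}U\in C(\overline{\mathbb{R}^{d+1}_+}\times[0,T])$; (b) each of $f_U=e^{-|X|^2/8t}\nabla U$, $e^{-|X|^2/8t}U$, $e^{-|X|^2/8t}X\cdot\nabla U$, $e^{-|X|^2/8t}\partial_tU$ belongs to $C((0,T);L^2(\mathbb{R}^{d+1}_+,x_0^a\,dX))$ and satisfies $\sup_{t\in(0,T)}\|f_U(\cdot,t)\|^2_{L^2(\mathbb{R}^{d+1}_+,x_0^adX)}<+\infty$; (c) $\sup_{t\in(0,T)}\|g_U(\cdot,t)e^{-|X|^2/4t}\|_{L^1(\mathbb{R}^{d+1}_+,x_0^adX)}<+\infty$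 for each of $g_U=UH$, $\partial_tU\,H$, $H(X\cdot\nabla U)$, where $$H:=2(X,t)\cdot\nabla_{(X,t)}\partial_tU+(d+1+a)\partial_tU .$$ *)

(* Defs.v *)
From HB Require Import structures.
From mathcomp Require Import all_boot all_order all_algebra.
From mathcomp Require Import all_classical all_reals all_analysis.

Set Implicit Arguments.
Unset Strict Implicit.
Unset Printing Implicit Defensive.

Import Order.TTheory GRing.Theory Num.Theory.
Import numFieldNormedType.Exports.

Local Open Scope classical_set_scope.
Local Open Scope ring_scope.

Section euclidean.
Context {R : realType}.

Definition dotrv n (v w : 'rV[R]_n) : R := \sum_(i < n) v 0 i * w 0 i.

(* The library norm of ['rV[R]_n] is the sup norm, hence these definitions. *)
Definition sqnorm n (v : 'rV[R]_n) : R := \sum_(i < n) v 0 i ^+ 2.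
Definition enorm n (v : 'rV[R]_n) : R := Num.sqrt (sqnorm v).

(* A point X = (x0, x) of R x R^n is [consrv x0 x], with coordinate [ord0]
   equal to x0 and [behrv X] equal to x. *)
Definition consrv n (x0 : R) (x : 'rV[R]_n) : 'rV[R]_n.+1 :=
  \row_i oapp (fun j => x 0 j) x0 (unlift ord0 i).
Definition behrv n (X : 'rV[R]_n.+1) : 'rV[R]_n := \row_j X 0 (lift ord0 j).

Definition grad n (f : 'rV[R]_n -> R) (x : 'rV[R]_n) : 'rV[R]_n :=
  \row_i 'D_('e_i) f x.

Definition halfspace n : set 'rV[R]_n.+1 := [set X | 0 < X 0 ord0].
Definition closed_halfspace n : set 'rV[R]_n.+1 := [set X | 0 <= X 0 ord0].

End euclidean.
Arguments halfspace {R} n.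
Arguments closed_halfspace {R} n.

(* Borel sets of R^n: the sigma-algebra generated by the coordinates. *)
Definition measure_rV_display : measure_display.
Proof. exact: default_measure_display. Qed.

Section measurable_rV.
Context (R : realType) (n : nat).

Let coord (i : 'I_n) (x : 'rV[R]_n) : measurableTypeR R := x 0 i.

Let rV_set0 : g_sigma_preimage coord set0.
Proof. exact: sigma_algebra0. Qed.

Let rV_setC A : g_sigma_preimage coord A -> g_sigma_preimage coord (~` A).
Proof. exact: sigma_algebraC. Qed.

Let rV_bigcup (F : (set _)^nat) : (forall i, g_sigma_preimage coord (F i)) ->
  g_sigma_preimage coord (\bigcup_i (F i)).
Proof. exact: sigma_algebra_bigcup. Qed.

HB.instance Definition _ := @isMeasurable.Build measure_rV_display
  ('rV[R]_n) (g_sigma_preimage coord) rV_set0 rV_setC rV_bigcup.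

End measurable_rV.

Section lebesgue_rV.
Context {R : realType}.

Lemma measurable_coord n (i : 'I_n) :
  measurable_fun [set: 'rV[R]_n] (fun x => x 0 i : measurableTypeR R).
Proof.
move=> _ Y mY; rewrite setTI; apply: sub_sigma_algebra.
rewrite -bigcup_seq/=; exists i => /=; first by rewrite mem_index_enum.
by exists Y => //; rewrite setTI.
Qed.

Lemma measurable_fun_rV d (T : measurableType d) n (f : T -> 'rV[R]_n) :
  (forall i, measurable_fun [set: T] (fun x => f x 0 i : measurableTypeR R)) ->
  measurable_fun [set: T] f.
Proof.
move=> mf _ Y mY; rewrite setTI.
pose G := [set A | measurable (f @^-1` A)].
suff : measurable `<=` G by apply.
apply: smallest_sub.
  split=> [|A mA|F mF]; rewrite /G /=.
  - by rewrite preimage_set0.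
  - by rewrite setTD preimage_setC; exact: measurableC.
  - by rewrite preimage_bigcup; exact: bigcupT_measurable.
rewrite -bigcup_seq => A [i _ [B mB <-]]; rewrite /G /= setTI.
by have := mf i measurableT B mB; rewrite setTI.
Qed.

Lemma measurable_consrv n : measurable_fun
  [set: measurableTypeR R * 'rV[R]_n] (fun p => consrv p.1 p.2).
Proof.
apply: measurable_fun_rV => i; rewrite /consrv.
case: (unliftP ord0 i) => [j|] ->.
- rewrite (_ : (fun _ => _) = (fun x : 'rV[R]_n => x 0 j : measurableTypeR R) \o snd).
    by apply: measurableT_comp => //; exact: measurable_coord.
  by apply/funext => p /=; rewrite mxE liftK.
- rewrite (_ : (fun _ => _) = fst) //.
  by apply/funext => p /=; rewrite mxE unlift_none.
Qed.

Lemma measurable_behrv n : measurable_fun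
  [set: 'rV[R]_n.+1] (fun X => (X 0 ord0 : measurableTypeR R, behrv X)).
Proof.
apply: measurable_fun_pair; first exact: measurable_coord.
apply: measurable_fun_rV => i.
rewrite (_ : (fun _ => _) = (fun X : 'rV[R]_n.+1 => X 0 (lift ord0 i) : measurableTypeR R)).
  exact: measurable_coord.
by apply/funext => X; rewrite mxE.
Qed.

Lemma consrvK n (p : R * 'rV[R]_n) :
  (consrv p.1 p.2 0 ord0, behrv (consrv p.1 p.2)) = p.
Proof.
case: p => x0 x /=; congr pair; first by rewrite mxE unlift_none.
by apply/rowP => j; rewrite !mxE liftK.
Qed.

Section pushforward_consrv.
Variables (n : nat) (mu : {sigma_finite_measure set 'rV[R]_n -> \bar R}).

Let prod_mu :=
  [the {measure set _ -> \bar R} of product_measure1 (@lebesgue_measure R) mu].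

Definition cons_measure : set 'rV[R]_n.+1 -> \bar R :=
  pushforward prod_mu (fun p => consrv p.1 p.2).

Let mpre (A : set 'rV[R]_n.+1) : measurable A ->
  measurable ((fun p : measurableTypeR R * 'rV[R]_n => consrv p.1 p.2) @^-1` A).
Proof. by move=> mA; have := measurable_consrv measurableT mA; rewrite setTI. Qed.

Let cons_measure0 : cons_measure set0 = 0%E.
Proof. by rewrite /cons_measure /pushforward preimage_set0 measure0. Qed.

Let cons_measure_ge0 A : (0 <= cons_measure A)%E.
Proof. exact: (measure_ge0 prod_mu). Qed.

Let cons_measure_sigma_additive : semi_sigma_additive cons_measure.
Proof.
move=> F mF tF mUF; rewrite /cons_measure /pushforward preimage_bigcup.
apply: measure_semi_sigma_additive.
- by move=> k; exact: mpre.
- apply/trivIsetP => /= i j _ _ ij; rewrite -preimage_setI.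
  by move/trivIsetP : tF => /(_ _ _ _ _ ij) ->//; rewrite preimage_set0.
- by rewrite -preimage_bigcup; exact: mpre.
Qed.

HB.instance Definition _ := isMeasure.Build _ _ _ cons_measure
  cons_measure0 cons_measure_ge0 cons_measure_sigma_additive.

Let cons_measure_sigma_finite : sigma_finite setT cons_measure.
Proof.
have /sigma_finiteP[F [FT ndF Foo]] := sigma_finiteT (@lebesgue_measure R).
have /sigma_finiteP[G [GT ndG Goo]] := sigma_finiteT mu.
pose g (X : 'rV[R]_n.+1) := (X 0 ord0 : measurableTypeR R, behrv X).
exists (fun k => g @^-1` (F k `*` G k)).
  rewrite -preimage_bigcup; apply/esym; rewrite -subTset => X _ /=.
  have : [set: measurableTypeR R] (X 0 ord0) by [].
  have : [set: 'rV[R]_n] (behrv X) by [].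
  rewrite FT GT => -[k _ Gk] [l _ Fl]; exists (maxn k l) => //=; split => /=.
  - by move: Fl; exact/subsetPset/ndF/leq_maxr.
  - by move: Gk; exact/subsetPset/ndG/leq_maxl.
move=> k; have [mFk Fk] := Foo k; have [mGk Gk] := Goo k; split.
  have := measurable_behrv measurableT (measurableX mFk mGk).
  by rewrite setTI.
rewrite /cons_measure /pushforward -comp_preimage.
rewrite (_ : g \o _ = id) ?preimage_id; last first.
  by apply/funext => p; exact: consrvK.
by rewrite /prod_mu /= product_measure1E// lte_mul_pinfty// ge0_fin_numE.
Qed.

HB.instance Definition _ := Measure_isSigmaFinite.Build _ _ _ cons_measure
  cons_measure_sigma_finite.

End pushforward_consrv.

(* Lebesgue measure on R^n, as the n-fold product of the one-dimensional one. *)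
Fixpoint lebesgue_rV n : {sigma_finite_measure set 'rV[R]_n -> \bar R} :=
  if n is m.+1 then cons_measure (lebesgue_rV m)
  else dirac (0 : 'rV[R]_0).

End lebesgue_rV.

Section gamma.
Context {R : realType}.

(* Euler's Gamma function: the integral formula when z > 0, extended by
   Gamma (z + 1) = z * Gamma z when z is negative and not an integer. *)
Definition Gamma (z : R) : R :=
  let n := if 0 < z then 0%N else (Num.truncn (- z)).+1 in
  (\int[lebesgue_measure]_(x in `]0, +oo[) (x `^ (z + n%:R - 1) * expR (- x))) /
  \prod_(k < n) (z + k%:R).

End gamma.

Section parabolic_holder.
Context {R : realType} (d : nat).
Implicit Types (Omega : set ('rV[R]_d * R)) (u : 'rV[R]_d -> R -> R).

Definition Linfty Omega u :=
  let mu := [the {measure set _ -> \bar R} of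
             product_measure1 (lebesgue_rV d) (@lebesgue_measure R)] in
  measurable_fun Omega (fun P => u P.1 P.2) /\
  ('N[mu]_+oo[EFin \o ((fun P => u P.1 P.2) \_ Omega)] < +oo)%E.

(* The space C^gamma_(t,x) is only defined for 0 < gamma <= 2. *)
Definition parabolic_holder (gamma : R) Omega u :=
  Linfty Omega u /\
  ((0 < gamma <= 1 /\
    exists2 C : R, 0 < C & forall x t z tau,
      Omega (x, t) -> Omega (z, tau) ->
      `|u x t - u z tau| <= C * (sqnorm (x - z) + `|t - tau|) `^ (gamma / 2)) \/
   (1 < gamma <= 2 /\
    [/\ exists2 C : R, 0 < C & forall x t tau,
          Omega (x, t) -> Omega (x, tau) ->
          `|u x t - u x tau| <= C * `|t - tau| `^ (gamma / 2),
        forall x t i, Omega (x, t) -> derivable (u^~ t) x 'e_i &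
        exists2 C : R, 0 < C & forall x z t,
          Omega (x, t) -> Omega (z, t) ->
          enorm (grad (u^~ t) x - grad (u^~ t) z) <=
            C * enorm (x - z) `^ (gamma - 1)])).

End parabolic_holder.

Section fractional_heat.
Context {R : realType} (d : nat) (s : R).

Definition heat_kernel (z : 'rV[R]_d) (tau : R) : R :=
  ((4 * pi) `^ (d%:R / 2) * `|Gamma (- s)|)^-1 *
  (expR (- sqnorm z / (4 * tau)) / tau `^ (d%:R / 2 + 1 + s)).

(* The inner integral must be taken first: for s >= 1/2 the integrand is in
   general not absolutely integrable over space-time. *)
Definition backward_heat (u : 'rV[R]_d -> R -> R) (x : 'rV[R]_d) (t : R) : R :=
  \int[lebesgue_measure]_(tau in `]t, +oo[)
    \int[lebesgue_rV d]_(z in setT)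
      ((u x t - u z tau) * heat_kernel (x - z) (tau - t)).

Definition poisson_kernel (x0 : R) (z : 'rV[R]_d) (tau : R) : R :=
  (4 `^ (d%:R / 2 + s) * pi `^ (d%:R / 2) * Gamma s)^-1 *
  (x0 `^ (2 * s) / tau `^ (d%:R / 2 + 1 + s)) *
  expR (- (x0 ^+ 2 + sqnorm z) / (4 * tau)).

(* The [else] branch is the value at x0 = 0; points with x0 < 0 are irrelevant. *)
Definition extension (u : 'rV[R]_d -> R -> R) (X : 'rV[R]_d.+1) (t : R) : R :=
  let x0 := X 0 ord0 in let x := behrv X in
  if 0 < x0 then
    \int[lebesgue_measure]_(tau in `]0, +oo[)
      \int[lebesgue_rV d]_(z in setT)
        (poisson_kernel x0 z tau * u (x - z) (t + tau))
  else u x t.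

Definition eta : R := 2 * s * `|Gamma (- s)| / (4 `^ s * Gamma s).

Definition calG (X : 'rV[R]_d.+1) (t : R) : R :=
  ((4 * pi) `^ (d%:R / 2) * Gamma s)^-1 *
  (expR (- sqnorm X / (4 * t)) / t `^ (d%:R / 2 + 1 - s)).

Definition calGs (p : R) (X : 'rV[R]_d.+1) (t : R) : R :=
  t `^ (2 * s / (p - 1) + 1) * calG X t.

Definition calGs_tilde (p : R) (x : 'rV[R]_d) (t : R) : R :=
  t `^ (2 * s / (p - 1) + 1) * calG (consrv 0 x) t.

End fractional_heat.

Section space_time_derivatives.
Context {R : realType}.

(* Derivative of the restriction of [f] to [I]: one-sided at the end points
   when [I] is a compact interval, the usual derivative in its interior. *)
Definition diff_quot_in (I : set R) (f : R -> R) (t : R) :=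
  (fun h => h^-1 * (f (t + h) - f t)) @ within [set h | I (t + h)] 0^'.
Definition derivable_in I f t := cvg (diff_quot_in I f t).
Definition derive_in I f t : R := lim (diff_quot_in I f t).

Variables (n : nat) (I : set R).
Implicit Types (U : 'rV[R]_n -> R -> R).

(* [Some i] stands for the i-th space variable and [None] for time. *)
Definition pderivable (v : option 'I_n) U X t :=
  if v is Some i then derivable (U^~ t) X 'e_i else derivable_in I (U X) t.
Definition pderive (v : option 'I_n) U X t : R :=
  if v is Some i then 'D_('e_i) (U^~ t) X else derive_in I (U X) t.

Definition continuous_on (D : set 'rV[R]_n) U :=
  {within D `*` I, continuous (fun P => U P.1 P.2)}.

Definition C1_on D U := continuous_on D U /\
  forall v, (forall X t, D X -> I t -> pderivable v U X t) /\
            continuous_on D (pderive v U).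
Definition C2_on D U := C1_on D U /\ forall v, C1_on D (pderive v U).

End space_time_derivatives.

Section class_U.
Context {R : realType} (d : nat) (a T : R).
Implicit Types (U : 'rV[R]_d.+1 -> R -> R).

(* [wint f] is the integral of f over the half-space against x0^a dX. *)
Definition wint (f : 'rV[R]_d.+1 -> R) : \bar R :=
  \int[lebesgue_rV d.+1]_(X in halfspace d) (X 0 ord0 `^ a * f X)%:E.

Definition bounded_wL1 U :=
  (forall t, t \in `]0, T[ -> measurable_fun (halfspace d) (U^~ t)) /\
  (ereal_sup [set wint (fun X => `|U X t|)%R | t in `]0%R, T[] < +oo)%E.

(* f belongs to C((0,T); L^2(x0^a dX)) with bounded norm; scalar functions are
   passed as 1 x 1 matrices. *)
Definition bounded_continuous_wL2 k (f : 'rV[R]_d.+1 -> R -> 'rV[R]_k) :=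
  [/\ forall t, t \in `]0, T[ ->
        measurable_fun (halfspace d) (f^~ t) /\
        (wint (fun X => sqnorm (f X t)) < +oo)%E,
      forall t, t \in `]0, T[ ->
        wint (fun X => sqnorm (f X r - f X t)) @[r --> t] --> 0%E &
      (ereal_sup [set wint (fun X => sqnorm (f X t)) | t in `]0%R, T[] < +oo)%E].

(* [W] below is the continuous extension of x0^a dU/dx0 up to x0 = 0. *)
Definition class_U U :=
  let I := `[0, T]%classic in
  let dt := pderive I None in
  let H X t := 2 * (dotrv X (grad (dt U ^~ t) X) + t * dt (dt U) X t) +
               (d%:R + 1 + a) * dt U X t in
  let w c (X : 'rV[R]_d.+1) t := expR (- sqnorm X / (c * t)) in
  [/\ C2_on I (halfspace d) U /\ continuous_on I (closed_halfspace d) U,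
      (forall x t, t \in `[0, T] ->
        x0 `^ (1 + a) * dt U (consrv x0 x) t @[x0 --> 0^'+] --> 0) /\
      (exists2 W, continuous_on I (closed_halfspace d) W &
        forall X t, halfspace d X -> t \in `[0, T] ->
          W X t = X 0 ord0 `^ a * 'D_('e_ord0) (U^~ t) X),
      [/\ bounded_continuous_wL2 (fun X t => w 8 X t *: grad (U^~ t) X),
          bounded_continuous_wL2 (fun X t => (w 8 X t * U X t)%:M : 'rV_1),
          bounded_continuous_wL2
            (fun X t => (w 8 X t * dotrv X (grad (U^~ t) X))%:M : 'rV_1) &
          bounded_continuous_wL2 (fun X t => (w 8 X t * dt U X t)%:M : 'rV_1)] &
      [/\ bounded_wL1 (fun X t => U X t * H X t * w 4 X t),
          bounded_wL1 (fun X t => dt U X t * H X t * w 4 X t) &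
          bounded_wL1 (fun X t => H X t * dotrv X (grad (U^~ t) X) * w 4 X t)]].

End class_U.

Section functional.
Context {R : realType} (d : nat) (s p : R).

Definition calJ (u : 'rV[R]_d -> R -> R) (t : R) : R :=
  let U := extension s u in
  \int[lebesgue_rV d.+1]_(X in halfspace d)
    (X 0 ord0 `^ (1 - 2 * s) * (sqnorm (grad (U^~ t) X) / 2) * calGs s p X t)
  - eta s / (p + 1) *
    \int[lebesgue_rV d]_(x in setT)
      (`|u x t| `^ (p + 1) * calGs_tilde s p x t)
  + s / (p - 1) *
    \int[lebesgue_rV d.+1]_(X in halfspace d)
      (X 0 ord0 `^ (1 - 2 * s) * (U X t ^+ 2 / (2 * t)) * calGs s p X t).

End functional.

(* Main.v *)
Require Import Defs.
From HB Require Import structures.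
From mathcomp Require Import all_boot all_order all_algebra.
From mathcomp Require Import all_classical all_reals all_analysis.
From mathcomp Require Import measurable_realfun ess_sup_inf.
From mathcomp Require Import ring lra.

Set Implicit Arguments.
Unset Strict Implicit.
Unset Printing Implicit Defensive.

Import Order.TTheory GRing.Theory Num.Theory.
Import numFieldNormedType.Exports.

Local Open Scope classical_set_scope.
Local Open Scope ring_scope.

(* Write be = 2s/(p-1), a = 1-2s and V(t,Y) = t^(be/2) U(sqrt t Y, t). Up to a
   constant, J(t) is the energy
     1/2 int |grad V|^2 dmu + be/4 int V^2 dmu - eta int |V(t,0,y)|^(p+1)/(p+1) dnu
   for the fixed weights dmu = y0^a e^(-|Y|^2/4) dY and dnu = e^(-|y|^2/4) dy, and
   U solves a degenerate heat equation with flux - eta |u|^(p-1) u on the boundary,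
   so that V satisfies, for all admissible test functions f,
     int grad V . grad f dmu + be/2 int V f dmu
       = t int V_t f dmu + eta int |V|^(p-1) V f dnu.
   Nothing is known about grad V_t; so this identity is used at two times t, t'
   with f = W = V(t') - V(t), which gives
     J(t') - J(t) = 1/2 int (t' V_t(t') + t V_t(t)) W dmu + O(int W^2 dnu)
   exactly in the quadratic terms and by the trapezoid rule in the nonlinear one.
   A trace inequality makes the error o(t'-t), while W/(t'-t) tends to V_t in
   L^2(dmu). Hence the derivative is t int V_t^2 dmu, which is the claim after
   scaling back. *)

(** * Lebesgue measure on R^n *)

Section measure_rV.
Context {R : realType}.
Local Notation leb := (@lebesgue_measure R).
Local Notation mu := (@lebesgue_rV R).

(** The trace inequality must hold with an arbitrarily small factor in front of the gradient: the
    weak identities at [t'] and [t], subtracted, bound [int |grad W|^2 dmu] by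
    [|int (t' V_t(t') - t V_t(t)) W dmu|] plus a multiple of [int W^2 dnu], and the latter has to be
    absorbed. What remains is [o(t'-t)], since [V_t(t')] and [W/(t'-t)] both tend to [V_t(t)] in
    L^2(dmu): the first by pointwise convergence together with convergence of the norms, the second
    by Jensen's inequality in time and Tonelli's theorem. The regularity class only says that
    [x0^a dU/dx0] has a continuous limit at the boundary. To identify this limit, the Poisson
    integral is used to show that [(U(x0,x,t) - u(x,t)) / x0^(2s)] converges to a multiple of the
    fractional heat operator, and l'Hopital's rule compares the two limits. The integrals converge
    because [u] is Hölder continuous of an order above [2s]; the first-order term of [u] drops out
    by parity, provided the space integral is taken first. The interior equation for [U] comes from
    differentiating the same Poisson integral. *)

Lemma ge0_integral_affine1 (c b : R) (f : measurableTypeR R -> \bar R) : c != 0 ->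
  measurable_fun [set: measurableTypeR R] f -> (forall x, 0 <= f x)%E ->
  (\int[leb]_x f x = `|c|%:E * \int[leb]_x f (c * x + b)%R)%E.
Proof.
move=> c0 mf f0; pose g (x : measurableTypeR R) : measurableTypeR R := c * x + b.
have mg : measurable_fun [set: measurableTypeR R] g.
  by apply: measurable_funD => //; apply: measurable_funM.
have nc0 : 0 <= `|c| by [].
pose nu0 := mscale (NngNum nc0) (pushforward leb g); pose nu := nu0 mg.
(* Lebesgue measure is determined by its values on intervals []u, v]]. The preimage of such an
   interval is of the same type for [c > 0], but closed on the left and open on the right for
   [c < 0]. *)
have nuE (A : set R) : measurable A -> leb A = nu A.
  apply: (@lebesgue_measure_unique R nu) => _ [[u v] _ <-] /=.
  have guv : g @^-1` `]u, v] = if 0 < c then `](u - b) / c, (v - b) / c]%classic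
     else `[(v - b) / c, (u - b) / c[%classic.
    case: ifPn => [cp|]; last rewrite -leNgt le_eqVlt (negbTE c0) /= => cn.
      apply/seteqP; split => x /=; rewrite !in_itv /= /g ltr_pdivrMr // ler_pdivlMr //;
        move=> /andP[h1 h2]; apply/andP; split; lra.
    apply/seteqP; split => x /=; rewrite !in_itv /= /g ltr_ndivlMr // ler_ndivrMr //;
      move=> /andP[h1 h2]; apply/andP; split; lra.
  rewrite /nu /nu0 /mscale /= /pushforward guv.
  have [uv|uv] := ltP u v; last first.
    rewrite set_itv_ge ?bnd_simp -?leNgt // measure0.
    case: ifPn => [cp|]; last rewrite -leNgt le_eqVlt (negbTE c0) /= => cn.
      by rewrite set_itv_ge ?measure0 ?mule0 // bnd_simp -leNgt ler_pM2r ?invr_gt0 // lerD2r.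
    by rewrite set_itv_ge ?measure0 ?mule0 // bnd_simp -leNgt ler_nM2r ?invr_lt0 // lerD2r.
  case: ifPn => [cp|]; last rewrite -leNgt le_eqVlt (negbTE c0) /= => cn.
    rewrite !lebesgue_measure_itv /= !lte_fin uv ltr_pM2r ?invr_gt0 // ltrD2r uv.
    by rewrite gtr0_norm // -!EFinB -EFinM; congr EFin; field.
  rewrite !lebesgue_measure_itv /= !lte_fin uv ltr_nM2r ?invr_lt0 // ltrD2r uv.
  by rewrite ltr0_norm // -!EFinB -EFinM; congr EFin; field.
rewrite (eq_measure_integral nu); last by move=> A mA _; exact: nuE.
rewrite ge0_integral_mscale //=; congr (_ * _)%E.
by rewrite ge0_integral_pushforward // preimage_setT.
Qed.

Lemma tonelli_rV n (f : 'rV[R]_n.+1 -> \bar R) :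
  measurable_fun setT f -> (forall X, 0 <= f X)%E ->
  (\int[mu n.+1]_X f X = \int[leb]_x \int[mu n]_y f (consrv x y))%E.
Proof.
move=> mf f0.
have mc := @measurable_consrv R n.
transitivity (\int[product_measure1 leb (mu n)]_p f (consrv p.1 p.2))%E.
  exact: (@ge0_integral_pushforward _ _ _ _ R _ mc _ setT f).
rewrite fubini_tonelli1 //; exact: (measurableT_comp mf mc).
Qed.

Lemma tonelli_rV2 n (f : 'rV[R]_n.+1 -> \bar R) :
  measurable_fun setT f -> (forall X, 0 <= f X)%E ->
  (\int[mu n.+1]_X f X = \int[mu n]_y \int[leb]_x f (consrv x y))%E.
Proof.
move=> mf f0; rewrite tonelli_rV //.
apply: (@fubini_tonelli _ _ _ _ R leb (mu n) (fun p => f (consrv p.1 p.2))) => //.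
exact: (measurableT_comp mf (@measurable_consrv R n)).
Qed.

Lemma measurable_consrv1 n (y : 'rV[R]_n) :
  measurable_fun [set: measurableTypeR R] (fun x => consrv x y).
Proof.
apply: (measurableT_comp (@measurable_consrv R n) (g := fun x => (x, y))).
exact: measurable_pair2.
Qed.

Lemma measurable_consrv2 n (x : R) :
  measurable_fun [set: 'rV[R]_n] (fun y => consrv x y).
Proof.
apply: (measurableT_comp (@measurable_consrv R n) (g := fun y => (x : measurableTypeR R, y))).
exact: measurable_pair1.
Qed.

Lemma integrable_consrv n (f : 'rV[R]_n.+1 -> \bar R) :
  (mu n.+1).-integrable setT f ->
  (leb \x mu n)%E.-integrable setT (fun p => f (consrv p.1 p.2)).
Proof.
have mc := @measurable_consrv R n.
move=> /integrableP[mf fi]; apply/integrableP; split.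
  exact: (measurableT_comp mf mc).
move: fi; have := @ge0_integral_pushforward _ _ _ _ R _ mc (leb \x mu n)%E setT (abse \o f).
move=> /= <- //; exact: (measurableT_comp _ mf).
Qed.

Lemma fubini_rV n (f : 'rV[R]_n.+1 -> \bar R) : (mu n.+1).-integrable setT f ->
  (\int[mu n.+1]_X f X = \int[leb]_x \int[mu n]_y f (consrv x y))%E.
Proof.
move=> fi; have fi2 := integrable_consrv fi.
have mc := @measurable_consrv R n.
transitivity (\int[leb \x mu n]_p f (consrv p.1 p.2))%E; last first.
  exact/esym/(integral12_prod_meas1 fi2).
exact: (@integral_pushforward _ _ _ _ R _ mc _ setT f (measurable_int _ fi) fi2 measurableT).
Qed.

Lemma fubini_rV2 n (f : 'rV[R]_n.+1 -> \bar R) : (mu n.+1).-integrable setT f ->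
  (\int[mu n.+1]_X f X = \int[mu n]_y \int[leb]_x f (consrv x y))%E.
Proof.
move=> fi; rewrite fubini_rV //.
exact: (@Fubini _ _ _ _ R leb (mu n) (fun p => f (consrv p.1 p.2)) (integrable_consrv fi)).
Qed.

(** The map acts on each coordinate separately, so Tonelli's theorem splits off one factor [|c|] per
    dimension. *)
Lemma ge0_integral_affine_rV n (c : R) (b : 'rV[R]_n) (f : 'rV[R]_n -> \bar R) :
  c != 0 -> measurable_fun setT f -> (forall x, 0 <= f x)%E ->
  (\int[mu n]_x f x = (`|c| ^+ n)%:E * \int[mu n]_x f (c *: x + b)%R)%E.
Proof.
move=> c0; elim: n b f => [|n IH] b f mf f0.
  rewrite expr0 mul1e; apply: eq_integral => x _; congr f.
  by apply/rowP => -[].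
have ma : measurable_fun [set: 'rV[R]_n.+1] (fun X => c *: X + b).
  apply: measurable_fun_rV => i.
  rewrite (_ : (fun _ => _) = (fun X : 'rV[R]_n.+1 => c * (X 0 i : measurableTypeR R) + b 0 i)).
    apply: measurable_funD => //; apply: measurable_funM => //; exact: measurable_coord.
  by apply/funext => X; rewrite !mxE.
have mfa : measurable_fun setT (fun X : 'rV[R]_n.+1 => f (c *: X + b)) by exact: (measurableT_comp mf ma).
have aE x y : c *: consrv x y + b = consrv (c * x + b 0 ord0) (c *: y + behrv b).
  by apply/rowP => i; rewrite !mxE; case: (unliftP ord0 i) => [j|] -> //=; rewrite !mxE.
rewrite (tonelli_rV mf f0) (tonelli_rV mfa (fun X => f0 _)).
have mF : measurable_fun [set: measurableTypeR R] (fun x => \int[mu n]_y f (consrv x y))%E.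
  apply: (@measurable_fun_fubini_tonelli_F _ _ _ _ R (mu n) (fun p => f (consrv p.1 p.2))).
    exact: (measurableT_comp mf (@measurable_consrv R n)).
  by move=> p; exact: f0.
have F0 (x : measurableTypeR R) : (0 <= \int[mu n]_y f (consrv x y))%E.
  by apply: integral_ge0 => y _; exact: f0.
rewrite (@ge0_integral_affine1 c (b 0 ord0) _ c0 mF F0).
rewrite exprS EFinM -muleA; congr (_ * _)%E.
under eq_integral => x _.
  rewrite (IH (behrv b) (fun y => f (consrv (c * x + b 0 ord0) y))) //; last first.
    exact: (measurableT_comp mf (measurable_consrv2 _)).
  over.
rewrite ge0_integralZl; first last.
- by rewrite lee_fin exprn_ge0.
- by move=> x _; apply: integral_ge0 => y _; exact: f0.
- apply: (@measurable_fun_fubini_tonelli_F _ _ _ _ R (mu n)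
    (fun p => f (consrv (c * p.1 + b 0 ord0) (c *: p.2 + behrv b)))); last by move=> p; exact: f0.
  rewrite (_ : (fun _ => _) = fun p => f (c *: consrv p.1 p.2 + b)); last first.
    by apply/funext => p; rewrite aE.
  exact: (measurableT_comp mfa (@measurable_consrv R n)).
- exact: measurableT.
by congr (_ * _)%E; apply: eq_integral => x _; apply: eq_integral => y _; rewrite aE.
Qed.

(** Covers non-integrable [f] as well: the positive and negative parts scale by the same positive
    factor, and infinite values of either part are checked case by case. *)
Lemma integral_affine_rV n (c : R) (b : 'rV[R]_n) (f : 'rV[R]_n -> \bar R) :
  c != 0 -> measurable_fun setT f ->
  (\int[mu n]_x f x = (`|c| ^+ n)%:E * \int[mu n]_x f (c *: x + b)%R)%E.
Proof.
move=> c0 mf; rewrite [LHS]integralE [in RHS]integralE.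
rewrite (ge0_integral_affine_rV b c0) //; last exact: measurable_funepos.
rewrite (ge0_integral_affine_rV b c0 (f := f^\-%E)) //; last exact: measurable_funeneg.
have cn0 : 0 < `|c| ^+ n by rewrite exprn_gt0 // normr_gt0.
set A := (\int[_]_x _)%E; set B := (\int[_]_x _)%E.
have : (0 <= A)%E by exact: integral_ge0.
have : (0 <= B)%E by exact: integral_ge0.
rewrite (_ : \int[mu n]_x _ - _ = A - B)%E //.
move: A B => [A| |] [B| |] //= _ _; rewrite ?gt0_muley ?gt0_muleNy ?lte_fin //=.
  change ((`|c| ^+ n * A - `|c| ^+ n * B)%:E = (`|c| ^+ n * (A - B))%:E).
  by rewrite mulrBr.
by congr (_ - _)%E; apply: eq_integral => x _; rewrite ?funeposE ?funenegE.
Qed.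

Lemma measurable_affine_rV n (c : R) (b : 'rV[R]_n) :
  measurable_fun [set: 'rV[R]_n] (fun x => c *: x + b).
Proof.
apply: measurable_fun_rV => i.
rewrite (_ : (fun _ => _) = (fun X : 'rV[R]_n => c * (X 0 i : measurableTypeR R) + b 0 i)).
  apply: measurable_funD => //; apply: measurable_funM => //; exact: measurable_coord.
by apply/funext => X; rewrite !mxE.
Qed.

Lemma integrable_affine_rV n (c : R) (b : 'rV[R]_n) (f : 'rV[R]_n -> \bar R) :
  c != 0 -> (mu n).-integrable setT f ->
  (mu n).-integrable setT (fun x => f (c *: x + b)).
Proof.
move=> c0 /integrableP[mf fi]; apply/integrableP; split.
  exact: (measurableT_comp mf (measurable_affine_rV _ _)).
move: fi; rewrite (ge0_integral_affine_rV b c0); last 2 first.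
- exact: (measurableT_comp _ mf).
- by move=> x.
have cn0 : 0 < `|c| ^+ n by rewrite exprn_gt0 // normr_gt0.
have : (0 <= \int[mu n]_x `|f (c *: x + b)%R|)%E by exact: integral_ge0.
set A := (\int[_]_x _)%E; move: A => [A| |] //= _; rewrite ?ltry // gt0_muley // lte_fin.
Qed.

Lemma mx_norm_lt n (x : 'rV[R]_n) e : 0 < e ->
  (`|x| < e) = [forall i, `|x 0 i| < e].
Proof.
move=> e0; apply/idP/forallP => [xe i|xe].
  apply: le_lt_trans xe; rewrite /Num.norm /= mx_normrE.
  exact: (le_bigmax_cond _ (fun ij : 'I_1 * 'I_n => `|x ij.1 ij.2|) (j := (0, i))).
rewrite /Num.norm /= mx_normrE; apply: bigmax_lt => // -[i j] _ /=.
by rewrite (ord1 i).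
Qed.

(** The sigma-algebra is generated by the coordinates and the topology by the sup norm. An open set
    is the union of the boxes with rational centre and radius that it contains, and there are
    countably many of these. *)
Lemma open_measurable_rV n (A : set 'rV[R]_n) : open A -> measurable A.
Proof.
move=> oA.
pose B (q : 'rV[rat]_n * rat) : set 'rV[R]_n :=
  [set x | forall i, `|x 0 i - ratr (q.1 0 i)| < ratr q.2].
pose D := [set q | B q `<=` A].
have -> : A = \bigcup_(q in D) B q.
  apply/seteqP; split => [x Ax|x [q Dq Bx]]; last exact: Dq.
  have [e /= e0 xA] : exists2 e, 0 < e & ball x e `<=` A by exact/nbhs_ballP/oA.
  have [r r0 re] : exists2 r : rat, (0 : R) < ratr r & ratr r < e / 2.
    have [r /andP[? ?]] : exists r : rat, ratr r \in `]0, e / 2[ by apply: rat_in_itvoo; lra.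
    by exists r.
  have /all_sig[q qP] i : {q : rat | `|x 0 i - ratr q| < ratr r}.
    apply: cid.
    have [q] : exists q : rat, ratr q \in `]x 0 i - ratr r, x 0 i[.
      by apply: rat_in_itvoo; lra.
    rewrite in_itv /= => /andP[h1 h2]; exists q.
    by rewrite gtr0_norm ?subr_gt0 //; lra.
  exists ((\row_i q i), r) => /=; last by move=> i; rewrite mxE.
  move=> y By; apply: xA; rewrite -ball_normE /ball_ /= mx_norm_lt //.
  apply/forallP => i; rewrite !mxE; have := By i; rewrite /= mxE => yq.
  by have := ler_distD (ratr (q i)) (x 0 i) (y 0 i); have := qP i; rewrite (distrC (y 0 i)) in yq; lra.
rewrite bigcup_mkcond; apply: countable_bigcupT_measurable => [|q].
  exact: countableP.
case: ifP => // _.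
have -> : B q = \bigcap_i ((fun x : 'rV[R]_n => x 0 i : measurableTypeR R) @^-1`
    `]ratr (q.1 0 i) - ratr q.2, ratr (q.1 0 i) + ratr q.2[).
  apply/seteqP; split => [x Bx i _ /=|x Bx i]; rewrite ?in_itv /=.
    by have := Bx i; rewrite ltr_distl.
  by have := Bx i Logic.I; rewrite /= in_itv /= ltr_distl.
apply: fin_bigcap_measurable => // i _.
by rewrite -[X in measurable X]setTI; apply: (measurable_coord i) => //; exact: measurable_itv.
Qed.

Lemma continuous_measurable_rV n (f : 'rV[R]_n -> R) (D : set 'rV[R]_n) :
  open D -> {in D, continuous f} -> measurable_fun D f.
Proof.
move=> oD cf; have mD := open_measurable_rV oD.
apply: (measurability _ (RGenOpens.measurableE R)) => _ [_ [a [b ->] <-]].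
have oU := @interval_open R (BRight a) (BLeft b) isT isT.
apply: open_measurable_rV.
rewrite openE => x [Dx Ux]; rewrite /interior /=.
by apply: filterI; [exact: open_nbhs_nbhs|apply: (cf x (mem_set Dx)); exact: open_nbhs_nbhs (conj oU Ux)].
Qed.

End measure_rV.

(** * Real-valued integrals and dominated convergence *)

Section Rintegral_tools.
Context {R : realType} {dsp : measure_display} {T : measurableType dsp}
  {mu : {measure set T -> \bar R}} {D : set T} (mD : measurable D).
Implicit Types f g : T -> R.
Local Notation itg f := (mu.-integrable D (EFin \o f)).

Lemma measurable_integrable f : itg f -> measurable_fun D f.
Proof. by move=> /integrableP[+ _]; move/measurable_EFinP. Qed.

Lemma le_integrableR f g : measurable_fun D f -> (forall x, D x -> `|f x| <= g x) ->
  itg g -> itg f.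
Proof.
move=> mf fg; apply: le_integrable => //; first exact/measurable_EFinP.
by move=> x Dx /=; rewrite lee_fin (le_trans (fg x Dx)) // ler_norm.
Qed.

Lemma integrableDR f g : itg f -> itg g -> itg (fun x => f x + g x).
Proof. by move=> fi gi; exact: (integrableD mD fi gi). Qed.

Lemma integrableBR f g : itg f -> itg g -> itg (fun x => f x - g x).
Proof. by move=> fi gi; exact: (integrableB mD fi gi). Qed.

Lemma integrableZR c f : itg f -> itg (fun x => c * f x).
Proof. by move=> fi; exact: (integrableZl mD c fi). Qed.

Lemma integrable_normR f : itg f -> itg (fun x => `|f x|).
Proof. by move=> fi; exact: (integrable_norm fi). Qed.

Lemma integrable_sumR (I : finType) (f : I -> T -> R) :
  (forall i, itg (f i)) -> itg (fun x => \sum_i f i x).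
Proof.
move=> fi; rewrite (_ : _ \o _ = fun x => (\sum_i (f i x)%:E)%E).
  by apply: (integrable_sum mD (index_enum I)) => i _; exact: fi.
by apply/funext => x /=; rewrite sumEFin.
Qed.

Lemma Rintegral_sumR (I : finType) (f : I -> T -> R) :
  (forall i, itg (f i)) ->
  \int[mu]_(x in D) (\sum_i f i x) = \sum_i \int[mu]_(x in D) f i x.
Proof.
move=> fi.
suff H s : itg (fun x => \sum_(i <- s) f i x) /\
  \int[mu]_(x in D) (\sum_(i <- s) f i x) = \sum_(i <- s) \int[mu]_(x in D) f i x.
  exact: (H _).2.
elim: s => [|i s [IH1 IH2]].
  split; last by rewrite big_nil; under eq_Rintegral do rewrite big_nil; rewrite Rintegral_cst // mul0r.
  by under eq_fun do rewrite big_nil; exact: integrable0.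
split; first by under eq_fun do rewrite big_cons; exact: integrableDR.
under eq_Rintegral do rewrite big_cons.
by rewrite big_cons RintegralD // IH2.
Qed.

Lemma dominatedR (f_ : nat -> T -> R) f g :
  (forall n, measurable_fun D (f_ n)) ->
  (forall x, D x -> f_ n x @[n --> \oo] --> f x) -> itg g ->
  (forall n x, D x -> `|f_ n x| <= g x) ->
  itg f /\ \int[mu]_(x in D) f_ n x @[n --> \oo] --> \int[mu]_(x in D) f x.
Proof.
move=> mf ff gi fg.
have mfl : measurable_fun D f.
  exact: (measurable_fun_cvg mf ff).
have ffe x : D x -> (EFin \o f_ n) x @[n --> \oo] --> (EFin \o f) x.
  by move=> Dx; apply: cvg_EFin; [exact: nearW|exact: ff].
have [fi _ fl] := @dominated_convergence _ _ _ mu _ mD (fun n => EFin \o f_ n) (EFin \o f) (EFin \o g)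
  (fun n => (measurable_EFinP _ _).2 (mf n)) ((measurable_EFinP _ _).2 mfl)
  (aeW _ ffe) gi (aeW _ (fun x n Dx => fg n x Dx)).
split => //; apply: (fine_cvg (f := fun n => \int[mu]_(x in D) (f_ n x)%:E)%E).
by rewrite fineK //; exact: integrable_fin_num.
Qed.

End Rintegral_tools.

(** * The Euclidean square norm and Gaussian integrals *)

Section euclidean_tools.
Context {R : realType}.
Implicit Types n : nat.
Local Notation leb := (@lebesgue_measure R).
Local Notation mu := (@lebesgue_rV R).

Lemma sqnorm_ge0 n (x : 'rV[R]_n) : 0 <= sqnorm x.
Proof. by apply: sumr_ge0 => i _; exact: sqr_ge0. Qed.

Lemma sqnormZ n c (x : 'rV[R]_n) : sqnorm (c *: x) = c ^+ 2 * sqnorm x.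
Proof. by rewrite /sqnorm mulr_sumr; apply: eq_bigr => i _; rewrite mxE exprMn. Qed.

Lemma sqnormN n (x : 'rV[R]_n) : sqnorm (- x) = sqnorm x.
Proof. by apply: eq_bigr => i _; rewrite mxE sqrrN. Qed.

Lemma sqnorm0 n : sqnorm (0 : 'rV[R]_n) = 0.
Proof. by rewrite /sqnorm big1 // => i _; rewrite mxE expr0n. Qed.

Lemma consrv0 n x0 (x : 'rV[R]_n) : consrv x0 x 0 ord0 = x0.
Proof. by rewrite mxE unlift_none. Qed.

Lemma consrvS n x0 (x : 'rV[R]_n) j : consrv x0 x 0 (lift ord0 j) = x 0 j.
Proof. by rewrite mxE liftK. Qed.

Lemma behrv_consrv n x0 (x : 'rV[R]_n) : behrv (consrv x0 x) = x.
Proof. by apply/rowP => j; rewrite mxE consrvS. Qed.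

Lemma consrv_behrv n (X : 'rV[R]_n.+1) : consrv (X 0 ord0) (behrv X) = X.
Proof.
by apply/rowP => i; case: (unliftP ord0 i) => [j|] ->; rewrite ?consrvS ?consrv0 ?mxE.
Qed.

Lemma consrvZ n c x0 (x : 'rV[R]_n) : c *: consrv x0 x = consrv (c * x0) (c *: x).
Proof.
by apply/rowP => i; case: (unliftP ord0 i) => [j|] ->; rewrite mxE ?consrvS ?consrv0 ?mxE.
Qed.

Lemma sqnorm_recl n (X : 'rV[R]_n.+1) : sqnorm X = X 0 ord0 ^+ 2 + sqnorm (behrv X).
Proof.
by rewrite /sqnorm big_ord_recl; congr (_ + _); apply: eq_bigr => i _; rewrite mxE.
Qed.

Lemma sqnorm_consrv n x0 (x : 'rV[R]_n) : sqnorm (consrv x0 x) = x0 ^+ 2 + sqnorm x.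
Proof. by rewrite sqnorm_recl consrv0 behrv_consrv. Qed.

Lemma sqr_coord_le n (x : 'rV[R]_n) i : x 0 i ^+ 2 <= sqnorm x.
Proof.
by rewrite /sqnorm (bigD1 i) //= lerDl sumr_ge0 // => j _; exact: sqr_ge0.
Qed.

Lemma measurable_sqnorm n : measurable_fun setT (@sqnorm R n).
Proof.
apply: (@measurable_sum _ _ R _ _ (index_enum 'I_n) (fun i (x : 'rV[R]_n) => x 0 i ^+ 2)) => i.
by apply: measurable_funX; exact: measurable_coord.
Qed.

Lemma integral_gauss1 (c : R) : 0 < c ->
  (\int[leb]_x (expR (- c * x ^+ 2))%:E = (Num.sqrt (pi / c))%:E)%E.
Proof.
move=> c0; have sc : 0 < Num.sqrt c by rewrite sqrtr_gt0.
have := @integralT_gauss R.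
rewrite (@ge0_integral_affine1 R (Num.sqrt c) 0 (fun x => (gauss_fun x)%:E)); first last.
- by move=> x; rewrite lee_fin expR_ge0.
- by apply/measurable_EFinP; apply: measurableT_comp => //; apply: measurable_funN; exact: measurable_funX.
- by rewrite gt_eqF.
under [in X in X -> _]eq_integral => x _.
  rewrite /gauss_fun addr0 exprMn sqr_sqrtr ?ltW // -mulNr; over.
set A := (\int[_]_x _)%E.
rewrite gtr0_norm // => H.
have : ((Num.sqrt c)^-1%:E * ((Num.sqrt c)%:E * A) = (Num.sqrt c)^-1%:E * (Num.sqrt pi)%:E)%E by rewrite H.
rewrite muleA -EFinM mulVf ?gt_eqF // mul1e => ->.
by rewrite -EFinM sqrtrM ?pi_ge0 // sqrtrV ?ltW // mulrC.
Qed.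

Lemma measurable_gauss_rV n (c : R) :
  measurable_fun setT (fun x : 'rV[R]_n => expR (- c * sqnorm x)).
Proof.
apply: measurableT_comp => //; apply: measurable_funM => //; exact: measurable_sqnorm.
Qed.

Lemma integral_gauss_rV n (c : R) : 0 < c ->
  (\int[mu n]_x (expR (- c * sqnorm x))%:E = (Num.sqrt (pi / c) ^+ n)%:E)%E.
Proof.
move=> c0; elim: n => [|n IH].
  rewrite /= integral_dirac //; last by apply/measurable_EFinP; exact: measurable_gauss_rV.
  rewrite diracT mul1e; congr EFin.
  by rewrite /sqnorm big_ord0 mulr0 expR0.
rewrite tonelli_rV; last 2 first.
- by apply/measurable_EFinP; exact: measurable_gauss_rV.
- by move=> X; rewrite lee_fin expR_ge0.
under eq_integral => x _.
  under eq_integral => y _ do rewrite sqnorm_consrv mulrDr expRD EFinM.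
  rewrite ge0_integralZl //; last by apply/measurable_EFinP; exact: measurable_gauss_rV.
  rewrite IH muleC; over.
rewrite ge0_integralZl //; first last.
- by apply/measurable_EFinP; apply: measurableT_comp => //; apply: measurable_funM => //; exact: measurable_funX.
by rewrite integral_gauss1 // -EFinM exprSr.
Qed.

Lemma integrable_gauss_rV n (c : R) : 0 < c ->
  (mu n).-integrable setT (EFin \o (fun x : 'rV[R]_n => expR (- c * sqnorm x))).
Proof.
move=> c0; apply/integrableP; split; first by apply/measurable_EFinP; exact: measurable_gauss_rV.
under eq_integral => x _ do rewrite /= ger0_norm ?expR_ge0 //.
by rewrite integral_gauss_rV // ltry.
Qed.

End euclidean_tools.

(** * Calculus in the half-space *)

Section line_calculus.
Context {R : realType}.
Local Notation leb := (@lebesgue_measure R).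
Local Notation mu := (@lebesgue_rV R).

(** The device that reduces partial derivatives to derivatives in one real variable: two functions
    on possibly different spaces that agree along two lines have the same directional derivative. *)
Lemma is_derive_quotient (V W : normedModType R) (f : V -> R) (g : W -> R) a v b w l :
  (forall h, f (h *: v + a) = g (h *: w + b)) ->
  is_derive a v f l <-> is_derive b w g l.
Proof.
move=> fg.
have fgab : f a = g b by have := fg 0; rewrite !scale0r !add0r.
have E : (fun h => h^-1 *: ((f \o shift a) (h *: v) - f a)) =
         (fun h => h^-1 *: ((g \o shift b) (h *: w) - g b)).
  by apply/funext => h /=; rewrite fg fgab.
split=> -[d1 d2]; apply: DeriveDef.
- by rewrite /derivable -E.
- by rewrite /derive -E.
- by rewrite /derivable E.
- by rewrite /derive E.
Qed.

Lemma is_derive_line n (f : 'rV[R]_n -> R) X v t l :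
  is_derive (X + t *: v) v f l <-> is_derive t (1 : R) (fun h => f (X + h *: v)) l.
Proof.
apply: is_derive_quotient => h; congr f.
by rewrite [_ *: 1]mulr1 scalerDl addrCA.
Qed.

Lemma is_derive_consrv0 n (f : 'rV[R]_n.+1 -> R) x y l :
  is_derive (consrv x y) 'e_ord0 f l <-> is_derive x (1 : R) (fun h => f (consrv h y)) l.
Proof.
apply: is_derive_quotient => h; congr f.
apply/rowP => i; case: (unliftP ord0 i) => [j|] ->; rewrite !mxE ?liftK ?unlift_none /=.
  by rewrite mulr0 add0r.
by rewrite mulr1 [_ *: 1]mulr1.
Qed.

Lemma is_derive_consrvS n (f : 'rV[R]_n.+1 -> R) x y j l :
  is_derive (consrv x y) 'e_(lift ord0 j) f l <-> is_derive y 'e_j (fun z => f (consrv x z)) l.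
Proof.
apply: is_derive_quotient => h; congr f.
apply/rowP => i; case: (unliftP ord0 i) => [k|] ->; rewrite !mxE ?liftK ?unlift_none /=.
  by rewrite !mxE (inj_eq lift_inj).
by rewrite mulr0 add0r.
Qed.

Lemma continuous_rVP (T : topologicalType) n (f : T -> 'rV[R]_n) x :
  (forall i, {for x, continuous (fun t => f t 0 i)}) -> {for x, continuous f}.
Proof.
move=> cf; apply/cvgrPdist_lt => e e0.
near=> t; rewrite mx_norm_lt //; apply/forallP => i; rewrite !mxE; move: i.
near: t; apply: filter_forall => i.
by have /cvgrPdist_lt /(_ _ e0) := cf i.
Unshelve. all: by end_near. Qed.

Lemma continuous_coord n (i : 'I_n) : continuous (fun X : 'rV[R]_n => X 0 i).
Proof. exact: coord_continuous. Qed.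

Lemma continuous_consrv1 n (y : 'rV[R]_n) : continuous (fun x => consrv x y).
Proof.
move=> x; apply: continuous_rVP => i; case: (unliftP ord0 i) => [j|] ->.
  by rewrite (_ : (fun _ => _) = cst (y 0 j)) ?funeqE => [|t]; [exact: cst_continuous|rewrite consrvS].
by rewrite (_ : (fun _ => _) = id) ?funeqE => [|t]; [exact: cvg_id|rewrite consrv0].
Qed.

Lemma continuous_consrv2 n x : continuous (fun y : 'rV[R]_n => consrv x y).
Proof.
move=> y; apply: continuous_rVP => i; case: (unliftP ord0 i) => [j|] ->.
  by rewrite (_ : (fun _ => _) = (fun z : 'rV[R]_n => z 0 j)) ?funeqE => [|t];
    [exact: continuous_coord|rewrite consrvS].
by rewrite (_ : (fun _ => _) = cst x) ?funeqE => [|t]; [exact: cst_continuous|rewrite consrv0].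
Qed.

Lemma continuous_behrv n : continuous (@behrv R n).
Proof.
move=> y; apply: continuous_rVP => i.
by rewrite (_ : (fun _ => _) = (fun z : 'rV[R]_n.+1 => z 0 (lift ord0 i))) ?funeqE => [|t];
  [exact: continuous_coord|rewrite mxE].
Qed.

Lemma continuous_sqnorm n : continuous (@sqnorm R n).
Proof.
suff H s : continuous (fun X : 'rV[R]_n => \sum_(i <- s) X 0 i ^+ 2) by exact: H.
elim: s => [|i s IH] X.
  by rewrite (_ : (fun _ => _) = cst 0) ?funeqE => [|t]; [exact: cst_continuous|rewrite big_nil].
rewrite (_ : (fun _ => _) = fun X : 'rV[R]_n => X 0 i * X 0 i + \sum_(j <- s) X 0 j ^+ 2).
  have c := @continuous_coord n i X.
  exact: (cvgD (cvgM c c) (IH X)).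
by apply/funext => Y; rewrite big_cons expr2.
Qed.

Lemma coord_le_norm n (X : 'rV[R]_n) i : `|X 0 i| <= `|X|.
Proof.
rewrite [leRHS]/Num.norm /= mx_normrE.
exact: (le_bigmax_cond _ (fun ij : 'I_1 * 'I_n => `|X ij.1 ij.2|) (j := (0, i))).
Qed.

Lemma sqnorm_le_norm n (X : 'rV[R]_n) M : `|X| <= M -> sqnorm X <= n%:R * M ^+ 2.
Proof.
move=> XM; rewrite /sqnorm -[n in leRHS]card_ord -sumr_const mulr_suml.
apply: ler_sum => i _; rewrite mul1r -real_normK ?num_real //.
by rewrite ler_pXn2r ?nnegrE // ?(le_trans (coord_le_norm X i)) // (le_trans _ XM).
Qed.

Lemma compact_continuous_bound (T : topologicalType) (K : set T) (f : T -> R) :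
  compact K -> {within K, continuous f} -> exists2 B, 0 <= B & forall X, K X -> `|f X| <= B.
Proof.
move=> cK cf.
have [M [_ HM]] := compact_bounded (continuous_compact cf cK).
exists (Num.max 0 (M + 1)); first by rewrite le_max lexx.
move=> X KX; rewrite le_max; apply/orP; right.
by apply: (HM (M + 1)); [rewrite ltrDl|exists X].
Qed.

Lemma compact_slab n (e M : R) : compact [set X : 'rV[R]_n.+1 | e <= X 0 ord0 /\ `|X| <= M].
Proof.
apply: bounded_closed_compact.
  exists M; split; first exact: num_real.
  by move=> x Mx X /= [_ XM]; rewrite (le_trans XM) // ltW.
apply: closedI.
  apply: (@closed_comp _ _ (fun X : 'rV[R]_n.+1 => X 0 ord0) [set x | e <= x]).
    by move=> X _; exact: continuous_coord.
  exact: closed_ge.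
apply: (@closed_comp _ _ (fun X : 'rV[R]_n.+1 => `|X|) [set x | x <= M]).
  by move=> X _; exact: norm_continuous.
exact: closed_le.
Qed.

Definition coord_gt n (e : R) : set 'rV[R]_n.+1 := [set X | e < X 0 ord0].
Arguments coord_gt : clear implicits.

Lemma measurable_coord_gt n (e : R) : measurable (coord_gt n e).
Proof.
have := @measurable_coord R n.+1 ord0 measurableT _ (measurable_itv `]e, +oo[).
by rewrite setTI; congr measurable; apply/seteqP; split=> X /=; rewrite in_itv /= andbT.
Qed.

Lemma open_coord_gt n (e : R) : open (coord_gt n e).
Proof.
apply: (@open_comp _ _ (fun X : 'rV[R]_n.+1 => X 0 ord0) [set x | e < x]).
  by move=> X _; exact: continuous_coord.
exact: open_gt.
Qed.

(** A bounded function that vanishes off a ball lies below a multiple of a Gaussian, whose integral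
    is known; the volume of the ball does not enter. *)
Lemma integrable_support n (D : set 'rV[R]_n) (f : 'rV[R]_n -> R) B M : measurable D ->
  measurable_fun D f ->
  (forall X, D X -> `|f X| <= B) -> (forall X, D X -> M < `|X| -> f X = 0) ->
  (mu n).-integrable D (EFin \o f).
Proof.
move=> mD mf fB fM.
apply: (@le_integrableR _ _ _ _ _ mD _
  (fun X => B * expR (n%:R * M ^+ 2) * expR (- 1 * sqnorm X))) => //.
  move=> X DX; have B0 : 0 <= B by rewrite (le_trans _ (fB X DX)).
  have [XM|XM] := leP `|X| M; last first.
    by rewrite fM // normr0 !mulr_ge0 // expR_ge0.
  apply: le_trans (fB X DX) _; rewrite -mulrA ler_peMr // -expRD -[leLHS]expR0 ler_expR.
  by rewrite mulN1r subr_ge0 sqnorm_le_norm.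
apply: (integrableZR mD).
apply: (@integrableS _ _ _ _ setT) => //.
by apply: integrable_gauss_rV.
Qed.

Lemma ftc2 (f f' : R -> R) (a b : R) : a < b ->
  (forall x : R, a <= x <= b -> is_derive x (1 : R) f (f' x)) ->
  (forall x : R, a <= x <= b -> {for x, continuous f'}) ->
  (\int[leb]_(x in `[a, b]) (f' x)%:E = (f b - f a)%:E)%E.
Proof.
move=> ab df cf'.
have cf x : a <= x <= b -> {for x, continuous f}.
  move=> xab; have [? _] := df x xab.
  by apply: differentiable_continuous; exact/derivable1_diffP.
rewrite (@continuous_FTC2 _ f' f) //.
- apply: continuous_in_subspaceT => x; rewrite inE /= in_itv /=; exact: cf'.
- split.
  + by move=> x; rewrite in_itv /= => /andP[? ?]; have [] := df x; rewrite ?ltW.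
  + by apply: cvg_at_right_filter; apply: cf; rewrite lexx ltW.
  + by apply: cvg_at_left_filter; apply: cf; rewrite lexx ltW.
- move=> x; rewrite in_itv /= => /andP[? ?].
  by rewrite derive1E; have [] := df x; rewrite ?ltW.
Qed.

Lemma integral_derive_ray (f f' : R -> R) (a b : R) :
  (forall x : R, a <= x -> is_derive x (1 : R) f (f' x)) ->
  (forall x : R, a <= x -> {for x, continuous f'}) ->
  (forall x : R, b < x -> f x = 0 /\ f' x = 0) ->
  (\int[leb]_(x in `]a, +oo[) (f' x)%:E = (- f a)%:E)%E.
Proof.
move=> df cf f0.
pose c := Num.max (a + 1) (b + 1).
have ac : a < c by rewrite lt_max ltrDl ltr01.
have bc : b < c by rewrite lt_max ltrDl ltr01 orbT.
have := @ftc2 f f' a c ac (fun x xab => df x (andP xab).1) (fun x xab => cf x (andP xab).1).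
rewrite (f0 c bc).1 sub0r => <-.
have mf : measurable_fun `]a, c[ f'.
  apply: open_continuous_measurable_fun; first exact: interval_open.
  by move=> x; rewrite inE /= in_itv /= => /andP[ax _]; apply: cf; exact: ltW.
rewrite -integral_itv_obnd_cbnd; last first.
  apply/measurable_EFinP; apply/measurable_fun_itv_bndo_bndcP => //.
rewrite integral_mkcond [in RHS]integral_mkcond; apply: eq_integral => x _.
rewrite /patch !mem_setE !in_itv /= andbT; case: ifPn => //= ax; case: ifPn => //; rewrite -ltNge => cx.
by rewrite (f0 x (lt_trans bc cx)).2.
Qed.

Lemma integral_derive_line0 (f f' : R -> R) (b : R) :
  (forall x : R, is_derive x (1 : R) f (f' x)) -> continuous f' ->
  (forall x : R, b < `|x| -> f x = 0 /\ f' x = 0) ->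
  (\int[leb]_x (f' x)%:E = 0)%E.
Proof.
move=> df cf f0; pose a := - (`|b| + 1).
have na x : x <= a -> b < `|x|.
  move=> xa; have x0 : x < 0 by rewrite (le_lt_trans xa) // oppr_lt0 ltr_pwDr.
  rewrite ltr0_norm //; have := ler_norm b; rewrite /a in xa; lra.
have <- : (\int[leb]_(x in `]a, +oo[) (f' x)%:E = 0)%E.
  rewrite (@integral_derive_ray f f' a `|b|); first by rewrite (f0 a (na a (lexx a))).1 oppr0.
  - by move=> x _; apply: cf.
  - by move=> x bx; apply: f0; rewrite (le_lt_trans (ler_norm b)) // (lt_le_trans bx) // ler_norm.
rewrite [in RHS]integral_mkcond; apply: eq_integral => x _.
rewrite /patch !mem_setE !in_itv /= andbT; case: ifPn => //; rewrite -leNgt => xa.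
by rewrite (f0 x (na x xa)).2.
Qed.

Lemma norm_consrv_gt n x (y : 'rV[R]_n) M : M < `|y| -> M < `|consrv x y|.
Proof.
rewrite !ltNge; apply: contra => H; rewrite leNgt; apply/negP => My.
have [M0|M0] := leP 0 M; last first.
  by have := lt_le_trans M0 (normr_ge0 (consrv x y)); rewrite ltNge H.
suff : `|y| < M + (`|y| - M) by rewrite addrC subrK ltxx.
rewrite mx_norm_lt; last by rewrite addrC subrK (le_lt_trans M0).
apply/forallP => j; rewrite -[y 0 j](consrvS x).
by rewrite (le_lt_trans (coord_le_norm _ _)) // (le_lt_trans H) // ltrDl subr_gt0.
Qed.

Lemma norm_consrv_gt0 n x (y : 'rV[R]_n) M : M < `|x| -> M < `|consrv x y|.
Proof. by move=> Mx; rewrite (lt_le_trans Mx) // -{1}(consrv0 x y); exact: coord_le_norm. Qed.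

(** A derivative with compact support integrates to zero along its own direction. Fubini's theorem
    and induction on [n] bring that direction to the innermost integral. *)
Lemma integral_partial_rV n (g dg : 'rV[R]_n -> R) i M :
  (forall X, is_derive X 'e_i g (dg X)) -> continuous dg ->
  (forall X, M < `|X| -> g X = 0 /\ dg X = 0) ->
  (\int[mu n]_X (dg X)%:E = 0)%E.
Proof.
elim: n g dg i => [|n IH] g dg i hg cdg s; first by case: i hg.
have mdg : measurable_fun setT dg by apply: continuous_measurable_rV => //; exact: openT.
have [B _ HB] := @compact_continuous_bound _ _ dg (@compact_slab n (- `|M|) `|M|)
   (continuous_subspaceT cdg).
have idg : (mu n.+1).-integrable setT (EFin \o dg).
  apply: (@integrable_support _ _ _ (Num.max 0 B) M) => //; last by move=> X _ /s[].
  move=> X _; have [XM|XM] := ltP M `|X|; first by rewrite (s X XM).2 normr0 le_max lexx.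
  rewrite le_max; apply/orP; right; apply: HB; split; last by rewrite (le_trans XM) // ler_norm.
  have := coord_le_norm X ord0; rewrite ler_norml => /andP[h _]; apply: le_trans h.
  by rewrite lerN2 (le_trans XM) // ler_norm.
case: (unliftP ord0 i) => [j|] ij; rewrite ij in hg.
  rewrite fubini_rV // integral0_eq // => x _.
  apply: (IH (fun y => g (consrv x y)) (fun y => dg (consrv x y)) j).
  - by move=> y; apply/is_derive_consrvS.
  - by move=> y; apply: continuous_comp; [exact: continuous_consrv2|exact: cdg].
  - by move=> y My; apply: s; exact: norm_consrv_gt.
rewrite fubini_rV2 // integral0_eq // => y _.
apply: (@integral_derive_line0 (fun x => g (consrv x y)) _ M).
- by move=> x; apply/is_derive_consrv0.
- by move=> x; apply: continuous_comp; [exact: continuous_consrv1|exact: cdg].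
- by move=> x Mx; apply: s; exact: norm_consrv_gt0.
Qed.

Section halfspace.
Variables (n : nat) (f : 'rV[R]_n.+1 -> R) (e M : R).
Hypothesis e0 : 0 < e.
Hypothesis cf : forall X : 'rV[R]_n.+1, 0 < X 0 ord0 -> {for X, continuous f}.
Hypothesis sf : forall X, M < `|X| -> f X = 0.

(** Continuity is available only in the open half-space, so integration by parts is done over
    [e < X_0]; the limit [e -> 0] is taken later, on the flux. *)
Lemma integrable_halfspace_support :
  (mu n.+1).-integrable (coord_gt n e) (EFin \o f).
Proof.
have [B _ HB] : exists2 B, 0 <= B & forall X : 'rV[R]_n.+1, e <= X 0 ord0 /\ `|X| <= M -> `|f X| <= B.
  apply: (compact_continuous_bound (@compact_slab n e M)).
  apply: continuous_in_subspaceT => X; rewrite inE => -[eX _].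
  by apply: cf; rewrite (lt_le_trans e0).
apply: (@integrable_support _ _ _ (Num.max 0 B) M).
- exact: measurable_coord_gt.
- apply: continuous_measurable_rV; first exact: open_coord_gt.
  by move=> X; rewrite inE => eX; apply: cf; exact: lt_trans eX.
- move=> X eX; have [XM|XM] := ltP M `|X|; first by rewrite sf // normr0 le_max lexx.
  by rewrite le_max HB ?orbT //; split=> //; exact: ltW.
- by move=> X _; exact: sf.
Qed.

Let F := EFin \o (f \_ (coord_gt n e)).

Let iF : (mu n.+1).-integrable setT F.
Proof.
rewrite /F -restrict_EFin.
by apply/(integrable_mkcond _ (measurable_coord_gt e)).1; exact: integrable_halfspace_support.
Qed.

Let intF : (\int[mu n.+1]_(X in coord_gt n e) (f X)%:E = \int[mu n.+1]_X F X)%E.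
Proof. by rewrite integral_mkcond /F -restrict_EFin. Qed.

Let FE x y : F (consrv x y) = (if e < x then f (consrv x y) else 0)%:E.
Proof.
rewrite /F /patch /= (_ : (consrv x y \in _) = (e < x)) //.
by apply/idP/idP; rewrite inE /coord_gt /= consrv0.
Qed.

Lemma integral_partial_tangential (g : 'rV[R]_n.+1 -> R) j :
  (forall X : 'rV[R]_n.+1, 0 < X 0 ord0 -> is_derive X 'e_(lift ord0 j) g (f X)) ->
  (forall X, M < `|X| -> g X = 0) ->
  (\int[mu n.+1]_(X in coord_gt n e) (f X)%:E = 0)%E.
Proof.
move=> hg sg; rewrite intF fubini_rV // integral0_eq // => x _.
under eq_integral do rewrite FE.
have [ex|ex] := ltP e x; last by rewrite integral0_eq.
have x0 := lt_trans e0 ex.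
apply: (@integral_partial_rV n (fun y => g (consrv x y)) (fun y => f (consrv x y)) j M).
- by move=> y; apply/is_derive_consrvS/hg; rewrite consrv0.
- by move=> y; apply: continuous_comp; [exact: continuous_consrv2|apply: cf; rewrite consrv0].
- by move=> y My; split; [apply: sg|apply: sf]; exact: norm_consrv_gt.
Qed.

Lemma integral_partial_normal (g : 'rV[R]_n.+1 -> R) :
  (forall X : 'rV[R]_n.+1, 0 < X 0 ord0 -> is_derive X 'e_ord0 g (f X)) ->
  (forall X, M < `|X| -> g X = 0) ->
  (\int[mu n.+1]_(X in coord_gt n e) (f X)%:E =
   \int[mu n]_y (- g (consrv e y))%:E)%E.
Proof.
move=> hg sg; rewrite intF fubini_rV2 //; apply: eq_integral => y _.
apply: (@etrans _ _ (\int[leb]_(x in `]e, +oo[) (f (consrv x y))%:E)%E).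
  rewrite [RHS]integral_mkcond; apply: eq_integral => x _.
  by rewrite FE /patch !mem_setE in_itv /= andbT; case: ifP.
apply: (@integral_derive_ray (fun x => g (consrv x y)) (fun x => f (consrv x y)) e M).
- by move=> x ex; apply/is_derive_consrv0/hg; rewrite consrv0 (lt_le_trans e0).
- move=> x ex; apply: continuous_comp; first exact: continuous_consrv1.
  by apply: cf; rewrite consrv0 (lt_le_trans e0).
- move=> x Mx; have Mx' : M < `|x| by rewrite (lt_le_trans Mx) // ler_norm.
  by split; [apply: sg|apply: sf]; exact: norm_consrv_gt0.
Qed.

End halfspace.
End line_calculus.
Arguments coord_gt {R} n e.

(** * Weighted L2 spaces *)

Section weighted_L2.
Context {R : realType} {dsp : measure_display} {T : measurableType dsp}.
Variables (mu : {measure set T -> \bar R}) (D : set T) (w : T -> R).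
Hypothesis mD : measurable D.
Hypothesis w0 : forall x, D x -> 0 <= w x.
Hypothesis mw : measurable_fun D w.
Implicit Types f g h : T -> R.

Definition L2w f := measurable_fun D f /\
  mu.-integrable D (EFin \o (fun x => w x * f x ^+ 2)).

Definition ipw f g := \int[mu]_(x in D) (w x * (f x * g x)).

Lemma measurable_L2w f : L2w f -> measurable_fun D f. Proof. by case. Qed.

Lemma L2w_mul f g : L2w f -> L2w g ->
  mu.-integrable D (EFin \o (fun x => w x * (f x * g x))).
Proof.
move=> [mf fi] [mg gi].
apply: (le_integrableR mD (g := fun x => w x * f x ^+ 2 + w x * g x ^+ 2)).
- by apply: measurable_funM => //; exact: measurable_funM.
- move=> x Dx; rewrite normrM ger0_norm ?w0 // -mulrDr ler_wpM2l ?w0 // ler_norml.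
  by apply/andP; split; nra.
- exact: (integrableDR mD fi gi).
Qed.

Lemma ipwC f g : ipw f g = ipw g f.
Proof. by apply: eq_Rintegral => x _; rewrite (mulrC (f x)). Qed.

Lemma ipw_ge0 f : 0 <= ipw f f.
Proof. by apply: Rintegral_ge0 => x Dx; rewrite mulr_ge0 ?w0 // -expr2 sqr_ge0. Qed.

Lemma L2wZ c f : L2w f -> L2w (fun x => c * f x).
Proof.
move=> [mf fi]; split; first exact: measurable_funM.
rewrite (_ : (fun x => _) = (fun x => c ^+ 2 * (w x * f x ^+ 2))); last by apply/funext => x; ring.
exact: integrableZR.
Qed.

Lemma L2wD f g : L2w f -> L2w g -> L2w (fun x => f x + g x).
Proof.
move=> Lf Lg; split; first by apply: measurable_funD; [case: Lf|case: Lg].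
rewrite (_ : (fun x => _) = (fun x => w x * f x ^+ 2 + (2 * (w x * (f x * g x)) + w x * g x ^+ 2)));
  last by apply/funext => x; ring.
apply: integrableDR => //; first by case: Lf.
apply: integrableDR => //; last by case: Lg.
by apply: integrableZR => //; exact: L2w_mul.
Qed.

Lemma L2wB f g : L2w f -> L2w g -> L2w (fun x => f x - g x).
Proof.
move=> Lf Lg; rewrite (_ : (fun x => _) = (fun x => f x + -1 * g x)); last by apply/funext => x; ring.
by apply: L2wD => //; exact: L2wZ.
Qed.

Lemma ipwDl f g h : L2w f -> L2w g -> L2w h ->
  ipw (fun x => f x + g x) h = ipw f h + ipw g h.
Proof.
move=> Lf Lg Lh; rewrite /ipw -RintegralD //; [|exact: L2w_mul..].
by apply: eq_Rintegral => x _; ring.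
Qed.

Lemma ipwZl c f h : L2w f -> L2w h -> ipw (fun x => c * f x) h = c * ipw f h.
Proof.
move=> Lf Lh; rewrite /ipw -RintegralZl //; [|exact: L2w_mul..].
by apply: eq_Rintegral => x _; ring.
Qed.

Lemma ipwBl f g h : L2w f -> L2w g -> L2w h ->
  ipw (fun x => f x - g x) h = ipw f h - ipw g h.
Proof.
move=> Lf Lg Lh; rewrite /ipw -RintegralB //; [|exact: L2w_mul..].
by apply: eq_Rintegral => x _; ring.
Qed.

Lemma ipwBr f g h : L2w f -> L2w g -> L2w h ->
  ipw h (fun x => f x - g x) = ipw h f - ipw h g.
Proof. by move=> *; rewrite ipwC ipwBl // !(ipwC h). Qed.

Lemma ipwDr f g h : L2w f -> L2w g -> L2w h ->
  ipw h (fun x => f x + g x) = ipw h f + ipw h g.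
Proof. by move=> *; rewrite ipwC ipwDl // !(ipwC h). Qed.

Lemma ipwZr c f h : L2w f -> L2w h -> ipw h (fun x => c * f x) = c * ipw h f.
Proof. by move=> *; rewrite ipwC ipwZl // !(ipwC h). Qed.

Lemma ipw_sqrB f g : L2w f -> L2w g ->
  ipw (fun x => f x - g x) (fun x => f x - g x) = ipw f f - 2 * ipw f g + ipw g g.
Proof.
move=> Lf Lg; rewrite ipwBl ?ipwBr //; [|exact: L2wB..].
rewrite (ipwC g f); ring.
Qed.

Lemma ipw_young c f g : 0 < c -> L2w f -> L2w g ->
  2 * `|ipw f g| <= c * ipw f f + c^-1 * ipw g g.
Proof.
move=> c0 Lf Lg.
(* [s] is the sign of [ipw f g]; expanding the square of [c f - s g] treats both signs at once. *)
suff H s : s ^+ 2 = 1 -> 2 * (s * ipw f g) <= c * ipw f f + c^-1 * ipw g g.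
  have [h|h] := leP 0 (ipw f g); first by rewrite ger0_norm // -[ipw f g]mul1r H // expr1n.
  by rewrite ltr0_norm // -mulN1r H // sqrrN expr1n.
move=> s1; have := ipw_ge0 (fun x => c * f x - s * g x).
rewrite ipw_sqrB; [|exact: L2wZ..].
rewrite !ipwZl ?ipwZr //; [|exact: L2wZ..].
move=> h; rewrite -subr_ge0 (_ : _ - _ = c^-1 * (c * (c * ipw f f) - 2 * (c * (s * ipw f g)) + s * (s * ipw g g))).
  by rewrite mulr_ge0 // invr_ge0 ltW.
have -> : s * (s * ipw g g) = ipw g g by rewrite mulrA -expr2 s1 mul1r.
by field; rewrite gt_eqF.
Qed.

Lemma cauchy_schwarz f g : L2w f -> L2w g -> ipw f g ^+ 2 <= ipw f f * ipw g g.
Proof.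
move=> Lf Lg; rewrite -real_normK ?num_real //.
have y c (c0 : 0 < c) := ipw_young c0 Lf Lg.
have A0 := ipw_ge0 f; have B0 := ipw_ge0 g.
have [F0|F0] := eqVneq (ipw f f) 0.
  suff -> : `|ipw f g| = 0 by rewrite F0 mul0r expr0n.
  apply/eqP; rewrite -normr_le0 leNgt normr_id; apply/negP => P0.
  (* When [ipw f f = 0], Young's inequality holds for every [c]. This choice makes its right-hand
     side smaller than [|ipw f g|], a contradiction. *)
  have c0 : 0 < (ipw g g + 1) / `|ipw f g| by rewrite divr_gt0 // ltr_wpDl.
  have := y _ c0; rewrite F0 mulr0 add0r invf_div mulrAC ler_pdivlMr ?ltr_wpDl //.
  by have : 0 <= `|ipw f g| * ipw g g; [exact: mulr_ge0|nra].
have Fp : 0 < ipw f f by rewrite lt_def F0.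
have [P0|P0] := eqVneq `|ipw f g| 0; first by rewrite P0 expr0n mulr_ge0.
have Pp : 0 < `|ipw f g| by rewrite lt_def P0 normr_ge0.
(* With this [c] the first term of Young's inequality equals [|ipw f g|], which is half of the
   left-hand side. *)
have c0 : 0 < `|ipw f g| / ipw f f by rewrite divr_gt0.
have := y _ c0; rewrite divfK // invf_div mulrAC -lerBlDl ler_pdivlMr //; nra.
Qed.

Section strong_convergence.
Variables (S : Type) (F : set_system S).

Definition sconv (f_ : S -> T -> R) f :=
  ipw (fun x => f_ n x - f x) (fun x => f_ n x - f x) @[n --> F] --> (0 : R).

Context {FF : Filter F}.

Lemma ipw_cvg0 (f_ g_ : S -> T -> R) c : (forall n, L2w (f_ n)) -> (forall n, L2w (g_ n)) ->
  ipw (f_ n) (f_ n) @[n --> F] --> (0 : R) ->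
  ipw (g_ n) (g_ n) @[n --> F] --> (c : R) ->
  ipw (f_ n) (g_ n) @[n --> F] --> (0 : R).
Proof.
move=> Lf Lg f0 gc; apply/norm_cvg0P.
suff : Num.sqrt (ipw (f_ n) (f_ n) * ipw (g_ n) (g_ n)) @[n --> F] --> (0 : R).
  apply: squeeze_cvgr; last exact: cvg_cst.
  apply: nearW => n; rewrite normr_ge0 /= -sqrtr_sqr ler_wsqrtr //; exact: cauchy_schwarz.
rewrite -[X in _ --> X]sqrtr0; apply: continuous_cvg; first exact: sqrt_continuous.
by rewrite -[X in _ --> X](mul0r c); exact: cvgM.
Qed.

Lemma sconv_ipw (f_ g_ : S -> T -> R) f g : (forall n, L2w (f_ n)) -> L2w f ->
  (forall n, L2w (g_ n)) -> L2w g -> sconv f_ f -> sconv g_ g ->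
  ipw (f_ n) (g_ n) @[n --> F] --> ipw f g.
Proof.
move=> Lf_ Lf Lg_ Lg cf cg.
have Lfd n := L2wB (Lf_ n) Lf; have Lgd n := L2wB (Lg_ n) Lg.
have -> : (fun n => ipw (f_ n) (g_ n)) = (fun n =>
  ipw (fun x => f_ n x - f x) (fun x => g_ n x - g x) + ipw (fun x => f_ n x - f x) g
  + ipw (fun x => g_ n x - g x) f + ipw f g).
  apply/funext => n; rewrite ipwBl // !ipwBr // !ipwBl //.
  by rewrite (ipwC (g_ n) f) (ipwC g f); ring.
rewrite -[X in _ --> X]add0r; apply: cvgD; last exact: cvg_cst.
rewrite -[X in _ --> X]addr0; apply: cvgD; last first.
  by apply: (@ipw_cvg0 _ (fun=> f) (ipw f f)) => //; exact: cvg_cst.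
rewrite -[X in _ --> X]addr0; apply: cvgD; first exact: (@ipw_cvg0 _ _ 0).
by apply: (@ipw_cvg0 _ (fun=> g) (ipw g g)) => //; exact: cvg_cst.
Qed.

End strong_convergence.

Lemma ipwE f : L2w f -> (ipw f f)%:E = (\int[mu]_(x in D) (w x * f x ^+ 2)%:E)%E.
Proof.
move=> [mf fi]; rewrite /ipw /Rintegral fineK //.
exact: (integrable_fin_num mD fi).
Qed.

(* Fatou's lemma applied to 2 f_n^2 + 2 f^2 - (f_n - f)^2 >= 0. *)
Lemma pointwise_sconv (f_ : nat -> T -> R) f : (forall n, L2w (f_ n)) -> L2w f ->
  (forall x, D x -> f_ n x @[n --> \oo] --> f x) ->
  ipw (f_ n) (f_ n) @[n --> \oo] --> ipw f f -> sconv \oo f_ f.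
Proof.
move=> Lf_ Lf ptw nrm.
have Ld n := L2wB (Lf_ n) Lf.
pose h n x := 2 * (w x * f_ n x ^+ 2) + 2 * (w x * f x ^+ 2) - w x * (f_ n x - f x) ^+ 2.
have hi n : mu.-integrable D (EFin \o h n).
  apply: (integrableBR mD); last by case: (Ld n).
  by apply: (integrableDR mD); apply: (integrableZR mD); [case: (Lf_ n)|case: Lf].
have h0 n x : D x -> 0 <= h n x.
  move=> Dx; rewrite /h (_ : _ - _ = w x * (f_ n x + f x) ^+ 2); last by ring.
  by rewrite mulr_ge0 ?w0 // sqr_ge0.
have hE n : \int[mu]_(x in D) h n x =
    2 * ipw (f_ n) (f_ n) + 2 * ipw f f - ipw (fun x => f_ n x - f x) (fun x => f_ n x - f x).
  rewrite /h RintegralB //; [|apply: (integrableDR mD); apply: (integrableZR mD); [by case: (Lf_ n)|by case: Lf]|by case: (Ld n)].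
  rewrite RintegralD //; [|by apply: (integrableZR mD); [by case: (Lf_ n)]|by apply: (integrableZR mD); [by case: Lf]].
  by rewrite RintegralZl ?(Lf_ n).2 // RintegralZl ?Lf.2 //.
have hl x : D x -> limn_einf (fun n => (h n x)%:E) = (4 * (w x * f x ^+ 2))%:E.
  move=> Dx; apply: (cvg_limn_einf_sup _).1; apply: cvg_EFin; first exact: nearW.
  have c1 := ptw x Dx.
  have cw : (cst (w x) : nat -> R) n @[n --> \oo] --> w x by exact: cvg_cst.
  have cf : (cst (f x) : nat -> R) n @[n --> \oo] --> f x by exact: cvg_cst.
  have -> : 4 * (w x * f x ^+ 2) = 2 * (w x * (f x * f x)) + 2 * (w x * f x ^+ 2) - w x * ((f x - f x) * (f x - f x)).
    by ring.
  have c2 : (cst 2 : nat -> R) n @[n --> \oo] --> (2 : R) by exact: cvg_cst.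
  have c4 := cvgM c2 (cvgM cw (cvgM c1 c1)).
  have c5 := cvgM cw (cvgM (cvgB c1 cf) (cvgB c1 cf)).
  have c6 : (cst (2 * (w x * f x ^+ 2)) : nat -> R) n @[n --> \oo] --> 2 * (w x * f x ^+ 2).
    exact: cvg_cst.
  rewrite (_ : fine \o _ = fun n => 2 * (w x * (f_ n x * f_ n x)) + 2 * (w x * f x ^+ 2)
     - w x * ((f_ n x - f x) * (f_ n x - f x))).
    by apply: cvgB; [apply: cvgD; [exact: c4|exact: c6]|exact: c5].
  by apply/funext => n; rewrite /h /= !expr2.
have mh n : measurable_fun D (EFin \o h n) by exact: measurable_int (hi n).
have h0E n x : D x -> (0 <= (EFin \o h n) x)%E by move=> Dx; rewrite lee_fin; exact: h0.
have := fatou mu mD mh h0E.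
rewrite (_ : (\int[mu]_(x in D) _ = (4 * ipw f f)%:E)%E); last first.
  rewrite -[in RHS](RintegralZl 4 mD (L2w_mul Lf Lf)) /Rintegral fineK; last first.
    by apply: (integrable_fin_num mD); apply: integrableZR => //; exact: L2w_mul.
  by apply: eq_integral => x; rewrite inE => Dx; rewrite [LHS](hl x Dx) expr2.
under [X in limn_einf X]eq_fun => n.
  rewrite (_ : (\int[mu]_(x in D) _ = (\int[mu]_(x in D) h n x)%:E)%E); last first.
    by rewrite /Rintegral fineK //; exact: (integrable_fin_num mD (hi n)).
  rewrite hE; over.
rewrite limn_einf_lim; set u := fun n => _.
rewrite (cvg_lim _ (ereal_nondecreasing_cvgn (nondecreasing_einfs u))) // => fat.
apply/cvgrPdist_lt => e e0.
have e2 : 0 < e / 2 by rewrite divr_gt0.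
have e4 : 0 < e / 4 by rewrite divr_gt0.
(* Fatou bounds [4 |f|^2] by the lower limit of [2 |f_n|^2 + 2 |f|^2 - |f_n - f|^2]. Losing [e / 2]
   here and twice [e / 4] in the convergence of the norms leaves [|f_n - f|^2 < e]. *)
have : ((4 * ipw f f - e / 2)%:E < ereal_sup (range (einfs u)))%E.
  by apply: lt_le_trans fat; rewrite lte_fin ltrBlDr ltrDl.
move=> /ereal_sup_gt[_ [N _ <-]] HN.
move/cvgrPdist_lt : nrm => /(_ _ e4) nrm.
near=> n.
have : (einfs u N <= u n)%E.
  by apply: ereal_inf_lbound; exists n => //=; near: n; exact: nbhs_infty_ge.
move=> /(lt_le_trans HN); rewrite lte_fin => H1.
have : `|ipw f f - ipw (f_ n) (f_ n)| < e / 4 by near: n.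
have := ipw_ge0 (fun x => f_ n x - f x).
rewrite ltr_norml => d0 /andP[H2 H3]; rewrite sub0r normrN ger0_norm //; lra.
Unshelve. all: by end_near. Qed.

End weighted_L2.

(** * Gaussian weight and cutoffs *)

Section derivative_tools.
Context {R : realType}.

Lemma is_derive_comp1 (V : normedModType R) (f : V -> R) (phi : R -> R) X v df p :
  is_derive X v f df -> is_derive (f X) (1 : R) phi p ->
  is_derive X v (fun x => phi (f x)) (p * df).
Proof.
move=> hf hp.
pose g (h : R) := f (X + h *: v).
have hg : is_derive (0 : R) (1 : R) g df.
  apply/(is_derive_quotient (a := X) (v := v) (f := f)) => //.
  by move=> h; rewrite /g addr0 [_ *: 1]mulr1 addrC.
have hg0 : is_derive (g 0) (1 : R) phi p by rewrite /g scale0r addr0.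
apply/(is_derive_quotient (b := 0) (w := 1) (g := phi \o g)).
  by move=> h; rewrite /g /= addr0 [_ *: 1]mulr1 addrC.
Qed.

Lemma is_derive_mul (V : normedModType R) (f g : V -> R) X v df dg :
  is_derive X v f df -> is_derive X v g dg ->
  is_derive X v (fun x => f x * g x) (df * g X + f X * dg).
Proof.
move=> hf hg; have := is_deriveM hf hg.
by rewrite (_ : f X *: dg + g X *: df = df * g X + f X * dg) //= /GRing.scale /=; ring.
Qed.

Lemma is_derive_add (V : normedModType R) (f g : V -> R) X v df dg :
  is_derive X v f df -> is_derive X v g dg ->
  is_derive X v (fun x => f x + g x) (df + dg).
Proof. by move=> hf hg; exact: is_deriveD. Qed.

Lemma is_derive_sub (V : normedModType R) (f g : V -> R) X v df dg :
  is_derive X v f df -> is_derive X v g dg ->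
  is_derive X v (fun x => f x - g x) (df - dg).
Proof. by move=> hf hg; exact: is_deriveB. Qed.

Lemma is_derive_scalel (V : normedModType R) (c : R) (f : V -> R) X v df :
  is_derive X v f df -> is_derive X v (fun x => c * f x) (c * df).
Proof. by move=> hf; have := @is_deriveZ _ _ _ f c X v df hf. Qed.

(** The remainder bound is global in [h], so the derivatives of coordinates, of the square norm, of
    the squared positive part and of the heat profile at time 0 each follow from one inequality. *)
Lemma is_derive_quadratic (f : R -> R) x l C :
  (forall h, `|f (x + h) - f x - l * h| <= C * h ^+ 2) -> is_derive x (1 : R) f l.
Proof.
move=> H.
suff cv : h^-1 *: ((f \o shift x) (h *: 1) - f x) @[h --> 0^'] --> l.
  by apply: DeriveDef; [apply/cvg_ex; exists l|exact: (cvg_lim _ cv)].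
apply/cvgrPdist_le => e e0.
have C0 : 0 <= C by rewrite (le_trans (normr_ge0 _) (le_trans (H 1) _)) // expr1n mulr1.
near=> h.
have h0 : h != 0 by near: h; exact: nbhs_dnbhs_neq.
have hC : `|h| < e / (C + 1).
  by near: h; apply: dnbhs0_lt; rewrite divr_gt0 // ltr_wpDl.
have h1 : 0 < `|h| by rewrite normr_gt0.
rewrite /= [_ *: 1]mulr1 (_ : l - _ = - (h^-1 * (f (x + h) - f x - l * h))); last first.
  by rewrite /GRing.scale /= [h + x]addrC; field.
rewrite normrN normrM normfV mulrC ler_pdivrMr // (le_trans (H h)) //.
rewrite -real_normK ?num_real // expr2 mulrA ler_pM2r //.
rewrite ltr_pdivlMr ?ltr_wpDl // in hC; nra.
Unshelve. all: by end_near. Qed.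

Lemma is_derive_coord n (X : 'rV[R]_n) i j :
  is_derive X 'e_i (fun Y : 'rV[R]_n => Y 0 j) ((i == j)%:R : R).
Proof.
rewrite -[X](addr0 X) -[0](scale0r ('e_i)); apply/is_derive_line.
rewrite (_ : (fun h => _) = (fun h => X 0 j + (i == j)%:R * h)); last first.
  by apply/funext => h; rewrite !mxE /= eq_sym mulrC.
apply: (@is_derive_quadratic _ _ _ 0) => h.
by rewrite mul0r normr_le0 (_ : _ - _ - _ = 0) //; ring.
Qed.

Lemma is_derive_sqnorm n (X : 'rV[R]_n) i :
  is_derive X 'e_i (@sqnorm R n) (2 * X 0 i).
Proof.
rewrite -[X](addr0 X) -[0](scale0r ('e_i)); apply/is_derive_line.
rewrite scale0r addr0 (_ : (fun h => _) = (fun h => sqnorm X + 2 * X 0 i * h + h ^+ 2)); last first.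
  apply/funext => h; rewrite /sqnorm (bigD1 i) //= [in RHS](bigD1 i) //= !mxE !eqxx /= mulr1.
  rewrite (eq_bigr (fun j => X 0 j ^+ 2)) => [|j ji]; first by ring.
  by rewrite !mxE (negbTE ji) /= mulr0 addr0.
apply: (@is_derive_quadratic _ _ _ 1) => h.
by rewrite mul1r (_ : _ - _ - _ = h ^+ 2); [rewrite ger0_norm ?sqr_ge0|ring].
Qed.

Lemma is_derive_pospart_sqr (x : R) :
  is_derive x (1 : R) (fun r => Num.max 0 r ^+ 2) (2 * Num.max 0 x).
Proof.
apply: (@is_derive_quadratic _ _ _ 1) => h; rewrite mul1r ler_norml.
by case: (leP 0 x) => x0; case: (leP 0 (x + h)) => xh; apply/andP; split; nra.
Qed.

Definition gwt n (a : R) (X : 'rV[R]_n.+1) : R := X 0 ord0 `^ a * expR (- (sqnorm X / 4)).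

Lemma gwt_ge0 n a (X : 'rV[R]_n.+1) : 0 <= gwt a X.
Proof. by rewrite mulr_ge0 ?powR_ge0 ?expR_ge0. Qed.

Lemma measurable_gwt n a : measurable_fun setT (@gwt n a).
Proof.
apply: measurable_funM.
  apply: (measurableT_comp (measurable_powR a)); exact: measurable_coord.
apply: measurableT_comp => //; apply: measurable_funN; apply: measurable_funM => //.
exact: measurable_sqnorm.
Qed.

Lemma is_derive_gwt n a (X : 'rV[R]_n.+1) i : 0 < X 0 ord0 ->
  is_derive X 'e_i (gwt a) (gwt a X * ((i == ord0)%:R * (a / X 0 ord0) - X 0 i / 2)).
Proof.
move=> X0.
have h1 := is_derive_comp1 (is_derive_coord X i ord0) (is_derive1_powR a X0).
have h2 : is_derive X 'e_i (fun Y => expR (- (sqnorm Y / 4)))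
    (expR (- (sqnorm X / 4)) * (- 4^-1 * (2 * X 0 i))).
  have h := is_derive_scalel (- 4^-1) (is_derive_sqnorm X i).
  have := is_derive_comp1 h (is_derive_expR _).
  rewrite (_ : (fun x => _) = fun Y : 'rV[R]_n.+1 => expR (- (sqnorm Y / 4))) ?funeqE => [|Y]; last first.
    by congr expR; ring.
  by rewrite (_ : - 4^-1 * sqnorm X = - (sqnorm X / 4)) //; ring.
have := is_derive_mul h1 h2; rewrite (_ : _ + _ =
  gwt a X * ((i == ord0)%:R * (a / X 0 ord0) - X 0 i / 2)) // /gwt.
have -> : X 0 ord0 `^ (a - 1) = X 0 ord0 `^ a / X 0 ord0.
  rewrite powRB; first by rewrite powRr1 // ltW.
  by apply/implyP => _; rewrite gt_eqF.
by field; rewrite gt_eqF.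
Qed.

(** The square of a positive part is C^1 with an explicit gradient of size [O(1/k)]. One derivative
    is enough, since the cutoff is differentiated only once. *)
Definition cutoff n (k : R) (X : 'rV[R]_n) : R := Num.max 0 (1 - sqnorm X / k ^+ 2) ^+ 2.

Definition dcutoff n (k : R) (i : 'I_n) (X : 'rV[R]_n) : R :=
  - (4 * X 0 i / k ^+ 2) * Num.max 0 (1 - sqnorm X / k ^+ 2).

Lemma is_derive_cutoff n k (X : 'rV[R]_n) i : is_derive X 'e_i (cutoff k) (dcutoff k i X).
Proof.
have h1 : is_derive X 'e_i (fun Y : 'rV[R]_n => 1 - sqnorm Y / k ^+ 2) (0 - (k ^+ 2)^-1 * (2 * X 0 i)).
  have h0 : is_derive X 'e_i (cst 1 : 'rV[R]_n -> R) 0 by exact: is_derive_cst.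
  apply: (is_derive_sub h0).
  rewrite (_ : (fun x => _) = fun x => (k ^+ 2)^-1 * sqnorm x); last by apply/funext => x; rewrite mulrC.
  by apply: is_derive_scalel; exact: is_derive_sqnorm.
have := is_derive_comp1 h1 (is_derive_pospart_sqr _).
by rewrite (_ : _ * _ = dcutoff k i X) // /dcutoff; ring.
Qed.

Lemma cutoff_ge0 n k (X : 'rV[R]_n) : 0 <= cutoff k X.
Proof. exact: sqr_ge0. Qed.

Lemma cutoff_factor n (k : R) (X : 'rV[R]_n) : 0 <= Num.max 0 (1 - sqnorm X / k ^+ 2) <= 1.
Proof.
rewrite le_max lexx /= ge_max ler01 /= gerBl.
by rewrite divr_ge0 ?sqnorm_ge0 ?sqr_ge0.
Qed.

Lemma cutoff_le1 n k (X : 'rV[R]_n) : cutoff k X <= 1.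
Proof. by have /andP[h1 h2] := cutoff_factor k X; rewrite /cutoff expr_le1. Qed.

Lemma cutoff_factor0 n (k : R) (X : 'rV[R]_n) : 0 < k -> k ^+ 2 <= sqnorm X ->
  Num.max 0 (1 - sqnorm X / k ^+ 2) = 0.
Proof.
by move=> k0 kX; apply/max_idPl; rewrite subr_le0 ler_pdivlMr ?exprn_gt0 // mul1r.
Qed.

Lemma sqnorm_gt_norm n (k : R) (X : 'rV[R]_n) : 0 < k -> k < `|X| -> k ^+ 2 <= sqnorm X.
Proof.
move=> k0; rewrite leNgt; apply: contraTN => Xk; rewrite -leNgt ltW // mx_norm_lt //.
apply/forallP => i; have := sqr_coord_le X i; rewrite ltr_norml => h; apply/andP; split; nra.
Qed.

Lemma cutoff0 n k (X : 'rV[R]_n) : 0 < k -> k < `|X| -> cutoff k X = 0.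
Proof. by move=> k0 kX; rewrite /cutoff cutoff_factor0 ?expr0n //; exact: sqnorm_gt_norm. Qed.

Lemma dcutoff0 n k i (X : 'rV[R]_n) : 0 < k -> k < `|X| -> dcutoff k i X = 0.
Proof. by move=> k0 kX; rewrite /dcutoff cutoff_factor0 ?mulr0 //; exact: sqnorm_gt_norm. Qed.

Lemma dcutoff_le n k i (X : 'rV[R]_n) : 0 < k -> `|dcutoff k i X| <= 4 / k.
Proof.
move=> k0; have [kX|kX] := leP (k ^+ 2) (sqnorm X).
  by rewrite /dcutoff cutoff_factor0 // mulr0 normr0 divr_ge0 // ltW.
have /andP[h1 h2] := cutoff_factor k X.
have Xk : `|X 0 i| <= k.
  have := sqr_coord_le X i; rewrite ler_norml => h; apply/andP; split; nra.
rewrite /dcutoff normrM normrN !normrM (ger0_norm h1) normfV (ger0_norm (sqr_ge0 k)) (@ger0_norm _ 4) //.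
apply: (@le_trans _ _ (4 * k / k ^+ 2 * 1)).
  by rewrite ler_pM // ?mulr_ge0 ?invr_ge0 ?sqr_ge0 // ler_wpM2r ?invr_ge0 ?sqr_ge0 // ler_wpM2l.
by rewrite mulr1 expr2 invfM mulrA mulfK ?gt_eqF.
Qed.

Lemma cvg_dcutoff n i (X : 'rV[R]_n) : dcutoff k.+1%:R i X @[k --> \oo] --> (0 : R).
Proof.
apply/norm_cvg0P; apply: (@squeeze_cvgr _ _ _ _ (cst 0) (fun k => 4 * k.+1%:R^-1)).
- by apply: nearW => k; rewrite normr_ge0 dcutoff_le.
- exact: cvg_cst.
- rewrite -[X in _ --> X](mulr0 4); apply: cvgM; first exact: cvg_cst.
  exact: cvg_harmonic.
Qed.

Lemma cvg_cutoff n (X : 'rV[R]_n) : cutoff k.+1%:R X @[k --> \oo] --> (1 : R).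
Proof.
apply: (@squeeze_cvgr _ _ _ _ (fun k => 1 - 2 * sqnorm X * k.+1%:R^-1) (cst 1)); last first.
- exact: cvg_cst.
- rewrite -[X in _ --> X](subr0 1) -[X in _ - X](mulr0 (2 * sqnorm X)).
  apply: cvgB; first exact: cvg_cst.
  by apply: cvgM; [exact: cvg_cst|exact: cvg_harmonic].
apply: nearW => k; rewrite cutoff_le1 andbT.
have k1 : 1 <= k.+1%:R :> R by rewrite ler1n.
have k0 : 0 < k.+1%:R :> R by rewrite ltr0n.
have r0 := sqnorm_ge0 X.
have rr : sqnorm X / k.+1%:R ^+ 2 <= sqnorm X * k.+1%:R^-1.
  by rewrite ler_wpM2l // lef_pV2 ?posrE ?exprn_gt0 // expr2 ler_peMl // ltW.
have r1 : 0 <= sqnorm X / k.+1%:R ^+ 2 by rewrite divr_ge0 // sqr_ge0.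
rewrite /cutoff -mulrA; move: rr r1; set u := sqnorm X / _; set v := sqnorm X / _ => rr r1.
by case: (leP 0 (1 - u)) => h; nra.
Qed.

End derivative_tools.

(** * Weak form of a degenerate elliptic equation *)

(** Reads off boundary limits from continuity relative to a closed set: the approach may be along
    any filter that stays in [A]. *)
Lemma within_cvg (T U : topologicalType) (A : set T) (h : T -> U) x (S : Type)
    (F : set_system S) {FF : Filter F} (g : S -> T) :
  {within A, continuous h} -> A x -> g s @[s --> F] --> x -> (\forall s \near F, A (g s)) ->
  h (g s) @[s --> F] --> h x.
Proof.
move=> ch Ax gx Ag; have /= chx := ch x.
apply: (@cvg_comp _ _ _ g h F (nbhs (x : subspace A)) _ _ chx).
apply/(subspace_cvgP _ Ax) => P; rewrite /within /= => xP.
have gP : \forall s \near F, (A (g s) -> P (g s)) by exact: (gx _ xP).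
change (\forall s \near F, P (g s)).
by apply: filterS2 gP Ag => s; apply.
Qed.

Section continuity_tools.
Context {R : realType}.

Section topological.
Context {T : topologicalType}.
Implicit Types (f g : T -> R) (x : T).

Lemma cont_cst (c : R) x : {for x, continuous (fun=> c)}.
Proof. exact: cst_continuous. Qed.

Lemma contM f g x : {for x, continuous f} -> {for x, continuous g} ->
  {for x, continuous (fun y => f y * g y)}.
Proof. by move=> cf cg; exact: (cvgM cf cg). Qed.

Lemma contD f g x : {for x, continuous f} -> {for x, continuous g} ->
  {for x, continuous (fun y => f y + g y)}.
Proof. by move=> cf cg; exact: (cvgD cf cg). Qed.

Lemma contN f x : {for x, continuous f} -> {for x, continuous (fun y => - f y)}.
Proof. by move=> cf; exact: (cvgN cf). Qed.

Lemma cont_sum (I : finType) (f : I -> T -> R) x : (forall i, {for x, continuous (f i)}) ->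
  {for x, continuous (fun y => \sum_i f i y)}.
Proof.
move=> cf.
suff H s : {for x, continuous (fun y => \sum_(i <- s) f i y)} by exact: H.
elim: s => [|i s IH].
  by rewrite (_ : (fun _ => _) = fun=> 0) ?funeqE => [|t]; [exact: cont_cst|rewrite big_nil].
rewrite (_ : (fun _ => _) = fun y => f i y + \sum_(j <- s) f j y); first exact: contD.
by apply/funext => y; rewrite big_cons.
Qed.

Lemma contX f n x : {for x, continuous f} -> {for x, continuous (fun y => f y ^+ n)}.
Proof.
move=> cf; elim: n => [|n IH].
  by rewrite (_ : (fun _ => _) = fun=> 1) ?funeqE => [|t]; [exact: cont_cst|rewrite expr0].
rewrite (_ : (fun _ => _) = fun y => f y * f y ^+ n); first exact: contM.
by apply/funext => y; rewrite exprS.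
Qed.

Lemma contV f x : f x != 0 -> {for x, continuous f} -> {for x, continuous (fun y => (f y)^-1)}.
Proof. by move=> fx cf; exact: (cvgV fx cf). Qed.

Lemma cont_max0 f x : {for x, continuous f} -> {for x, continuous (fun y => Num.max 0 (f y))}.
Proof.
move=> cf; rewrite (_ : (fun _ => _) = fun y => 2^-1 * (f y + `|f y|)).
  apply: contM; first exact: cont_cst; apply: contD => //.
  by apply: continuous_comp => //; exact: norm_continuous.
by apply/funext => y; rewrite maxr_absE add0r sub0r normrN mulrC.
Qed.

Lemma cont_comp f (phi : R -> R) x : {for x, continuous f} -> {for f x, continuous phi} ->
  {for x, continuous (fun y => phi (f y))}.
Proof. by move=> cf cp; exact: (continuous_comp cf cp). Qed.

End topological.

Lemma derivable_cont (f : R -> R) (x l : R) : is_derive x (1 : R) f l -> {for x, continuous f}.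
Proof. by case=> d _; apply: differentiable_continuous; exact/derivable1_diffP. Qed.

Lemma cont_powR (a x : R) : 0 < x -> {for x, continuous (fun r : R => r `^ a)}.
Proof. by move=> x0; apply: derivable_cont; exact: is_derive1_powR. Qed.

Lemma cont_gwt n a (X : 'rV[R]_n.+1) : 0 < X 0 ord0 -> {for X, continuous (gwt a)}.
Proof.
move=> X0; apply: contM.
  apply: (@cont_comp _ (fun Y : 'rV[R]_n.+1 => Y 0 ord0) (fun r => r `^ a)).
    exact: continuous_coord.
  exact: cont_powR.
apply: (@cont_comp _ (fun Y : 'rV[R]_n.+1 => - (sqnorm Y / 4)) expR); last exact: continuous_expR.
by apply: contN; apply: contM; [exact: continuous_sqnorm|exact: cont_cst].
Qed.

Lemma cont_cutoff_factor n k (X : 'rV[R]_n) :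
  {for X, continuous (fun Y : 'rV[R]_n => Num.max 0 (1 - sqnorm Y / k ^+ 2))}.
Proof.
apply: cont_max0; apply: contD; first exact: cont_cst.
by apply: contN; apply: contM; [exact: continuous_sqnorm|exact: cont_cst].
Qed.

Lemma cont_cutoff n k (X : 'rV[R]_n) : {for X, continuous (cutoff k)}.
Proof. by apply: contX; exact: cont_cutoff_factor. Qed.

Lemma cont_dcutoff n k i (X : 'rV[R]_n) : {for X, continuous (dcutoff k i)}.
Proof.
apply: contM; last exact: cont_cutoff_factor.
apply: contN; apply: contM; last exact: cont_cst.
by apply: contM; [exact: cont_cst|exact: continuous_coord].
Qed.

End continuity_tools.

Section weak_form.
Context {R : realType}.
Variables (n : nat) (a B : R) (dV ddV dphi : 'I_n.+1 -> 'rV[R]_n.+1 -> R).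
Variables (phi G N : 'rV[R]_n.+1 -> R).
Local Notation mu := (@lebesgue_rV R).
Local Notation H := (@halfspace R n).
Local Notation L2 := (L2w (mu n.+1) H (gwt a)).
Hypothesis hdV : forall i X, H X -> is_derive X 'e_i (dV i) (ddV i X).
Hypothesis hphi : forall i X, H X -> is_derive X 'e_i phi (dphi i X).
Hypothesis cdV : forall i X, H X -> {for X, continuous (dV i)}.
Hypothesis cddV : forall i X, H X -> {for X, continuous (ddV i)}.
Hypothesis cphi : forall X, H X -> {for X, continuous phi}.
Hypothesis cdphi : forall i X, H X -> {for X, continuous (dphi i)}.
Hypothesis cG : forall X, H X -> {for X, continuous G}.
Hypothesis pde : forall X, H X ->
  \sum_i ddV i X + a / X 0 ord0 * dV ord0 X - \sum_i X 0 i / 2 * dV i X = G X.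
Hypothesis cN : {within closed_halfspace n, continuous N}.
Hypothesis cphi0 : {within closed_halfspace n, continuous phi}.
Hypothesis hN : forall X, H X -> N X = X 0 ord0 `^ a * dV ord0 X.
Hypothesis bN : forall y, `|N (consrv 0 y) * phi (consrv 0 y)| <= B.
Hypothesis LdV : forall i, L2 (dV i).
Hypothesis Lphi : L2 phi.
Hypothesis Ldphi : forall i, L2 (dphi i).
Hypothesis LG : L2 G.

Let mH : measurable H. Proof. exact: (measurable_coord_gt (0 : R)). Qed.
Let oH : open H. Proof. exact: (@open_coord_gt R n 0). Qed.
Let w0 (X : 'rV[R]_n.+1) (_ : H X) : 0 <= gwt a X. Proof. exact: gwt_ge0. Qed.
Let mw : measurable_fun H (@gwt R n a).
Proof. by apply: measurable_funTS; exact: measurable_gwt. Qed.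

(* The i-th component of the vector field gwt * cutoff * phi * dV and its i-th
   partial derivative. *)
Let g k (i : 'I_n.+1) X := gwt a X * (cutoff k X * (phi X * dV i X)).
Let dg k (i : 'I_n.+1) X :=
  gwt a X * ((i == ord0)%:R * (a / X 0 ord0) - X 0 i / 2) * (cutoff k X * (phi X * dV i X)) +
  gwt a X * (dcutoff k i X * (phi X * dV i X) +
             cutoff k X * (dphi i X * dV i X + phi X * ddV i X)).
(** The divergence of the vector field, with the second derivatives of [V] eliminated by the
    equation. Only in this form is it dominated uniformly in [k]. *)
Let f k X := gwt a X * (cutoff k X * (phi X * G X) +
  \sum_i (dcutoff k i X * phi X + cutoff k X * dphi i X) * dV i X).

Let is_derive_g k i X : H X -> is_derive X 'e_i (g k i) (dg k i X).
Proof.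
move=> HX; have h := is_derive_mul (hphi i HX) (hdV i HX).
by have := is_derive_mul (is_derive_gwt a i HX) (is_derive_mul (is_derive_cutoff k X i) h).
Qed.

Let cont_dg k i X : H X -> {for X, continuous (dg k i)}.
Proof.
move=> HX; have cg : {for X, continuous (gwt a)} by exact: cont_gwt.
have cc := @cont_cutoff R n.+1 k X.
have cd := @cont_dcutoff R n.+1 k i X.
have c1 := cphi HX; have c2 := @cdV i X HX; have c3 := @cddV i X HX; have c4 := @cdphi i X HX.
apply: contD; last first.
  apply: contM => //; apply: contD; first by apply: contM => //; exact: contM.
  by apply: contM => //; apply: contD; exact: contM.
apply: contM; last by apply: contM => //; exact: contM.
apply: contM => //; apply: contD.
  apply: contM; first exact: cont_cst; apply: contM; first exact: cont_cst.
  by apply: contV; [rewrite gt_eqF|exact: continuous_coord].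
by apply: contN; apply: contM; [exact: continuous_coord|exact: cont_cst].
Qed.

Let sum_dg k X : H X -> \sum_i dg k i X = f k X.
Proof.
move=> HX; rewrite /f -(pde HX).
pose c := gwt a X * (cutoff k X * phi X).
rewrite (eq_bigr (fun i => c * ddV i X + c * ((i == ord0)%:R * (a / X 0 ord0 * dV i X)) +
  (- c) * (X 0 i / 2 * dV i X) +
  gwt a X * ((dcutoff k i X * phi X + cutoff k X * dphi i X) * dV i X))); last first.
  by move=> i _; rewrite /dg /c; ring.
rewrite !big_split /= -!mulr_sumr.
rewrite (_ : \sum_i (i == ord0)%:R * (a / X 0 ord0 * dV i X) = a / X 0 ord0 * dV ord0 X); last first.
  by rewrite (bigD1 ord0) //= mul1r big1 ?addr0 // => i /negbTE ->; rewrite mul0r.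
by rewrite /c; ring.
Qed.

Let support_g k i X : 0 < k -> k < `|X| -> g k i X = 0 /\ dg k i X = 0.
Proof.
move=> k0 kX; rewrite /g /dg cutoff0 // dcutoff0 //; split; ring.
Qed.

Let integral_f k e : 0 < k -> 0 < e ->
  (\int[mu n.+1]_(X in coord_gt n e) (f k X)%:E = \int[mu n]_y (- g k ord0 (consrv e y))%:E)%E.
Proof.
move=> k0 e0.
transitivity (\int[mu n.+1]_(X in coord_gt n e) \sum_i (dg k i X)%:E)%E.
  apply: eq_integral => X; rewrite inE => eX.
  by rewrite sumEFin sum_dg //; exact: lt_trans eX.
have idg i : (mu n.+1).-integrable (coord_gt n e) (EFin \o dg k i).
  apply: (integrable_halfspace_support e0 (@cont_dg k i)) => X kX.
  by have [] := support_g i k0 kX.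
rewrite integral_sum //; last exact: measurable_coord_gt.
rewrite big_ord_recl big1 ?adde0 => [|j _].
  apply: (@integral_partial_normal _ _ _ e k) => // X; first exact: cont_dg.
  - by move=> kX; have [] := support_g ord0 k0 kX.
  - exact: is_derive_g.
  - by move=> kX; have [] := support_g ord0 k0 kX.
apply: (@integral_partial_tangential _ _ _ e k _ _ _ (g k (lift ord0 j))) => // X; first exact: cont_dg.
- by move=> kX; have [] := support_g (lift ord0 j) k0 kX.
- exact: is_derive_g.
- by move=> kX; have [] := support_g (lift ord0 j) k0 kX.
Qed.

(** The common majorant of all [f k] with [k >= 1]; the factor 4 comes from the bound [4 / k] on the
    cutoff gradient. *)
Let F X := gwt a X * `|phi X * G X| +
   \sum_i (4 * (gwt a X * `|phi X * dV i X|) + gwt a X * `|dphi i X * dV i X|).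

Let norm_gwt (X : 'rV[R]_n.+1) : `|gwt a X| = gwt a X. Proof. by rewrite ger0_norm //; exact: gwt_ge0. Qed.

Let norm_integrable (u v : 'rV[R]_n.+1 -> R) : L2 u -> L2 v ->
  (mu n.+1).-integrable H (EFin \o (fun X => gwt a X * `|u X * v X|)).
Proof.
move=> Lu Lv; have := integrable_normR (L2w_mul mH w0 mw Lu Lv).
by congr integrable; apply/funext => X /=; rewrite normrM norm_gwt.
Qed.

Let integrable_F : (mu n.+1).-integrable H (EFin \o F).
Proof.
apply: (integrableDR mH); first exact: norm_integrable.
apply: (integrable_sumR mH) => i; apply: (integrableDR mH); last exact: norm_integrable.
by apply: (integrableZR mH); exact: norm_integrable.
Qed.

Let f_le k X : 1 <= k -> `|f k X| <= F X.
Proof.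
move=> k1; have k0 : 0 < k by rewrite (lt_le_trans ltr01).
rewrite /f normrM norm_gwt /F.
rewrite [X in _ <= _ + X](eq_bigr (fun i => gwt a X * (4 * `|phi X * dV i X| + `|dphi i X * dV i X|))); last first.
  by move=> i _; ring.
rewrite -mulr_sumr -mulrDr ler_wpM2l ?gwt_ge0 //.
have c0 := cutoff_ge0 k X; have c1 := cutoff_le1 k X.
apply: le_trans (ler_normD _ _) _; apply: lerD.
  by rewrite normrM ger0_norm // ler_piMl.
apply: le_trans (ler_norm_sum _ _ _) _; apply: ler_sum => i _.
rewrite mulrDl; apply: le_trans (ler_normD _ _) _; apply: lerD.
  rewrite -(mulrA (dcutoff k i X)) normrM ler_wpM2r // (le_trans (dcutoff_le i X k0)) // ler_pdivrMr //.
  by rewrite ler_peMr.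
by rewrite -(mulrA (cutoff k X)) normrM ger0_norm // ler_piMl.
Qed.

Let mf k : measurable_fun H (f k).
Proof.
have mc : measurable_fun H (@cutoff R n.+1 k).
  by apply: continuous_measurable_rV => [|X _]; [exact: oH|exact: cont_cutoff].
have md i : measurable_fun H (@dcutoff R n.+1 k i).
  by apply: continuous_measurable_rV => [|X _]; [exact: oH|exact: cont_dcutoff].
have mp := measurable_L2w Lphi.
apply: measurable_funM => //; apply: measurable_funD.
  by apply: measurable_funM => //; apply: measurable_funM => //; exact: measurable_L2w LG.
apply: measurable_sum => i; apply: measurable_funM; last exact: measurable_L2w (LdV i).
apply: measurable_funD; apply: measurable_funM => //; exact: measurable_L2w (Ldphi i).
Qed.

Let rho (y : 'rV[R]_n) := expR (- (sqnorm y / 4)).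

(** In the normal component the power [X_0^a] of the weight merges with the normal derivative into
    [N], which is continuous up to the boundary although its two factors need not be. *)
Let gE k e y : 0 < e -> g k ord0 (consrv e y) =
  expR (- (e ^+ 2 / 4)) * rho y * (cutoff k (consrv e y) * (N (consrv e y) * phi (consrv e y))).
Proof.
move=> e0; have HX : H (consrv e y) by rewrite /halfspace /= consrv0.
rewrite /g hN // /gwt sqnorm_consrv consrv0 /rho mulrDl opprD expRD; ring.
Qed.

Let inv_n (m : nat) : R := m.+1%:R^-1.
Let inv_gt0 m : 0 < inv_n m. Proof. by rewrite invr_gt0 ltr0n. Qed.
Let cvg_inv : inv_n m @[m --> \oo] --> (0 : R). Proof. exact: cvg_harmonic. Qed.

Let cvg_trace (h : 'rV[R]_n.+1 -> R) y : {within closed_halfspace n, continuous h} ->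
  h (consrv (inv_n m) y) @[m --> \oo] --> h (consrv 0 y).
Proof.
move=> ch; apply: (within_cvg ch).
- by rewrite /closed_halfspace /= consrv0.
- exact: (cvg_comp _ _ cvg_inv (@continuous_consrv1 R n y 0)).
- by apply: nearW => m; rewrite /closed_halfspace /= consrv0 ltW.
Qed.

Let bound_trace k : exists2 C, 0 <= C & forall e y, 0 <= e -> `|consrv e y| <= k ->
  `|N (consrv e y) * phi (consrv e y)| <= C.
Proof.
have sub : [set X : 'rV[R]_n.+1 | 0 <= X 0 ord0 /\ `|X| <= k] `<=` closed_halfspace n.
  by move=> X [].
have [C1 C10 H1] := compact_continuous_bound (@compact_slab R n 0 k) (continuous_subspaceW sub cN).
have [C2 C20 H2] := compact_continuous_bound (@compact_slab R n 0 k) (continuous_subspaceW sub cphi0).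
exists (C1 * C2) => [|e y e0 ek]; first exact: mulr_ge0.
rewrite normrM ler_pM //.
  by apply: H1; rewrite /= consrv0.
by apply: H2; rewrite /= consrv0.
Qed.

Let mtrace (h : 'rV[R]_n.+1 -> R) e : {within closed_halfspace n, continuous h} -> 0 <= e ->
  measurable_fun setT (fun y => h (consrv e y)).
Proof.
move=> ch e0; apply: continuous_measurable_rV; first exact: openT.
move=> y _; apply: (@within_cvg _ _ _ h _ _ (nbhs y) _ (fun y => consrv e y) ch).
- by rewrite /closed_halfspace /= consrv0.
- exact: continuous_consrv2.
- by apply: nearW => z; rewrite /closed_halfspace /= consrv0.
Qed.

Let rho0 y : 0 <= rho y. Proof. exact: expR_ge0. Qed.
Let mrho : measurable_fun setT rho.
Proof.
apply: measurableT_comp => //; apply: measurable_funN; apply: measurable_funM => //.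
exact: measurable_sqnorm.
Qed.
Let irho : (mu n).-integrable setT (EFin \o rho).
Proof.
have i4 : 0 < 4^-1 :> R by [].
have := integrable_gauss_rV n i4.
by congr integrable; apply/funext => y /=; rewrite /rho mulNr mulrC.
Qed.

Let mcut k e : measurable_fun setT (fun y : 'rV[R]_n => cutoff k (consrv e y)).
Proof.
apply: continuous_measurable_rV => [|y _]; first exact: openT.
apply: continuous_comp; [exact: continuous_consrv2|exact: cont_cutoff].
Qed.

Let T k e y := rho y * (cutoff k (consrv e y) * (N (consrv e y) * phi (consrv e y))).

Let mT k e : 0 <= e -> measurable_fun setT (T k e).
Proof.
move=> e0; apply: measurable_funM => //; apply: measurable_funM => //.
by apply: measurable_funM; exact: mtrace.
Qed.

(** The height [e] tends to 0 while the cutoff stays fixed. On the support of the cutoff [N] and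
    [phi] are bounded by compactness, which dominates the boundary integrals; [F] dominates the
    interior ones. *)
Let limit_normal k : 1 <= k -> \int[mu n.+1]_(X in H) f k X = \int[mu n]_y (- T k 0 y).
Proof.
move=> k1; have k0 : 0 < k by rewrite (lt_le_trans ltr01).
have l1 : \int[mu n.+1]_(X in H) (f k \_ (coord_gt n (inv_n m))) X @[m --> \oo] -->
    \int[mu n.+1]_(X in H) f k X.
  refine (proj2 (@dominatedR _ _ _ (mu n.+1) H mH (fun m => f k \_ (coord_gt n (inv_n m)))
    (f k) F _ _ integrable_F _)).
  - move=> m; apply/measurable_restrict => //; first exact: measurable_coord_gt.
    by apply: measurable_funS (@mf k) => //; move=> X [].
  - move=> X HX; apply: cvg_near_cst; near=> m.
    rewrite /patch mem_set // /coord_gt /=; near: m.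
    exact: (cvgr_lt _ cvg_inv).
  - move=> m X HX; rewrite /patch; case: ifP => _; first exact: f_le.
    by rewrite normr0 (le_trans _ (f_le X k1)).
have [C C0 HC] := bound_trace k.
have l2 : \int[mu n]_y (- (expR (- (inv_n m ^+ 2 / 4)) * T k (inv_n m) y)) @[m --> \oo] -->
    \int[mu n]_y (- T k 0 y).
  refine (proj2 (@dominatedR _ _ _ (mu n) setT measurableT
    (fun m y => - (expR (- (inv_n m ^+ 2 / 4)) * T k (inv_n m) y)) _ (fun y => C * rho y) _ _ _ _)).
  - move=> m; apply: measurable_funN; apply: measurable_funM => //; apply: mT; exact: ltW.
  - move=> y _; apply: cvgN; rewrite -[X in _ --> X]mul1r; apply: cvgM.
      have c : {for 0, continuous (fun r : R => expR (- (r ^+ 2 / 4)))}.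
        apply: (@cont_comp _ _ (fun r : R => - (r ^+ 2 / 4)) expR); last exact: continuous_expR.
        by apply: contN; apply: contM; [exact: contX|exact: cont_cst].
      have := cvg_comp _ _ cvg_inv c.
      by rewrite expr0n /= mul0r oppr0 expR0.
    apply: cvgM; first exact: cvg_cst.
    apply: cvgM; last by apply: cvgM; exact: cvg_trace.
    have c : {for 0, continuous (fun r : R => cutoff k (consrv r y))}.
      by apply: continuous_comp; [exact: continuous_consrv1|exact: cont_cutoff].
    exact: (cvg_comp _ _ cvg_inv c).
  - by apply: integrableZR.
  - move=> m y _; rewrite normrN normrM ger0_norm ?expR_ge0 //.
    rewrite /T normrM (ger0_norm (rho0 y)) mulrA.
    have [ky|ky] := ltP k `|consrv (inv_n m) y|.
      rewrite cutoff0 // mul0r normr0 mulr0 mulr_ge0 //.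
    rewrite normrM (ger0_norm (cutoff_ge0 _ _)) mulrA [C * _]mulrC.
    have h1 : expR (- (inv_n m ^+ 2 / 4)) * cutoff k (consrv (inv_n m) y) <= 1.
      rewrite mulr_ile1 ?expR_ge0 ?cutoff_ge0 ?cutoff_le1 //.
      by rewrite -expR0 ler_expR oppr_le0 divr_ge0 ?sqr_ge0.
    rewrite -[leLHS](_ : rho y * (`|N (consrv (inv_n m) y) * phi (consrv (inv_n m) y)| *
      (expR (- (inv_n m ^+ 2 / 4)) * cutoff k (consrv (inv_n m) y))) = _); last by ring.
    rewrite ler_wpM2l //; apply: le_trans (HC (inv_n m) y (ltW (inv_gt0 m)) ky).
    by rewrite ler_piMr.
apply: (cvg_unique _ l1); first exact: Rhausdorff.
apply: cvg_trans l2.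
rewrite (_ : (fun m => \int[mu n.+1]_(X in H) _) = (fun m =>
  \int[mu n]_y - (expR (- (inv_n m ^+ 2 / 4)) * T k (inv_n m) y))) //.
apply/funext => m; rewrite -Rintegral_mkcondr.
have -> : H `&` coord_gt n (inv_n m) = coord_gt n (inv_n m).
  by apply/seteqP; split=> [X []//|X mX]; split => //; exact: lt_trans mX.
rewrite /Rintegral integral_f //; congr fine; apply: eq_integral => y _.
by rewrite gE // /T -!mulrA.
Unshelve. all: by end_near. Qed.

(** The cutoff is removed last. [F] still dominates in the interior, while on the boundary
    compactness is lost and the global bound [bN] takes over. *)
Lemma weak_form :
  \int[mu n.+1]_(X in H) (gwt a X * (phi X * G X + \sum_i dphi i X * dV i X)) =
  \int[mu n]_y (- (expR (- (sqnorm y / 4)) * (N (consrv 0 y) * phi (consrv 0 y)))).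
Proof.
have k1 m : 1 <= m.+1%:R :> R by rewrite ler1n.
have l1 : \int[mu n.+1]_(X in H) f m.+1%:R X @[m --> \oo] -->
  \int[mu n.+1]_(X in H) (gwt a X * (phi X * G X + \sum_i dphi i X * dV i X)).
  refine (proj2 (@dominatedR _ _ _ (mu n.+1) H mH (fun m => f m.+1%:R) _ F _ _ integrable_F _)).
  - by move=> m; exact: mf.
  - move=> X HX; apply: cvgM; first exact: cvg_cst.
    apply: cvgD.
      rewrite -[Y in _ --> Y]mul1r; apply: cvgM; [exact: cvg_cutoff|exact: cvg_cst].
    have H1 i : (dcutoff m.+1%:R i X * phi X + cutoff m.+1%:R X * dphi i X) * dV i X @[m --> \oo] -->
        dphi i X * dV i X.
      apply: cvgM; last exact: cvg_cst.
      rewrite -[Y in _ --> Y]add0r -[Y in Y + _](mul0r (phi X)) -[Y in _ + Y]mul1r.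
      by apply: cvgD; (apply: cvgM; last exact: cvg_cst); [exact: cvg_dcutoff|exact: cvg_cutoff].
    suff Hs s : \sum_(i <- s) (dcutoff m.+1%:R i X * phi X + cutoff m.+1%:R X * dphi i X) * dV i X
        @[m --> \oo] --> \sum_(i <- s) dphi i X * dV i X by exact: Hs.
    elim: s => [|i s IH].
      by rewrite big_nil; under eq_fun do rewrite big_nil; exact: cvg_cst.
    by rewrite big_cons; under eq_fun do rewrite big_cons; apply: cvgD.
  - by move=> m X _; exact: f_le.
apply: (cvg_unique _ l1); first exact: Rhausdorff.
rewrite (_ : (fun m => _) = (fun m : nat => \int[mu n]_y (- T m.+1%:R 0 y))); last first.
  by apply/funext => m; exact: limit_normal.
refine (proj2 (@dominatedR _ _ _ (mu n) setT measurableT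
    (fun m y => - T m.+1%:R 0 y) _ (fun y => B * rho y) _ _ _ _)).
- by move=> m; apply: measurable_funN; exact: mT.
- move=> y _; apply: cvgN; apply: cvgM; first exact: cvg_cst.
  rewrite -[Y in _ --> Y]mul1r; apply: cvgM; [exact: cvg_cutoff|exact: cvg_cst].
- by apply: integrableZR.
- move=> m y _; rewrite normrN /T normrM (ger0_norm (rho0 y)) mulrC ler_wpM2r //.
  rewrite normrM (ger0_norm (cutoff_ge0 _ _)) (le_trans _ (bN y)) //.
  by rewrite ler_piMl // cutoff_le1.
Qed.

End weak_form.

(** * A weighted trace inequality *)

Section trace_inequality.
Context {R : realType}.
Local Notation leb := (@lebesgue_measure R).
Local Notation mu := (@lebesgue_rV R).

Lemma cont_integrable (f : R -> R) (e d : R) :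
  (forall r, e <= r <= d -> {for r, continuous f}) ->
  leb.-integrable `[e, d] (EFin \o f).
Proof.
move=> cf; apply: continuous_compact_integrable; first exact: segment_compact.
by apply: continuous_in_subspaceT => r; rewrite inE /= in_itv /=; exact: cf.
Qed.

(* With G(r) = - (1 + l r^(1-a)) (1 - (r/d)^2), where l and d are chosen so that
   r^(-a) G^2 / kappa + G' <= 3 r / d^2, the derivative of G v^2 is at most
   (3 / d^2) r^a v^2 + kappa r^a v'^2. *)
Lemma trace_line (a kappa : R) : a < 1 -> 0 < kappa -> exists2 C, 0 <= C &
  forall (v dv : R -> R) (v0 : R),
  (forall r : R, 0 < r -> is_derive r (1 : R) v (dv r)) ->
  (forall r : R, 0 < r -> {for r, continuous dv}) ->
  v r @[r --> 0^'+] --> v0 ->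
  ((v0 ^+ 2)%:E <= \int[leb]_(r in `]0%R, 1%R[) (r `^ a * (C * v r ^+ 2 + kappa * dv r ^+ 2))%:E)%E.
Proof.
move=> a1 k0; pose b := 1 - a; have b0 : 0 < b by rewrite subr_gt0.
(* [l] is chosen so that [l b = 9 / (4 kappa)], and [d] so that [q = l r^b] stays below 1/2 for
   [r <= d]. Then [(1 + q)^2 <= 9/4], which is what Young's inequality has to pay for. *)
pose l := 9 / (4 * kappa * b); have l0 : 0 < l by rewrite divr_gt0 // !mulr_gt0.
pose d := (1 + 2 * l) `^ (- b^-1).
have d0 : 0 < d by rewrite powR_gt0 // ltr_pwDl // mulr_ge0 // ltW.
have ld : l * d `^ b <= 2^-1.
  rewrite -powRrM mulNr mulVf ?gt_eqF // powR_inv1; last by rewrite addr_ge0 // mulr_ge0 // ltW.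
  have p1 : 0 < 1 + 2 * l by rewrite ltr_pwDl // mulr_ge0 // ltW.
  rewrite ler_pdivrMr // mulrDr mulr1 mulrA mulVf // mul1r; lra.
have d1 : d <= 1.
  rewrite -[leRHS](powRr0 (1 + 2 * l)) ler_powR //; last by rewrite oppr_le0 invr_ge0 ltW.
  by rewrite lerDl mulr_ge0 // ltW.
exists (3 / d ^+ 2) => [|v dv v0 hv cv v0E]; first by rewrite divr_ge0 // sqr_ge0.
have cont_v (r : R) : 0 < r -> {for r, continuous v} by move=> r0; exact: derivable_cont (hv r r0).
pose F (r : R) := r `^ a * (3 / d ^+ 2 * v r ^+ 2 + kappa * dv r ^+ 2).
have F0 (r : R) : 0 <= F r.
  rewrite mulr_ge0 ?powR_ge0 // addr_ge0 // mulr_ge0 ?sqr_ge0 ?(ltW k0) //.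
  by rewrite divr_ge0 // sqr_ge0.
pose G (r : R) := - ((1 + l * r `^ b) * (1 - r ^+ 2 / d ^+ 2)).
pose dG (r : R) := - (l * (b * r `^ (- a)) * (1 - r ^+ 2 / d ^+ 2) + (1 + l * r `^ b) * (- (2 * r / d ^+ 2))).
have hG (r : R) : 0 < r -> is_derive r (1 : R) G (dG r).
  move=> r0; have h1 := is_derive1_powR b r0.
  rewrite (_ : b - 1 = - a) in h1; last by rewrite /b; ring.
  have h2 : is_derive r (1 : R) (fun r => 1 + l * r `^ b) (0 + l * (b * r `^ (- a))).
    exact: (is_derive_add (is_derive_cst (1 : R) r (1 : R)) (is_derive_scalel l h1)).
  have h3 : is_derive r (1 : R) (fun r => 1 - r ^+ 2 / d ^+ 2) (- (2 * r / d ^+ 2)).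
    have i2 : is_derive r (1 : R) (fun r => (d ^+ 2)^-1 * (r * r)) ((d ^+ 2)^-1 * (1 * r + r * 1)).
      exact: (is_derive_scalel (d ^+ 2)^-1 (is_derive_mul (is_derive_id r (1 : R)) (is_derive_id r (1 : R)))).
    have := is_derive_sub (is_derive_cst (1 : R) r (1 : R)) i2.
    rewrite (_ : (fun x : R => _) = (fun r => 1 - r ^+ 2 / d ^+ 2)); last first.
      by apply/funext => x; rewrite /= expr2 mulrC.
    by rewrite (_ : 0 - _ = - (2 * r / d ^+ 2)) //; ring.
  have := is_derive_scalel (-1) (is_derive_mul h2 h3).
  rewrite (_ : (fun x : R => _) = G); last by apply/funext => x; rewrite mulN1r.
  by rewrite add0r mulN1r.
have key (r : R) : 0 < r <= d -> 2 * (G r * (v r * dv r)) + dG r * v r ^+ 2 <= F r.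
  move=> /andP[r0 rd].
  have ra0 : 0 < r `^ a by rewrite powR_gt0.
  have rNa : r `^ (- a) = (r `^ a)^-1 by rewrite powRN.
  have lr0 : 0 <= l * r `^ b by rewrite mulr_ge0 ?powR_ge0 // ltW.
  have lr : l * r `^ b <= 2^-1.
    apply: le_trans ld; rewrite ler_wpM2l ?(ltW l0) // ge0_ler_powR ?nnegrE ?(ltW r0) ?(ltW d0) ?(ltW b0) //.
  (* Valid because [d <= 1] and [a < 1]; it trades the remaining [3 r / d^2] for the weighted
     [3 r^a / d^2]. *)
  have rra : r <= r `^ a.
    by apply: ger1_powR; [rewrite r0 (le_trans rd)|exact: ltW].
  have chi0 : 0 <= 1 - r ^+ 2 / d ^+ 2.
    by rewrite subr_ge0 ler_pdivrMr ?exprn_gt0 // mul1r !expr2 ler_pM ?(ltW r0) //.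
  have chi1 : 1 - r ^+ 2 / d ^+ 2 <= 1 by rewrite gerBl divr_ge0 ?sqr_ge0.
  have lb : l * b = 9 / 4 / kappa by rewrite /l; field; rewrite !gt_eqF.
  rewrite /F /dG rNa (mulrA l b) lb /G.
  set A := r `^ a in ra0 rra *; set q := l * r `^ b in lr0 lr *.
  set chi := 1 - r ^+ 2 / d ^+ 2 in chi0 chi1 *.
  have h1 : 2 * (- ((1 + q) * chi) * (v r * dv r)) <=
      kappa * A * dv r ^+ 2 + (9 / 4 / kappa / A * chi) * v r ^+ 2.
    have kA : 0 < kappa * A by rewrite mulr_gt0.
    apply: (@le_trans _ _ (kappa * A * dv r ^+ 2 + (kappa * A)^-1 * (((1 + q) * chi) ^+ 2 * v r ^+ 2))).
      rewrite -subr_ge0.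
      rewrite (_ : _ - _ = (kappa * A)^-1 * (kappa * A * dv r + (1 + q) * chi * v r) ^+ 2).
        by rewrite mulr_ge0 ?sqr_ge0 // invr_ge0 ltW.
      by field; rewrite !gt_eqF.
    rewrite lerD2l (_ : 9 / 4 / kappa / A * chi * v r ^+ 2 = (kappa * A)^-1 * (9 / 4 * chi * v r ^+ 2)); last first.
      by field; rewrite !gt_eqF.
    rewrite ler_wpM2l ?invr_ge0 ?(ltW kA) // ler_wpM2r ?sqr_ge0 // exprMn.
    have : (1 + q) ^+ 2 <= 9 / 4 by nra.
    move=> hq; apply: ler_pM; rewrite ?sqr_ge0 // expr2 ler_piMr //.
  have h2 : (1 + q) * (2 * r / d ^+ 2) <= A * (3 / d ^+ 2).
    rewrite (_ : (1 + q) * (2 * r / d ^+ 2) = (1 + q) * (2 * r) / d ^+ 2); last by ring.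
    by rewrite (mulrA A) ler_pM2r ?invr_gt0 ?exprn_gt0 //; nra.
  have v2 : 0 <= v r ^+ 2 by exact: sqr_ge0.
  have h3 := ler_wpM2r v2 h2.
  rewrite -subr_ge0; rewrite -subr_ge0 in h1; rewrite -subr_ge0 in h3.
  apply: le_trans (addr_ge0 h1 h3) _; rewrite le_eqVlt; apply/orP; left; apply/eqP.
  by field; rewrite !gt_eqF.
have cF (r : R) : 0 < r -> {for r, continuous F}.
  move=> r0; apply: contM; first exact: cont_powR.
  apply: contD; (apply: contM; first exact: cont_cst); apply: contX; [exact: cont_v|exact: cv].
pose K (r : R) := 2 * (G r * (v r * dv r)) + dG r * v r ^+ 2.
have cK (r : R) : 0 < r -> {for r, continuous K}.
  move=> r0; have cG : {for r, continuous G} := derivable_cont (hG r r0).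
  apply: contD; last apply: contM; [..|apply: contX; exact: cont_v].
    apply: contM; first exact: cont_cst; apply: contM => //.
    by apply: contM; [exact: cont_v|exact: cv].
  have c2 : {for r, continuous (fun x : R => 1 - x ^+ 2 / d ^+ 2)}.
    by apply: contD; [exact: cont_cst|apply: contN; apply: contM; [exact: contX|exact: cont_cst]].
  have cp e : {for r, continuous (fun x : R => l * x `^ e)}.
    by apply: contM; [exact: cont_cst|exact: cont_powR].
  have c3 : {for r, continuous (fun x : R => l * (b * x `^ (- a)))}.
    by apply: contM; [exact: cont_cst|apply: contM; [exact: cont_cst|exact: cont_powR]].
  have c4 : {for r, continuous (fun x : R => 1 + l * x `^ b)}.
    by apply: contD; [exact: cont_cst|exact: cp].
  have c5 : {for r, continuous (fun x : R => - (2 * x / d ^+ 2))}.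
    by apply: contN; apply: contM; [apply: contM; [exact: cont_cst|exact: cvg_id]|exact: cont_cst].
  exact: contN (contD (contM c3 c2) (contM c4 c5)).
have mF : measurable_fun `](0 : R), 1[ F.
  apply: open_continuous_measurable_fun; first exact: interval_open.
  by move=> r; rewrite inE /= in_itv /= => /andP[r0 _]; exact: cF.
(* [G] vanishes at [d] and [- G(e)] is at least [1 - e^2 / d^2], so integrating the derivative of
   [G v^2] over [[e, d]] controls [v(e)^2]. *)
have bound (e : R) : 0 < e < d ->
    (((1 - e ^+ 2 / d ^+ 2) * v e ^+ 2)%:E <= \int[leb]_(r in `]0%R, 1%R[) (F r)%:E)%E.
  move=> /andP[e0 ed].
  apply: (@le_trans _ _ (\int[leb]_(r in `[e, d[) (F r)%:E)%E); last first.
    apply: ge0_subset_integral => //.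
    - exact/measurable_EFinP.
    - by move=> r _; rewrite lee_fin.
    - move=> r; rewrite /= !in_itv /= => /andP[er rd].
      by rewrite (lt_le_trans e0 er) (lt_le_trans rd).
  have ms : measurable_fun `]e, d[ F.
    apply: measurable_funS mF => // r; rewrite /= !in_itv /= => /andP[er rd].
    by rewrite (lt_trans e0 er) (lt_le_trans rd).
  rewrite integral_itv_bndo_bndc; last first.
    by apply/measurable_EFinP/measurable_fun_itv_obnd_cbndP.
  apply: (@le_trans _ _ (\int[leb]_(r in `[e, d]) (K r)%:E)%E); last first.
    apply: le_integral => //.
    - by apply: cont_integrable => r /andP[er _]; apply: cK; exact: lt_le_trans er.
    - by apply: cont_integrable => r /andP[er _]; apply: cF; exact: lt_le_trans er.
    - move=> r; rewrite inE /= in_itv /= => /andP[er rd]; rewrite lee_fin; apply: key.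
      by rewrite rd (lt_le_trans e0 er).
  have Gd : G d = 0 by rewrite /G divff ?subrr ?mulr0 ?oppr0 // gt_eqF // exprn_gt0.
  have hder (r : R) : e <= r <= d -> is_derive r (1 : R) (fun r => G r * v r ^+ 2) (K r).
    move=> /andP[er _]; have r0 := lt_le_trans e0 er.
    have := is_derive_mul (hG r r0) (is_derive_mul (hv r r0) (hv r r0)).
    rewrite (_ : (fun x : R => _) = fun x => G x * v x ^+ 2); last by apply/funext => x; rewrite expr2.
    by rewrite (_ : _ + _ = K r) // /K; ring.
  have hcont (r : R) : e <= r <= d -> {for r, continuous K}.
    by move=> /andP[er _]; apply: cK; exact: lt_le_trans er.
  rewrite (ftc2 ed hder hcont) lee_fin.
  rewrite [leRHS](_ : _ = (1 + l * e `^ b) * ((1 - e ^+ 2 / d ^+ 2) * v e ^+ 2)); last first.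
    by rewrite Gd /G; ring.
  rewrite ler_peMl //; last by rewrite lerDl mulr_ge0 ?powR_ge0 // ltW.
  rewrite mulr_ge0 ?sqr_ge0 // subr_ge0 ler_pdivrMr ?exprn_gt0 // mul1r.
  by rewrite !expr2 ler_pM ?(ltW e0) ?(ltW ed).
have l1 : ((1 - r ^+ 2 / d ^+ 2) * v r ^+ 2)%:E @[r --> 0^'+] --> (v0 ^+ 2)%:E.
  apply: cvg_EFin; first exact: nearW.
  rewrite -[X in _ --> X]mul1r; apply: cvgM; last first.
    by rewrite expr2; under eq_fun do rewrite expr2; exact: cvgM.
  have c : {for 0, continuous (fun x : R => 1 - x ^+ 2 / d ^+ 2)}.
    by apply: contD; [exact: cont_cst|apply: contN; apply: contM; [exact: contX|exact: cont_cst]].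
  have := @cvg_at_right_filter _ _ _ 0 _ c.
  by rewrite expr0n /= mul0r subr0.
rewrite -(cvg_lim _ l1) //; apply: lime_le; first by apply/cvg_ex; eexists; exact: l1.
near=> e; apply: bound; apply/andP; split; first by [].
by near: e; apply: nbhs_right_lt.
Unshelve. all: by end_near. Qed.

(** [trace_line] is applied on every vertical line with [kappa / E], where [E = e^(1/4)]. Only
    heights [0 < r < 1] enter, and there the missing Gaussian factor [e^(-r^2/4)] is at least
    [1 / E]. *)
Lemma trace_inequality n (a kappa : R) : a < 1 -> 0 < kappa -> exists2 C, 0 <= C &
  forall phi dphi : 'rV[R]_n.+1 -> R,
  (forall X, halfspace n X -> is_derive X 'e_ord0 phi (dphi X)) ->
  (forall X, halfspace n X -> {for X, continuous phi}) ->
  (forall X, halfspace n X -> {for X, continuous dphi}) ->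
  {within closed_halfspace n, continuous phi} ->
  L2w (mu n.+1) (halfspace n) (gwt a) phi -> L2w (mu n.+1) (halfspace n) (gwt a) dphi ->
  (\int[mu n]_y (expR (- (sqnorm y / 4)) * phi (consrv 0%R y) ^+ 2)%:E <=
   (C * ipw (mu n.+1) (halfspace n) (gwt a) phi phi +
    kappa * ipw (mu n.+1) (halfspace n) (gwt a) dphi dphi)%:E)%E.
Proof.
move=> a1 k0; pose E := expR 4^-1 : R; have E0 : 0 < E by exact: expR_gt0.
have [C C0 HC] := trace_line a1 (divr_gt0 k0 E0).
exists (E * C) => [|phi dphi hphi cphi cdphi cphi0 Lphi Ldphi]; first by rewrite mulr_ge0 // ltW.
have mH : measurable (@halfspace R n) by exact: (measurable_coord_gt (0 : R)).
pose F (X : 'rV[R]_n.+1) := gwt a X * (E * C * phi X ^+ 2 + kappa * dphi X ^+ 2).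
have F0 X : 0 <= F X.
  rewrite mulr_ge0 ?gwt_ge0 // addr_ge0 // mulr_ge0 ?sqr_ge0 // ?mulr_ge0 // ltW //.
have mF : measurable_fun (halfspace n) F.
  apply: continuous_measurable_rV; first exact: (@open_coord_gt R n 0).
  move=> X; rewrite inE => HX; apply: contM; first exact: cont_gwt.
  by apply: contD; (apply: contM; first exact: cont_cst); apply: contX; [exact: cphi|exact: cdphi].
have w0 (X : 'rV[R]_n.+1) : halfspace n X -> 0 <= gwt a X by move=> _; exact: gwt_ge0.
have mw : measurable_fun (halfspace n) (@gwt R n a) by apply: measurable_funTS; exact: measurable_gwt.
have FE : F = fun X => E * C * (gwt a X * (phi X * phi X)) + kappa * (gwt a X * (dphi X * dphi X)).
  by apply/funext => X; rewrite /F; ring.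
have i1 := L2w_mul mH w0 mw Lphi Lphi; have i2 := L2w_mul mH w0 mw Ldphi Ldphi.
have -> : ((E * C * ipw (mu n.+1) (halfspace n) (gwt a) phi phi +
    kappa * ipw (mu n.+1) (halfspace n) (gwt a) dphi dphi)%:E =
    \int[mu n.+1]_(X in halfspace n) (F X)%:E)%E.
  transitivity (\int[mu n.+1]_(X in halfspace n) F X)%:E; last first.
    rewrite /Rintegral fineK // FE; apply: (integrable_fin_num mH).
    by apply: (integrableDR mH); apply: (integrableZR mH).
  congr EFin; rewrite FE RintegralD //; [|exact: (integrableZR mH)..].
  by rewrite !RintegralZl.
rewrite [leRHS]integral_mkcond.
have mp : measurable_fun setT ((fun X => (F X)%:E) \_ (halfspace n)).
  by apply/(measurable_restrictT _ mH); exact/measurable_EFinP.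
have p0 X : (0 <= ((fun X => (F X)%:E) \_ (halfspace n)) X)%E.
  by rewrite /patch; case: ifP => // _; rewrite lee_fin.
rewrite tonelli_rV2 //.
have ctr (y : 'rV[R]_n) : {for y, continuous (fun x : 'rV[R]_n => expR (- (sqnorm x / 4)) * phi (consrv 0 x) ^+ 2)}.
  apply: contM.
    apply: (@cont_comp _ _ (fun y : 'rV[R]_n => - (sqnorm y / 4)) expR); last exact: continuous_expR.
    by apply: contN; apply: contM; [exact: continuous_sqnorm|exact: cont_cst].
  apply: contX; apply: (@within_cvg _ _ _ phi _ _ (nbhs y) _ (fun y => consrv 0 y) cphi0).
  + by rewrite /closed_halfspace /= consrv0.
  + exact: continuous_consrv2.
  + by apply: nearW => z; rewrite /closed_halfspace /= consrv0.
apply: ge0_le_integral => //.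
- by move=> y _; rewrite lee_fin mulr_ge0 ?expR_ge0 ?sqr_ge0.
- apply/measurable_EFinP; apply: continuous_measurable_rV => [|y _]; [exact: openT|exact: ctr].
- apply: (@measurable_fun_fubini_tonelli_G _ _ _ _ R leb
    (fun p => ((fun X => (F X)%:E) \_ (halfspace n)) (consrv p.1 p.2))) => //.
  exact: (measurableT_comp mp (@measurable_consrv R n)).
move=> y _; pose rho := expR (- (sqnorm y / 4)).
have rho0 : 0 <= rho by exact: expR_ge0.
have Hxy (r : R) : 0 < r -> halfspace n (consrv r y) by rewrite /halfspace /= consrv0.
have hl : phi (consrv r y) @[r --> 0^'+] --> phi (consrv 0 y).
  apply: (@within_cvg _ _ _ phi _ _ _ _ (fun r => consrv r y) cphi0).
  + by rewrite /closed_halfspace /= consrv0.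
  + exact: cvg_at_right_filter (@continuous_consrv1 R n y 0).
  + near=> r; rewrite /closed_halfspace /= consrv0 ltW //.
rewrite EFinM.
have cphir (r : R) : 0 < r -> {for r, continuous (fun r => phi (consrv r y))}.
  by move=> r0; apply: continuous_comp; [exact: continuous_consrv1|exact: cphi (Hxy r r0)].
have cdphir (r : R) : 0 < r -> {for r, continuous (fun r => dphi (consrv r y))}.
  by move=> r0; apply: continuous_comp; [exact: continuous_consrv1|exact: cdphi (Hxy r r0)].
have cfr (r : R) : 0 < r -> {for r, continuous (fun r : R => r `^ a *
    (C * phi (consrv r y) ^+ 2 + kappa / E * dphi (consrv r y) ^+ 2))}.
  move=> r0; apply: contM; first exact: cont_powR.
  by apply: contD; (apply: contM; first exact: cont_cst); apply: contX; [exact: cphir|exact: cdphir].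
have hd (r : R) : 0 < r -> is_derive r (1 : R) (fun r => phi (consrv r y)) (dphi (consrv r y)).
  by move=> r0; apply/is_derive_consrv0/hphi/Hxy.
have hC := HC _ _ _ hd cdphir hl.
apply: le_trans (lee_wpmul2l _ hC) _; first by rewrite lee_fin.
rewrite -ge0_integralZl //; last 2 first.
- apply/measurable_EFinP; apply: open_continuous_measurable_fun; first exact: interval_open.
  by move=> r; rewrite inE /= in_itv /= => /andP[r0 _]; exact: cfr.
- move=> r _; rewrite lee_fin mulr_ge0 ?powR_ge0 // addr_ge0 // mulr_ge0 ?sqr_ge0 //.
  by rewrite divr_ge0 // ltW.
rewrite integral_mkcond; apply: ge0_le_integral => //.
- move=> r _; rewrite /patch; case: ifP => // _.
  rewrite lee_fin mulr_ge0 // mulr_ge0 ?powR_ge0 // addr_ge0 // mulr_ge0 ?sqr_ge0 //.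
  by rewrite divr_ge0 // ltW.
- apply/(measurable_restrictT _ (measurable_itv `]0, 1[)).
  apply/measurable_EFinP; apply: measurable_funM => //.
  apply: open_continuous_measurable_fun; first exact: interval_open.
  by move=> r; rewrite inE /= in_itv /= => /andP[r0 _]; exact: cfr.
- exact: (measurableT_comp mp (measurable_consrv1 y)).
move=> r _; rewrite {1}/patch; case: ifP => [|_]; last exact: p0.
rewrite inE /= in_itv /= => /andP[r0 r1].
rewrite /patch mem_set; last exact: Hxy.
rewrite lee_fin /F /gwt consrv0 sqnorm_consrv mulrDl opprD expRD -/rho.
set A := r `^ a; set p2 := phi _ ^+ 2; set d2 := dphi _ ^+ 2.
rewrite (_ : rho * (A * (C * p2 + kappa / E * d2)) = A * rho * (E^-1 * (E * C * p2 + kappa * d2))); last first.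
  by field; rewrite gt_eqF.
rewrite (_ : A * (expR (- (r ^+ 2 / 4)) * rho) * (E * C * p2 + kappa * d2) =
  A * rho * (expR (- (r ^+ 2 / 4)) * (E * C * p2 + kappa * d2))); last by ring.
rewrite ler_wpM2l ?mulr_ge0 ?powR_ge0 // ler_wpM2r //.
  by rewrite addr_ge0 // mulr_ge0 ?sqr_ge0 // ?mulr_ge0 // ltW.
rewrite -expRN ler_expR lerN2 ler_pdivrMr // mulVf // expr_le1 ?ltW //.
Unshelve. all: by end_near. Qed.

End trace_inequality.

(** * The power nonlinearity *)

Lemma EFin_Rintegral {R : realType} {dsp : measure_display} {T : measurableType dsp}
    {mu : {measure set T -> \bar R}} {D : set T} (f : T -> R) : measurable D ->
  mu.-integrable D (EFin \o f) ->
  (\int[mu]_(x in D) f x)%:E = (\int[mu]_(x in D) (f x)%:E)%E.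
Proof. by move=> mD fi; rewrite /Rintegral fineK //; exact: (integrable_fin_num mD fi). Qed.

Section power_nonlinearity.
Context {R : realType}.
Implicit Types x y : R.

(** The tangent-line inequality of the convex function [x^q] at [y], obtained from Young's
    inequality for [x] and [y^(q-1)]. *)
Lemma young_powR (q x y : R) : 1 < q -> 0 <= x -> 0 <= y ->
  q * (y `^ (q - 1) * x) <= x `^ q + (q - 1) * y `^ q.
Proof.
move=> q1 x0 y0; have q0 : 0 < q := lt_trans ltr01 q1.
have q10 : 0 < q - 1 by rewrite subr_gt0.
have h : q^-1 + (q / (q - 1))^-1 = 1 by field; rewrite !gt_eqF.
have := conjugate_powR x0 (powR_ge0 y (q - 1)) q0 (divr_gt0 q0 q10) h.
rewrite -powRrM (_ : (q - 1) * (q / (q - 1)) = q); last by field; rewrite gt_eqF.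
move=> /(ler_wpM2l (ltW q0)).
rewrite (_ : q * (x `^ q / q + y `^ q / (q / (q - 1))) = x `^ q + (q - 1) * y `^ q).
  by rewrite (mulrC x).
by field; rewrite !gt_eqF.
Qed.

Definition fpow (p v : R) : R := `|v| `^ (p - 1) * v.
Definition Fpow (p v : R) : R := `|v| `^ (p + 1) / (p + 1).

(* fpow p is the derivative of the convex function Fpow p. *)
Lemma Fpow_subgradient p x y : 1 < p -> fpow p x * (y - x) <= Fpow p y - Fpow p x.
Proof.
move=> p1; have p0 : 0 < p := lt_trans ltr01 p1.
have p10 : 0 < p + 1 by rewrite addr_gt0.
have q1 : 1 < p + 1 by rewrite ltrDr.
have := @young_powR (p + 1) `|y| `|x| q1 (normr_ge0 _) (normr_ge0 _).
rewrite addrK => h.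
have e1 : `|x| `^ p = `|x| `^ (p - 1) * `|x|.
  by rewrite mulrC mulr_powRB1.
have e2 : `|x| `^ (p + 1) = `|x| `^ (p - 1) * x ^+ 2.
  rewrite -(@mulr_powRB1 _ `|x| (p + 1)) // addrK e1 mulrCA -expr2 real_normK //.
  exact: num_real.
rewrite -(ler_pM2l p10) /fpow /Fpow.
rewrite (_ : (p + 1) * (`|y| `^ (p + 1) / (p + 1) - _) = `|y| `^ (p + 1) - `|x| `^ (p + 1)); last first.
  by field; rewrite gt_eqF.
rewrite e2 in h *.
have A0 : 0 <= `|x| `^ (p - 1) by exact: powR_ge0.
have xy : x * y <= `|x| * `|y| by rewrite -normrM ler_norm.
have := ler_wpM2l A0 xy; rewrite e1 in h; nra.
Qed.

Lemma powR_increment p M x y : 1 < p -> 0 <= x <= y -> y <= M ->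
  y `^ p - x `^ p <= p * M `^ (p - 1) * (y - x).
Proof.
move=> p1 /andP[x0 xy] yM; have y0 := le_trans x0 xy.
have p0 : 0 < p := lt_trans ltr01 p1.
have := young_powR p1 x0 y0.
have <- : y * y `^ (p - 1) = y `^ p by rewrite mulr_powRB1.
have h : y `^ (p - 1) <= M `^ (p - 1).
  by rewrite ge0_ler_powR ?nnegrE // ?subr_ge0 ?(ltW p1) // (le_trans y0).
have := powR_ge0 y (p - 1).
set A := y `^ (p - 1) in h *; set B := M `^ (p - 1) in h *; move=> A0 h2.
have : p * A * (y - x) <= p * B * (y - x).
  by rewrite ler_wpM2r ?subr_ge0 // ler_wpM2l // ltW.
nra.
Qed.

Lemma fpowN p v : fpow p (- v) = - fpow p v.
Proof. by rewrite /fpow normrN mulrN. Qed.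

Lemma fpow_ge0E p v : 1 < p -> 0 <= v -> fpow p v = v `^ p.
Proof.
by move=> p1 v0; rewrite /fpow ger0_norm // mulrC mulr_powRB1 // (lt_trans ltr01).
Qed.

Lemma fpow_increment p M x y : 1 < p -> x <= y -> `|x| <= M -> `|y| <= M ->
  0 <= fpow p y - fpow p x <= p * M `^ (p - 1) * (y - x).
Proof.
move=> p1 xy xM yM; apply/andP; split.
  rewrite subr_ge0; have := @Fpow_subgradient p x y p1; have := @Fpow_subgradient p y x p1.
  have [->//|xny] := eqVneq x y.
  have : 0 < y - x by rewrite subr_gt0 lt_def eq_sym xny.
  nra.
have p0 : 0 < p := lt_trans ltr01 p1.
have M0 : 0 <= M := le_trans (normr_ge0 _) xM.
have [x0|x0] := leP 0 x.
  have y0 := le_trans x0 xy.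
  rewrite !fpow_ge0E //; apply: powR_increment => //; first by rewrite x0.
  by rewrite -(ger0_norm y0).
(* For [x < 0 <= y] the increments from [x] to 0 and from 0 to [y] are bounded separately. *)
have [y0|y0] := leP 0 y.
  rewrite -[x]opprK fpowN opprK !fpow_ge0E // ?oppr_ge0 ?(ltW x0) //.
  rewrite ltr0_norm // in xM; rewrite ger0_norm // in yM.
  have nx0 : 0 <= - x by rewrite oppr_ge0 ltW.
  have h (v : R) : 0 <= v -> v <= M -> v `^ p <= p * M `^ (p - 1) * v.
    move=> v0 vM; have := @powR_increment p M 0 v p1.
    by rewrite lexx v0 !subr0 powR0 ?gt_eqF // subr0; apply.
  by have := h _ nx0 xM; have := h _ y0 yM; nra.
have e (z : R) : z < 0 -> fpow p z = - (- z) `^ p.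
  by move=> z0; rewrite -{1}[z]opprK fpowN fpow_ge0E // oppr_ge0 ltW.
rewrite ltr0_norm // in xM.
have yx : 0 <= - y <= - x by rewrite oppr_ge0 (ltW y0) lerN2.
have := powR_increment p1 yx xM; rewrite !e //; lra.
Qed.

Lemma fpow_lipschitz p M x y : 1 < p -> `|x| <= M -> `|y| <= M ->
  `|fpow p y - fpow p x| <= p * M `^ (p - 1) * `|y - x|.
Proof.
move=> p1 xM yM; have [xy|yx] := leP x y.
  have /andP[h0 h1] := fpow_increment p1 xy xM yM.
  by rewrite ger0_norm // ger0_norm ?subr_ge0.
have /andP[h0 h1] := fpow_increment p1 (ltW yx) yM xM.
by rewrite distrC ger0_norm // distrC ger0_norm // subr_ge0 ltW.
Qed.

(** Convexity replaces a Taylor expansion: the subgradient inequalities at [x] and at [y] enclose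
    the increment of [Fpow] between [fpow x (y - x)] and [fpow y (y - x)], and the Lipschitz bound
    on [fpow] measures the gap. *)
Lemma Fpow_trapezoid p M x y : 1 < p -> `|x| <= M -> `|y| <= M ->
  `|2^-1 * ((fpow p x + fpow p y) * (y - x)) - (Fpow p y - Fpow p x)| <=
  p * M `^ (p - 1) * (y - x) ^+ 2.
Proof.
move=> p1 xM yM.
have h1 := @Fpow_subgradient p x y p1; have h2 := @Fpow_subgradient p y x p1.
have h3 : `|(fpow p y - fpow p x) * (y - x)| <= p * M `^ (p - 1) * (y - x) ^+ 2.
  rewrite normrM -(@real_normK _ (y - x)) ?num_real // expr2 mulrA.
  by rewrite ler_wpM2r // fpow_lipschitz.
apply: le_trans h3; rewrite ler_norml; have := ler_norm ((fpow p y - fpow p x) * (y - x)).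
move=> h4; apply/andP; split; nra.
Qed.

Lemma fpow_le p M x : 1 < p -> `|x| <= M -> `|fpow p x| <= M `^ p.
Proof.
move=> p1 xM; have p0 : 0 < p := lt_trans ltr01 p1.
rewrite /fpow normrM (ger0_norm (powR_ge0 _ _)) mulrC mulr_powRB1 //.
by rewrite ge0_ler_powR ?nnegrE ?(ltW p0) // (le_trans _ xM).
Qed.

Lemma Fpow_le p M x : 1 < p -> `|x| <= M -> `|Fpow p x| <= M `^ (p + 1).
Proof.
move=> p1 xM; have p0 : 0 < p := lt_trans ltr01 p1.
have p10 : 0 < p + 1 by rewrite addr_gt0.
rewrite /Fpow normrM (ger0_norm (powR_ge0 _ _)) gtr0_norm ?invr_gt0 // ler_pdivrMr //.
rewrite -[leLHS]mulr1 ler_pM ?powR_ge0 //; last by rewrite lerDr ltW.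
by rewrite ge0_ler_powR ?nnegrE ?(ltW p10) // (le_trans _ xM).
Qed.

Lemma measurable_fpow p : measurable_fun setT (fpow p).
Proof.
apply: measurable_funM => //.
by apply: (measurableT_comp (measurable_powR _)); exact: normr_measurable.
Qed.

Lemma measurable_Fpow p : measurable_fun setT (Fpow p).
Proof.
apply: measurable_funM => //.
by apply: (measurableT_comp (measurable_powR _)); exact: normr_measurable.
Qed.

End power_nonlinearity.

Section jensen.
Context {R : realType}.
Local Notation leb := (@lebesgue_measure R).
Local Notation mu := (@lebesgue_rV R).

(* From 0 <= int (v' - (v(b) - v(a)) / (b - a))^2. *)
Lemma sqr_increment_le (v dv : R -> R) (a b : R) : a < b ->
  (forall x : R, a <= x <= b -> is_derive x (1 : R) v (dv x)) ->
  (forall x : R, a <= x <= b -> {for x, continuous dv}) ->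
  (((v b - v a) ^+ 2)%:E <= (b - a)%:E * \int[leb]_(x in `[a, b]) (dv x ^+ 2)%:E)%E.
Proof.
move=> ab hv cdv; have ba : 0 < b - a by rewrite subr_gt0.
pose m := (v b - v a) / (b - a).
have i1 : leb.-integrable `[a, b] (EFin \o dv) by exact: cont_integrable.
have i2 : leb.-integrable `[a, b] (EFin \o (fun x => dv x ^+ 2)).
  by apply: cont_integrable => x xab; apply: contX; exact: cdv.
have mI : measurable (`[a, b]%classic : set R) by [].
have ic : leb.-integrable `[a, b] (EFin \o (fun=> m ^+ 2)).
  by apply: cont_integrable => x _; exact: cont_cst.
have I1 : \int[leb]_(x in `[a, b]) dv x = v b - v a by rewrite /Rintegral (ftc2 ab hv cdv).
have : 0 <= \int[leb]_(x in `[a, b]) ((dv x - m) ^+ 2).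
  by apply: Rintegral_ge0 => x _; exact: sqr_ge0.
rewrite (_ : (fun x => (dv x - m) ^+ 2) = fun x => dv x ^+ 2 - 2 * m * dv x + m ^+ 2); last first.
  by apply/funext => x; ring.
have iZ : leb.-integrable `[a, b] (EFin \o (fun x => 2 * m * dv x)).
  by apply: cont_integrable => x xab; apply: contM; [exact: cont_cst|exact: cdv].
have iB : leb.-integrable `[a, b] (EFin \o (fun x => dv x ^+ 2 - 2 * m * dv x)).
  apply: cont_integrable => x xab; apply: contD; first by apply: contX; exact: cdv.
  by apply: contN; apply: contM; [exact: cont_cst|exact: cdv].
rewrite RintegralD // RintegralB //.
have Lm : fine (leb (`[a, b]%classic : set R)) = b - a.
  by rewrite (lebesgue_measure_itv `[a, b]) /= lte_fin ab.
rewrite RintegralZl // I1 Rintegral_cst // Lm => h.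
rewrite (_ : \int[leb]_(x in `[a, b]) (dv x ^+ 2)%:E = (\int[leb]_(x in `[a, b]) dv x ^+ 2)%:E)%E; last first.
  by rewrite (EFin_Rintegral _ i2).
rewrite -EFinM lee_fin; move: h; set I2 := \int[leb]_(x in _) _ => h.
have vE : v b - v a = m * (b - a) by rewrite /m divfK // gt_eqF.
rewrite vE in h *; nra.
Qed.

End jensen.

(** * The energy identity *)

Section L2_increment.
Context {R : realType}.
Local Notation leb := (@lebesgue_measure R).
Local Notation mu := (@lebesgue_rV R).
Variables (n : nat) (a A B : R) (V Vd : R -> 'rV[R]_n.+1 -> R).
Local Notation H := (@halfspace R n).
Local Notation L2 := (L2w (mu n.+1) H (gwt a)).
Local Notation ip := (ipw (mu n.+1) H (gwt a)).
Hypothesis hV : forall (t : R) X, A < t < B -> H X -> is_derive t (1 : R) (V^~ X) (Vd t X).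
Hypothesis cVd : forall Z : 'rV[R]_n.+2, A < Z 0 ord0 < B -> H (behrv Z) ->
  {for Z, continuous (fun Z : 'rV[R]_n.+2 => Vd (Z 0 ord0) (behrv Z))}.

Lemma measurable_halfspace m : measurable (@halfspace R m).
Proof. exact: (measurable_coord_gt (0 : R)). Qed.

Lemma open_halfspace m : open (@halfspace R m).
Proof. exact: (@open_coord_gt R m 0). Qed.

Lemma gwt_halfspace_ge0 m (X : 'rV[R]_m.+1) : halfspace m X -> 0 <= gwt a X.
Proof. by move=> _; exact: gwt_ge0. Qed.

Lemma measurable_gwt_halfspace m : measurable_fun (@halfspace R m) (@gwt R m a).
Proof. by apply: measurable_funTS; exact: measurable_gwt. Qed.

(** Jensen's inequality in time for each [X], integrated against the weight. Tonelli's theorem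
    exchanges time and space; for this, time is coordinate 0 of a vector of dimension [n + 2], and
    the joint continuity of [Vd] gives measurability. *)
Lemma L2_increment (t1 t2 K : R) : A < t1 -> t1 < t2 -> t2 < B ->
  L2 (V t1) -> L2 (V t2) ->
  (forall r : R, t1 <= r <= t2 -> L2 (Vd r) /\ ip (Vd r) (Vd r) <= K) ->
  ip (fun X => V t2 X - V t1 X) (fun X => V t2 X - V t1 X) <= (t2 - t1) ^+ 2 * K.
Proof.
move=> At1 t12 t2B L1 L2' HK.
have mH := @measurable_halfspace n.
have h0 : 0 < t2 - t1 by rewrite subr_gt0.
have LW := L2wB mH (@gwt_halfspace_ge0 n) (@measurable_gwt_halfspace n) L2' L1.
pose D : set 'rV[R]_n.+2 := [set Z : 'rV[R]_n.+2 | (t1 <= Z 0 ord0 <= t2) /\ H (behrv Z)].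
(* [D] is not open in time; measurability on it comes from continuity on the larger open set [O]. *)
pose O : set 'rV[R]_n.+2 := [set Z : 'rV[R]_n.+2 | (A < Z 0 ord0 < B) /\ H (behrv Z)].
pose phi (Z : 'rV[R]_n.+2) := gwt a (behrv Z) * Vd (Z 0 ord0) (behrv Z) ^+ 2.
have cphi Z : O Z -> {for Z, continuous phi}.
  move=> [ZAB HZ]; apply: contM; last by apply: contX; exact: cVd.
  by apply: continuous_comp; [exact: continuous_behrv|exact: cont_gwt].
have oO : open O.
  have -> : O = [set Z : 'rV[R]_n.+2 | A < Z 0 ord0] `&` [set Z : 'rV[R]_n.+2 | Z 0 ord0 < B] `&` [set Z : 'rV[R]_n.+2 | H (behrv Z)].
    apply/seteqP; split => Z; first by move=> [/andP[? ?] ?].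
    by move=> [[/= h1 h2] h3]; split; rewrite //= h1 h2.
  apply: openI; first apply: openI.
  - exact: open_coord_gt.
  - apply: (@open_comp _ _ (fun X : 'rV[R]_n.+2 => X 0 ord0) [set x | x < B]).
      by move=> X _; exact: continuous_coord.
    exact: open_lt.
  - apply: (@open_comp _ _ (@behrv R n.+1) H); first by move=> X _; exact: continuous_behrv.
    exact: open_halfspace.
have mphi : measurable_fun O phi.
  by apply: continuous_measurable_rV => // Z; rewrite inE; exact: cphi.
have DO : D `<=` O.
  by move=> Z [/andP[h1 h2] h3]; split=> //; rewrite (lt_le_trans At1) //= (le_lt_trans h2).
have mD : measurable D.
  have -> : D = (fun Z : 'rV[R]_n.+2 => (Z 0 ord0 : measurableTypeR R, behrv Z)) @^-1` (`[t1, t2]%classic `*` H).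
    by apply/seteqP; split => Z; rewrite /D /setX /= in_itv.
  have := @measurable_behrv R n.+1 measurableT _ (measurableX (measurable_itv `[t1, t2]) mH).
  by rewrite setTI.
pose f := (fun Z : 'rV[R]_n.+2 => (phi Z)%:E) \_ D.
have mf : measurable_fun setT f.
  apply/(measurable_restrictT _ mD); apply/measurable_EFinP.
  by apply: measurable_funS mphi => //; exact: open_measurable_rV.
have phi0 Z : 0 <= phi Z by rewrite mulr_ge0 ?gwt_ge0 ?sqr_ge0.
have f0 Z : (0 <= f Z)%E by rewrite /f /patch; case: ifP => // _; rewrite lee_fin.
have fE r X : f (consrv r X) =
    if (t1 <= r <= t2) && (X \in H) then (gwt a X * Vd r X ^+ 2)%:E else 0%E.
  rewrite /f /patch (_ : (consrv r X \in D) = (t1 <= r <= t2) && (X \in H)).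
    by case: ifP => // _; rewrite /phi consrv0 behrv_consrv.
  have DE : D (consrv r X) <-> (t1 <= r <= t2) /\ H X.
    by rewrite /D /mkset consrv0 behrv_consrv.
  apply/idP/andP => [/set_mem/DE[h1 h2]|[h1 /set_mem h2]]; last exact/mem_set/DE.
  by split => //; exact: mem_set.
have lo : ((t2 - t1)^-1%:E * (ip (fun X => V t2 X - V t1 X) (fun X => V t2 X - V t1 X))%:E
   <= \int[mu n.+2]_Z f Z)%E.
  rewrite ipwE // tonelli_rV2 // -ge0_integralZl //; last 3 first.
  - apply: measurable_int; exact: LW.2.
  - by move=> X _; rewrite lee_fin mulr_ge0 ?gwt_ge0 ?sqr_ge0.
  - by rewrite lee_fin invr_ge0 ltW.
  rewrite integral_mkcond; apply: ge0_le_integral => //.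
  - move=> X _; rewrite /patch; case: ifP => // _.
    by rewrite -EFinM lee_fin mulr_ge0 ?invr_ge0 ?(ltW h0) // mulr_ge0 ?gwt_ge0 ?sqr_ge0.
  - apply/(measurable_restrictT _ mH); apply: measurable_funeM.
    apply: measurable_int; exact: LW.2.
  - apply: (@measurable_fun_fubini_tonelli_G _ _ _ _ R leb (fun p => f (consrv p.1 p.2))).
      exact: (measurableT_comp mf (@measurable_consrv R n.+1)).
    by move=> p; exact: f0.
  move=> X _; rewrite {1}/patch; case: ifPn => HX; last first.
    by apply: integral_ge0 => r _; exact: f0.
  have HX' := set_mem HX.
  have cr (r : R) : t1 <= r <= t2 -> {for r, continuous (Vd^~ X)}.
    move=> /andP[r1 r2].
    have := @cVd (consrv r X); rewrite consrv0 behrv_consrv => /(_ _ HX') c.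
    have {}c : {for consrv r X, continuous (fun Z : 'rV[R]_n.+2 => Vd (Z 0 ord0) (behrv Z))}.
      by apply: c; rewrite (lt_le_trans At1) //= (le_lt_trans r2).
    have := continuous_comp (@continuous_consrv1 R n.+1 X r) c.
    rewrite (_ : _ \o _ = Vd^~ X) //.
    by apply/funext => r' /=; rewrite consrv0 behrv_consrv.
  have inc : (((V t2 X - V t1 X) ^+ 2)%:E <= (t2 - t1)%:E * \int[leb]_(r in `[t1, t2]) (Vd r X ^+ 2)%:E)%E.
    apply: (@sqr_increment_le R (V^~ X) (Vd^~ X)) => // r /andP[r1 r2].
    by apply: hV => //; rewrite (lt_le_trans At1) //= (le_lt_trans r2).
  have -> : (\int[leb]_r f (consrv r X) = (gwt a X)%:E * \int[leb]_(r in `[t1, t2]) (Vd r X ^+ 2)%:E)%E.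
    rewrite -ge0_integralZl //; last 3 first.
    - apply: measurable_int; apply: cont_integrable => r rt.
      by apply: contX; exact: cr.
    - by move=> r _; rewrite lee_fin sqr_ge0.
    - by rewrite lee_fin gwt_ge0.
    rewrite [RHS]integral_mkcond; apply: eq_integral => r _.
    by rewrite fE HX andbT /patch mem_setE in_itv /=; case: ifP.
  rewrite [X in (X <= _)%E](_ : _ = (gwt a X)%:E * ((t2 - t1)^-1%:E * ((V t2 X - V t1 X) ^+ 2)%:E))%E; last first.
    by rewrite -!EFinM; congr EFin; rewrite expr2; ring.
  apply: lee_wpmul2l; first by rewrite lee_fin gwt_ge0.
  have ih : (0 <= (t2 - t1)^-1%:E :> \bar R)%E by rewrite lee_fin invr_ge0 ltW.
  apply: le_trans (lee_wpmul2l ih inc) _.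
  by rewrite muleA -EFinM mulVf ?gt_eqF // mul1e.
have hi : (\int[mu n.+2]_Z f Z <= ((t2 - t1) * K)%:E)%E.
  rewrite tonelli_rV //.
  apply: (@le_trans _ _ (\int[leb]_(r in `[t1, t2]) K%:E)%E); last first.
    by rewrite integral_cst //= lebesgue_measure_itv /= lte_fin t12 -EFinM mulrC.
  rewrite [leRHS]integral_mkcond; apply: ge0_le_integral => //.
  - by move=> r _; apply: integral_ge0 => X _; exact: f0.
  - apply: (@measurable_fun_fubini_tonelli_F _ _ _ _ R (mu n.+1) (fun p => f (consrv p.1 p.2))).
      exact: (measurableT_comp mf (@measurable_consrv R n.+1)).
    by move=> p; exact: f0.
  - by apply/(measurable_restrictT _ (measurable_itv `[t1, t2])).
  move=> r _; under eq_integral do rewrite fE.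
  rewrite /patch (_ : (r \in `[t1, t2]%classic) = (t1 <= r <= t2)); last by rewrite mem_setE in_itv.
  case: ifPn => rt /=; last by rewrite integral0_eq.
  have [Lr Kr] := HK r rt.
  have <- : ((ip (Vd r) (Vd r))%:E = \int[mu n.+1]_x
      (if x \in H then (gwt a x * Vd r x ^+ 2)%:E else 0))%E by rewrite ipwE // integral_mkcond.
  by rewrite lee_fin.
have := le_trans lo hi; rewrite -EFinM lee_fin ler_pdivrMl // => h.
by rewrite expr2 -mulrA.
Qed.

End L2_increment.

Section energy.
Context {R : realType}.
Local Notation mu := (@lebesgue_rV R).
Variables (n : nat) (a be eta p M T : R).
Variables (V Vd N : R -> 'rV[R]_n.+1 -> R) (dV ddV : R -> 'I_n.+1 -> 'rV[R]_n.+1 -> R).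
Local Notation H := (@halfspace R n).
Local Notation L2 := (L2w (mu n.+1) H (gwt a)).
Local Notation ip := (ipw (mu n.+1) H (gwt a)).
Local Notation I t := (0 < t < T).
Hypothesis a1 : a < 1.
Hypothesis p1 : 1 < p.
Hypothesis be0 : 0 <= be.
Hypothesis eta0 : 0 <= eta.
Hypothesis hV : forall t i X, I t -> H X -> is_derive X 'e_i (V t) (dV t i X).
Hypothesis hdV : forall t i X, I t -> H X -> is_derive X 'e_i (dV t i) (ddV t i X).
Hypothesis cV : forall t X, I t -> H X -> {for X, continuous (V t)}.
Hypothesis cdV : forall t i X, I t -> H X -> {for X, continuous (dV t i)}.
Hypothesis cddV : forall t i X, I t -> H X -> {for X, continuous (ddV t i)}.
Hypothesis cVd : forall Z : 'rV[R]_n.+2, I (Z 0 ord0) -> H (behrv Z) ->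
  {for Z, continuous (fun Z : 'rV[R]_n.+2 => Vd (Z 0 ord0) (behrv Z))}.
Hypothesis hVt : forall (t : R) X, I t -> H X -> is_derive t (1 : R) (V^~ X) (Vd t X).
Hypothesis cV0 : forall t, I t -> {within closed_halfspace n, continuous (V t)}.
Hypothesis cN : forall t, I t -> {within closed_halfspace n, continuous (N t)}.
Hypothesis hN : forall t X, I t -> H X -> N t X = X 0 ord0 `^ a * dV t ord0 X.
Hypothesis flux : forall t y, I t -> N t (consrv 0 y) = - eta * fpow p (V t (consrv 0 y)).
Hypothesis pde : forall t X, I t -> H X ->
  \sum_i ddV t i X + a / X 0 ord0 * dV t ord0 X - \sum_i X 0 i / 2 * dV t i X =
  be / 2 * V t X - t * Vd t X.
Hypothesis V_le : forall t y, I t -> `|V t (consrv 0 y)| <= M.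
Hypothesis LV : forall t, I t -> L2 (V t).
Hypothesis LdV : forall t i, I t -> L2 (dV t i).
Hypothesis LVd : forall t, I t -> L2 (Vd t).
Hypothesis norm_Vd : forall t : R, I t -> ip (Vd r) (Vd r) @[r --> t] --> ip (Vd t) (Vd t).

Definition energy (t : R) : R :=
  2^-1 * \sum_i ip (dV t i) (dV t i) + be / 4 * ip (V t) (V t) -
  eta * \int[mu n]_y (expR (- (sqnorm y / 4)) * Fpow p (V t (consrv 0 y))).

Let mH : measurable H. Proof. exact: measurable_halfspace. Qed.
Let w0 (X : 'rV[R]_n.+1) (HX : H X) : 0 <= gwt a X. Proof. exact: gwt_ge0. Qed.
Let mw : measurable_fun H (@gwt R n a). Proof. exact: measurable_gwt_halfspace. Qed.
Let B (f g : 'rV[R]_n.+1 -> R) : L2 f -> L2 g -> L2 (fun X => f X - g X).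
Proof. exact: L2wB. Qed.
Let rho (y : 'rV[R]_n) := expR (- (sqnorm y / 4)).
Let L := p * M `^ (p - 1).

Let M0 t : I t -> 0 <= M. Proof. by move=> It; exact: le_trans (normr_ge0 _) (@V_le t 0 It). Qed.

Let L0 t : I t -> 0 <= L.
Proof. by move=> It; rewrite mulr_ge0 ?powR_ge0 // ltW // (lt_trans ltr01). Qed.

Let mtrace t : I t -> measurable_fun setT (fun y => V t (consrv 0 y)).
Proof.
move=> It; apply: continuous_measurable_rV; first exact: openT.
move=> y _; apply: (@within_cvg _ _ _ (V t) _ _ (nbhs y) _ (fun y => consrv 0 y) (cV0 It)).
- by rewrite /closed_halfspace /= consrv0.
- exact: continuous_consrv2.
- by apply: nearW => z; rewrite /closed_halfspace /= consrv0.
Qed.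

Let mrho : measurable_fun setT rho.
Proof.
apply: measurableT_comp => //; apply: measurable_funN; apply: measurable_funM => //.
exact: measurable_sqnorm.
Qed.

Let irho : (mu n).-integrable setT (EFin \o rho).
Proof.
have i4 : 0 < 4^-1 :> R by [].
have := integrable_gauss_rV n i4.
by congr integrable; apply/funext => y /=; rewrite /rho mulNr mulrC.
Qed.

Let integrable_rho (f : 'rV[R]_n -> R) K : measurable_fun setT f -> (forall y, `|f y| <= K) ->
  (mu n).-integrable setT (EFin \o (fun y => rho y * f y)).
Proof.
move=> mf fK; apply: (@le_integrableR _ _ _ (mu n) _ measurableT _ (fun y => K * rho y)).
- exact: measurable_funM.
- by move=> y _; rewrite normrM ger0_norm ?expR_ge0 // mulrC ler_wpM2r ?expR_ge0.
- by apply: integrableZR.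
Qed.

Let weak t t1 t2 : I t -> I t1 -> I t2 ->
  \sum_i ip (dV t i) (fun X => dV t1 i X - dV t2 i X) =
  t * ip (Vd t) (fun X => V t1 X - V t2 X) - be / 2 * ip (V t) (fun X => V t1 X - V t2 X) +
  eta * \int[mu n]_y (rho y * (fpow p (V t (consrv 0 y)) *
    (V t1 (consrv 0 y) - V t2 (consrv 0 y)))).
Proof.
move=> It I1 I2.
pose phi X := V t1 X - V t2 X; pose dphi i X := dV t1 i X - dV t2 i X.
pose G X := be / 2 * V t X - t * Vd t X.
have Lphi : L2 phi by apply: B; exact: LV.
have Ldphi i : L2 (dphi i) by apply: B; exact: LdV.
have LG : L2 G by apply: B; apply: (L2wZ mH); [exact: LV|exact: LVd].
have bN y : `|N t (consrv 0 y) * phi (consrv 0 y)| <= eta * M `^ p * (M + M).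
  rewrite normrM; apply: ler_pM => //.
    rewrite flux // mulNr normrN.
    rewrite normrM ger0_norm // ler_wpM2l //; exact: fpow_le (@V_le t y It).
  by apply: le_trans (ler_normB _ _) _; apply: lerD; exact: V_le.
have W := @weak_form R n a (eta * M `^ p * (M + M)) (dV t) (ddV t) dphi phi G (N t)
  (fun i X HX => @hdV t i X It HX) _ (fun i X HX => @cdV t i X It HX) (fun i X HX => @cddV t i X It HX)
  _ _ (fun X HX => @pde t X It HX) (cN It) _ (fun X HX => @hN t X It HX) bN
  (fun i => @LdV t i It) Lphi Ldphi LG.
have {W} : \int[mu n.+1]_(X in H) (gwt a X * (phi X * G X + \sum_i dphi i X * dV t i X)) =
  \int[mu n]_y (- (expR (- (sqnorm y / 4)) * (N t (consrv 0 y) * phi (consrv 0 y)))).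
  apply: W.
  - move=> i X HX; apply: is_derive_sub; exact: hV.
  - move=> X HX; apply: contD; [exact: cV|apply: contN; exact: cV].
  - move=> i X HX; apply: contD; [exact: cdV|apply: contN; exact: cdV].
  - move=> X; apply: continuousB; [exact: (cV0 I1)|exact: (cV0 I2)].
rewrite (_ : (fun X => gwt a X * (phi X * G X + \sum_i dphi i X * dV t i X)) =
  fun X => gwt a X * (phi X * G X) + \sum_i gwt a X * (dphi i X * dV t i X)); last first.
  by apply/funext => X; rewrite mulrDr mulr_sumr.
rewrite RintegralD //; last 2 first.
- exact: L2w_mul.
- by apply: (integrable_sumR mH) => i; apply: L2w_mul => //; exact: LdV.
rewrite Rintegral_sumR // => [|i]; last by apply: L2w_mul => //; exact: LdV.
have -> : (fun y => - (expR (- (sqnorm y / 4)) * (N t (consrv 0 y) * phi (consrv 0 y)))) =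
  fun y => eta * (rho y * (fpow p (V t (consrv 0 y)) * (V t1 (consrv 0 y) - V t2 (consrv 0 y)))).
  by apply/funext => y; rewrite flux // /rho /phi; ring.
rewrite RintegralZl //; last first.
  apply: (@integrable_rho _ (M `^ p * (M + M))).
    apply: measurable_funM; first by apply: (measurableT_comp (measurable_fpow p)); exact: mtrace.
    by apply: measurable_funB; exact: mtrace.
  move=> y; rewrite normrM ler_pM //; first exact: fpow_le (@V_le t y It).
  by apply: le_trans (ler_normB _ _) _; apply: lerD; exact: V_le.
rewrite -/(ip phi G) => E.
have EG : ip phi G = be / 2 * ip (V t) phi - t * ip (Vd t) phi.
  rewrite /G ipwBr //; [|exact: (L2wZ mH _ (LV It))|exact: (L2wZ mH _ (LVd It))].
  by rewrite (ipwZr mH w0 mw _ (LV It) Lphi) (ipwZr mH w0 mw _ (LVd It) Lphi) !(ipwC _ _ _ phi).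
rewrite EG in E; rewrite -E (eq_bigr (fun i => ip (dphi i) (dV t i))) => [|i _].
  by rewrite /phi; ring.
exact: ipwC.
Qed.

Let trace_diff t1 t2 : I t1 -> I t2 ->
  (mu n).-integrable setT (EFin \o (fun y => rho y * (V t1 (consrv 0 y) - V t2 (consrv 0 y)) ^+ 2)).
Proof.
move=> I1 I2; apply: (@integrable_rho _ ((M + M) ^+ 2)).
  by apply: measurable_funX; apply: measurable_funB; exact: mtrace.
move=> y; rewrite normrX ler_pXn2r ?nnegrE // ?addr_ge0 ?(M0 I1) //.
by apply: le_trans (ler_normB _ _) _; apply: lerD; exact: V_le.
Qed.

Let w2 t1 t2 := \int[mu n]_y (rho y * (V t1 (consrv 0 y) - V t2 (consrv 0 y)) ^+ 2).

Let w2_ge0 t1 t2 : 0 <= w2 t1 t2.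
Proof. by apply: Rintegral_ge0 => y _; rewrite mulr_ge0 ?expR_ge0 ?sqr_ge0. Qed.

Let energy_increment t1 t2 : I t1 -> I t2 ->
  `|energy t1 - energy t2 - 2^-1 * ip (fun X => t1 * Vd t1 X + t2 * Vd t2 X)
     (fun X => V t1 X - V t2 X)| <= eta * L * w2 t1 t2.
Proof.
move=> I1 I2.
have Ft t : I t -> (mu n).-integrable setT (EFin \o (fun y => rho y * Fpow p (V t (consrv 0 y)))).
  move=> It; apply: (@integrable_rho _ (M `^ (p + 1))).
    by apply: (measurableT_comp (measurable_Fpow p)); exact: mtrace.
  by move=> y; exact: Fpow_le (@V_le t y It).
have ft t : I t -> (mu n).-integrable setT (EFin \o (fun y => rho y * (fpow p (V t (consrv 0 y)) *
    (V t1 (consrv 0 y) - V t2 (consrv 0 y))))).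
  move=> It; apply: (@integrable_rho _ (M `^ p * (M + M))).
    apply: measurable_funM; first by apply: (measurableT_comp (measurable_fpow p)); exact: mtrace.
    by apply: measurable_funB; exact: mtrace.
  move=> y; rewrite normrM ler_pM //; first exact: fpow_le (@V_le t y It).
  by apply: le_trans (ler_normB _ _) _; apply: lerD; exact: V_le.
have L1 := LV I1; have L2' := LV I2; have LW := B L1 L2'.
(* [|x|^2 - |y|^2 = (x + y).(x - y)]: each quadratic term becomes a sum of two pairings with the
   increment, and [weak] evaluates the gradient pairings. *)
have E1 : \sum_i ip (dV t1 i) (dV t1 i) - \sum_i ip (dV t2 i) (dV t2 i) =
   \sum_i ip (dV t1 i) (fun X => dV t1 i X - dV t2 i X) +
   \sum_i ip (dV t2 i) (fun X => dV t1 i X - dV t2 i X).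
  rewrite -sumrB -big_split; apply: eq_bigr => i _ /=.
  have Li1 := @LdV t1 i I1; have Li2 := @LdV t2 i I2.
  by rewrite !ipwBr // (ipwC _ _ _ (dV t2 i) (dV t1 i)); ring.
have E2 : ip (V t1) (V t1) - ip (V t2) (V t2) =
   ip (V t1) (fun X => V t1 X - V t2 X) + ip (V t2) (fun X => V t1 X - V t2 X).
  by rewrite !ipwBr // (ipwC _ _ _ (V t2) (V t1)); ring.
have E3 : ip (fun X => t1 * Vd t1 X + t2 * Vd t2 X) (fun X => V t1 X - V t2 X) =
   t1 * ip (Vd t1) (fun X => V t1 X - V t2 X) + t2 * ip (Vd t2) (fun X => V t1 X - V t2 X).
  have l1 := LVd I1; have l2 := LVd I2.
  by rewrite ipwDl // ?ipwZl //; exact: (L2wZ mH).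
pose q y := 2^-1 * ((fpow p (V t2 (consrv 0 y)) + fpow p (V t1 (consrv 0 y))) * (V t1 (consrv 0 y) - V t2 (consrv 0 y)))
   - (Fpow p (V t1 (consrv 0 y)) - Fpow p (V t2 (consrv 0 y))).
have E4 : energy t1 - energy t2 - 2^-1 * ip (fun X => t1 * Vd t1 X + t2 * Vd t2 X)
     (fun X => V t1 X - V t2 X) = eta * \int[mu n]_y (rho y * q y).
  have -> : \int[mu n]_y (rho y * q y) =
      2^-1 * (\int[mu n]_y (rho y * (fpow p (V t1 (consrv 0 y)) * (V t1 (consrv 0 y) - V t2 (consrv 0 y)))) +
       \int[mu n]_y (rho y * (fpow p (V t2 (consrv 0 y)) * (V t1 (consrv 0 y) - V t2 (consrv 0 y))))) -
      (\int[mu n]_y (rho y * Fpow p (V t1 (consrv 0 y))) - \int[mu n]_y (rho y * Fpow p (V t2 (consrv 0 y)))).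
    have f1 := ft _ I1; have f2 := ft _ I2; have F1 := Ft _ I1; have F2 := Ft _ I2.
    rewrite -RintegralD // -RintegralB // -RintegralZl //; last by apply: integrableDR.
    rewrite -RintegralB //; [|by apply: integrableZR => //; exact: integrableDR|by apply: integrableBR].
    by apply: eq_Rintegral => y _; rewrite /q; ring.
  have W1 := weak I1 I1 I2; have W2 := weak I2 I1 I2.
  have num (s1 s2 v1 v2 F1 F2 d1 d2 g1 g2 c1 c2 f1 f2 : R) :
    s1 - s2 = g1 + g2 -> v1 - v2 = c1 + c2 -> g1 = t1 * d1 - be / 2 * c1 + eta * f1 ->
    g2 = t2 * d2 - be / 2 * c2 + eta * f2 ->
    2^-1 * s1 + be / 4 * v1 - eta * F1 - (2^-1 * s2 + be / 4 * v2 - eta * F2) -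
    2^-1 * (t1 * d1 + t2 * d2) = eta * (2^-1 * (f1 + f2) - (F1 - F2)).
    move=> /eqP; rewrite subr_eq => /eqP -> /eqP; rewrite subr_eq => /eqP -> -> ->; by field.
  by rewrite E3 /energy; exact: num E1 E2 W1 W2.
rewrite E4 normrM ger0_norm // -mulrA ler_wpM2l //.
have mq : measurable_fun setT q.
  have m1 := mtrace I1; have m2 := mtrace I2.
  have mf := measurable_fpow p; have mF := measurable_Fpow p.
  apply: measurable_funB; last by apply: measurable_funB; [exact: (measurableT_comp mF m1)|exact: (measurableT_comp mF m2)].
  apply: measurable_funM => //; apply: measurable_funM; last exact: measurable_funB.
  by apply: measurable_funD; [exact: (measurableT_comp mf m2)|exact: (measurableT_comp mf m1)].
have qle y : `|q y| <= L * (V t1 (consrv 0 y) - V t2 (consrv 0 y)) ^+ 2.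
  exact: Fpow_trapezoid p1 (@V_le t2 y I2) (@V_le t1 y I1).
have iq : (mu n).-integrable setT (EFin \o (fun y => rho y * q y)).
  apply: (@integrable_rho _ (L * (M + M) ^+ 2)) => // y.
  apply: le_trans (qle y) _; rewrite ler_wpM2l ?(L0 I1) //.
  rewrite -[leLHS]ger0_norm ?sqr_ge0 // normrX ler_pXn2r ?nnegrE // ?addr_ge0 ?(M0 I1) //.
  by apply: le_trans (ler_normB _ _) _; apply: lerD; exact: V_le.
have iw : (mu n).-integrable setT (EFin \o (fun y => L * (rho y * (V t1 (consrv 0 y) - V t2 (consrv 0 y)) ^+ 2))).
  by apply: integrableZR => //; exact: trace_diff.
have le y : setT y -> `|rho y * q y| <= L * (rho y * (V t1 (consrv 0 y) - V t2 (consrv 0 y)) ^+ 2).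
  by move=> _; rewrite normrM ger0_norm ?expR_ge0 // mulrCA ler_wpM2l ?expR_ge0 //; exact: qle.
have h1 := le_normr_Rintegral measurableT iq.
have h2 := le_Rintegral measurableT (integrable_normR iq) iw le.
have h3 := RintegralZl L measurableT (trace_diff I1 I2).
by rewrite /w2 -h3; exact: le_trans h1 h2.
Qed.

(* Young's inequality and the trace inequality absorb the boundary term. *)
Let w2_le : exists2 C, 0 <= C & forall t1 t2, I t1 -> I t2 ->
  w2 t1 t2 <= C * (ip (fun X => V t1 X - V t2 X) (fun X => V t1 X - V t2 X) +
   `|ip (fun X => t1 * Vd t1 X - t2 * Vd t2 X) (fun X => V t1 X - V t2 X)|).
Proof.
(* If [M < 0], then by [V_le] there is no admissible time, and any constant will do. *)
have [M0'|M0'] := leP 0 M; last first.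
  exists 0 => // t1 t2 I1 _; exfalso.
  by have := M0 I1; rewrite leNgt M0'.
have L0' : 0 <= L by rewrite mulr_ge0 ?powR_ge0 // ltW // (lt_trans ltr01).
have eL0 : 0 <= eta * L by rewrite mulr_ge0.
(* With this factor the gradient term returns at most half of [w2], so that half of it survives the
   absorption. Adding 1 covers [eta L = 0]. *)
have k0 : 0 < (2 * (eta * L + 1))^-1 by rewrite invr_gt0 mulr_gt0 // ltr_wpDl.
pose kap := (2 * (eta * L + 1))^-1 / n.+1%:R.
have kap0 : 0 < kap by rewrite divr_gt0 // ltr0n.
have [C C0 HC] := trace_inequality n a1 k0.
exists (2 * C + 2) => [|t1 t2 I1 I2]; first by rewrite addr_ge0 // mulr_ge0.
pose W X := V t1 X - V t2 X; pose dW i X := dV t1 i X - dV t2 i X.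
rewrite -/W.
have LW : L2 W by apply: B; exact: LV.
have LdW i : L2 (dW i) by apply: B; exact: LdV.
have h1 : w2 t1 t2 <= C * ip W W + (2 * (eta * L + 1))^-1 * ip (dW ord0) (dW ord0).
  have := HC W (dW ord0).
  rewrite -lee_fin /w2 -(EFin_Rintegral measurableT (trace_diff I1 I2)) lee_fin.
  apply => //.
  - by move=> X HX; apply: is_derive_sub; exact: hV.
  - by move=> X HX; apply: contD; [exact: cV|apply: contN; exact: cV].
  - by move=> X HX; apply: contD; [exact: cdV|apply: contN; exact: cdV].
  - by move=> X; apply: continuousB; [exact: (cV0 I1)|exact: (cV0 I2)].
have S0 i : 0 <= ip (dW i) (dW i) by exact: ipw_ge0.
have h2 : ip (dW ord0) (dW ord0) <= \sum_i ip (dW i) (dW i).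
  by rewrite (bigD1 ord0) //= lerDl sumr_ge0.
pose f12 y := fpow p (V t1 (consrv 0 y)) - fpow p (V t2 (consrv 0 y)).
have h3 : \sum_i ip (dW i) (dW i) + be / 2 * ip W W =
    ip (fun X => t1 * Vd t1 X - t2 * Vd t2 X) W +
    eta * \int[mu n]_y (rho y * (f12 y * (V t1 (consrv 0 y) - V t2 (consrv 0 y)))).
  have W1 := weak I1 I1 I2; have W2 := weak I2 I1 I2.
  have ft t : I t -> (mu n).-integrable setT (EFin \o (fun y => rho y * (fpow p (V t (consrv 0 y)) *
      (V t1 (consrv 0 y) - V t2 (consrv 0 y))))).
    move=> It; apply: (@integrable_rho _ (M `^ p * (M + M))).
      apply: measurable_funM; first by apply: (measurableT_comp (measurable_fpow p)); exact: mtrace.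
      by apply: measurable_funB; exact: mtrace.
    move=> y; rewrite normrM ler_pM //; first exact: fpow_le (@V_le t y It).
    by apply: le_trans (ler_normB _ _) _; apply: lerD; exact: V_le.
  have -> : \int[mu n]_y (rho y * (f12 y * (V t1 (consrv 0 y) - V t2 (consrv 0 y)))) =
     \int[mu n]_y (rho y * (fpow p (V t1 (consrv 0 y)) * (V t1 (consrv 0 y) - V t2 (consrv 0 y)))) -
     \int[mu n]_y (rho y * (fpow p (V t2 (consrv 0 y)) * (V t1 (consrv 0 y) - V t2 (consrv 0 y)))).
    rewrite -(RintegralB measurableT (ft _ I1) (ft _ I2)).
    by apply: eq_Rintegral => y _; rewrite /f12; ring.
  have -> : \sum_i ip (dW i) (dW i) = \sum_i ip (dV t1 i) (dW i) - \sum_i ip (dV t2 i) (dW i).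
    rewrite -sumrB; apply: eq_bigr => i _.
    exact: (ipwBl mH w0 mw (@LdV t1 i I1) (@LdV t2 i I2) (LdW i)).
  have -> : ip (fun X => t1 * Vd t1 X - t2 * Vd t2 X) W = t1 * ip (Vd t1) W - t2 * ip (Vd t2) W.
    rewrite ipwBl //; [|exact: (L2wZ mH _ (LVd I1))|exact: (L2wZ mH _ (LVd I2))].
    by rewrite !ipwZl //; exact: LVd.
  have -> : ip W W = ip (V t1) W - ip (V t2) W.
    exact: (ipwBl mH w0 mw (LV I1) (LV I2) LW).
  by rewrite /dW W1 W2 /W; ring.
have h4 : \int[mu n]_y (rho y * (f12 y * (V t1 (consrv 0 y) - V t2 (consrv 0 y)))) <= L * w2 t1 t2.
  rewrite /w2 -(RintegralZl L measurableT (trace_diff I1 I2)).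
  have le y : setT y -> rho y * (f12 y * (V t1 (consrv 0 y) - V t2 (consrv 0 y))) <=
      L * (rho y * (V t1 (consrv 0 y) - V t2 (consrv 0 y)) ^+ 2).
    move=> _; rewrite [leRHS]mulrCA ler_wpM2l ?expR_ge0 //.
    apply: le_trans (ler_norm _) _; rewrite normrM -[_ ^+ 2]real_normK ?num_real // expr2 mulrA.
    rewrite ler_wpM2r //; exact: fpow_lipschitz p1 (@V_le t2 y I2) (@V_le t1 y I1).
  apply: (le_Rintegral measurableT _ _ le).
    apply: (@integrable_rho _ ((M `^ p + M `^ p) * (M + M))).
      have m1 := mtrace I1; have m2 := mtrace I2; have mf := measurable_fpow p.
      apply: measurable_funM; last exact: measurable_funB.
      by apply: measurable_funB; [exact: (measurableT_comp mf m1)|exact: (measurableT_comp mf m2)].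
    move=> y; rewrite normrM; apply: ler_pM => //.
      by apply: le_trans (ler_normB _ _) _; apply: lerD; apply: fpow_le => //; exact: V_le.
    by apply: le_trans (ler_normB _ _) _; apply: lerD; exact: V_le.
  by apply: integrableZR => //; exact: trace_diff.
have Y0 : 0 <= ip W W by exact: ipw_ge0.
have N0 := ler_norm (ip (fun X => t1 * Vd t1 X - t2 * Vd t2 X) W).
have w20 := w2_ge0 t1 t2.
have kE : (2 * (eta * L + 1))^-1 * (2 * (eta * L + 1)) = 1 by rewrite mulVf // gt_eqF // -invr_gt0.
have k1 : (2 * (eta * L + 1))^-1 <= 1 by rewrite invf_le1 ?mulr_gt0 ?ltr_wpDl //; lra.
move: h1 h2 h3 h4 Y0 N0 w20 kE k0 k1 eL0 C0; rewrite -/W.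
set S := \sum_i _; set S0' := ip (dW ord0) _; set Y := ip W W; set z := `|_|; set z' := ip _ W.
set J := \int[_]_y _; set kk := _^-1; set w := w2 _ _; set e := eta * L.
move=> h1 h2 h3 h4 Y0 N0 w20 kE k0' k1 e0 C0.
have be2 : 0 <= be / 2 * Y by rewrite mulr_ge0 // divr_ge0.
have h5 : S <= z + e * w.
  have : eta * J <= eta * (L * w) by rewrite ler_wpM2l.
  by rewrite mulrA -/e; lra.
have h6 : kk * S0' <= kk * (z + e * w) by rewrite ler_wpM2l ?(ltW k0') // (le_trans h2).
have h7 : kk * (e * w) <= 2^-1 * w.
  rewrite mulrA ler_wpM2r //.
  by have : kk * e <= kk * (e + 1); [rewrite ler_wpM2l ?(ltW k0') //; lra|lra].
have z0 : 0 <= z by exact: normr_ge0.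
have h8 : kk * z <= z by rewrite ler_piMl.
have h9 : 0 <= C * z by rewrite mulr_ge0.
by rewrite mulrDr in h6; rewrite mulrDr !mulrDl; lra.
Qed.

Let near_I (t : R) : I t -> \forall r \near t, I r.
Proof.
move=> /andP[t0 tT]; near=> r; apply/andP; split; near: r.
- exact: lt_nbhsr.
- exact: lt_nbhsl.
Unshelve. all: by end_near. Qed.

Let cVd_t (X : 'rV[R]_n.+1) (t : R) : I t -> H X -> Vd r X @[r --> t] --> Vd t X.
Proof.
move=> It HX.
have c : {for consrv t X, continuous (fun Z : 'rV[R]_n.+2 => Vd (Z 0 ord0) (behrv Z))}.
  by apply: cVd; rewrite ?consrv0 ?behrv_consrv.
have := continuous_comp (@continuous_consrv1 R n.+1 X t) c.
rewrite (_ : _ \o _ = Vd^~ X); last first.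
  by apply/funext => r /=; rewrite consrv0 behrv_consrv.
by [].
Qed.

(** [sconv_ipw] asks for members of L^2 at every parameter, so [Vd], and below the difference
    quotient [Q], are replaced by [Vd t] where they leave the time interval. *)
Let Vd' t r := if I r then Vd r else Vd t.

Let LVd' t r : I t -> L2 (Vd' t r).
Proof. by rewrite /Vd'; case: ifP => [Ir _|_ It]; exact: LVd. Qed.

Let near_Vd' (t : R) : I t -> \forall r \near t, Vd' t r = Vd r.
Proof. by move=> It; have := near_I It; apply: filterS => r Ir; rewrite /Vd' Ir. Qed.

(* Pointwise convergence and convergence of the norms. *)
Let sconv_Vd t : I t -> sconv (mu n.+1) H (gwt a) t^' (Vd' t) (Vd t).
Proof.
move=> It; apply/cvgr_dnbhsP => u [_ ut].
apply: (@pointwise_sconv _ _ _ (mu n.+1) H (gwt a) mH w0 mw (fun k => Vd' t (u k)) (Vd t)).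
- by move=> k; exact: LVd'.
- exact: LVd.
- move=> X HX; have h : Vd' t r X @[r --> t] --> Vd t X.
    apply: cvg_trans (cVd_t It HX); apply: near_eq_cvg.
    by have := near_Vd' It; apply: filterS => r ->.
  exact: (cvg_comp _ _ ut h).
- have h : ip (Vd' t r) (Vd' t r) @[r --> t] --> ip (Vd t) (Vd t).
    apply: cvg_trans (norm_Vd It); apply: near_eq_cvg.
    by have := near_Vd' It; apply: filterS => r ->.
  exact: (cvg_comp _ _ ut h).
Qed.

Let near_Vd_le (t e : R) : I t -> 0 < e ->
  \forall r \near t, I r /\ ip (fun X => Vd r X - Vd t X) (fun X => Vd r X - Vd t X) <= e.
Proof.
move=> It e0.
have h := @sconv_Vd t It.
have {}h : \forall r \near t^', ip (fun X => Vd' t r X - Vd t X) (fun X => Vd' t r X - Vd t X) < e.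
  move/cvgrPdist_lt : h => /(_ _ e0); apply: filterS => r.
  by rewrite sub0r normrN ger0_norm // ipw_ge0.
have {}h : \forall r \near t, r != t -> ip (fun X => Vd' t r X - Vd t X) (fun X => Vd' t r X - Vd t X) < e.
  by move: h; rewrite near_withinE; apply.
near=> r.
have Ir : I r by near: r; exact: near_I.
split => //; have [->|rt] := eqVneq r t.
  have -> : ip (fun X => Vd t X - Vd t X) (fun X => Vd t X - Vd t X) = 0.
    have Lt := @LVd t It; rewrite (ipwBl mH w0 mw Lt Lt) ?subrr //; exact: B.
  exact: ltW.
have -> : Vd r = Vd' t r by rewrite /Vd' Ir.
by apply/ltW; move: rt; near: r.
Unshelve. all: by end_near. Qed.

(** [L2_increment] is applied to [V r - r Vd(t)], whose time derivative [Vd r - Vd t] is small in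
    L^2 for [r] near [t]. Negative [h] is reduced to positive [h] by exchanging the end points. *)
Let V_increment (t e : R) : I t -> 0 < e -> \forall h \near (0 : R), I (t + h) /\
  ip (fun X => V (t + h) X - V t X - h * Vd t X) (fun X => V (t + h) X - V t X - h * Vd t X) <= h ^+ 2 * e.
Proof.
move=> It e0.
have /nbhs_ballP[dl /= dl0 Hd] := @near_Vd_le t e It e0.
have {}Hd (r : R) : `|t - r| < dl ->
  I r /\ ip (fun X => Vd r X - Vd t X) (fun X => Vd r X - Vd t X) <= e by exact: Hd.
have key t1 t2 : `|t - t1| < dl -> `|t - t2| < dl -> t1 < t2 ->
    ip (fun X => V t2 X - V t1 X - (t2 - t1) * Vd t X) (fun X => V t2 X - V t1 X - (t2 - t1) * Vd t X)
     <= (t2 - t1) ^+ 2 * e.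
  move=> d1 d2 t12.
  have [I1 _] := Hd _ d1; have [I2 _] := Hd _ d2.
  have Lt : L2 (Vd t) by exact: LVd.
  have := @L2_increment R n a 0 T (fun r X => V r X - r * Vd t X) (fun r X => Vd r X - Vd t X) _ _ t1 t2 e.
  rewrite (_ : (fun X => V t2 X - t2 * Vd t X - (V t1 X - t1 * Vd t X)) =
    fun X => V t2 X - V t1 X - (t2 - t1) * Vd t X); last by apply/funext => X; ring.
  apply => //.
  - move=> r X Ir HX.
    have h1 : is_derive r (1 : R) (fun r : R => r * Vd t X) (Vd t X).
      have h0 : is_derive r (1 : R) (fun r : R => r) 1 by exact: is_derive_id.
      have := is_derive_scalel (Vd t X) h0.
      by rewrite mulr1; rewrite (_ : (fun x => _) = fun r : R => r * Vd t X) //; apply/funext => x; rewrite mulrC.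
    exact: (is_derive_sub (hVt Ir HX) h1).
  - move=> Z IZ HZ; apply: contD; first exact: cVd.
    apply: contN.
    have c : {for Z, continuous (fun Z : 'rV[R]_n.+2 => Vd t (behrv Z))}.
      have c1 : {for consrv t (behrv Z), continuous (fun Z : 'rV[R]_n.+2 => Vd (Z 0 ord0) (behrv Z))}.
        by apply: cVd; rewrite ?consrv0 ?behrv_consrv.
      have := continuous_comp (continuous_comp (@continuous_behrv R n.+1 Z) (@continuous_consrv2 R n.+1 t (behrv Z))) c1.
      rewrite (_ : _ \o _ = fun Z : 'rV[R]_n.+2 => Vd t (behrv Z)) //.
      by apply/funext => Z' /=; rewrite consrv0 behrv_consrv.
    exact: c.
  - by case/andP: I1.
  - by case/andP: I2.
  - by apply: B; [exact: LV|exact: (L2wZ mH)].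
  - by apply: B; [exact: LV|exact: (L2wZ mH)].
  - move=> r /andP[r1 r2].
    have [|Ir le] := Hd r; last by split => //; apply: B => //; exact: LVd.
    move: d1 d2; rewrite !ltr_norml => /andP[a1' a2'] /andP[b1' b2']; apply/andP; split; lra.
near=> h.
have hd : `|h| < dl by near: h; apply/nbhs_ballP; exists dl => //= h; rewrite /ball /= sub0r normrN.
have [Ih _] : I (t + h) /\ ip (fun X => Vd (t + h) X - Vd t X) (fun X => Vd (t + h) X - Vd t X) <= e.
  by apply: Hd; rewrite opprD addrA subrr sub0r normrN.
split => //.
have [h0|h0|->] := ltgtP h 0.
- have := key (t + h) t; rewrite opprD addrA !subrr !sub0r !normrN normr0 => /(_ hd dl0).
  rewrite sqrrN.
  rewrite (_ : (fun X => V t X - V (t + h) X - - h * Vd t X) =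
     fun X => -1 * (V (t + h) X - V t X - h * Vd t X)); last by apply/funext => X; ring.
  have LE : L2 (fun X => V (t + h) X - V t X - h * Vd t X).
    by apply: B; [apply: B; exact: LV|apply: (L2wZ mH); exact: LVd].
  rewrite (ipwZl mH w0 mw) ?(ipwZr mH w0 mw) //; last exact: (L2wZ mH).
  by rewrite !mulN1r opprK; apply; lra.
- have := key t (t + h); rewrite opprD addrA !subrr !sub0r !normrN normr0 => /(_ dl0 hd).
  by rewrite (_ : t + h - t = h); [apply; lra|ring].
- have -> : ip (fun X => V (t + 0) X - V t X - 0 * Vd t X) (fun X => V (t + 0) X - V t X - 0 * Vd t X)
    = ip (fun X => 0 * Vd t X) (fun X => 0 * Vd t X).
    by congr ipw; apply/funext => X; rewrite addr0 subrr mul0r subrr.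
  by rewrite (ipwZl mH w0 mw) ?mul0r ?expr0n ?mul0r //; [exact: LVd|apply: (L2wZ mH); exact: LVd].
Unshelve. all: by end_near. Qed.

Let Q t h X := if I (t + h) then h^-1 * (V (t + h) X - V t X) else Vd t X.

Let LQ t h : I t -> L2 (Q t h).
Proof.
move=> It; rewrite /Q; case: (boolP (I (t + h))) => [Ih|_]; last exact: LVd.
by apply: (L2wZ mH); apply: B; exact: LV.
Qed.

Let sconv_Q t : I t -> sconv (mu n.+1) H (gwt a) 0^' (Q t) (Vd t).
Proof.
move=> It; apply/cvgrPdist_le => e e0.
have h := @V_increment t e It e0.
near=> h'; rewrite sub0r normrN ger0_norm ?ipw_ge0 //.
have h0 : h' != 0 by near: h'; exact: nbhs_dnbhs_neq.
have [Ih le] : I (t + h') /\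
  ip (fun X => V (t + h') X - V t X - h' * Vd t X) (fun X => V (t + h') X - V t X - h' * Vd t X) <= h' ^+ 2 * e.
  by near: h'; apply: nbhs_dnbhs.
have LE : L2 (fun X => V (t + h') X - V t X - h' * Vd t X).
  by apply: B; [apply: B; exact: LV|apply: (L2wZ mH); exact: LVd].
rewrite (_ : (fun X => Q t h' X - Vd t X) = fun X => h'^-1 * (V (t + h') X - V t X - h' * Vd t X)); last first.
  by apply/funext => X; rewrite /Q Ih; field.
rewrite (ipwZl mH w0 mw) ?(ipwZr mH w0 mw) //; last exact: (L2wZ mH).
rewrite mulrA -expr2 exprVn ler_pdivrMl //.
by rewrite exprn_even_gt0.
Unshelve. all: by end_near. Qed.

(** Since [V(t+h) - V(t) = h Q], the pairings in [energy_increment] and [w2_le] carry factors [h]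
    and are otherwise given by [P], [P'] and [Z], which all tend to [ip (Vd t) (Vd t)]. After
    division by [|h|] the error contains [|h| Z] and [|(t + h) P - t P'|], and both vanish in the
    limit. *)
Lemma is_derive_energy t : I t -> is_derive t (1 : R) energy (t * ip (Vd t) (Vd t)).
Proof.
move=> It.
have [C C0 HC] := w2_le.
have Lt : L2 (Vd t) by exact: LVd.
have s1 : sconv (mu n.+1) H (gwt a) 0^' (fun h => Vd' t (t + h)) (Vd t).
  have /cvgrPdist_le h := @sconv_Vd t It.
  apply/cvgrPdist_le => e /h; rewrite near_withinE => /nbhs_ballP[dl /= dl0 hd].
  rewrite near_withinE; apply/nbhs_ballP; exists dl => //= r; rewrite /ball /= sub0r normrN => rd r0.
  apply: hd; first by rewrite /ball /= opprD addrA subrr sub0r normrN.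
  by rewrite addrC -subr_eq0 addrK.
have s2 := @sconv_Q t It.
have s3 : sconv (mu n.+1) H (gwt a) 0^' (fun _ : R => Vd t) (Vd t).
  rewrite /sconv (_ : (fun _ => _) = fun=> 0); first exact: cvg_cst.
  by apply/funext => _; rewrite (ipwBl mH w0 mw Lt Lt) ?subrr //; exact: B.
have L1 h : L2 (Vd' t (t + h)) by exact: LVd'.
have L2' h : L2 (Q t h) by exact: LQ.
have c1 := sconv_ipw mH w0 mw L1 Lt L2' Lt s1 s2.
have c2 := sconv_ipw mH w0 mw (fun _ : R => Lt) Lt L2' Lt s3 s2.
have c3 := sconv_ipw mH w0 mw L2' Lt L2' Lt s2 s2.
have cid : (h : R) @[h --> 0^'] --> (0 : R) by apply: cvg_within_filter; exact: cvg_id.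
have c4 : t + h @[h --> 0^'] --> t.
  rewrite -[X in _ --> X]addr0; apply: cvgD => //; exact: cvg_cst.
set z := ip (Vd t) (Vd t) in c1 c2 c3 *.
pose P h := ip (Vd' t (t + h)) (Q t h).
pose P' h := ip (Vd t) (Q t h).
pose Z h := ip (Q t h) (Q t h).
have c5 : 2^-1 * ((t + h) * P h + t * P' h) @[h --> 0^'] --> t * z.
  rewrite (_ : t * z = 2^-1 * (t * z + t * z)); last by field.
  apply: cvgM; first exact: cvg_cst.
  by apply: cvgD; apply: cvgM; [exact: c4|exact: c1|exact: cvg_cst|exact: c2].
have c6 : eta * L * (C * (`|h| * Z h + `|(t + h) * P h - t * P' h|)) @[h --> 0^'] --> 0.
  rewrite [X in _ --> X](_ : 0 = eta * L * (C * (`|0 : R| * z + `|t * z - t * z|))); last first.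
    by rewrite subrr normr0 mul0r add0r !mulr0.
  apply: cvgM; first exact: cvg_cst.
  apply: cvgM; first exact: cvg_cst.
  apply: cvgD; first by apply: cvgM; [exact: cvg_norm|exact: c3].
  by apply: cvg_norm; apply: cvgB; apply: cvgM; [exact: c4|exact: c1|exact: cvg_cst|exact: c2].
have c7 : h^-1 * (energy (t + h) - energy t) @[h --> 0^'] --> t * z.
  apply/cvgrPdist_le => e e0.
  have e20 : 0 < e / 2 by rewrite divr_gt0.
  move/cvgrPdist_le : c5 => /(_ _ e20) c5; move/cvgrPdist_le : c6 => /(_ _ e20) c6.
  near=> h.
  have h0 : h != 0 by near: h; exact: nbhs_dnbhs_neq.
  have Ih : I (t + h).
    have [//] : I (t + h) /\
     ip (fun X => V (t + h) X - V t X - h * Vd t X) (fun X => V (t + h) X - V t X - h * Vd t X) <= h ^+ 2 * 1.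
    near: h; apply: nbhs_dnbhs; exact: V_increment.
  have a5 : `|t * z - 2^-1 * ((t + h) * P h + t * P' h)| <= e / 2 by near: h.
  have a6 : `|0 - eta * L * (C * (`|h| * Z h + `|(t + h) * P h - t * P' h|))| <= e / 2 by near: h.
  have E := @energy_increment (t + h) t Ih It.
  have w := HC (t + h) t Ih It.
  have LVh := LVd Ih.
  have LQh := L2' h.
  have QE : (fun X => V (t + h) X - V t X) = fun X => h * Q t h X.
    by apply/funext => X; rewrite /Q Ih mulrA divff // mul1r.
  have VE : Vd (t + h) = Vd' t (t + h) by rewrite /Vd' Ih.
  have lZ1 c : L2 (fun X => c * Vd' t (t + h) X) by exact: (L2wZ mH).
  have lZ2 c : L2 (fun X => c * Vd t X) by exact: (L2wZ mH).
  have lZ3 c : L2 (fun X => c * Q t h X) by exact: (L2wZ mH).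
  have E1 : ip (fun X => (t + h) * Vd (t + h) X + t * Vd t X) (fun X => V (t + h) X - V t X) =
     h * ((t + h) * P h + t * P' h).
    rewrite QE VE (ipwDl mH w0 mw) // !(ipwZl mH w0 mw) // !(ipwZr mH w0 mw) //.
    by rewrite -/(P h) -/(P' h); ring.
  have E2 : ip (fun X => (t + h) * Vd (t + h) X - t * Vd t X) (fun X => V (t + h) X - V t X) =
     h * ((t + h) * P h - t * P' h).
    rewrite QE VE (ipwBl mH w0 mw) // !(ipwZl mH w0 mw) // !(ipwZr mH w0 mw) //.
    by rewrite -/(P h) -/(P' h); ring.
  have E3 : ip (fun X => V (t + h) X - V t X) (fun X => V (t + h) X - V t X) = h ^+ 2 * Z h.
    by rewrite QE (ipwZl mH w0 mw) // (ipwZr mH w0 mw) // -/(Z h); ring.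
  rewrite E1 in E; rewrite E2 E3 in w.
  set A := (t + h) * P h in a5 a6 E w; set A' := t * P' h in a5 a6 E w.
  have eL : 0 <= eta * L by rewrite mulr_ge0 // (L0 It).
  have hpos : 0 < `|h| by rewrite normr_gt0.
  have b1 : `|energy (t + h) - energy t - 2^-1 * (h * (A + A'))| <= `|h| * (e / 2).
    apply: le_trans E _; apply: le_trans (ler_wpM2l eL w) _.
    rewrite normrM -[h ^+ 2]real_normK ?num_real //.
    rewrite (_ : eta * L * (C * (`|h| ^+ 2 * Z h + `|h| * `|A - A'|)) =
      `|h| * (eta * L * (C * (`|h| * Z h + `|A - A'|)))); last by ring.
    rewrite ler_wpM2l //; apply: le_trans a6.
    by rewrite sub0r normrN ler_norm.
  have b2 : `|h^-1 * (energy (t + h) - energy t) - 2^-1 * (A + A')| <= e / 2.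
    rewrite -(ler_pM2l hpos) -normrM; apply: le_trans b1.
    have num (D x : R) : h * (h^-1 * D - 2^-1 * x) = D - 2^-1 * (h * x) by field.
    by rewrite num.
  apply: (@le_trans _ _ (e / 2 + e / 2)); last by lra.
  apply: le_trans (lerD a5 b2); apply: le_trans (ler_distD (2^-1 * (A + A')) _ _) _.
  by rewrite lerD // distrC.
have E : (fun h : R => h^-1 *: ((energy \o shift t) (h *: 1) - energy t)) =
    fun h => h^-1 * (energy (t + h) - energy t).
  by apply/funext => h; rewrite /= [h%:A]mulr1 [h + t]addrC.
apply: DeriveDef.
- by rewrite /derivable E; apply/cvg_ex; exists (t * z).
- by rewrite /derive E; apply: cvg_lim.
Unshelve. all: by end_near. Qed.

End energy.

(** * Heat kernel profiles and Euler integrals *)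

Section heat_profile.
Context {R : realType}.
Implicit Types k q tau : R.

(** From [1 + y <= (1 + k/c) e^(c y / k)], raised to the power [k]. *)
Lemma powR_expR_bounded (k c : R) : 0 < k -> 0 < c ->
  exists2 C, 0 <= C & forall y, 0 <= y -> (1 + y) `^ k * expR (- (c * y)) <= C.
Proof.
move=> k0 c0; exists ((1 + k / c) `^ k) => [|y y0]; first exact: powR_ge0.
have ck0 : 0 < c / k by rewrite divr_gt0.
have kc0 : 0 < k / c by rewrite divr_gt0.
have le1 : 1 + y <= (1 + k / c) * expR (c / k * y).
  apply: (@le_trans _ _ ((1 + k / c) * (1 + c / k * y))).
    rewrite mulrDl mul1r mulrDr mulr1 mulrA (_ : k / c * (c / k) = 1); last first.
      by field; rewrite ?gt_eqF.
    have : 0 <= c / k * y by rewrite mulr_ge0 ?(ltW ck0).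
    by move: kc0; lra.
  by rewrite ler_wpM2l ?expR_ge1Dx // addr_ge0 ?(ltW kc0).
have h : (1 + y) `^ k <= (1 + k / c) `^ k * expR (c * y).
  apply: (@le_trans _ _ (((1 + k / c) * expR (c / k * y)) `^ k)).
    by apply: ge0_ler_powR; rewrite ?nnegrE ?(ltW k0) ?addr_ge0 ?mulr_ge0 ?addr_ge0 ?expR_ge0 ?(ltW kc0).
  rewrite powRM ?expR_ge0 ?addr_ge0 ?(ltW kc0) // -expRM.
  by rewrite (_ : c / k * y * k = c * y) //; field; rewrite gt_eqF.
apply: le_trans (ler_wpM2r (expR_ge0 _) h) _.
by rewrite -mulrA -expRD subrr expR0 mulr1.
Qed.

Lemma powRV (x k : R) : 0 < x -> x^-1 `^ k = (x `^ k)^-1.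
Proof.
move=> x0; have xk : 0 < x `^ k by rewrite powR_gt0.
apply: (mulIf (lt0r_neq0 xk)); rewrite -powRM ?invr_ge0 ?(ltW x0) //.
by rewrite !mulVf ?powR1 // gt_eqF.
Qed.

Lemma powRS (x k : R) : 0 < x -> x `^ (k + 1) = x `^ k * x.
Proof.
move=> x0; rewrite powRD; last by apply/implyP => _; rewrite gt_eqF.
by rewrite powRr1 // ltW.
Qed.

(* The value 0 for tau <= 0 extends the heat kernel profile smoothly when q > 0. *)
Definition hk k q tau : R :=
  if 0 < tau then expR (- q / (4 * tau)) / tau `^ k else 0.

Lemma hk_ge0 k q tau : 0 <= hk k q tau.
Proof. by rewrite /hk; case: ifP => // _; rewrite divr_ge0 ?expR_ge0 ?powR_ge0. Qed.

Lemma hkE k q tau : 0 < tau -> hk k q tau = expR (- q / (4 * tau)) / tau `^ k.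
Proof. by rewrite /hk => ->. Qed.

Lemma hk_le0 k q tau : tau <= 0 -> hk k q tau = 0.
Proof. by rewrite /hk ltNge => ->. Qed.

Lemma hkS k q tau : hk (k + 1) q tau = hk k q tau / tau.
Proof.
rewrite /hk; case: ifP => [t0|_]; last by rewrite mul0r.
by rewrite powRS // -mulrA -invfM.
Qed.

Lemma hkSS k q tau : hk (k + 2) q tau = hk k q tau / tau ^+ 2.
Proof.
rewrite (_ : k + 2 = k + 1 + 1); last by ring.
by rewrite !hkS expr2 invfM mulrA.
Qed.

Lemma le_hk k q1 q2 tau : q1 <= q2 -> hk k q2 tau <= hk k q1 tau.
Proof.
move=> q12; rewrite /hk; case: ifP => // t0.
rewrite ler_wpM2r ?invr_ge0 ?powR_ge0 // ler_expR ler_pM2r ?invr_gt0 ?mulr_gt0 //.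
by rewrite lerN2.
Qed.

Lemma hkD k q1 q2 tau : hk k (q1 + q2) tau = expR (- q1 / (4 * tau)) * hk k q2 tau.
Proof.
rewrite /hk; case: ifP => _; last by rewrite mulr0.
by rewrite opprD mulrDl expRD mulrA.
Qed.

(** Half of the exponent absorbs the factor [q / tau], by [x e^(-x) <= 1] with [x = q / (8 tau)]. *)
Lemma hkS_le k q tau : 0 <= q -> q * hk (k + 1) q tau <= 8 * hk k (q / 2) tau.
Proof.
move=> q0; have [t0|t0] := leP tau 0; first by rewrite !hk_le0 // !mulr0.
rewrite {2}(splitr q) hkS hkD mulrAC.
set x := q / 2 / (4 * tau).
have -> : q * (expR (- (q / 2) / (4 * tau)) / tau * hk k (q / 2) tau) =
  8 * (x * expR (- x)) * hk k (q / 2) tau.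
  by rewrite /x !mulNr; field; rewrite ?gt_eqF.
rewrite ler_wpM2r ?hk_ge0 // ler_piMr //.
rewrite expRN ler_pdivrMr ?expR_gt0 // mul1r.
by apply: le_trans (expR_ge1Dx x); rewrite lerDr.
Qed.

Lemma hkSS_le k q tau : 0 <= q -> q ^+ 2 * hk (k + 2) q tau <= 128 * hk k (q / 4) tau.
Proof.
move=> q0; rewrite (_ : k + 2 = k + 1 + 1); last by ring.
rewrite expr2 -mulrA.
apply: le_trans (ler_wpM2l q0 (@hkS_le (k + 1) q tau q0)) _.
have q20 : 0 <= q / 2 by rewrite divr_ge0.
have := @hkS_le k (q / 2) tau q20.
rewrite (_ : q / 2 / 2 = q / 4); last by field.
by lra.
Qed.

(** All shifts by at most [dl] are dominated by the profile at the latest time [tau + dl]. One half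
    of the exponent supplies the Gaussian at that time; the other half beats the ratio of the powers
    of time, for which [q] has to stay away from 0. *)
Lemma hk_time_le k q0 dl : 0 < k -> 0 < q0 -> 0 < dl ->
  exists2 C, 0 <= C & forall q h tau, q0 <= q -> `|h| <= dl ->
    hk k q (tau + h) <= C * hk k (q / 2) (tau + dl).
Proof.
move=> k0 q00 dl0.
have c0 : 0 < q0 / 8 / (2 * dl) by rewrite !divr_gt0 // mulr_gt0.
have [C C0 HC] := powR_expR_bounded k0 c0.
exists C => // q h tau qq hd.
have [t0|t0] := leP (tau + h) 0; first by rewrite hk_le0 // mulr_ge0 ?hk_ge0.
set r := tau + h in t0 *; set s := tau + dl.
have [hd1 hd2] := ler_normlP _ _ hd.
have rs : r <= s by rewrite /r /s; lra.
have sr : s <= r + 2 * dl by rewrite /r /s; lra.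
have s0 : 0 < s by exact: lt_le_trans rs.
clearbody r s.
rewrite !hkE //.
have y0 : 0 <= 2 * dl / r by rewrite divr_ge0 ?(ltW t0) // mulr_ge0 ?(ltW dl0).
have e1 : expR (- q / (4 * r)) <= expR (- (q0 / 8 / (2 * dl) * (2 * dl / r))) * expR (- (q / 2) / (4 * s)).
  rewrite -expRD ler_expR.
  have -> : q0 / 8 / (2 * dl) * (2 * dl / r) = q0 / (8 * r) by field; rewrite !gt_eqF.
  have -> : - q / (4 * r) = - (q / (8 * r)) - q / (8 * r) by field; rewrite gt_eqF.
  have -> : - (q / 2) / (4 * s) = - (q / (8 * s)) by field; rewrite gt_eqF.
  rewrite lerD // lerN2 ?ler_wpM2r ?invr_ge0 ?mulr_ge0 ?(ltW t0) //.
  by rewrite ler_wpM2l ?(le_trans (ltW q00)) // lef_pV2 ?posrE ?mulr_gt0 // ler_pM2l.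
have e2 : (r `^ k)^-1 <= (1 + 2 * dl / r) `^ k / s `^ k.
  rewrite ler_pdivlMr ?powR_gt0 // mulrC ler_pdivrMr ?powR_gt0 //.
  rewrite -powRM ?addr_ge0 ?(ltW t0) //.
  apply: ge0_ler_powR; rewrite ?nnegrE ?(ltW k0) ?(ltW s0) ?mulr_ge0 ?addr_ge0 ?(ltW t0) //.
  by rewrite mulrDl mul1r divfK ?gt_eqF.
apply: le_trans (ler_pM _ _ e1 e2) _; rewrite ?expR_ge0 ?invr_ge0 ?powR_ge0 //.
have := HC _ y0; set A := expR _; set D := expR _; set P := _ `^ k; set S := (s `^ k)^-1 => le.
rewrite (_ : A * D * (P * S) = P * A * (D * S)); last by ring.
by rewrite ler_wpM2r // mulr_ge0 ?expR_ge0 ?invr_ge0 ?powR_ge0.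
Qed.

Lemma is_derive_hk_q k q tau :
  is_derive q (1 : R) (hk k ^~ tau) (- 4^-1 * hk (k + 1) q tau).
Proof.
have [t0|t0] := leP tau 0.
  rewrite hk_le0 // mulr0 (_ : hk k ^~ tau = cst 0); first exact: is_derive_cst.
  by apply/funext => r; rewrite hk_le0.
have h0 : is_derive q (1 : R) (fun q : R => q) 1 by exact: is_derive_id.
have h := is_derive_comp1 (is_derive_scalel (- (4 * tau)^-1) h0) (is_derive_expR _).
have := is_derive_scalel (tau `^ k)^-1 h.
rewrite (_ : (fun x => _) = hk k ^~ tau); last first.
  by apply/funext => r; rewrite hkE // mulrC; congr (expR _ / _); rewrite mulrC mulrN mulNr.
rewrite (_ : _ * _ = - 4^-1 * hk (k + 1) q tau) //.
rewrite hkS hkE // (_ : - q / (4 * tau) = - (4 * tau)^-1 * q); last by rewrite mulrC mulrN mulNr.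
by field; rewrite ?gt_eqF ?powR_gt0.
Qed.

Lemma is_derive_hk_tau k q tau : 0 < k -> 0 < q ->
  is_derive tau (1 : R) (hk k q) (- k * hk (k + 1) q tau + q / 4 * hk (k + 2) q tau).
Proof.
move=> k0 q0.
have near_eq (f g : R -> R) (x l : R) : {near x, f =1 g} ->
    is_derive x (1 : R) g l -> is_derive x (1 : R) f l.
  move=> fg hg.
  have fg' : \forall y \near x, g y = f y by apply: filterS fg => y ->.
  exact: (near_eq_is_derive fg').
have [t0|t0|->] := ltgtP tau 0.
- rewrite !hk_le0 ?(ltW t0) // !mulr0 addr0.
  have hc : is_derive tau (1 : R) (fun=> 0 : R) 0 by exact: is_derive_cst.
  apply: near_eq hc.
  near=> y; rewrite hk_le0 //; apply/ltW; near: y; exact: lt_nbhsl.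
- apply: (near_eq _ (fun r => expR (- q / 4 * r^-1) * r `^ (- k))).
    near=> y; have y0 : 0 < y by near: y; exact: lt_nbhsr.
    rewrite hkE // powRN; congr (expR _ * _); rewrite invfM mulrA //.
  have t0' : tau != 0 by rewrite gt_eqF.
  have h0 : is_derive tau (1 : R) (fun q : R => q) 1 by exact: is_derive_id.
  have h1 := is_derive_scalel (- q / 4) (is_deriveV t0' h0).
  have h2 := is_derive_comp1 h1 (is_derive_expR _).
  have := is_derive_mul h2 (is_derive1_powR (- k) t0).
  rewrite (_ : _ + _ = - k * hk (k + 1) q tau + q / 4 * hk (k + 2) q tau) //.
  rewrite hkS hkSS hkE // -powRN.
  have -> : - q / (4 * tau) = - q / 4 * tau^-1 by rewrite invfM mulrA.
  have -> : tau `^ (- k - 1) = tau `^ (- k) / tau.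
    by rewrite -[in RHS](subrK 1 (- k)) powRS // mulfK.
  by rewrite /GRing.scale /=; field.
- rewrite !hk_le0 // !mulr0 addr0.
  (* At time 0 the profile is flat: [powR_expR_bounded] with [y = 1 / h] gives
     [hk k q h <= C h^2]. *)
  have q40 : 0 < q / 4 by rewrite divr_gt0.
  have k20 : 0 < k + 2 by rewrite addr_gt0.
  have [C C0 HC] := powR_expR_bounded k20 q40.
  apply: (@is_derive_quadratic _ _ _ _ C) => h.
  rewrite add0r mul0r [hk _ _ 0]hk_le0 // !subr0 ger0_norm ?hk_ge0 //.
  have [h0|h0] := leP h 0; first by rewrite hk_le0 // mulr_ge0 // sqr_ge0.
  rewrite hkE //.
  have y0 : 0 <= h^-1 by rewrite invr_ge0 ltW.
  have := HC _ y0 => /(ler_wpM2r (sqr_ge0 h)); apply: le_trans.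
  rewrite (_ : - q / (4 * h) = - (q / 4 / h)); last by rewrite invfM mulrA !mulNr.
  rewrite [leRHS]mulrAC [leLHS]mulrC ler_wpM2r ?expR_ge0 //.
  apply: (@le_trans _ _ (h^-1 `^ (k + 2) * h ^+ 2)).
    rewrite (_ : k + 2 = k + 1 + 1); last by ring.
    rewrite !powRS ?invr_gt0 // powRV //.
    by rewrite le_eqVlt; apply/orP; left; apply/eqP; field; rewrite ?gt_eqF ?powR_gt0.
  rewrite ler_wpM2r ?sqr_ge0 //; apply: ge0_ler_powR; rewrite ?nnegrE ?(ltW k20) ?addr_ge0 //.
  by rewrite lerDr.
Unshelve. all: by end_near. Qed.

Lemma measurable_hk d (T : measurableType d) k (f g : T -> R) :
  measurable_fun setT f -> measurable_fun setT g ->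
  measurable_fun setT (fun x => hk k (f x) (g x)).
Proof.
move=> mf mg.
rewrite (_ : (fun x => _) = fun x =>
  if 0 < g x then expR (- (f x / 4) * g x `^ (-1)) * g x `^ (- k) else 0); last first.
  apply/funext => x; rewrite /hk; case: ifP => // g0.
  by rewrite powRN powR_inv1 ?(ltW g0) // invfM mulrA !mulNr.
apply: measurable_fun_if => //; first exact: measurable_fun_ltr.
apply: (@measurable_funS _ _ _ _ setT) => //.
have mp r : measurable_fun setT (fun x => g x `^ r) by exact: (measurableT_comp (measurable_powR r)).
apply: measurable_funM => //; apply: measurableT_comp => //; apply: measurable_funM => //.
by apply: measurable_funN; apply: measurable_funM.
Qed.

End heat_profile.

(** * Improper integrals over the half-line and Euler's integral *)

Section ray_integrals.
Context {R : realType}.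
Local Notation leb := (@lebesgue_measure R).
Local Notation ray := ([set` `]0%R, +oo[] : set (measurableTypeR R)).

Let mray : measurable ray. Proof. exact: measurable_itv. Qed.

(** This exhaustion of the half-line is adapted to inversion: [r |-> c / r] maps [seg 1 n] onto
    [seg c n], as the substitution in [integral_hk] requires. *)
Let seg (c : R) (n : nat) : set (measurableTypeR R) := `[c / n.+1%:R, c * n.+1%:R]%classic.

Let seg_gt0 (c : R) n x : 0 < c -> seg c n x -> 0 < x.
Proof.
by move=> c0; rewrite /seg /= in_itv /= => /andP[h _]; apply: lt_le_trans h; rewrite divr_gt0.
Qed.

Let seg_lt (c : R) n : 0 < c -> (0 < n)%N -> c / n.+1%:R < c * n.+1%:R.
Proof.
move=> c0 n0; rewrite ltr_pM2l //.
have n1 : 1 < n.+1%:R :> R by rewrite ltr1n.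
by apply: lt_trans n1; rewrite invf_lt1 ?ltr1n // ltr0n.
Qed.

Lemma cvg_integral_ray (f : R -> \bar R) (c : R) : 0 < c ->
  measurable_fun ray f -> (forall x, 0 < x -> (0 <= f x)%E) ->
  (\int[leb]_(x in `[(c / n.+1%:R)%R, (c * n.+1%:R)%R]) f x @[n --> \oo] -->
   \int[leb]_(x in `]0%R, +oo[) f x)%E.
Proof.
move=> c0 mf f0.
have sub n : seg c n `<=` ray.
  by move=> x /(seg_gt0 c0) x0; rewrite /= in_itv /= andbT.
rewrite (_ : ray = \bigcup_n seg c n); last first.
  apply/seteqP; split => [x|x [n _]]; last exact: sub.
  rewrite /= in_itv /= andbT => x0; near \oo => n.
  have h1 : c / x <= n%:R by near: n; exact: nbhs_infty_ger.
  have h2 : x / c <= n%:R by near: n; exact: nbhs_infty_ger.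
  have nS : n%:R <= n.+1%:R :> R by rewrite ler_nat.
  exists n => //; rewrite /seg /= in_itv /=; apply/andP; split.
    by rewrite ler_pdivrMr // mulrC -ler_pdivrMr // (le_trans h1).
  by rewrite mulrC -ler_pdivrMr // (le_trans h2).
apply: ge0_nondecreasing_set_cvg_integral.
- move=> i j ij; apply/subsetPset => x; rewrite /seg /= !in_itv /= => /andP[h1 h2].
  have ij' : i.+1%:R <= j.+1%:R :> R by rewrite ler_nat ltnS.
  apply/andP; split.
    by apply: le_trans h1; rewrite ler_pM2l // lef_pV2 // posrE ltr0n.
  by apply: le_trans h2 _; rewrite ler_pM2l.
- by move=> i; exact: measurable_itv.
- by move=> i; apply: measurable_funS mf => //; exact: sub.
- by move=> i x /(seg_gt0 c0); exact: f0.
Unshelve. all: by end_near. Qed.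

(** The integrand is the derivative of [- 1 / (k (1 + t^k))]. It behaves like [t^(k-1)] at 0 and
    like [t^(-k-1)] at infinity, and thus serves as a majorant at both ends. *)
Lemma integrable_bump (k : R) : 0 < k ->
  leb.-integrable ray (EFin \o (fun t : R => t `^ (k - 1) / (1 + t `^ k) ^+ 2)).
Proof.
move=> k0; pose f (t : R) := t `^ (k - 1) / (1 + t `^ k) ^+ 2.
have f0 t : 0 <= f t by rewrite divr_ge0 ?powR_ge0 // sqr_ge0.
have p1 t : 0 < 1 + t `^ k by rewrite ltr_wpDr ?powR_ge0.
have mf : measurable_fun setT f.
  rewrite (_ : f = fun t => t `^ (k - 1) * (1 + t `^ k) `^ (- 2)).
    apply: measurable_funM; first exact: measurable_powR.
    apply: (measurableT_comp (measurable_powR (- 2))).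
    by apply: measurable_funD => //; exact: measurable_powR.
  by apply/funext => t; rewrite powRN powR_mulrn ?ltW.
apply/integrableP; split; first by apply/measurable_EFinP; apply: measurable_funS mf.
apply: (@le_lt_trans _ _ (k^-1)%:E); last exact: ltry.
under eq_integral => x _ do rewrite /= ger0_norm ?f0 //.
have cv : (\int[leb]_(x in `[(1 / n.+1%:R)%R, (1 * n.+1%:R)%R]) (f x)%:E @[n --> \oo] -->
    \int[leb]_(x in `]0%R, +oo[) (f x)%:E)%E.
  apply: cvg_integral_ray => //; last by move=> x _; rewrite lee_fin.
  by apply/measurable_EFinP; apply: measurable_funS mf.
apply: (cvge_le _ cv); exists 1%N => // n /= n0.
pose F (t : R) := - k^-1 * (1 + t `^ k)^-1.
have dF (x : R) : 1 / n.+1%:R <= x <= 1 * n.+1%:R -> is_derive x (1 : R) F (f x).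
  move=> xs; have x0 : 0 < x by exact: (@seg_gt0 1 n).
  have h := is_derive1_powR k x0.
  have h0 : is_derive x (1 : R) (fun x : R => 1 + x `^ k) (k * x `^ (k - 1)).
    have hc : is_derive x (1 : R) (fun=> 1 : R) 0 by exact: is_derive_cst.
    by have := is_derive_add hc h; rewrite add0r.
  have nz : 1 + x `^ k != 0 by rewrite gt_eqF.
  have := is_derive_scalel (- k^-1) (@is_deriveV R (fun x : R => 1 + x `^ k) x _ _ nz h0).
  rewrite (_ : _ * _ = f x) // /f /GRing.scale /=.
  by field; rewrite nz gt_eqF.
have cf (x : R) : 1 / n.+1%:R <= x <= 1 * n.+1%:R -> {for x, continuous f}.
  move=> xs; have x0 : 0 < x by exact: (@seg_gt0 1 n).
  have c r : {for x, continuous (fun t : R => t `^ r)}.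
    exact: (derivable_cont (is_derive1_powR r x0)).
  have c1 : {for x, continuous (fun t : R => (1 + t `^ k) ^+ 2)}.
    by apply: contX; apply: contD; [exact: cont_cst|exact: c].
  have nz : (1 + x `^ k) ^+ 2 != 0 by rewrite gt_eqF // exprn_gt0.
  have c2 := @contV _ _ (fun t : R => (1 + t `^ k) ^+ 2) x nz c1.
  exact: (contM (c (k - 1)) c2).
rewrite (ftc2 (seg_lt ltr01 n0) dF cf) lee_fin /F.
set A := (1 + _)^-1; set B := (1 + _)^-1.
have A0 : 0 <= A by rewrite invr_ge0 ltW.
have B1 : B <= 1 by rewrite invf_le1 // lerDl powR_ge0.
have ki : 0 <= k^-1 by rewrite invr_ge0 ltW.
have h1 : 0 <= k^-1 * A by rewrite mulr_ge0.
have h2 : k^-1 * B <= k^-1 by rewrite ler_piMr.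
by rewrite !mulNr opprK; lra.
Qed.

Definition euler_integral (s : R) : R :=
  \int[leb]_(x in `]0%R, +oo[) (x `^ (s - 1) * expR (- x)).

Lemma integrable_euler (s : R) : 0 < s ->
  leb.-integrable ray (EFin \o (fun x : R => x `^ (s - 1) * expR (- x))).
Proof.
(* This exponent makes [(1 + x^s)^2 <= 4 (1 + x)^(2 max(1, s))], a power that the exponential
   absorbs. *)
move=> s0; have r0 : 0 < 2 * Num.max 1 s by rewrite mulr_gt0 // lt_max ltr01.
have [C C0 HC] := @powR_expR_bounded R _ _ r0 ltr01.
apply: (@le_integrableR _ _ _ leb ray mray _ (fun t : R => (4 * C) * (t `^ (s - 1) / (1 + t `^ s) ^+ 2))) => //.
- apply: measurable_funM; first by apply: measurable_funS (measurable_powR _).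
  by apply: measurableT_comp => //; apply: measurable_funN.
- move=> x; rewrite /= in_itv /= andbT => x0.
  rewrite ger0_norm ?mulr_ge0 ?powR_ge0 ?expR_ge0 // mulrCA ler_wpM2l ?powR_ge0 //.
  rewrite ler_pdivlMr ?exprn_gt0 ?ltr_wpDr ?powR_ge0 //.
  apply: le_trans (_ : 4 * (1 + x) `^ (2 * Num.max 1 s) * expR (- (1 * x)) <= _); last first.
    by rewrite -mulrA ler_pM2l // HC // ltW.
  rewrite mul1r mulrC ler_wpM2r ?expR_ge0 //.
  have x1 : 1 <= 1 + x by rewrite lerDl ltW.
  have le1 : 1 + x `^ s <= 2 * (1 + x) `^ Num.max 1 s.
    rewrite mulr2n mulrDl mul1r; apply: lerD.
      by rewrite -[leLHS](powRr0 (1 + x)); apply: ler_powR => //; rewrite le_max ler01.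
    apply: (@le_trans _ _ ((1 + x) `^ s)); last by apply: ler_powR => //; rewrite le_max lexx orbT.
    by apply: ge0_ler_powR; rewrite ?nnegrE ?(ltW s0) ?(ltW x0) ?addr_ge0 ?(ltW x0) ?lerDr.
  rewrite [2 * Num.max 1 s]mulrC powRrM powR_mulrn ?powR_ge0 //.
  apply: (@le_trans _ _ ((2 * (1 + x) `^ Num.max 1 s) ^+ 2)).
    by rewrite ler_pXn2r ?nnegrE ?addr_ge0 ?mulr_ge0 ?powR_ge0.
  by rewrite exprMn; lra.
- by apply: integrableZR => //; exact: integrable_bump.
Qed.

Lemma euler_integral_gt0 (s : R) : 0 < s -> 0 < euler_integral s.
Proof.
move=> s0; rewrite -lte_fin (EFin_Rintegral mray (integrable_euler s0)).
have m0 : measurable_fun ray (fun x : R => x `^ (s - 1) * expR (- x)).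
  exact: (measurable_integrable (integrable_euler s0)).
(* On [[1, 2]] the integrand is at least this positive constant; the minimum covers both signs of
   [s - 1]. *)
apply: (@lt_le_trans _ _ (\int[leb]_(x in `[1%R, 2%R]) cst (Num.min 1 (2 `^ (s - 1)) * expR (- 2))%:E x)%E).
  rewrite integral_cst /=; last exact: measurable_itv.
  rewrite lebesgue_measure_itv /= lte_fin ltr1n /=.
  rewrite -EFinB -EFinM lte_fin !mulr_gt0 ?expR_gt0 // ?lt_min ?ltr01 ?powR_gt0 //.
apply: (@le_trans _ _ (\int[leb]_(x in `[1%R, 2%R]) (x `^ (s - 1) * expR (- x))%:E)%E).
  apply: ge0_le_integral => //.
  - by move=> x _; rewrite lee_fin mulr_ge0 ?expR_ge0 // le_min ler01 powR_ge0.
  - apply/measurable_EFinP; apply: measurable_funS m0 => // x /=; rewrite !in_itv /= andbT => /andP[x1 _].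
    exact: lt_le_trans x1.
  - move=> x; rewrite /= in_itv /= => /andP[x1 x2]; rewrite lee_fin.
    have x0 : 0 < x by exact: lt_le_trans x1.
    apply: ler_pM; rewrite ?expR_ge0 // ?le_min ?ler01 ?powR_ge0 //; last by rewrite ler_expR lerN2.
    have [s1|s1] := leP 0 (s - 1).
      apply: (@le_trans _ _ 1); first by rewrite ge_min lexx.
      by rewrite -[leLHS](powRr0 x); apply: ler_powR.
    apply: (@le_trans _ _ (2 `^ (s - 1))); first by rewrite ge_min lexx orbT.
    rewrite -[s - 1]opprK powRN [leRHS]powRN lef_pV2 ?posrE ?powR_gt0 //.
    by apply: ge0_ler_powR; rewrite ?nnegrE ?(ltW x0) // oppr_ge0 ltW.
apply: ge0_subset_integral => //.
- by apply/measurable_EFinP.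
- by move=> x _; rewrite lee_fin mulr_ge0 ?expR_ge0 ?powR_ge0.
- by move=> x /=; rewrite !in_itv /= andbT => /andP[x1 _]; exact: lt_le_trans x1.
Qed.

(* Substitute x = q / (4 tau). *)
Lemma integral_hk (s q : R) : 0 < s -> 0 < q ->
  (\int[leb]_(tau in `]0%R, +oo[) (hk (1 + s) q tau)%:E = ((4 / q) `^ s * euler_integral s)%:E)%E.
Proof.
move=> s0 q0; pose c := q / 4; have c0 : 0 < c by rewrite divr_gt0.
pose G (x : R) := x `^ (s - 1) * expR (- x); pose F (r : R) := c / r.
have mhk : measurable_fun setT (hk (1 + s) q).
  by apply: (@measurable_hk R _ (measurableTypeR R) (1 + s) (cst q) (fun x => x)).
have cvG : (\int[leb]_(x in `[(c / n.+1%:R)%R, (c * n.+1%:R)%R]) (G x)%:E @[n --> \oo] -->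
    \int[leb]_(x in `]0%R, +oo[) (G x)%:E)%E.
  apply: cvg_integral_ray => //.
    by apply/measurable_EFinP; exact: measurable_integrable (integrable_euler s0).
  by move=> x _; rewrite lee_fin mulr_ge0 ?expR_ge0 ?powR_ge0.
have cvH : (\int[leb]_(x in `[(1 / n.+1%:R)%R, (1 * n.+1%:R)%R]) (hk (1 + s) q x)%:E @[n --> \oo] -->
    \int[leb]_(x in `]0%R, +oo[) (hk (1 + s) q x)%:E)%E.
  apply: cvg_integral_ray => //.
    by apply/measurable_EFinP; apply: measurable_funS mhk.
  by move=> x _; rewrite lee_fin hk_ge0.
rewrite (_ : (_ * _)%:E = (((4 / q) `^ s)%:E * \int[leb]_(x in `]0%R, +oo[) (G x)%:E)%E); last first.
  by rewrite EFinM (EFin_Rintegral mray (integrable_euler s0)).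
apply: (cvg_unique _ cvH) => //.
have {}cvG := cvgeZl (erefl : ((4 / q) `^ s)%:E \is a fin_num) cvG.
apply: cvg_trans cvG; apply: near_eq_cvg; exists 1%N => // n /= n0.
have dF (x : R) : 0 < x -> is_derive x (1 : R) F (- c / x ^+ 2).
  move=> x0; have nz : x != 0 by rewrite gt_eqF.
  have h0 : is_derive x (1 : R) (fun q : R => q) 1 by exact: is_derive_id.
  have := is_derive_scalel c (is_deriveV nz h0).
  by rewrite (_ : _ * _ = - c / x ^+ 2) // /GRing.scale /= mulr1 mulrN mulNr.
have dF' (x : R) : 0 < x -> F^`()%classic x = - c / x ^+ 2.
  by move=> x0; rewrite derive1E; have [_ ->] := dF x x0.
have pos (x : R) : (x \in `[1 / n.+1%:R, 1 * n.+1%:R]) -> 0 < x by exact: seg_gt0.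
have ab := seg_lt ltr01 n0.
have E : F (1 * n.+1%:R) = c / n.+1%:R /\ F (1 / n.+1%:R) = c * n.+1%:R.
  by rewrite /F !mul1r invrK.
have cdF (x : R) : 0 < x -> {for x, continuous F^`()%classic}.
  move=> x0; have cx : {for x, continuous (fun r : R => - c / r ^+ 2)}.
    apply: contM; first exact: cont_cst.
    have c2 : {for x, continuous (fun r : R => r ^+ 2)} by exact: exprn_continuous.
    by apply: (contV _ c2); rewrite gt_eqF // exprn_gt0.
  rewrite /prop_for /continuous_at dF' //.
  apply: cvg_trans cx; apply: near_eq_cvg; near=> r.
  by rewrite dF' //; near: r; exact: lt_nbhsr.
have p1 : 0 < 1 / n.+1%:R :> R by rewrite divr_gt0.
have p2 : 0 < 1 * n.+1%:R :> R by rewrite mul1r.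
have -> : (\int[leb]_(x in `[(c / n.+1%:R)%R, (c * n.+1%:R)%R]) (G x)%:E =
  \int[leb]_(x in `[(1 / n.+1%:R)%R, (1 * n.+1%:R)%R]) (((G \o F) * - F^`()%classic) x)%:E)%E.
  have [e1 e2] := E; rewrite -{1}e1 -{1}e2.
  apply: integration_by_substitution_decreasing.
  - exact: ltW.
  - move=> x y /pos x0 /pos y0 xy; rewrite /F ltr_pM2l // ltf_pV2 //.
  - by move=> x; rewrite in_itv /= => /andP[h _]; apply: cdF; exact: lt_trans h.
  - by apply/cvg_ex; exists (F^`()%classic (1 / n.+1%:R)); apply: cvg_at_right_filter; exact: cdF.
  - by apply/cvg_ex; exists (F^`()%classic (1 * n.+1%:R)); apply: cvg_at_left_filter; exact: cdF.
  - split.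
    + by move=> x; rewrite in_itv /= => /andP[h _]; have [] := dF x (lt_trans p1 h).
    + apply: cvg_at_right_filter; exact: (derivable_cont (dF _ p1)).
    + apply: cvg_at_left_filter; exact: (derivable_cont (dF _ p2)).
  - apply: continuous_in_subspaceT => x; rewrite inE /= in_itv /= e1 => /andP[h _].
    have x0 : 0 < x by apply: lt_le_trans h; rewrite divr_gt0.
    have cE : {for x, continuous (fun r : R => expR (- r))}.
      by apply: continuous_comp; [exact: opp_continuous|exact: continuous_expR].
    have cP : {for x, continuous (fun r : R => r `^ (s - 1))}.
      exact: (derivable_cont (is_derive1_powR _ x0)).
    exact: (contM cP cE).
have EH (x : R) : x \in `[1 / n.+1%:R, 1 * n.+1%:R] ->
    ((G \o F) * - F^`()%classic) x = (q / 4) `^ s * hk (1 + s) q x.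
  move=> /pos x0.
  rewrite (_ : ((G \o F) * - F^`()%classic) x = G (F x) * - F^`()%classic x) // dF' // /G /F hkE //.
  rewrite -/c -powRV ?powR_gt0 // (_ : - q / (4 * x) = - (c / x)); last first.
    by rewrite /c; field; rewrite gt_eqF.
  have -> : x^-1 `^ (1 + s) = x^-1 `^ (s - 1) * x^-1 * x^-1.
    by rewrite -!powRS ?invr_gt0 //; congr (_ `^ _); ring.
  have -> : c `^ s = c `^ (s - 1) * c by rewrite -powRS // subrK.
  rewrite powRM ?invr_ge0 ?(ltW x0) ?(ltW c0) //.
  by field; rewrite gt_eqF.
have -> : (\int[leb]_(x in `[(1 / n.+1%:R)%R, (1 * n.+1%:R)%R]) (((G \o F) * - F^`()%classic) x)%:E =
   ((q / 4) `^ s)%:E * \int[leb]_(x in `[(1 / n.+1%:R)%R, (1 * n.+1%:R)%R]) (hk (1 + s) q x)%:E)%E.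
  rewrite -ge0_integralZl //.
  - by apply: eq_integral => x; rewrite inE => xs; rewrite EH.
  - by apply/measurable_EFinP; apply: measurable_funS mhk.
  - by move=> x _; rewrite lee_fin hk_ge0.
  - by rewrite lee_fin powR_ge0.
rewrite muleA -EFinM -powRM ?divr_ge0 ?(ltW q0) //.
rewrite (_ : 4 / q * (q / 4) = 1) ?powR1 ?mul1e //.
by field; rewrite gt_eqF.
Unshelve. all: by end_near. Qed.

End ray_integrals.

Section gamma_facts.
Context {R : realType}.
Implicit Types s : R.

Lemma GammaE s : 0 < s -> Gamma s = euler_integral s.
Proof. by move=> s0; rewrite /Gamma s0 big_ord0 divr1 addr0. Qed.

Lemma Gamma_gt0 s : 0 < s -> 0 < Gamma s.
Proof. by move=> s0; rewrite GammaE // euler_integral_gt0. Qed.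

Lemma normr_GammaN_gt0 s : 0 < s < 1 -> 0 < `|Gamma (- s)|.
Proof.
move=> /andP[s0 s1]; rewrite normr_gt0 /Gamma oppr_gt0 opprK ltNge (ltW s0) /=.
(* So the definition takes exactly one step of the recursion,
   [Gamma (-s) = Gamma (1 - s) / (-s)]. *)
have -> : Num.truncn s = 0%N by apply/truncn0Pn; rewrite -ltNge.
rewrite big_ord_recl big_ord0 mulr1 addr0 mulf_neq0 ?invr_eq0 ?oppr_eq0 ?gt_eqF //.
have s1' : 0 < 1 - s by rewrite subr_gt0.
by have := euler_integral_gt0 s1'; rewrite [1 - s]addrC.
Qed.

End gamma_facts.

(** * Space and space-time integrals of the heat profile *)

Section heat_profile_integrals.
Context {R : realType}.
Local Notation mu := (@lebesgue_rV R).
Local Notation leb := (@lebesgue_measure R).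
Variables (n : nat) (s : R).
Hypothesis s0 : 0 < s.
Let m : R := n%:R / 2 + 1 + s.

Lemma measurable_behrv2 : measurable_fun setT (@behrv R n).
Proof.
apply: measurable_fun_rV => i; rewrite (_ : (fun x => _) = fun x : 'rV[R]_n.+1 => x 0 (lift ord0 i)).
  exact: measurable_coord.
by apply/funext => x; rewrite mxE.
Qed.

Lemma measurable_hk_rV (c q0 : R) : measurable_fun setT
  (fun Q : 'rV[R]_n.+1 => hk m (c * (q0 + sqnorm (behrv Q))) (Q 0 ord0)).
Proof.
apply: measurable_hk; last exact: measurable_coord.
apply: measurable_funM => //; apply: measurable_funD => //.
apply: (measurableT_comp (@measurable_sqnorm R n)).
exact: measurable_behrv2.
Qed.

(** The Gaussian integral in [z] produces [tau^(n/2)], which lowers the exponent of time from [m] to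
    [1 + s]. *)
Lemma integral_hk_space (c q0 tau : R) : 0 < c ->
  (\int[mu n]_z (hk m (c * (q0 + sqnorm z)) tau)%:E =
   ((4 * pi / c) `^ (n%:R / 2) * hk (1 + s) (c * q0) tau)%:E)%E.
Proof.
move=> c0; have [t0|t0] := leP tau 0.
  rewrite hk_le0 // mulr0; apply: integral0_eq => z _; by rewrite hk_le0.
have ct : 0 < c / (4 * tau) by rewrite divr_gt0 // mulr_gt0.
have pc : 0 < 4 * pi / c by rewrite divr_gt0 // mulr_gt0 // pi_gt0.
pose K := expR (- (c * q0) / (4 * tau)) / tau `^ m.
have K0 : 0 <= K by rewrite divr_ge0 ?expR_ge0 ?powR_ge0.
transitivity (\int[mu n]_z (K%:E * (expR (- (c / (4 * tau)) * sqnorm z))%:E))%E.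
  apply: eq_integral => z _; rewrite -EFinM hkE // /K mulrAC -expRD; congr (expR _ / _)%:E.
  by field; rewrite gt_eqF.
have mg : measurable_fun setT (fun z : 'rV[R]_n => (expR (- (c / (4 * tau)) * sqnorm z))%:E).
  by apply/measurable_EFinP; exact: measurable_gauss_rV.
rewrite ge0_integralZl //.
rewrite integral_gauss_rV // -EFinM; congr EFin; rewrite hkE // /K.
have -> : pi / (c / (4 * tau)) = 4 * pi / c * tau by field; rewrite !gt_eqF.
have pt : 0 <= 4 * pi / c * tau by rewrite ltW // mulr_gt0.
rewrite -(powR12_sqrt pt) -powR_mulrn ?powR_ge0 // -powRrM.
rewrite [2^-1 * _]mulrC powRM ?(ltW pc) ?(ltW t0) //.
have -> : tau `^ m = tau `^ (n%:R / 2) * tau `^ (1 + s).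
  by rewrite /m -addrA powRD //; apply/implyP => _; rewrite gt_eqF.
by field; rewrite !gt_eqF ?powR_gt0.
Qed.

Lemma integral_hk_rV (c q0 : R) : 0 < c -> 0 < q0 ->
  (\int[mu n.+1]_Q (hk m (c * (q0 + sqnorm (behrv Q))) (Q 0 ord0))%:E =
   ((4 * pi / c) `^ (n%:R / 2) * ((4 / (c * q0)) `^ s * euler_integral s))%:E)%E.
Proof.
move=> c0 q00.
rewrite tonelli_rV //; last 2 first.
- by apply/measurable_EFinP; exact: measurable_hk_rV.
- by move=> Q; rewrite lee_fin hk_ge0.
transitivity (\int[leb]_tau (((4 * pi / c) `^ (n%:R / 2))%:E * (hk (1 + s) (c * q0) tau)%:E))%E.
  apply: eq_integral => tau _; rewrite -EFinM -(integral_hk_space q0 tau c0).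
  by apply: eq_integral => z _; rewrite consrv0 behrv_consrv.
have mh : measurable_fun setT (hk (1 + s) (c * q0)).
  exact: (@measurable_hk R _ (measurableTypeR R) (1 + s) (cst (c * q0)) (fun x => x)).
rewrite ge0_integralZl //; last 3 first.
- by apply/measurable_EFinP.
- by move=> z _; rewrite lee_fin hk_ge0.
- by rewrite lee_fin powR_ge0.
rewrite EFinM -integral_hk ?mulr_gt0 //; congr (_ * _)%E.
rewrite [RHS]integral_mkcond; apply: eq_integral => tau _; rewrite patchE.
case: ifPn => //; rewrite notin_setE /= in_itv /= andbT => /negP; rewrite -leNgt => t0.
by rewrite hk_le0.
Qed.

Lemma integrable_hk_rV (c q0 : R) : 0 < c -> 0 < q0 ->
  (mu n.+1).-integrable setT
    (EFin \o (fun Q : 'rV[R]_n.+1 => hk m (c * (q0 + sqnorm (behrv Q))) (Q 0 ord0))).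
Proof.
move=> c0 q00; apply/integrableP; split.
  by apply/measurable_EFinP; exact: measurable_hk_rV.
under eq_integral => x _ do rewrite /= ger0_norm ?hk_ge0 //.
by rewrite integral_hk_rV // ltry.
Qed.

End heat_profile_integrals.

(** * Heat potentials *)

Section differentiation_under_the_integral.
Context {R : realType} {dsp : measure_display} {T : measurableType dsp}.
Variables (mu : measure T R) (D : set T).
Hypothesis mD : measurable D.

Lemma is_derive_under_integral (f f' : R -> T -> R) (G : T -> R) (a dl : R) : 0 < dl ->
  (forall h, `|h - a| < dl -> mu.-integrable D (EFin \o f h)) ->
  (forall h x, `|h - a| < dl -> D x -> is_derive h (1 : R) (f^~ x) (f' h x)) ->
  mu.-integrable D (EFin \o G) ->
  (forall h x, `|h - a| < dl -> D x -> `|f' h x| <= G x) ->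
  is_derive a (1 : R) (fun h => \int[mu]_(x in D) f h x) (\int[mu]_(x in D) f' a x).
Proof.
move=> dl0 fi df Gi fG.
have H h : `]a - dl, a + dl[%classic h -> `|h - a| < dl.
  rewrite /= in_itv /= => /andP[h1 h2]; rewrite ltr_norml; apply/andP; split; lra.
have Ia : `]a - dl, a + dl[%classic a by rewrite /= in_itv /=; apply/andP; split; lra.
have p12 h x : `]a - dl, a + dl[%classic h -> D x -> partial1of2 f h x = f' h x.
  by move=> /H hd Dx; rewrite /partial1of2 derive1E; have [_ ->] := df h x hd Dx.
have fi' h : `]a - dl, a + dl[%classic h -> mu.-integrable D (EFin \o f h) by move=> /H /fi.
have df' h x : `]a - dl, a + dl[%classic h -> D x -> derivable (f^~ x) h 1.
  by move=> /H hd Dx; have [] := df h x hd Dx.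
have G0 x : 0 <= `|G x| by exact: normr_ge0.
have fG' h x : `]a - dl, a + dl[%classic h -> D x -> `|partial1of2 f h x| <= `|G x|.
  by move=> hI Dx; rewrite p12 // (le_trans (fG h x (H h hI) Dx)) // ler_norm.
have e1 := differentiation_under_integral mD Ia fi' df' G0 (integrable_normR Gi) fG'.
have e2 := derivable_under_integral mD Ia fi' df' G0 (integrable_normR Gi) fG'.
apply: DeriveDef => //; rewrite -derive1E e1.
by apply: eq_Rintegral => x; rewrite inE => Dx; rewrite p12.
Qed.

End differentiation_under_the_integral.

Section heat_potential.
Context {R : realType}.
Local Notation mu := (@lebesgue_rV R).
Variables (n : nat) (s M : R) (g : 'rV[R]_n.+1 -> R).
Hypothesis s0 : 0 < s.
Hypothesis mg : measurable_fun setT g.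
Hypothesis gM : forall Q, `|g Q| <= M.
Let m : R := n%:R / 2 + 1 + s.
Let m0 : 0 < m. Proof. by rewrite /m ltr_wpDl // ltW // ltr_wpDl // divr_ge0. Qed.
Local Notation H := (@halfspace R n).
Implicit Types (X Q : 'rV[R]_n.+1) (k t h c : R).

(* Q stands for a source at time Q 0 ord0 and position behrv Q; hker1,
   hker2 and hkert are the derivatives of hker in X_i, twice in X_i, and in t. *)
Definition hdisp X Q : 'rV[R]_n.+1 := X - consrv 0 (behrv Q).
Definition hker k X t Q : R := hk k (sqnorm (hdisp X Q)) (Q 0 ord0 - t).
Definition hker1 k i X t Q : R := - (2^-1 * hdisp X Q 0 i) * hker (k + 1) X t Q.
Definition hker2 k i X t Q : R :=
  - 2^-1 * hker (k + 1) X t Q + 4^-1 * (hdisp X Q 0 i) ^+ 2 * hker (k + 2) X t Q.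
Definition hkert k X t Q : R :=
  k * hker (k + 1) X t Q - 4^-1 * sqnorm (hdisp X Q) * hker (k + 2) X t Q.

Lemma hdisp0 X Q : hdisp X Q 0 ord0 = X 0 ord0.
Proof. by rewrite !mxE unlift_none /= subr0. Qed.

Lemma sqnorm_hdisp X Q : sqnorm (hdisp X Q) = X 0 ord0 ^+ 2 + sqnorm (behrv X - behrv Q).
Proof.
rewrite sqnorm_recl hdisp0; congr (_ + sqnorm _).
by apply/rowP => i; rewrite !mxE liftK /= !mxE.
Qed.

Lemma sqnorm_hdisp_ge X Q : X 0 ord0 ^+ 2 <= sqnorm (hdisp X Q).
Proof. by rewrite sqnorm_hdisp lerDl sqnorm_ge0. Qed.

Let is_derive_sqnorm_hdisp X Q i :
  is_derive X 'e_i (fun X => sqnorm (hdisp X Q)) (2 * hdisp X Q 0 i).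
Proof.
have h := is_derive_sqnorm (hdisp X Q) i.
suff q : forall h : R, sqnorm (hdisp (h *: 'e_i + X) Q) = sqnorm (h *: 'e_i + hdisp X Q).
  exact: (is_derive_quotient _ q).2 h.
by move=> r; rewrite /hdisp addrA.
Qed.

Let is_derive_hdisp X Q i : is_derive X 'e_i (fun X => hdisp X Q 0 i) 1.
Proof.
have := is_derive_sub (is_derive_coord X i i)
  (is_derive_cst (consrv 0 (behrv Q) 0 i) X 'e_i : is_derive X 'e_i (fun=> consrv 0 (behrv Q) 0 i) 0).
rewrite eqxx subr0 (_ : (fun x => _) = fun X => hdisp X Q 0 i) //.
by apply/funext => Y; rewrite !mxE.
Qed.

Lemma is_derive_hker k i X t Q : is_derive X 'e_i (fun X => hker k X t Q) (hker1 k i X t Q).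
Proof.
have := is_derive_comp1 (is_derive_sqnorm_hdisp X Q i) (is_derive_hk_q k _ (Q 0 ord0 - t)).
by rewrite (_ : _ * _ = hker1 k i X t Q) // /hker1 /hker; field.
Qed.

Lemma is_derive_hker1 k i X t Q :
  is_derive X 'e_i (fun X => hker1 k i X t Q) (hker2 k i X t Q).
Proof.
have h1 := is_derive_scalel (- 2^-1) (is_derive_hdisp X Q i).
have := is_derive_mul h1 (is_derive_hker (k + 1) i X t Q).
rewrite (_ : (fun x => _) = fun X => hker1 k i X t Q); last first.
  by apply/funext => Y; rewrite /hker1 mulNr.
rewrite (_ : - 2^-1 * 1 * hker (k + 1) X t Q + - 2^-1 * hdisp X Q 0 i * hker1 (k + 1) i X t Q =
  hker2 k i X t Q) // /hker2 /hker1.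
rewrite (_ : k + 2 = k + 1 + 1); last by ring.
by field.
Qed.

Lemma is_derive_hker_time k X t Q : 0 < k -> H X ->
  is_derive t (1 : R) (fun t => hker k X t Q) (hkert k X t Q).
Proof.
move=> k0 X0.
have q0 : 0 < sqnorm (hdisp X Q) by apply: lt_le_trans (sqnorm_hdisp_ge X Q); rewrite exprn_gt0.
have h0 : is_derive t (1 : R) (fun t : R => Q 0 ord0 - t) (- 1).
  have h1 : is_derive t (1 : R) (fun=> Q 0 ord0 : R) 0 by exact: is_derive_cst.
  have h2 : is_derive t (1 : R) (fun q : R => q) 1 by exact: is_derive_id.
  by have := is_derive_sub h1 h2; rewrite sub0r.
have := is_derive_comp1 h0 (is_derive_hk_tau _ k0 q0).
rewrite (_ : _ * _ = hkert k X t Q) // /hkert /hker; by field.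
Qed.

(** Without its factor [X_0^(2s)] the Poisson kernel is a heat kernel radial in the effective
    dimension [n + 2 + 2s = 2 m]: [n] tangential variables and a normal variable that counts as
    [2 + 2s] dimensions. This explains the coefficient [1 + 2s]. *)
Lemma hker_pde X t Q : H X ->
  \sum_i hker2 m i X t Q + (1 + 2 * s) / X 0 ord0 * hker1 m ord0 X t Q + hkert m X t Q = 0.
Proof.
move=> X0; rewrite /hker2 big_split /= sumr_const card_ord -mulr_suml -mulr_sumr.
rewrite /hker1 hdisp0 /hkert -/(sqnorm (hdisp X Q)).
rewrite -mulr_natl -natr1 /m; field.
by rewrite gt_eqF.
Qed.

Let measurable_hdisp X i : measurable_fun setT (fun Q => hdisp X Q 0 i).
Proof.
case: (unliftP ord0 i) => [j|] ->.
  rewrite (_ : (fun Q => _) = fun Q : 'rV[R]_n.+1 => X 0 (lift ord0 j) - Q 0 (lift ord0 j)).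
    by apply: measurable_funB => //; exact: measurable_coord.
  by apply/funext => Q; rewrite !mxE liftK /= !mxE.
by rewrite (_ : (fun Q => _) = fun=> X 0 ord0) //; apply/funext => Q; rewrite hdisp0.
Qed.

Let measurable_sqnorm_hdisp X : measurable_fun setT (fun Q => sqnorm (hdisp X Q)).
Proof.
apply: (@measurable_sum _ _ R _ _ (index_enum 'I_n.+1) (fun i (Q : 'rV[R]_n.+1) => hdisp X Q 0 i ^+ 2)) => i.
by apply: measurable_funX; exact: measurable_hdisp.
Qed.

Let mtau t : measurable_fun setT (fun Q : 'rV[R]_n.+1 => Q 0 ord0 - t).
Proof. by apply: measurable_funB => //; exact: measurable_coord. Qed.

Lemma measurable_hker k X t : measurable_fun setT (hker k X t).
Proof. by apply: measurable_hk => //. Qed.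

Lemma measurable_hker1 k i X t : measurable_fun setT (hker1 k i X t).
Proof.
apply: measurable_funM; last exact: measurable_hker.
by apply: measurable_funN; apply: measurable_funM.
Qed.

Lemma measurable_hker2 k i X t : measurable_fun setT (hker2 k i X t).
Proof.
apply: measurable_funD; apply: measurable_funM => //; try exact: measurable_hker.
by apply: measurable_funM => //; apply: measurable_funX.
Qed.

Lemma measurable_hkert k X t : measurable_fun setT (hkert k X t).
Proof.
apply: measurable_funB; apply: measurable_funM => //; try exact: measurable_hker.
exact: measurable_funM.
Qed.

(** The kernel with its Gaussian exponent weakened by the factor [c]: [c = 1/16] dominates the space
    derivatives and [c = 1/8] the time derivative. *)
Definition hdom c X t Q : R := hk m (c * sqnorm (hdisp X Q)) (Q 0 ord0 - t).

Lemma integrable_hdom c X t : 0 < c -> H X ->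
  (mu n.+1).-integrable setT (EFin \o hdom c X t).
Proof.
move=> c0 X0; have q0 : 0 < X 0 ord0 ^+ 2 by rewrite exprn_gt0.
have := @integrable_affine_rV R n.+1 1 (- consrv t (behrv X)) _ (oner_neq0 _) (integrable_hk_rV n s0 c0 q0).
congr integrable; apply/funext => Q /=; rewrite /hdom sqnorm_hdisp scale1r.
congr (hk _ (_ * (_ + _)) _)%:E; last by rewrite !mxE unlift_none.
rewrite -[LHS]sqnormN; congr sqnorm; apply/rowP => i; rewrite !mxE liftK /= !mxE opprD opprK addrC //.
Qed.

(* Within a quarter of the distance to the boundary, the squared distance to
   the pole loses at most a factor 4. *)
Let near_pole X Q i h : H X -> `|h| <= X 0 ord0 / 4 ->
  [/\ sqnorm (hdisp X Q) / 4 <= sqnorm (hdisp (X + h *: 'e_i) Q),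
      (hdisp (X + h *: 'e_i) Q 0 i) ^+ 2 <= 4 * sqnorm (hdisp X Q) &
      `|hdisp (X + h *: 'e_i) Q 0 i| <= 2 / X 0 ord0 * sqnorm (hdisp X Q)].
Proof.
move=> X0 hX; set q := sqnorm (hdisp X Q); set w := hdisp X Q 0 i.
have x0 : 0 < X 0 ord0 by [].
have q1 : X 0 ord0 ^+ 2 <= q by exact: sqnorm_hdisp_ge.
have w1 : w ^+ 2 <= q by exact: sqr_coord_le.
have h1 : h ^+ 2 <= q / 16.
  rewrite -[h ^+ 2]real_normK ?num_real //.
  apply: (@le_trans _ _ ((X 0 ord0 / 4) ^+ 2)).
    by rewrite ler_pXn2r ?nnegrE // divr_ge0 // ltW.
  by rewrite expr_div_n; lra.
have wh : hdisp (X + h *: 'e_i) Q 0 i = w + h.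
  by rewrite /w /hdisp !mxE !eqxx mulr1 addrAC.
have qh : sqnorm (hdisp (X + h *: 'e_i) Q) = q + 2 * h * w + h ^+ 2.
  rewrite /q /sqnorm (bigD1 i) //= [in RHS](bigD1 i) //= wh -/w.
  rewrite (eq_bigr (fun j => hdisp X Q 0 j ^+ 2)) => [|j ji].
    by ring.
  by rewrite /hdisp !mxE eqxx /= (negbTE ji) mulr0 addr0.
have a1 : (2 * h + w) ^+ 2 >= 0 by exact: sqr_ge0.
have a2 : (w - h) ^+ 2 >= 0 by exact: sqr_ge0.
have b : (w + h) ^+ 2 <= 4 * q by nra.
split; rewrite ?wh ?qh //; first by nra.
have e : 0 <= 2 / X 0 ord0 * q by rewrite mulr_ge0 ?divr_ge0 ?(ltW x0) ?sqnorm_ge0.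
rewrite -(ler_pXn2r (n := 2)) ?nnegrE // real_normK ?num_real //.
apply: le_trans b _; rewrite exprMn expr_div_n.
rewrite (_ : 2 ^+ 2 / X 0 ord0 ^+ 2 * q ^+ 2 = 4 * q * (q / X 0 ord0 ^+ 2)); last by field; rewrite gt_eqF.
rewrite ler_peMr ?mulr_ge0 ?sqnorm_ge0 // ler_pdivlMr ?exprn_gt0 // mul1r //.
Qed.

Let hk16 X Q t : H X -> hk m (sqnorm (hdisp X Q) / 8) (Q 0 ord0 - t) <= hdom (16^-1) X t Q.
Proof. by move=> X0; apply: le_hk; have := sqnorm_ge0 (hdisp X Q); lra. Qed.

(** The squared distance [q] to the pole is at least [X_0^2], so the displacement is bounded by a
    multiple of [q]; then [hkS_le] converts [q] times the profile of exponent [m + 1] into one of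
    exponent [m]. *)
Lemma hker1_le X : H X -> exists2 C, 0 <= C & forall i h t Q, `|h| <= X 0 ord0 / 4 ->
  `|hker1 m i (X + h *: 'e_i) t Q| <= C * hdom (16^-1) X t Q.
Proof.
move=> X0; have x0 : 0 < X 0 ord0 by [].
have C0 : 0 <= 32 / X 0 ord0 by rewrite divr_ge0 // ltW.
exists (32 / X 0 ord0) => // i h t Q hX.
have [q1 q2 q3] := near_pole Q i X0 hX.
set q := sqnorm (hdisp X Q) in q1 q2 q3.
have q0 : 0 <= q by exact: sqnorm_ge0.
apply: le_trans (ler_wpM2l C0 (hk16 Q t X0)).
rewrite /hker1 normrM normrN normrM ger0_norm // [`|hker _ _ _ _|]ger0_norm ?hk_ge0 //.
have k1 : hker (m + 1) (X + h *: 'e_i) t Q <= hk (m + 1) (q / 4) (Q 0 ord0 - t) by exact: le_hk.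
apply: le_trans (ler_pM _ _ (ler_wpM2l _ q3) k1) _; rewrite ?mulr_ge0 ?hk_ge0 //.
have q40 : 0 <= q / 4 by rewrite divr_ge0.
have := @hkS_le R m (q / 4) (Q 0 ord0 - t) q40.
rewrite (_ : q / 4 / 2 = q / 8); last by field.
move=> /(ler_wpM2l C0) h1.
set A := hk (m + 1) _ _ in h1 *; set B := hk m _ _ in h1 *.
have x4 : 0 <= 4 / X 0 ord0 by rewrite divr_ge0 // ltW.
rewrite (_ : 2^-1 * (2 / X 0 ord0 * q) * A = 8^-1 * (32 / X 0 ord0 * (q / 4 * A))); last first.
  by field; rewrite gt_eqF.
by lra.
Qed.

Lemma hker2_le X : H X -> exists2 C, 0 <= C & forall i h t Q, `|h| <= X 0 ord0 / 4 ->
  `|hker2 m i (X + h *: 'e_i) t Q| <= C * hdom (16^-1) X t Q.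
Proof.
move=> X0; have x0 : 0 < X 0 ord0 by [].
have C0 : 0 <= 16 / X 0 ord0 ^+ 2 by rewrite divr_ge0 // sqr_ge0.
(* [129 = 1 + 128] collects the two terms of [hker2], each measured in units of [16 / X_0^2] times
   [hdom]. *)
exists (129 * (16 / X 0 ord0 ^+ 2)) => [|i h t Q hX]; first by rewrite mulr_ge0.
have [q1 q2 _] := near_pole Q i X0 hX.
have qX : X 0 ord0 ^+ 2 <= sqnorm (hdisp X Q) by exact: sqnorm_hdisp_ge.
have h8 := hk16 Q t X0.
set q := sqnorm (hdisp X Q) in q1 q2 qX h8.
have q0 : 0 <= q by exact: sqnorm_ge0.
have q40 : 0 <= q / 4 by rewrite divr_ge0.
have qX1 : 1 <= q / X 0 ord0 ^+ 2 by rewrite ler_pdivlMr ?exprn_gt0 // mul1r.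
have k1 : hker (m + 1) (X + h *: 'e_i) t Q <= hk (m + 1) (q / 4) (Q 0 ord0 - t) by exact: le_hk.
have k2 : hker (m + 2) (X + h *: 'e_i) t Q <= hk (m + 2) (q / 4) (Q 0 ord0 - t) by exact: le_hk.
have e1 := @hkS_le R m (q / 4) (Q 0 ord0 - t) q40.
have e2 := @hkSS_le R m (q / 4) (Q 0 ord0 - t) q40.
have q16 : hk m (q / 4 / 4) (Q 0 ord0 - t) = hdom (16^-1) X t Q.
  by rewrite /hdom -/q; congr hk; field.
rewrite (_ : q / 4 / 2 = q / 8) in e1; last by field.
rewrite q16 in e2.
rewrite /hker2.
set A := hker (m + 1) _ _ _ in k1 *; set B := hker (m + 2) _ _ _ in k2 *.
have A0 : 0 <= A by exact: hk_ge0.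
have B0 : 0 <= B by exact: hk_ge0.
set A' := hk (m + 1) _ _ in k1 e1; set B' := hk (m + 2) _ _ in k2 e2.
set G := hdom _ _ _ _ in h8 e2 *; set w := (hdisp _ _ _ _) ^+ 2 in q2 *.
have w0 : 0 <= w by exact: sqr_ge0.
have le1 : A <= 4 / X 0 ord0 ^+ 2 * (q / 4 * A').
  rewrite (_ : 4 / X 0 ord0 ^+ 2 * (q / 4 * A') = q / X 0 ord0 ^+ 2 * A'); last by field; rewrite gt_eqF.
  by apply: le_trans k1 _; rewrite ler_peMl // hk_ge0.
have le2 : w * B <= 64 / X 0 ord0 ^+ 2 * ((q / 4) ^+ 2 * B').
  rewrite (_ : 64 / X 0 ord0 ^+ 2 * ((q / 4) ^+ 2 * B') = q / X 0 ord0 ^+ 2 * (4 * q * B')); last by field; rewrite gt_eqF.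
  apply: (@le_trans _ _ (4 * q * B')); first by apply: ler_pM.
  by rewrite ler_peMl // mulr_ge0 ?hk_ge0 // mulr_ge0.
have C40 : 0 <= 4 / X 0 ord0 ^+ 2 by rewrite divr_ge0 // sqr_ge0.
have C640 : 0 <= 64 / X 0 ord0 ^+ 2 by rewrite divr_ge0 // sqr_ge0.
have le3 := le_trans le1 (ler_wpM2l C40 (le_trans e1 (ler_wpM2l _ h8))).
have {}le3 : A <= 4 / X 0 ord0 ^+ 2 * (8 * G) by exact: le3.
have le4 : w * B <= 64 / X 0 ord0 ^+ 2 * (128 * G) := le_trans le2 (ler_wpM2l C640 e2).
apply: le_trans (ler_normD _ _) _; rewrite normrM normrN [`|2^-1|]ger0_norm // (ger0_norm A0).
have wB : 0 <= 4^-1 * w * B by rewrite mulr_ge0 // mulr_ge0.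
rewrite (ger0_norm wB) -mulrA.
set y := X 0 ord0 ^+ 2 in le3 le4 *.
rewrite (_ : 4 / y * (8 * G) = 2 * (16 / y * G)) in le3; last by ring.
rewrite (_ : 64 / y * (128 * G) = 512 * (16 / y * G)) in le4; last by ring.
by rewrite -(mulrA 129); lra.
Qed.

(** [hk_time_le] with [dl = 1]: the kernels at all times within 1 of [t] lie below the one at
    [t - 1], where the elapsed time is longest. Its lower bound on [q] is provided by the height of
    [X]. *)
Lemma hkert_le X : H X -> exists2 C, 0 <= C & forall h t Q, `|h| <= 1 ->
  `|hkert m X (t + h) Q| <= C * hdom (8^-1) X (t - 1) Q.
Proof.
move=> X0; have x0 : 0 < X 0 ord0 by [].
have y0 : 0 < X 0 ord0 ^+ 2 by rewrite exprn_gt0.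
have y40 : 0 < X 0 ord0 ^+ 2 / 4 by rewrite divr_gt0.
have [C C0 HC] := @hk_time_le R m _ 1 m0 y40 ltr01.
exists ((8 * m + 32) / X 0 ord0 ^+ 2 * C) => [|h t Q hd].
  by rewrite mulr_ge0 // divr_ge0 ?(ltW y0) // addr_ge0 // mulr_ge0 // ltW.
have qX : X 0 ord0 ^+ 2 <= sqnorm (hdisp X Q) by exact: sqnorm_hdisp_ge.
set q := sqnorm (hdisp X Q) in qX.
have q0 : 0 <= q by exact: sqnorm_ge0.
have hN : `|- h| <= 1 by rewrite normrN.
have q4 : X 0 ord0 ^+ 2 / 4 <= q / 4 by lra.
have {HC} := HC (q / 4) (- h) (Q 0 ord0 - t) q4 hN.
have -> : Q 0 ord0 - t - h = Q 0 ord0 - (t + h) by ring.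
have -> : hk m (q / 4 / 2) (Q 0 ord0 - t + 1) = hdom (8^-1) X (t - 1) Q.
  by rewrite /hdom -/q; congr hk; [field|ring].
have e1 := @hkS_le R m q (Q 0 ord0 - (t + h)) q0.
have e2 := @hkSS_le R m q (Q 0 ord0 - (t + h)) q0.
have e3 : hk m (q / 2) (Q 0 ord0 - (t + h)) <= hk m (q / 4) (Q 0 ord0 - (t + h)) by apply: le_hk; lra.
rewrite /hkert /hker -/q.
set A := hk (m + 1) _ _ in e1 *; set B := hk (m + 2) _ _ in e2 *.
set D := hk m (q / 2) _ in e1 e3; set E := hk m (q / 4) _ in e2 e3 *.
have A0 : 0 <= A by exact: hk_ge0.
have B0 : 0 <= B by exact: hk_ge0.
move=> le; set G := hdom _ _ _ _ in le *; set y := X 0 ord0 ^+ 2 in qX y0 y40 q4 *.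
apply: le_trans (ler_normB _ _) _; rewrite !ger0_norm ?mulr_ge0 ?(ltW m0) //.
have yq : 1 <= q / y by rewrite ler_pdivlMr // mul1r.
have iy : 0 <= y^-1 by rewrite invr_ge0 ltW.
have a1 : m * A <= m / y * (8 * E).
  apply: (@le_trans _ _ (m / y * (q * A))).
    by rewrite (_ : m / y * (q * A) = q / y * (m * A)); [rewrite ler_peMl // mulr_ge0 // ltW|ring].
  by rewrite ler_wpM2l ?mulr_ge0 ?(ltW m0) //; lra.
have a2 : 4^-1 * q * B <= y^-1 * (32 * E).
  apply: (@le_trans _ _ (4^-1 / y * (q ^+ 2 * B))).
    by rewrite (_ : 4^-1 / y * (q ^+ 2 * B) = q / y * (4^-1 * q * B)); [rewrite ler_peMl // !mulr_ge0|ring].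
  rewrite (_ : y^-1 * (32 * E) = 4^-1 / y * (128 * E)); last by field; rewrite gt_eqF.
  by rewrite ler_wpM2l // mulr_ge0.
apply: le_trans (lerD a1 a2) _.
rewrite (_ : m / y * (8 * E) + y^-1 * (32 * E) = (8 * m + 32) / y * E); last by ring.
by rewrite -[leRHS]mulrA ler_wpM2l // divr_ge0 ?(ltW y0) // addr_ge0 // mulr_ge0 // ltW.
Qed.

Definition hpot (F : 'rV[R]_n.+1 -> R) : R := \int[mu n.+1]_Q (F Q * g Q).

Let M0 : 0 <= M. Proof. exact: le_trans (normr_ge0 _) (gM 0). Qed.

Let ihpot (F G : 'rV[R]_n.+1 -> R) C : measurable_fun setT F ->
  (mu n.+1).-integrable setT (EFin \o G) -> (forall Q, `|F Q| <= C * G Q) ->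
  (mu n.+1).-integrable setT (EFin \o (fun Q => F Q * g Q)).
Proof.
move=> mF iG FG; apply: (@le_integrableR _ _ _ (mu n.+1) _ measurableT _ (fun Q => M * C * G Q)).
- exact: measurable_funM.
- move=> Q _; rewrite normrM mulrC -mulrA; apply: ler_pM => //; exact: gM.
- exact: integrableZR.
Qed.

Let is_derive_pot (f f' : R -> 'rV[R]_n.+1 -> R) (G : 'rV[R]_n.+1 -> R) (C' dl : R) : 0 < dl ->
  (forall h, measurable_fun setT (f h)) ->
  (forall h, `|h| < dl -> exists2 G' : 'rV[R]_n.+1 -> R, (mu n.+1).-integrable setT (EFin \o G') &
    forall Q, `|f h Q| <= G' Q) ->
  (forall h Q, `|h| < dl -> is_derive h (1 : R) (f^~ Q) (f' h Q)) ->
  (mu n.+1).-integrable setT (EFin \o G) ->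
  (forall h Q, `|h| < dl -> `|f' h Q| <= C' * G Q) ->
  is_derive (0 : R) (1 : R) (fun h => hpot (f h)) (hpot (f' 0)).
Proof.
move=> dl0 mf fG df iG fG'.
apply: (@is_derive_under_integral _ _ _ (mu n.+1) setT measurableT (fun h Q => f h Q * g Q)
  (fun h Q => f' h Q * g Q) (fun Q => M * C' * G Q) 0 dl dl0).
- move=> h; rewrite subr0 => /fG[G' iG' le].
  by apply: (ihpot (C := 1) (mf h) iG') => Q; rewrite mul1r.
- move=> h Q; rewrite subr0 => hd _.
  have := is_derive_scalel (g Q) (df h Q hd).
  rewrite [g Q * f' h Q]mulrC (_ : (fun x => _) = fun h => f h Q * g Q) //.
  by apply/funext => x; rewrite mulrC.
- exact: integrableZR.
- move=> h Q; rewrite subr0 => hd _; rewrite normrM mulrC -mulrA; apply: ler_pM => //; exact: fG'.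
Qed.

Let quarter X : H X -> 0 < X 0 ord0 / 4. Proof. by move=> X0; rewrite divr_gt0. Qed.

Let i16 : 0 < 16^-1 :> R. Proof. by []. Qed.

Let i8 : 0 < 8^-1 :> R. Proof. by []. Qed.

Lemma is_derive_hpot1 i X t : H X ->
  is_derive X 'e_i (fun X => hpot (hker m X t)) (hpot (hker1 m i X t)).
Proof.
move=> X0; have [C C0 HC] := hker1_le X0.
rewrite -[X](addr0 X) -[0](scale0r ('e_i)); apply/is_derive_line.
apply: (is_derive_pot (f := fun h => hker m (X + h *: 'e_i) t)
  (f' := fun h => hker1 m i (X + h *: 'e_i) t) (C' := C) (quarter X0) _ _ _ (integrable_hdom t i16 X0)).
- by move=> h; exact: measurable_hker.
- move=> h /ltW hd; exists (hdom 16^-1 X t) => [|Q]; first exact: integrable_hdom.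
  rewrite ger0_norm ?hk_ge0 //; apply: le_hk.
  have [h1 _ _] := near_pole Q i X0 hd; apply: le_trans h1.
  by have := sqnorm_ge0 (hdisp X Q); lra.
- move=> h Q _.
  exact: ((is_derive_line (fun X => hker m X t Q) X 'e_i h _).1 (is_derive_hker m i _ t Q)).
- by move=> h Q /ltW hd; exact: HC.
Qed.

Lemma is_derive_hpot2 i X t : H X ->
  is_derive X 'e_i (fun X => hpot (hker1 m i X t)) (hpot (hker2 m i X t)).
Proof.
move=> X0; have [C C0 HC] := hker1_le X0; have [C' C'0 HC'] := hker2_le X0.
rewrite -[X](addr0 X) -[0](scale0r ('e_i)); apply/is_derive_line.
apply: (is_derive_pot (f := fun h => hker1 m i (X + h *: 'e_i) t)
  (f' := fun h => hker2 m i (X + h *: 'e_i) t) (C' := C') (quarter X0) _ _ _ (integrable_hdom t i16 X0)).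
- by move=> h; exact: measurable_hker1.
- move=> h /ltW hd; exists (fun Q => C * hdom 16^-1 X t Q) => [|Q]; last exact: HC.
  by apply: integrableZR => //; exact: integrable_hdom.
- move=> h Q _.
  exact: ((is_derive_line (fun X => hker1 m i X t Q) X 'e_i h _).1 (is_derive_hker1 m i _ t Q)).
- by move=> h Q /ltW hd; exact: HC'.
Qed.

Lemma is_derive_hpot_time X t : H X ->
  is_derive t (1 : R) (fun t => hpot (hker m X t)) (hpot (hkert m X t)).
Proof.
move=> X0; have [C C0 HC] := hkert_le X0.
have E (h : R) : hpot (hker m X (h *: 1 + t)) = hpot (hker m X (t + (h *: 1 + 0))).
  by rewrite addr0 addrC.
apply/(is_derive_quotient (f := fun t => hpot (hker m X t)) (g := fun h => hpot (hker m X (t + h))) _ E).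
rewrite -[t in hkert _ _ t]addr0.
apply: (is_derive_pot (f := fun h => hker m X (t + h)) (f' := fun h => hkert m X (t + h))
  (C' := C) ltr01 _ _ _ (integrable_hdom (t - 1) i8 X0)).
- by move=> h; exact: measurable_hker.
- move=> h _; exists (hdom 1 X (t + h)) => [|Q]; first exact: integrable_hdom.
  by rewrite /hdom mul1r ger0_norm ?hk_ge0.
- move=> h Q _.
  have E' (r : R) : hker m X (t + (r *: 1 + h)) Q = hker m X (r *: 1 + (t + h)) Q.
    by rewrite addrCA.
  apply/(is_derive_quotient (f := fun h => hker m X (t + h) Q) (g := fun t => hker m X t Q) _ E').
  exact: is_derive_hker_time.
- by move=> h Q /ltW hd; exact: HC.
Qed.

Lemma integrable_hpot X t : H X ->
  [/\ (mu n.+1).-integrable setT (EFin \o (fun Q => hker m X t Q * g Q)),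
      forall i, (mu n.+1).-integrable setT (EFin \o (fun Q => hker1 m i X t Q * g Q)),
      forall i, (mu n.+1).-integrable setT (EFin \o (fun Q => hker2 m i X t Q * g Q)) &
      (mu n.+1).-integrable setT (EFin \o (fun Q => hkert m X t Q * g Q))].
Proof.
move=> X0; have [C C0 HC] := hker1_le X0; have [C' C'0 HC'] := hker2_le X0.
have [C2 C20 HC2] := hkert_le X0.
have z0 : `|0 : R| <= X 0 ord0 / 4 by rewrite normr0 ltW // quarter.
split.
- apply: (@ihpot _ _ 1 (measurable_hker m X t) (integrable_hdom t ltr01 X0)) => Q.
  by rewrite mul1r /hdom mul1r ger0_norm ?hk_ge0.
- move=> i; apply: (@ihpot _ _ C (measurable_hker1 m i X t) (integrable_hdom t i16 X0)) => Q.
  by have := HC i 0 t Q z0; rewrite scale0r addr0.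
- move=> i; apply: (@ihpot _ _ C' (measurable_hker2 m i X t) (integrable_hdom t i16 X0)) => Q.
  by have := HC' i 0 t Q z0; rewrite scale0r addr0.
- apply: (@ihpot _ _ C2 (measurable_hkert m X t) (integrable_hdom (t - 1) i8 X0)) => Q.
  by have := HC2 0 t Q; rewrite addr0; apply; rewrite normr0.
Qed.

Lemma hpot_pde X t : H X ->
  \sum_i hpot (hker2 m i X t) + (1 + 2 * s) / X 0 ord0 * hpot (hker1 m ord0 X t) +
  hpot (hkert m X t) = 0.
Proof.
move=> X0; have [_ i1 i2 i3] := integrable_hpot t X0.
rewrite -(Rintegral_sumR measurableT i2).
rewrite -(RintegralZl _ measurableT (i1 ord0)).
rewrite -(RintegralD measurableT (integrable_sumR measurableT i2) (integrableZR measurableT _ (i1 ord0))).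
rewrite -(RintegralD measurableT (integrableDR measurableT (integrable_sumR measurableT i2) (integrableZR measurableT _ (i1 ord0))) i3).
transitivity (\int[mu n.+1]_(Q in setT) cst (0 : R) Q); last by rewrite Rintegral_cst // mul0r.
apply: eq_Rintegral => Q _.
by rewrite -mulr_suml mulrA -!mulrDl hker_pde ?mul0r.
Qed.

End heat_potential.

(** * The extension and its boundary increment *)

Section iterated_integrals.
Context {R : realType}.
Local Notation mu := (@lebesgue_rV R).
Local Notation leb := (@lebesgue_measure R).

Lemma integral_shift1 (b : R) (f : measurableTypeR R -> \bar R) : measurable_fun setT f ->
  (\int[leb]_x f x = \int[leb]_x f (x + b)%R)%E.
Proof.
have sh (g : measurableTypeR R -> \bar R) : measurable_fun setT g -> (forall x, 0 <= g x)%E ->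
    (\int[leb]_x g x = \int[leb]_x g (x + b)%R)%E.
  move=> mg g0; rewrite (ge0_integral_affine1 b (oner_neq0 _) mg g0) normr1 mul1e.
  by apply: eq_integral => x _; rewrite mul1r.
move=> mf; rewrite [LHS]integralE [RHS]integralE.
have e1 := sh _ (measurable_funepos mf) (fun x => funepos_ge0 f x).
have e2 := sh _ (measurable_funeneg mf) (fun x => funeneg_ge0 f x).
by rewrite e1 e2; congr (_ - _)%E; apply: eq_integral => x _; rewrite ?funeposE ?funenegE.
Qed.

Lemma integrable_shift1 (b : R) (f : R -> R) :
  leb.-integrable setT (EFin \o f) -> leb.-integrable setT (EFin \o (fun x => f (x + b))).
Proof.
move=> /integrableP[mf fi]; apply/integrableP; split.
  apply: (measurableT_comp mf); exact: measurable_funD.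
rewrite -(@integral_shift1 b (fun x => `|(EFin \o f) x|)%E) //.
exact: measurableT_comp.
Qed.

Lemma Rintegral_shift1 (b : R) (f : R -> R) : measurable_fun setT f ->
  \int[leb]_x f x = \int[leb]_x f (x + b).
Proof.
by move=> mf; rewrite /Rintegral (integral_shift1 b) //; exact/measurable_EFinP.
Qed.

Lemma Rintegral_affine_rV n (c : R) (b : 'rV[R]_n) (f : 'rV[R]_n -> R) : c != 0 ->
  measurable_fun setT f ->
  \int[mu n]_x f x = `|c| ^+ n * \int[mu n]_x f (c *: x + b).
Proof.
move=> c0 mf; rewrite /Rintegral (integral_affine_rV b c0); last exact/measurable_EFinP.
case: (\int[mu n]_x _)%E => [r| |] //=; rewrite ?mulr0 //.
- by rewrite gt0_muley // lte_fin exprn_gt0 // normr_gt0.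
- by rewrite gt0_muleNy // lte_fin exprn_gt0 // normr_gt0.
Qed.

Section slices.
Variables (n : nat) (F : 'rV[R]_n.+1 -> R).
Hypothesis iF : (mu n.+1).-integrable setT (EFin \o F).
Hypothesis sF : forall x, (mu n).-integrable setT (EFin \o (fun y => F (consrv x y))).

Let sliceE x : (\int[mu n]_y (F (consrv x y))%:E = (\int[mu n]_y F (consrv x y))%:E)%E.
Proof. by rewrite (EFin_Rintegral measurableT (sF x)). Qed.

Lemma Rintegral_iterated :
  \int[mu n.+1]_Q F Q = \int[leb]_x \int[mu n]_y F (consrv x y).
Proof.
rewrite /Rintegral (fubini_rV iF); congr fine; apply: eq_integral => x _.
by rewrite sliceE.
Qed.

Lemma integrable_slice : leb.-integrable setT (EFin \o (fun x : R => \int[mu n]_y F (consrv x y))).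
Proof.
have := integrable_fubini_F (integrable_consrv iF); congr integrable; apply/funext => x.
by rewrite /fubini_F /= -sliceE.
Qed.

End slices.

Lemma Rintegral_ray (b : R) (f : R -> R) : (forall x, x <= b -> f x = 0) ->
  \int[leb]_(x in `]b, +oo[) f x = \int[leb]_x f x.
Proof.
move=> f0; rewrite /Rintegral; congr fine; rewrite integral_mkcond.
apply: eq_integral => x _; rewrite patchE; case: ifPn => //.
rewrite notin_setE /= in_itv /= andbT => /negP; rewrite -leNgt => x0.
by rewrite f0.
Qed.

End iterated_integrals.

(** * The extension as a space-time potential *)

Section poisson_extension.
Context {R : realType}.
Local Notation mu := (@lebesgue_rV R).
Local Notation leb := (@lebesgue_measure R).
Variables (d : nat) (s M TF : R) (u : 'rV[R]_d -> R -> R).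
Hypothesis s0 : 0 < s.
Hypothesis um : measurable_fun (setT `*` [set` `]- TF, +oo[])
  (fun P : 'rV[R]_d * measurableTypeR R => u P.1 P.2).
Hypothesis uM : forall x t, - TF < t -> `|u x t| <= M.
Let m : R := d%:R / 2 + 1 + s.
Local Notation H := (@halfspace R d).
Implicit Types (X Q : 'rV[R]_d.+1) (t tau : R).

(* Nothing is assumed about u up to time - TF, where it is replaced by 0. *)
Definition past Q : R := if - TF < Q 0 ord0 then u (behrv Q) (Q 0 ord0) else 0.

Lemma measurable_past : measurable_fun setT past.
Proof.
pose Om : set ('rV[R]_d * measurableTypeR R) := setT `*` [set` `]- TF, +oo[].
have mOm : measurable Om by apply: measurableX => //; exact: measurable_itv.
have := (measurable_restrictT (fun P : 'rV[R]_d * measurableTypeR R => u P.1 P.2) mOm).1 um.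
have mb : measurable_fun setT (fun Q : 'rV[R]_d.+1 => (behrv Q, Q 0 ord0 : measurableTypeR R)).
  by apply: measurable_fun_pair; [exact: measurable_behrv2|exact: measurable_coord].
move=> mr; have := measurableT_comp mr mb.
rewrite (_ : _ \o _ = past) //; apply/funext => Q /=; rewrite /past patchE.
have -> : ((behrv Q, Q 0 ord0) \in Om) = (- TF < Q 0 ord0).
  by apply/idP/idP; rewrite inE /Om /= in_itv /= andbT; [case|].
by [].
Qed.

Let M0 : 0 <= M.
Proof. by apply: le_trans (normr_ge0 (u 0 (- TF + 1))) _; apply: uM; rewrite ltrDl. Qed.

Lemma past_le Q : `|past Q| <= M.
Proof. by rewrite /past; case: ifPn => [/uM//|_]; rewrite normr0. Qed.

Definition poisson_cst : R := (4 `^ (d%:R / 2 + s) * pi `^ (d%:R / 2) * Gamma s)^-1.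

Let integrable_hk_mul (g : 'rV[R]_d -> R) C q0 tau : measurable_fun setT g ->
  (forall z, `|g z| <= C) ->
  (mu d).-integrable setT (EFin \o (fun z => hk m (q0 + sqnorm z) tau * g z)).
Proof.
move=> mg gC.
have mh : measurable_fun setT (fun z : 'rV[R]_d => hk m (q0 + sqnorm z) tau).
  by apply: measurable_hk => //; apply: measurable_funD => //; exact: measurable_sqnorm.
apply: (@le_integrableR _ _ _ (mu d) _ measurableT _ (fun z => C * hk m (q0 + sqnorm z) tau)).
- exact: measurable_funM.
- by move=> z _; rewrite normrM ger0_norm ?hk_ge0 // mulrC ler_wpM2r ?hk_ge0.
- apply: integrableZR => //; apply/integrableP; split; first exact/measurable_EFinP.
  under eq_integral => x _ do rewrite /= ger0_norm ?hk_ge0 // -(mul1r (q0 + _)).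
  by rewrite integral_hk_space // ltry.
Qed.

Lemma integrable_hker_slice (g : 'rV[R]_d -> R) C X t sigma : measurable_fun setT g ->
  (forall z, `|g z| <= C) ->
  (mu d).-integrable setT (EFin \o (fun z => hker m X t (consrv sigma z) * g z)).
Proof.
move=> mg gC; have n10 : -1 != 0 :> R by rewrite oppr_eq0 oner_eq0.
have mg' : measurable_fun setT (fun z : 'rV[R]_d => g (-1 *: z + behrv X)).
  by apply: (measurableT_comp mg); exact: measurable_affine_rV.
have i1 := @integrable_hk_mul _ C (X 0 ord0 ^+ 2) (sigma - t) mg' (fun z => gC _).
have := integrable_affine_rV (behrv X) n10 i1; congr integrable.
apply/funext => z /=; rewrite /hker sqnorm_hdisp consrv0 behrv_consrv !scaleN1r.
by rewrite opprD opprK subrK [- z + _]addrC.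
Qed.

(** A translation in time and a reflection in space turn the two convolution integrals into one
    integral over sources [Q]. The kernel vanishes for sources up to time [t], so only values of [u]
    after [- TF] contribute. *)
Lemma extensionE X t : H X -> - TF < t ->
  extension s u X t = poisson_cst * X 0 ord0 `^ (2 * s) * hpot past (hker m X t).
Proof.
move=> X0 tT; have x0 : 0 < X 0 ord0 by [].
rewrite /extension x0.
have [iF _ _ _] := integrable_hpot s0 measurable_past past_le t X0.
have mpast sigma : measurable_fun setT (fun z => past (consrv sigma z)).
  by apply: (measurableT_comp measurable_past); exact: measurable_consrv2.
have sF sigma : (mu d).-integrable setT
    (EFin \o (fun z => hker m X t (consrv sigma z) * past (consrv sigma z))).
  by apply: (@integrable_hker_slice _ M) => // z; exact: past_le.
pose I sigma := \int[mu d]_z (hker m X t (consrv sigma z) * past (consrv sigma z)).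
have inner tau : 0 < tau ->
    \int[mu d]_(z in setT) (poisson_kernel s (X 0 ord0) z tau * u (behrv X - z) (t + tau)) =
    poisson_cst * X 0 ord0 `^ (2 * s) * I (t + tau).
  move=> tau0; rewrite -RintegralZl //.
  have n10 : -1 != 0 :> R by rewrite oppr_eq0 oner_eq0.
  rewrite [RHS](Rintegral_affine_rV (behrv X) n10); last first.
    apply: measurable_funM => //; apply: measurable_funM => //.
    by apply: (measurableT_comp (measurable_hker m X t)); exact: measurable_consrv2.
  rewrite normrN normr1 expr1n mul1r; apply: eq_Rintegral => z _.
  rewrite /past consrv0 behrv_consrv (lt_trans tT) ?ltrDl // scaleN1r.
  rewrite /hker sqnorm_hdisp consrv0 behrv_consrv [- z + _]addrC mulrA; congr (_ * _).
  rewrite [t + tau - t]addrAC subrr add0r hkE // /poisson_kernel -/poisson_cst.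
  rewrite opprB [behrv X + _]addrC subrK.
  by rewrite -!mulrA; congr (_ * (_ * _)); rewrite mulrC.
transitivity (\int[leb]_(tau in `]0, +oo[) (poisson_cst * X 0 ord0 `^ (2 * s) * I (t + tau))).
  by apply: eq_Rintegral => tau; rewrite inE /= in_itv /= andbT => /inner.
have I0 tau : tau <= 0 -> I (t + tau) = 0.
  move=> tau0; rewrite /I (_ : (fun z => _) = cst 0); first by rewrite Rintegral_cst // mul0r.
  apply/funext => z; rewrite /hker consrv0 hk_le0 ?mul0r //.
  by rewrite [t + tau]addrC addrK.
rewrite (@Rintegral_ray _ 0 (fun tau => poisson_cst * X 0 ord0 `^ (2 * s) * I (t + tau))); last first.
  by move=> tau /I0 ->; rewrite mulr0.
have iI := integrable_slice iF sF.
have mI : measurable_fun setT I by exact: measurable_integrable iI.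
transitivity (\int[leb]_tau (poisson_cst * X 0 ord0 `^ (2 * s) * I tau)).
  rewrite [RHS](Rintegral_shift1 t); last exact: measurable_funM.
  by apply: eq_Rintegral => tau _; rewrite addrC.
by rewrite /hpot (Rintegral_iterated iF sF) -(RintegralZl _ measurableT iI).
Qed.

(** The mass of the Poisson kernel is computed so that [u x t] can be brought under the integral in
    [extension_increment]. *)
Lemma poisson_cstE X t : H X ->
  poisson_cst * X 0 ord0 `^ (2 * s) * \int[mu d.+1]_Q hker m X t Q = 1.
Proof.
move=> X0; have x0 : 0 < X 0 ord0 by [].
have q0 : 0 < X 0 ord0 ^+ 2 by rewrite exprn_gt0.
have mh : measurable_fun setT (fun Q : 'rV[R]_d.+1 => hk m (1 * (X 0 ord0 ^+ 2 + sqnorm (behrv Q))) (Q 0 ord0)).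
  exact: measurable_hk_rV.
have -> : \int[mu d.+1]_Q hker m X t Q =
    \int[mu d.+1]_Q hk m (1 * (X 0 ord0 ^+ 2 + sqnorm (behrv Q))) (Q 0 ord0).
  rewrite [RHS](Rintegral_affine_rV (- consrv t (behrv X)) (oner_neq0 _) mh).
  rewrite normr1 expr1n mul1r; apply: eq_Rintegral => Q _.
  rewrite /hker sqnorm_hdisp scale1r mul1r; congr (hk _ (_ + _) _); last first.
    by rewrite !mxE unlift_none.
  rewrite -[LHS]sqnormN; congr sqnorm; apply/rowP => i.
  by rewrite !mxE liftK /= !mxE opprD opprK addrC.
rewrite /Rintegral integral_hk_rV //= divr1 -GammaE // /poisson_cst.
have -> : X 0 ord0 `^ (2 * s) = (X 0 ord0 ^+ 2) `^ s.
  by rewrite powRrM powR_mulrn // ltW.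
have p4 : 0 < 4 :> R by [].
rewrite [_ `^ (d%:R / 2 + s)]powRD; last by apply/implyP.
have -> : (4 / (1 * X 0 ord0 ^+ 2)) `^ s = 4 `^ s * ((X 0 ord0 ^+ 2) `^ s)^-1.
  by rewrite mul1r powRM ?invr_ge0 ?sqr_ge0 // powRV.
have -> : (4 * pi) `^ (d%:R / 2) = 4 `^ (d%:R / 2) * pi `^ (d%:R / 2) :> R.
  by rewrite powRM ?(ltW (pi_gt0 R)).
have g0 := Gamma_gt0 s0.
have pp : 0 < pi `^ (d%:R / 2) :> R by rewrite powR_gt0 ?pi_gt0.
have p1 : 0 < 4 `^ (d%:R / 2) :> R by rewrite powR_gt0.
have p2 : 0 < 4 `^ s :> R by rewrite powR_gt0.
have p3 : 0 < (X 0 ord0 ^+ 2) `^ s :> R by rewrite powR_gt0.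
move: g0 pp p1 p2 p3; move: (Gamma s) (pi `^ _) (4 `^ (_ / _)) (4 `^ s) (_ `^ s) => G P A B Y.
by move=> G0 P0 A0 B0 Y0; field; rewrite !gt_eqF.
Qed.

(** The increment of [u] weighted in space by an unnormalised heat kernel at elapsed time [tau]. Its
    integral over [tau] is, up to constants, both the limit of the boundary quotient of the
    extension and [- backward_heat]. *)
Definition pinc (x : 'rV[R]_d) t tau : R :=
  \int[mu d]_z (hk m (sqnorm z) tau * (u (x + z) (t + tau) - u x t)).

(** The height above the boundary enters only through [e^(- q0 / (4 tau))], where [q0] is its
    square. This factor tends to 1 at the boundary. *)
Let pincE x t q0 tau : - TF < t -> 0 < tau ->
  \int[mu d]_z (hk m (q0 + sqnorm z) tau * (past (consrv (t + tau) (x + z)) - u x t)) =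
  expR (- q0 / (4 * tau)) * pinc x t tau.
Proof.
move=> tT tau0.
have mp : measurable_fun setT (fun z => past (consrv (t + tau) (x + z)) - u x t).
  apply: measurable_funB => //; apply: (measurableT_comp measurable_past).
  apply: (measurableT_comp (measurable_consrv2 (t + tau))).
  have := measurable_affine_rV 1 x; congr measurable_fun.
  by apply/funext => z; rewrite scale1r addrC.
have pl z : `|past (consrv (t + tau) (x + z)) - u x t| <= M + M.
  by apply: le_trans (ler_normB _ _) _; apply: lerD; [exact: past_le|exact: uM].
have -> : pinc x t tau = \int[mu d]_z (hk m (0 + sqnorm z) tau * (past (consrv (t + tau) (x + z)) - u x t)).
  apply: eq_Rintegral => z _; rewrite add0r /past consrv0 behrv_consrv.
  by rewrite (lt_trans tT) // ltrDl.
rewrite -(RintegralZl _ measurableT (integrable_hk_mul 0 tau mp pl)).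
by apply: eq_Rintegral => z _; rewrite add0r hkD mulrA.
Qed.

Lemma pinc_le0 x t tau : tau <= 0 -> pinc x t tau = 0.
Proof.
move=> t0; rewrite /pinc (_ : (fun z => _) = cst 0); first by rewrite Rintegral_cst // mul0r.
by apply/funext => z; rewrite hk_le0 ?mul0r.
Qed.

Let shifted x t (r : R) : - TF < t -> 0 < r ->
  leb.-integrable setT (EFin \o (fun tau => expR (- r ^+ 2 / (4 * tau)) * pinc x t tau)) /\
  \int[mu d.+1]_Q (hker m (consrv r x) t Q * (past Q - u x t)) =
  \int[leb]_tau (expR (- r ^+ 2 / (4 * tau)) * pinc x t tau).
Proof.
move=> tT r0; have X0 : H (consrv r x) by rewrite /halfspace /= consrv0.
have mp : measurable_fun setT (fun Q => past Q - u x t) by apply: measurable_funB => //; exact: measurable_past.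
have pl Q : `|past Q - u x t| <= M + M.
  by apply: le_trans (ler_normB _ _) _; apply: lerD; [exact: past_le|exact: uM].
have [iF _ _ _] := integrable_hpot s0 mp pl t X0.
have sF sigma : (mu d).-integrable setT
    (EFin \o (fun z => hker m (consrv r x) t (consrv sigma z) * (past (consrv sigma z) - u x t))).
  apply: (@integrable_hker_slice (fun z => past (consrv sigma z) - u x t) (M + M)) => //.
  by apply: (measurableT_comp mp); exact: measurable_consrv2.
pose I sigma := \int[mu d]_z (hker m (consrv r x) t (consrv sigma z) * (past (consrv sigma z) - u x t)).
have iI : leb.-integrable setT (EFin \o I) by exact: (integrable_slice iF sF).
have IE tau : I (tau + t) = expR (- r ^+ 2 / (4 * tau)) * pinc x t tau.
  have [t0|t0] := leP tau 0.
    rewrite pinc_le0 // mulr0 /I (_ : (fun z => _) = cst 0); first by rewrite Rintegral_cst // mul0r.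
    by apply/funext => z; rewrite /hker consrv0 hk_le0 ?mul0r // addrK.
  rewrite -pincE // /I (Rintegral_affine_rV x (oner_neq0 _)); last first.
    exact: measurable_integrable (sF _).
  rewrite normr1 expr1n mul1r; apply: eq_Rintegral => z _.
  rewrite scale1r /hker sqnorm_hdisp !consrv0 !behrv_consrv addrK; congr (hk _ (_ + _) _ * _).
    by rewrite opprD addrA [x - z]addrC addrK sqnormN.
  by rewrite [z + x]addrC [tau + t]addrC.
have E : (fun tau => expR (- r ^+ 2 / (4 * tau)) * pinc x t tau) = fun tau => I (tau + t).
  by apply/funext => tau; rewrite IE.
rewrite E; split.
  exact: integrable_shift1.
rewrite (Rintegral_iterated iF sF) -/I; apply: Rintegral_shift1.
exact: measurable_integrable iI.
Qed.

(** Taken from the integrability at height 1 in [shifted], by multiplying the exponential factor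
    away. *)
Lemma measurable_pinc x t : - TF < t -> measurable_fun setT (pinc x t).
Proof.
move=> tT; have [/measurable_integrable m1 _] := shifted x tT ltr01.
rewrite (_ : pinc x t = fun tau => expR (4^-1 * tau `^ (-1)) * (expR (- 1 ^+ 2 / (4 * tau)) * pinc x t tau)).
  apply: measurable_funM => //; apply: measurableT_comp => //; apply: measurable_funM => //.
apply/funext => tau; have [t0|t0] := leP tau 0; first by rewrite pinc_le0 // !mulr0.
rewrite mulrA -expRD powR_inv1 ?(ltW t0) // expr1n mulN1r invfM addrN expR0 mul1r //.
Qed.

Lemma extension_increment x t r : - TF < t -> 0 < r ->
  extension s u (consrv r x) t - u x t = poisson_cst * r `^ (2 * s) *
    \int[leb]_(tau in `]0, +oo[) (expR (- r ^+ 2 / (4 * tau)) * pinc x t tau).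
Proof.
move=> tT r0; have X0 : H (consrv r x) by rewrite /halfspace /= consrv0.
rewrite (@Rintegral_ray _ 0 (fun tau => expR (- r ^+ 2 / (4 * tau)) * pinc x t tau)); last first.
  by move=> tau t0; rewrite pinc_le0 // mulr0.
have [_ <-] := shifted x tT r0.
have P := poisson_cstE t X0.
have num (K A B c : R) : K * B = 1 -> K * A - c = K * (A - c * B).
  by move=> KB; rewrite mulrBr mulrCA KB mulr1.
rewrite extensionE // (num _ _ _ _ P) consrv0; congr (_ * _).
have [iF _ _ _] := integrable_hpot s0 measurable_past past_le t X0.
have b1 (Q : 'rV[R]_d.+1) : `|cst (1 : R) Q| <= 1 by rewrite /= normr1.
have [iG _ _ _] := integrable_hpot s0 (measurable_cst (1 : R)) b1 t X0.
have iK : (mu d.+1).-integrable setT (EFin \o hker m (consrv r x) t).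
  by move: iG; congr integrable; apply/funext => Q /=; rewrite mulr1.
rewrite -(RintegralZl _ measurableT iK) -(RintegralB measurableT iF (integrableZR measurableT _ iK)).
by apply: eq_Rintegral => Q _; rewrite mulrBr [u x t * _]mulrC.
Qed.

End poisson_extension.

(** * The boundary quotient and the fractional heat operator *)

Section boundary_increment.
Context {R : realType}.
Local Notation mu := (@lebesgue_rV R).
Local Notation leb := (@lebesgue_measure R).
Variables (d : nat) (s M TF : R) (u : 'rV[R]_d -> R -> R).
Hypothesis s01 : 0 < s < 1.
Hypothesis um : measurable_fun (setT `*` [set` `]- TF, +oo[])
  (fun P : 'rV[R]_d * measurableTypeR R => u P.1 P.2).
Hypothesis uM : forall x t, - TF < t -> `|u x t| <= M.
(** [lin tau] plays the role of the spatial gradient of [u] at time [t + tau], or of 0 when the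
    Hölder order is at most 1; [kap] is half of that order. *)
Variables (kap C : R) (x : 'rV[R]_d) (t : R) (lin : R -> 'rV[R]_d).
Hypothesis kaps : s < kap.
Hypothesis C0 : 0 <= C.
Hypothesis tT : - TF < t.
Hypothesis increment : forall tau z, 0 < tau ->
  `|u (x + z) (t + tau) - u x t - \sum_i lin tau 0 i * z 0 i| <= C * (sqnorm z + tau) `^ kap.
Let m : R := d%:R / 2 + 1 + s.
Let s0 : 0 < s. Proof. by case/andP: s01. Qed.
Let kap0 : 0 < kap. Proof. exact: lt_trans kaps. Qed.
Local Notation pinc := (pinc s u x t).
Local Notation ray := ([set` `]0%R, +oo[] : set (measurableTypeR R)).

Let mray : measurable ray. Proof. exact: measurable_itv. Qed.

(** Half of the Gaussian exponent absorbs the power [(1 + q / tau)^kap], so a parabolic power of the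
    distance costs only [tau^kap]. *)
Let hk_weight : exists2 K, 0 <= K & forall q tau, 0 <= q -> 0 < tau ->
  (q + tau) `^ kap * hk m q tau <= K * tau `^ kap * hk m (2^-1 * q) tau.
Proof.
have i8 : 0 < 8^-1 :> R by [].
have [K K0 HK] := powR_expR_bounded kap0 i8.
exists K => // q tau q0 t0.
have y0 : 0 <= q / tau by rewrite divr_ge0 // ltW.
have -> : hk m q tau = expR (- (8^-1 * (q / tau))) * hk m (2^-1 * q) tau.
  rewrite (_ : q = 2^-1 * q + 2^-1 * q :> R); last by field.
  rewrite hkD -(_ : q = 2^-1 * q + 2^-1 * q :> R); last by field.
  by congr (expR _ * _); field; rewrite gt_eqF.
have -> : (q + tau) `^ kap = tau `^ kap * (1 + q / tau) `^ kap.
  rewrite -powRM ?addr_ge0 ?(ltW t0) //; congr (_ `^ _).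
  by field; rewrite gt_eqF.
have := HK _ y0; set A := _ `^ kap; set B := expR _; set T := tau `^ kap; set h := hk _ _ _ => le.
rewrite (_ : T * A * (B * h) = A * B * (T * h)); last by ring.
by rewrite -[K * T * h]mulrA ler_wpM2r // mulr_ge0 ?powR_ge0 ?hk_ge0.
Qed.

Let mhkz c tau : measurable_fun setT (fun z : 'rV[R]_d => hk m (c * sqnorm z) tau).
Proof. by apply: measurable_hk => //; apply: measurable_funM => //; exact: measurable_sqnorm. Qed.

Let int_hkz c tau : 0 < c -> 0 < tau ->
  (mu d).-integrable setT (EFin \o (fun z => hk m (c * sqnorm z) tau)) /\
  \int[mu d]_z hk m (c * sqnorm z) tau = (4 * pi / c) `^ (d%:R / 2) / tau `^ (1 + s).
Proof.
move=> c0 t0.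
have E : (\int[mu d]_z (hk m (c * sqnorm z) tau)%:E = ((4 * pi / c) `^ (d%:R / 2) / tau `^ (1 + s))%:E)%E.
  have := @integral_hk_space R d s c 0 tau c0.
  rewrite mulr0 [hk (1 + s) _ _]hkE // oppr0 mul0r expR0 mul1r => <-.
  by apply: eq_integral => z _; rewrite add0r.
split; last by rewrite /Rintegral E.
apply/integrableP; split; first exact/measurable_EFinP.
under eq_integral => z _ do rewrite /= ger0_norm ?hk_ge0 //.
by rewrite E ltry.
Qed.

Let inc tau z := u (x + z) (t + tau) - u x t.

Let minc tau : 0 < tau -> measurable_fun setT (inc tau).
Proof.
move=> t0; apply: measurable_funB => //.
have mp : measurable_fun setT (fun z => past TF u (consrv (t + tau) (x + z))).
  apply: (measurableT_comp (measurable_past um)).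
  apply: (measurableT_comp (measurable_consrv2 (t + tau))).
  have := measurable_affine_rV 1 x; congr measurable_fun.
  by apply/funext => z; rewrite scale1r addrC.
apply: eq_measurable_fun mp => z _.
by rewrite /past consrv0 behrv_consrv (lt_trans tT) // ltrDl.
Qed.

Let inc_le tau z : 0 < tau -> `|inc tau z| <= M + M.
Proof.
move=> t0; apply: le_trans (ler_normB _ _) _; apply: lerD; apply: uM => //.
by rewrite (lt_trans tT) // ltrDl.
Qed.

Let M0 : 0 <= M. Proof. exact: le_trans (normr_ge0 _) (uM x tT). Qed.

Let iinc tau : 0 < tau ->
  (mu d).-integrable setT (EFin \o (fun z => hk m (sqnorm z) tau * inc tau z)).
Proof.
move=> t0; have [i1 _] := int_hkz ltr01 t0.
apply: (@le_integrableR _ _ _ (mu d) _ measurableT _ (fun z => (M + M) * hk m (1 * sqnorm z) tau)).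
- by have := measurable_funM (mhkz 1 tau) (minc t0); congr measurable_fun;
    apply/funext => z /=; rewrite mul1r.
- by move=> z _; rewrite normrM ger0_norm ?hk_ge0 // mulrC mul1r ler_wpM2r ?hk_ge0 ?inc_le.
- exact: integrableZR.
Qed.

Let pinc_large tau : 0 < tau ->
  `|pinc tau| <= (M + M) * (4 * pi / 1) `^ (d%:R / 2) / tau `^ (1 + s).
Proof.
move=> t0; have [i1 e1] := int_hkz ltr01 t0.
apply: le_trans (le_normr_Rintegral measurableT (iinc t0)) _.
rewrite -mulrA -e1 -(RintegralZl _ measurableT i1).
apply: (le_Rintegral measurableT (integrable_normR (iinc t0)) (integrableZR measurableT _ i1)).
by move=> z _; rewrite normrM ger0_norm ?hk_ge0 // mulrC mul1r ler_wpM2r ?hk_ge0 ?inc_le.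
Qed.

(* The linear part integrates to zero against the even kernel. *)
Let pinc_small : exists2 K, 0 <= K & forall tau, 0 < tau ->
  `|pinc tau| <= K * (tau `^ kap / tau `^ (1 + s)).
Proof.
have [K K0 HK] := hk_weight; pose A : R := (4 * pi / 2^-1) `^ (d%:R / 2).
have A0 : 0 <= A by exact: powR_ge0.
exists (C * K * A) => [|tau t0]; first by rewrite !mulr_ge0.
have i20 : 0 < 2^-1 :> R by [].
have [i1 e1] := int_hkz i20 t0.
pose l (z : 'rV[R]_d) := \sum_i lin tau 0 i * z 0 i.
pose B (z : 'rV[R]_d) := C * K * tau `^ kap * hk m (2^-1 * sqnorm z) tau.
have CK0 : 0 <= C * K * tau `^ kap by rewrite !mulr_ge0 ?powR_ge0.
have iB : (mu d).-integrable setT (EFin \o B) by exact: integrableZR.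
have ml : measurable_fun setT l.
  apply: (@measurable_sum _ _ R _ _ (index_enum 'I_d) (fun i (z : 'rV[R]_d) => lin tau 0 i * z 0 i)) => i.
  by apply: measurable_funM => //; exact: measurable_coord.
have mk : measurable_fun setT (fun z : 'rV[R]_d => hk m (sqnorm z) tau).
  by have := mhkz 1 tau; congr measurable_fun; apply/funext => z; rewrite mul1r.
have le1 z : `|hk m (sqnorm z) tau * (inc tau z - l z)| <= B z.
  rewrite normrM ger0_norm ?hk_ge0 //.
  apply: le_trans (ler_wpM2l (hk_ge0 _ _ _) (increment z t0)) _.
  rewrite mulrCA /B -!mulrA ler_wpM2l // mulrC !mulrA.
  exact: HK (sqnorm_ge0 z) t0.
have i2 : (mu d).-integrable setT (EFin \o (fun z => hk m (sqnorm z) tau * (inc tau z - l z))).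
  apply: (@le_integrableR _ _ _ (mu d) _ measurableT _ B) => //.
  by apply: measurable_funM => //; apply: measurable_funB => //; exact: minc.
have i3 : (mu d).-integrable setT (EFin \o (fun z => hk m (sqnorm z) tau * l z)).
  have := integrableBR measurableT (iinc t0) i2; congr integrable.
  by apply/funext => z /=; congr EFin; ring.
have O : \int[mu d]_z (hk m (sqnorm z) tau * l z) = 0.
  have n10 : -1 != 0 :> R by rewrite oppr_eq0 oner_eq0.
  have := Rintegral_affine_rV 0 n10 (measurable_integrable i3).
  rewrite normrN normr1 expr1n mul1r.
  have -> : \int[mu d]_z (hk m (sqnorm (-1 *: z + 0)) tau * l (-1 *: z + 0)) =
      -1 * \int[mu d]_z (hk m (sqnorm z) tau * l z).
    rewrite -(RintegralZl _ measurableT i3); apply: eq_Rintegral => z _.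
    rewrite addr0 scaleN1r sqnormN mulrCA; congr (_ * _).
    by rewrite /l mulN1r -sumrN; apply: eq_bigr => i _; rewrite mxE mulrN.
  by set I := Rintegral _ _ _; lra.
have -> : pinc tau = \int[mu d]_z (hk m (sqnorm z) tau * (inc tau z - l z)).
  rewrite -[LHS]subr0 -O -(RintegralB measurableT (iinc t0) i3).
  by apply: eq_Rintegral => z _; rewrite [RHS]mulrBr.
apply: le_trans (le_normr_Rintegral measurableT i2) _.
apply: (@le_trans _ _ (\int[mu d]_z B z)).
  by apply: (le_Rintegral measurableT (integrable_normR i2) iB) => z _; exact: le1.
rewrite /B (RintegralZl _ measurableT i1) e1 -/A.
by rewrite le_eqVlt; apply/orP; left; apply/eqP; ring.
Qed.

(** Near 0 the Hölder bound gives [tau^(kap - s - 1)], and for large [tau] the boundedness of [u]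
    gives [tau^(- 1 - s)]. With [k = min(kap - s, s)] both lie below a multiple of the integrable
    bump. *)
Let pinc_bump : exists k K, [/\ 0 < k, 0 <= K & forall tau, 0 < tau ->
  `|pinc tau| <= K * (tau `^ (k - 1) / (1 + tau `^ k) ^+ 2)].
Proof.
have [K K0 HK] := pinc_small; pose k := Num.min (kap - s) s.
pose K' := (M + M) * (4 * pi / 1) `^ (d%:R / 2).
have K'0 : 0 <= K' by rewrite mulr_ge0 ?powR_ge0 ?addr_ge0.
have k0 : 0 < k by rewrite lt_min subr_gt0 kaps s0.
exists k, (4 * (K + K')); split => [//||tau t0]; first by rewrite mulr_ge0 // addr_ge0.
have pk : 0 < tau `^ k by rewrite powR_gt0.
have d0 : 0 < (1 + tau `^ k) ^+ 2 by rewrite exprn_gt0 // addr_gt0.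
have [t1|t1] := leP tau 1.
- apply: (@le_trans _ _ (K * tau `^ (k - 1))).
    apply: le_trans (HK _ t0) _; rewrite ler_wpM2l //.
    rewrite -powRB; last by apply/implyP => _; rewrite gt_eqF.
    apply: ger_powR; first by rewrite t0 t1.
    have kl : k <= kap - s by rewrite ge_min lexx.
    by lra.
  rewrite mulrA ler_pdivlMr //.
  have tk1 : tau `^ k <= 1.
    have k1 : 1 `^ k = 1 :> R by rewrite powR1.
    by rewrite -[leRHS]k1; apply: ge0_ler_powR; rewrite ?nnegrE ?(ltW k0) ?(ltW t0).
  have le4 : (1 + tau `^ k) ^+ 2 <= 4.
    by rewrite (_ : 4 = 2 ^+ 2 :> R) ?ler_pXn2r ?nnegrE ?addr_ge0 ?(ltW pk) //; [lra|ring].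
  have p0 : 0 <= tau `^ (k - 1) by exact: powR_ge0.
  apply: (@le_trans _ _ (K * tau `^ (k - 1) * 4)); first by rewrite ler_wpM2l // mulr_ge0.
  by have : 0 <= K' * tau `^ (k - 1); [rewrite mulr_ge0|nra].
- apply: le_trans (pinc_large t0) _; rewrite -/K'.
  have T1 := ltW t1.
  have ks : tau `^ k <= tau `^ s by apply: ler_powR => //; rewrite ge_min lexx orbT.
  have k1 : 1 <= tau `^ k by rewrite -[leLHS](powRr0 tau); apply: ler_powR => //; exact: ltW.
  have E1 : tau `^ (1 + s) = tau * tau `^ s by rewrite addrC powRS // mulrC.
  have E2 : tau `^ (k - 1) = tau `^ k / tau by rewrite -[in RHS](subrK 1 k) powRS // mulfK // gt_eqF.
  apply: (@le_trans _ _ (K' / (tau * tau `^ k))).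
    by rewrite ler_wpM2l // lef_pV2 ?posrE ?powR_gt0 ?mulr_gt0 // E1 ler_pM2l.
  rewrite E2; move: (tau `^ k) pk d0 k1 => y y0 d0 y1.
  rewrite mulrA ler_pdivlMr // (_ : K' / (tau * y) * (1 + y) ^+ 2 = K' / tau * ((1 + y) ^+ 2 / y)); last first.
    by field; rewrite !gt_eqF.
  have le4 : (1 + y) ^+ 2 / y <= 4 * y.
    by rewrite ler_pdivrMr // -mulrA -expr2 -subr_ge0 (_ : _ - _ = (y - 1) * (3 * y + 1)); [rewrite mulr_ge0; lra|ring].
  apply: (@le_trans _ _ (K' / tau * (4 * y))).
    by rewrite ler_wpM2l // divr_ge0 // ltW.
  rewrite (_ : 4 * (K + K') * (y / tau) = K / tau * (4 * y) + K' / tau * (4 * y)); last by ring.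
  by rewrite lerDr mulr_ge0 ?mulr_ge0 ?invr_ge0 ?(ltW y0) ?(ltW t0).
Qed.

Lemma integrable_pinc : leb.-integrable ray (EFin \o pinc).
Proof.
have [k [K [k0 K0 HK]]] := pinc_bump.
apply: (@le_integrableR _ _ _ leb ray mray _ (fun tau => K * (tau `^ (k - 1) / (1 + tau `^ k) ^+ 2))).
- by apply: measurable_funS (measurable_pinc s0 um uM x tT).
- by move=> tau; rewrite /= in_itv /= andbT; exact: HK.
- by apply: integrableZR => //; exact: integrable_bump.
Qed.

(** After division by [r^(2s)] only the exponential depends on [r]. It is at most 1 and tends to 1,
    so [|pinc|] dominates. *)
Lemma extension_boundary_quotient :
  (extension s u (consrv r x) t - u x t) / r `^ (2 * s) @[r --> 0^'+] -->
  poisson_cst d s * \int[leb]_(tau in `]0, +oo[) pinc tau.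
Proof.
apply: (@cvg_trans _ (poisson_cst d s *
   \int[leb]_(tau in `]0, +oo[) (expR (- r ^+ 2 / (4 * tau)) * pinc tau) @[r --> 0^'+])).
  apply: near_eq_cvg; near=> r.
  have r0 : 0 < r by near: r; exact: nbhs_right_gt.
  rewrite (extension_increment s0 um uM) // [_ * _ * Rintegral _ _ _]mulrAC mulfK //.
  by rewrite gt_eqF ?powR_gt0.
apply: cvgM; first exact: cvg_cst.
apply/cvg_at_rightP => r_ [r0 rcv].
have ip := integrable_pinc.
refine (proj2 (@dominatedR _ _ _ leb ray mray (fun n tau => expR (- r_ n ^+ 2 / (4 * tau)) * pinc tau)
   pinc (fun tau => `|pinc tau|) _ _ (integrable_normR ip) _)).
- move=> n; have mp : measurable_fun setT pinc by exact: (measurable_pinc s0 um uM x tT).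
  have mg : measurable_fun ray (fun tau => expR (- r_ n ^+ 2 / 4 * tau `^ (-1)) * pinc tau).
    apply: (@measurable_funS _ _ _ _ setT) => //; apply: measurable_funM => //.
    by apply: measurableT_comp => //; apply: measurable_funM => //; exact: measurable_powR.
  apply: eq_measurable_fun mg => tau; rewrite inE /= in_itv /= andbT => t0.
  by rewrite powR_inv1 ?(ltW t0) // invfM !mulrA.
- move=> tau _.
  have c : {for 0, continuous (fun r : R => expR (- r ^+ 2 / (4 * tau)) * pinc tau)}.
    apply: contM; last exact: cont_cst.
    apply: (cont_comp (phi := expR)); last exact: continuous_expR.
    by apply: contM; [apply: contN; apply: contX; exact: cvg_id|exact: cont_cst].
  have := cvg_comp _ _ rcv c.
  by rewrite expr0n /= oppr0 mul0r expR0 mul1r.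
- move=> n tau; rewrite /= in_itv /= andbT => t0.
  rewrite normrM ger0_norm ?expR_ge0 // ler_piMl // -expR0 ler_expR.
  by rewrite mulNr oppr_le0 divr_ge0 ?sqr_ge0 // mulr_ge0 // ltW.
Unshelve. all: by end_near. Qed.

Definition heat_cst : R := ((4 * pi) `^ (d%:R / 2) * `|Gamma (- s)|)^-1.

Lemma backward_heatE :
  backward_heat s u x t = - heat_cst * \int[leb]_(tau in `]0, +oo[) pinc tau.
Proof.
have mp : measurable_fun setT pinc by exact: (measurable_pinc s0 um uM x tT).
have p0 tau : tau <= 0 -> pinc tau = 0 by exact: pinc_le0.
rewrite -(RintegralZl _ mray integrable_pinc).
rewrite (@Rintegral_ray _ 0 (fun tau => - heat_cst * pinc tau)); last by move=> tau /p0 ->; rewrite mulr0.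
rewrite (Rintegral_shift1 (- t)); last exact: measurable_funM.
rewrite -(@Rintegral_ray _ t (fun tau => - heat_cst * pinc (tau - t))); last first.
  by move=> tau h; rewrite p0 ?mulr0 // subr_le0.
apply: eq_Rintegral => sigma; rewrite inE /= in_itv /= andbT -subr_gt0 => st.
rewrite -(RintegralZl _ measurableT (iinc st)).
rewrite [RHS](Rintegral_affine_rV (- x) (oner_neq0 _)); last first.
  by apply: measurable_funM => //; exact: measurable_integrable (iinc st).
rewrite normr1 expr1n mul1r; apply: eq_Rintegral => z _.
rewrite scale1r.
have -> : inc (sigma - t) (z - x) = u z sigma - u x t.
  by rewrite /inc; congr (u _ _ - _); rewrite addrC subrK.
rewrite /heat_kernel -/heat_cst hkE // -[sqnorm (x - z)]sqnormN opprB.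
by ring.
Qed.

End boundary_increment.

(** * Parabolic Hölder functions *)

Section boundary_flux.
Context {R : realType}.

(** L'Hopital's rule: the derivatives of [f - f0] and [r^(2s)] have the quotient
    [r^(1-2s) df / (2s)], which tends to [W0 / (2s)]. Existence of [L] forces [f -> f0], so the rule
    applies. *)
Lemma flux_of_quotient (s W0 f0 L : R) (f df : R -> R) : 0 < s ->
  (forall r : R, 0 < r -> is_derive r (1 : R) f (df r)) ->
  (r `^ (1 - 2 * s) * df r @[r --> (0 : R)^'+] --> W0) ->
  ((f r - f0) / r `^ (2 * s) @[r --> (0 : R)^'+] --> L) -> W0 = 2 * s * L.
Proof.
move=> s0 df' cW cL; have s20 : 0 < 2 * s by rewrite mulr_gt0.
have cg := powR_cvg0 s20.
have cf : f r - f0 @[r --> (0 : R)^'+] --> 0.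
  apply: (@cvg_trans _ ((f r - f0) / r `^ (2 * s) * r `^ (2 * s) @[r --> (0 : R)^'+])).
    apply: near_eq_cvg; near=> r.
    by rewrite divfK // gt_eqF // powR_gt0 //; near: r; exact: nbhs_right_gt.
  have cc : (f r - f0) / r `^ (2 * s) * r `^ (2 * s) @[r --> (0 : R)^'+] --> L * 0 by exact: cvgM.
  by rewrite mulr0 in cc; exact: cc.
have pos (r : R) : r \in `]0, 1[ -> 0 < r by rewrite in_itv /= => /andP[].
have dg (r : R) : r \in `]0, 1[ -> is_derive r (1 : R) (fun r : R => r `^ (2 * s)) (2 * s * r `^ (2 * s - 1)).
  by move=> /pos; exact: is_derive1_powR.
have dF (r : R) : r \in `]0, 1[ -> is_derive r (1 : R) (fun r : R => f r - f0) (df r).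
  move=> /pos r0; have hc : is_derive r (1 : R) (fun=> f0 : R) 0 by exact: is_derive_cst.
  by have := is_derive_sub (df' r r0) hc; rewrite subr0.
have dg0 (r : R) : r \in `]0, 1[ -> 2 * s * r `^ (2 * s - 1) != 0.
  by move=> /pos r0; rewrite gt_eqF // mulr_gt0 ?powR_gt0.
have cq : df r / (2 * s * r `^ (2 * s - 1)) @[r --> (0 : R)^'+] --> W0 / (2 * s).
  apply: (@cvg_trans _ (r `^ (1 - 2 * s) * df r / (2 * s) @[r --> (0 : R)^'+])).
    apply: near_eq_cvg; near=> r.
    have r0 : 0 < r by near: r; exact: nbhs_right_gt.
    rewrite -(opprB (2 * s)) powRN; have : 0 < r `^ (2 * s - 1) by rewrite powR_gt0.
    by move=> p0; field; rewrite !gt_eqF.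
  by apply: cvgM cW _; exact: cvg_cst.
have := lhopital_at_right (ltr01 : (0 : R) < 1) dF dg cf cg dg0 cq => cq'.
have := cvg_unique _ cL cq' => -> //.
by field; rewrite gt_eqF.
Unshelve. all: by end_near. Qed.

End boundary_flux.

(** * Taylor estimates and the chain rule from partial derivatives *)

Section holder_space.
Context {R : realType}.
Local Notation mu := (@lebesgue_rV R).
Local Notation leb := (@lebesgue_measure R).

Lemma enormE n (v : 'rV[R]_n) : enorm v `^ 2 = sqnorm v.
Proof. by rewrite powR_mulrn ?sqrtr_ge0 // sqr_sqrtr // sqnorm_ge0. Qed.

Lemma coord_le_enorm n (v : 'rV[R]_n) i : `|v 0 i| <= enorm v.
Proof. by rewrite -sqrtr_sqr; apply: ler_wsqrtr; exact: sqr_coord_le. Qed.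

Lemma enorm_powR n (v : 'rV[R]_n) (g : R) : enorm v `^ g = sqnorm v `^ (g / 2).
Proof. by rewrite -[in RHS]enormE -powRrM; congr (_ `^ _); field. Qed.

(* Telescope along the path that switches on the coordinates of z one by one. *)
Lemma taylor_box n (f : 'rV[R]_n -> R) (df : 'I_n -> 'rV[R]_n -> R) (x z : 'rV[R]_n) (e : R) :
  (forall (y : 'rV[R]_n) i, (forall j, `|y 0 j - x 0 j| <= `|z 0 j|) -> is_derive y 'e_i f (df i y)) ->
  (forall (y : 'rV[R]_n) i, (forall j, `|y 0 j - x 0 j| <= `|z 0 j|) -> `|df i y - df i x| <= e) ->
  `|f (x + z) - f x - \sum_i df i x * z 0 i| <= e * \sum_i `|z 0 i|.
Proof.
move=> hdf hf.
pose p k : 'rV[R]_n := \row_i (if (i < k)%N then x 0 i + z 0 i else x 0 i).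
have p0 : p 0%N = x by apply/rowP => i; rewrite mxE.
have pn : p n = x + z by apply/rowP => i; rewrite !mxE ltn_ord.
have pS (k : 'I_n) : p k.+1 = p k + z 0 k *: 'e_k.
  apply/rowP => i; rewrite !mxE eqxx /= ltnS leq_eqVlt (inj_eq val_inj) eq_sym.
  by have [->|ne] := eqVneq k i; rewrite ?ltnn ?mulr1 //= mulr0 addr0.
have -> : f (x + z) - f x - \sum_i df i x * z 0 i =
    \sum_(k < n) (f (p k.+1) - f (p k) - df k x * z 0 k).
  rewrite sumrB; congr (_ - _).
  rewrite -(big_mkord xpredT (fun k => f (p k.+1) - f (p k))) telescope_sumr //.
  by rewrite p0 pn.
apply: le_trans (ler_norm_sum _ _ _) _; rewrite mulr_sumr; apply: ler_sum => k _.
pose xi c := p k + (c * z 0 k) *: 'e_k.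
have box c : 0 <= c <= 1 -> forall j, `|xi c 0 j - x 0 j| <= `|z 0 j|.
  move=> /andP[c0 c1] j; rewrite /xi /p !mxE eqxx /=.
  have [->|ne] := eqVneq j k.
    by rewrite ltnn mulr1 addrAC subrr add0r normrM (ger0_norm c0) ler_piMl.
  rewrite mulr0 addr0; case: ifP => _; first by rewrite addrAC subrr add0r.
  by rewrite subrr normr0.
have dphi (c : R) : 0 <= c <= 1 -> is_derive c (1 : R) (fun c => f (xi c)) (df k (xi c) * z 0 k).
  move=> c01; have h1 := (is_derive_line f (p k) 'e_k (c * z 0 k) _).1 (hdf _ k (box c c01)).
  have h0 : is_derive c (1 : R) (fun c : R => c) 1 by exact: is_derive_id.
  have := is_derive_comp1 (is_derive_scalel (z 0 k) h0) _.
  rewrite mulr1 => h2; have := h2 (fun r => f (p k + r *: 'e_k)) (df k (xi c)).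
  rewrite (_ : (fun c => f (xi c)) = (fun r => f (p k + (z 0 k * r) *: 'e_k))); last first.
    by apply/funext => r; rewrite /xi mulrC.
  by apply; rewrite mulrC.
have cphi : {within `[0, 1], continuous (fun c => f (xi c))}.
  apply: continuous_in_subspaceT => c; rewrite inE /= in_itv /= => c01.
  exact: derivable_cont (dphi c c01).
have dphi' (c : R) : c \in `]0, 1[ -> is_derive c (1 : R) (fun c => f (xi c)) (df k (xi c) * z 0 k).
  by rewrite in_itv /= => /andP[c0 c1]; apply: dphi; rewrite !ltW.
have [c c01 E] := MVT ltr01 dphi' cphi.
have xi1 : f (xi 1) = f (p k.+1) by rewrite /xi mul1r pS.
have xi0 : f (xi 0) = f (p k) by rewrite /xi mul0r scale0r addr0.
rewrite -xi1 -xi0 E subr0 mulr1 -mulrBl normrM ler_wpM2r //; apply: hf.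
by apply: box; move: c01; rewrite in_itv /= => /andP[c0 c1]; rewrite !ltW.
Qed.

Lemma holder_taylor n (f : 'rV[R]_n -> R) (x z : 'rV[R]_n) (g C : R) : 1 < g -> 0 <= C ->
  (forall y i, derivable f y 'e_i) ->
  (forall y, enorm (grad f y - grad f x) <= C * enorm (y - x) `^ (g - 1)) ->
  `|f (x + z) - f x - \sum_i grad f x 0 i * z 0 i| <= n%:R * C * sqnorm z `^ (g / 2).
Proof.
move=> g1 C0 df hf.
have T := @taylor_box n f (fun i y => grad f y 0 i) x z (C * enorm z `^ (g - 1)) _ _.
apply: le_trans (T _ _) _.
- by move=> y i _; apply: DeriveDef => //; rewrite mxE.
- move=> y k hy; apply: le_trans (_ : enorm (grad f y - grad f x) <= _).
    by have := coord_le_enorm (grad f y - grad f x) k; rewrite !mxE.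
  apply: le_trans (hf _) _; rewrite ler_wpM2l //.
  apply: ge0_ler_powR; rewrite ?nnegrE ?sqrtr_ge0 ?subr_ge0 ?(ltW g1) //.
  apply: ler_wsqrtr; apply: ler_sum => i _.
  rewrite -[leLHS]real_normK ?num_real // -[leRHS]real_normK ?num_real //.
  by rewrite ler_pXn2r ?nnegrE // !mxE.
- have le1 : \sum_i `|z 0 i| <= n%:R * enorm z.
    apply: le_trans (_ : \sum_(i < n) enorm z <= _); first by apply: ler_sum => i _; exact: coord_le_enorm.
    by rewrite sumr_const card_ord -[leLHS]mulr_natl.
  have C1 : 0 <= C * enorm z `^ (g - 1) by rewrite mulr_ge0 ?powR_ge0.
  apply: le_trans (ler_wpM2l C1 le1) _; rewrite -enorm_powR.
  rewrite -(@mulr_powRB1 _ (enorm z) g) ?sqrtr_ge0 ?(lt_trans ltr01) //.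
  by rewrite le_eqVlt; apply/orP; left; apply/eqP; ring.
Qed.

(** Only partial derivatives are given, continuous at the single point [c t]. [taylor_box] turns
    this into a first-order expansion there, because the box spanned by a small increment lies in a
    sup-norm ball around the point. *)
Lemma is_derive_chain n (f : 'rV[R]_n -> R) (df : 'I_n -> 'rV[R]_n -> R) (c : R -> 'rV[R]_n)
    (c' : 'rV[R]_n) (t : R) :
  (\forall y \near c t, forall i, is_derive y 'e_i f (df i y)) ->
  (forall i, {for c t, continuous (df i)}) ->
  (forall i, is_derive t (1 : R) (fun r => c r 0 i) (c' 0 i)) ->
  is_derive t (1 : R) (fun r => f (c r)) (\sum_i df i (c t) * c' 0 i).
Proof.
move=> hdf cdf hc.
have cq i : h^-1 * (c (t + h) 0 i - c t 0 i) @[h --> 0^'] --> c' 0 i.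
  have [d1 d2] := hc i; rewrite -d2.
  have := d1; rewrite /derivable => /cvgP; rewrite /derive.
  rewrite (_ : (fun h => _ *: _) = fun h => h^-1 * (c (t + h) 0 i - c t 0 i)) //.
  by apply/funext => h /=; rewrite [h%:A]mulr1 [h + t]addrC.
have key (e : R) : 0 < e -> \forall h \near 0^',
   `|f (c (t + h)) - f (c t) - \sum_i df i (c t) * (c (t + h) 0 i - c t 0 i)| <=
   e * \sum_i `|c (t + h) 0 i - c t 0 i|.
  move=> e0.
  have cc : {for t, continuous c}.
    by apply: continuous_rVP => i; exact: derivable_cont (hc i).
  have near1 : \forall y \near c t, forall i, is_derive y 'e_i f (df i y) /\ `|df i y - df i (c t)| <= e.
    have hn : \forall y \near c t, forall i, `|df i y - df i (c t)| <= e.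
      apply: (@filter_forall _ 'I_n (fun i y => `|df i y - df i (c t)| <= e) (nbhs (c t))) => i.
      have /cvgrPdist_le /(_ _ e0) := cdf i.
      by apply: filterS => y; rewrite distrC.
    by near=> y; split; [move: i; near: y|move: i; near: y].
  have /nbhs_ballP[dl /= dl0 Hd] := near1.
  have : \forall h \near 0^', ball (c t) dl (c (t + h)).
    have /cvgrPdist_lt /(_ _ dl0) := cc; rewrite -ball_normE => /nbhs_ballP[r /= r0 Hr].
    apply: nbhs_dnbhs; apply/nbhs_ballP; exists r => //= h; rewrite /ball /= sub0r normrN => hr.
    by apply: Hr; rewrite /ball /= opprD addrA subrr sub0r normrN.
  apply: filterS => h; rewrite -ball_normE /= mx_norm_lt // => /forallP bh.
  have inball (y : 'rV[R]_n) : (forall j, `|y 0 j - c t 0 j| <= `|(c (t + h) - c t) 0 j|) -> ball (c t) dl y.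
    move=> hy; rewrite -ball_normE /= mx_norm_lt //; apply/forallP => j.
    have := bh j; have := hy j; rewrite !mxE => h1 h2.
    by rewrite distrC; apply: le_lt_trans h1 _; rewrite distrC.
  have T := @taylor_box n f df (c t) (c (t + h) - c t) e
    (fun y i hy => (Hd y (inball y hy) i).1) (fun y i hy => (Hd y (inball y hy) i).2).
  move: T; rewrite [c t + _]addrC subrK.
  rewrite (eq_bigr (fun i => df i (c t) * (c (t + h) 0 i - c t 0 i))) => [|i _]; last by rewrite !mxE.
  rewrite [X in _ <= e * X](eq_bigr (fun i => `|c (t + h) 0 i - c t 0 i|)) => [//|i _].
  by rewrite !mxE.
suff cv : h^-1 * (f (c (t + h)) - f (c t)) @[h --> 0^'] --> \sum_i df i (c t) * c' 0 i.
  have E : (fun h : R => h^-1 *: (((fun r => f (c r)) \o shift t) (h *: 1) - f (c t))) =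
      fun h => h^-1 * (f (c (t + h)) - f (c t)).
    by apply/funext => h; rewrite /= [h%:A]mulr1 [h + t]addrC.
  apply: DeriveDef.
  - by rewrite /derivable E; apply/cvg_ex; exists (\sum_i df i (c t) * c' 0 i).
  - by rewrite /derive E; apply: cvg_lim.
have c1 : \sum_i df i (c t) * (h^-1 * (c (t + h) 0 i - c t 0 i)) @[h --> 0^'] --> \sum_i df i (c t) * c' 0 i.
  apply: cvg_big => [|i _]; first exact: add_continuous.
  by apply: cvgM; [exact: cvg_cst|exact: cq].
have c2 : \sum_i `|h^-1 * (c (t + h) 0 i - c t 0 i)| @[h --> 0^'] --> \sum_i `|c' 0 i|.
  apply: cvg_big => [|i _]; first exact: add_continuous.
  by apply: cvg_norm; exact: cq.
set S' := \sum_i `|c' 0 i| in c2.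
have S0 : 0 <= S' by apply: sumr_ge0.
apply/cvgrPdist_le => e e0.
have e20 : 0 < e / 2 by rewrite divr_gt0.
have e30 : 0 < e / 2 / (S' + 1) by rewrite divr_gt0 // ltr_wpDl.
move/cvgrPdist_le : c1 => /(_ _ e20) c1; move/cvgrPdist_le : c2 => /(_ _ ltr01) c2.
near=> h.
have h0 : h != 0 by near: h; exact: nbhs_dnbhs_neq.
have k : `|f (c (t + h)) - f (c t) - \sum_i df i (c t) * (c (t + h) 0 i - c t 0 i)| <=
   e / 2 / (S' + 1) * \sum_i `|c (t + h) 0 i - c t 0 i| by near: h; exact: key.
have a1 : `|\sum_i df i (c t) * c' 0 i - \sum_i df i (c t) * (h^-1 * (c (t + h) 0 i - c t 0 i))| <= e / 2
  by near: h.
have a2 : `|S' - \sum_i `|h^-1 * (c (t + h) 0 i - c t 0 i)| | <= 1 by near: h.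
have hp : 0 < `|h| by rewrite normr_gt0.
have k2 : `|h^-1 * (f (c (t + h)) - f (c t)) - \sum_i df i (c t) * (h^-1 * (c (t + h) 0 i - c t 0 i))| <= e / 2.
  rewrite -(ler_pM2l hp) -normrM mulrBr mulrA divff // mul1r mulr_sumr.
  rewrite (eq_bigr (fun i => df i (c t) * (c (t + h) 0 i - c t 0 i))) => [|i _]; last first.
    by rewrite mulrCA (mulrA h) divff // mul1r.
  have a3 : \sum_i `|c (t + h) 0 i - c t 0 i| <= `|h| * (S' + 1).
    rewrite mulrC -ler_pdivrMr // mulr_suml.
    rewrite (eq_bigr (fun i => `|h^-1 * (c (t + h) 0 i - c t 0 i)|)) => [|i _]; last first.
      by rewrite normrM normfV mulrC.
    by move: a2; rewrite ler_distlC => /andP[].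
  apply: le_trans k _; apply: le_trans (ler_wpM2l (ltW e30) a3) _.
  by rewrite mulrCA divfK // gt_eqF // ltr_wpDl.
apply: le_trans (ler_distD (\sum_i df i (c t) * (h^-1 * (c (t + h) 0 i - c t 0 i))) _ _) _.
by rewrite [leRHS](splitr e) lerD // distrC.
Unshelve. all: by end_near. Qed.

End holder_space.

(** * From almost everywhere bounds to pointwise bounds *)

Section bounded_representative.
Context {R : realType}.
Local Notation mu := (@lebesgue_rV R).
Local Notation leb := (@lebesgue_measure R).

Lemma lebesgue_itv_gt0 (a b : R) : a < b -> (0 < leb `]a, b[%classic)%E.
Proof. by move=> ab; rewrite lebesgue_measure_itv /= lte_fin ab -EFinB lte_fin subr_gt0. Qed.

(** Cubes are used because [consrv] makes them products, so that their positive measure follows by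
    induction on the dimension; this includes dimension 0. *)
Definition cube n (x : 'rV[R]_n) (r : R) : set 'rV[R]_n :=
  [set y | forall i, x 0 i - r < y 0 i < x 0 i + r].

Lemma cube_consrv n x0 (x : 'rV[R]_n) r :
  (fun p : measurableTypeR R * 'rV[R]_n => consrv p.1 p.2) @^-1` cube (consrv x0 x) r =
  `]x0 - r, x0 + r[%classic `*` cube x r.
Proof.
apply/seteqP; split => [[a y] /= h|[a y] /= [h1 h2] i].
  split; first by have := h ord0; rewrite !consrv0 /= in_itv.
  by move=> i; have := h (lift ord0 i); rewrite !consrvS.
by case: (unliftP ord0 i) => [j|] ->; rewrite ?consrv0 ?consrvS //=; move: h1; rewrite in_itv.
Qed.

Lemma measurable_cube n (x : 'rV[R]_n) r : measurable (cube x r).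
Proof.
have -> : cube x r = \bigcap_(i in [set: 'I_n]) ((fun y : 'rV[R]_n => y 0 i) @^-1` `]x 0 i - r, x 0 i + r[%classic).
  apply/seteqP; split => [y h i _|y h i]; first by rewrite /= in_itv /=; exact: h.
  by have := h i I; rewrite /= in_itv.
apply: fin_bigcap_measurable => // i _; rewrite -[X in measurable X]setTI.
by apply: measurable_coord => //; exact: measurable_itv.
Qed.

Lemma lebesgue_cube_gt0 n (x : 'rV[R]_n) r : 0 < r -> (0 < mu n (cube x r))%E.
Proof.
move=> r0; elim: n x => [|n IH] x.
  by rewrite /= diracE mem_set ?lte01 // => -[].
rewrite -(consrv_behrv x) /= /cons_measure /pushforward cube_consrv.
rewrite [X in (0 < X)%E](product_measure1E leb (mu n)); [|exact: measurable_itv|exact: measurable_cube].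
by apply: mule_gt0; [apply: lebesgue_itv_gt0; lra|exact: IH].
Qed.

Lemma ae_slice d1 d2 (T1 : measurableType d1) (T2 : measurableType d2)
    (m1 : {sigma_finite_measure set T1 -> \bar R}) (m2 : {sigma_finite_measure set T2 -> \bar R})
    (A : set (T1 * T2)) :
  (\forall P \ae product_measure1 m1 m2, A P) ->
  \forall x \ae m1, \forall t \ae m2, A (x, t).
Proof.
move=> [N [mN N0 sub]].
have mx := measurable_fun_xsection m2 mN.
have : (\int[m1]_x `|(m2 \o xsection N) x|)%E = 0.
  by rewrite -[RHS]N0; apply: eq_integral => x _; rewrite gee0_abs.
move/(ae_eq_integral_abs m1 measurableT mx).
apply: filterS => x /(_ I) /= h; exists (xsection N x); split => //.
  exact: measurable_xsection.
by move=> t /= hA; rewrite /xsection /= inE; exact: sub.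
Qed.

Lemma ae_itv (A : set R) (t dl : R) : 0 < dl -> (\forall r \ae leb, A r) ->
  exists2 r, t < r < t + dl & A r.
Proof.
move=> dl0 [N [mN N0 sub]]; apply: contrapT => h.
have : (leb `]t, (t + dl)%R[%classic <= leb N)%E.
  apply: le_measure; rewrite ?inE //.
  move=> r; rewrite /= in_itv /= => tr; apply: sub => Ar; apply: h.
  by exists r.
by rewrite N0 leNgt => /negP; apply; apply: lebesgue_itv_gt0; rewrite ltrDl.
Qed.

Lemma ae_cube n (A : set 'rV[R]_n) (x : 'rV[R]_n) (dl : R) : 0 < dl ->
  (\forall y \ae mu n, A y) -> exists2 y, cube x dl y & A y.
Proof.
move=> dl0 [N [mN N0 sub]]; apply: contrapT => h.
have : (mu n (cube x dl) <= mu n N)%E.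
  apply: le_measure; rewrite ?inE //; first exact: measurable_cube.
  by move=> y xy; apply: sub => Ay; apply: h; exists y.
by rewrite N0 leNgt lebesgue_cube_gt0.
Qed.

Variables (d : nat) (TF : R) (u : 'rV[R]_d -> R -> R) (g : R).
Let Om : set ('rV[R]_d * R) := setT `*` [set` `]- TF, +oo[].
Hypothesis hu : parabolic_holder g Om u.

Let OmE x t : Om (x, t) <-> - TF < t.
Proof. by rewrite /Om /= in_itv /= andbT; split => [[]|]. Qed.

Lemma holder_measurable : measurable_fun (setT `*` [set` `]- TF, +oo[])
  (fun P : 'rV[R]_d * measurableTypeR R => u P.1 P.2).
Proof. by case: hu => -[]. Qed.

Let g0 : 0 < g.
Proof. by case: hu => _ [[/andP[]//]|[/andP[g1 _] _]]; exact: lt_trans g1. Qed.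

Let time_holder : exists2 C, 0 <= C & forall x t tau, - TF < t -> - TF < tau ->
  `|u x t - u x tau| <= C * `|t - tau| `^ (g / 2).
Proof.
case: hu => _ [[_ [C C0 HC]]|[_ [[C C0 HC] _ _]]]; exists C; rewrite ?ltW // => x t tau h1 h2.
  by have := HC x t x tau ((OmE x t).2 h1) ((OmE x tau).2 h2); rewrite subrr sqnorm0 add0r.
by apply: HC; exact/OmE.
Qed.

Let sqnorm_cube (x y : 'rV[R]_d) (dl : R) : 0 < dl -> cube x dl y -> sqnorm (y - x) <= d%:R * dl ^+ 2.
Proof.
move=> dl0 xy; apply: (@le_trans _ _ (\sum_(i < d) dl ^+ 2)).
  apply: ler_sum => i _; rewrite !mxE -[leLHS]real_normK ?num_real // ler_pXn2r ?nnegrE ?(ltW dl0) //.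
  by have /andP[h1 h2] := xy i; rewrite ler_norml; apply/andP; split; lra.
by rewrite sumr_const card_ord mulr_natl.
Qed.

(** [K] depends on the point: for order above 1 it contains the gradient of [u] there, for which no
    uniform bound is assumed. *)
Let space_continuous x t : - TF < t -> exists K k, [/\ 0 <= K, 0 < k &
  forall (dl : R) y, 0 < dl <= 1 -> cube x dl y -> `|u y t - u x t| <= K * dl `^ k].
Proof.
move=> tT.
have pw (dl : R) : 0 < dl -> (d%:R * dl ^+ 2) `^ (g / 2) = d%:R `^ (g / 2) * dl `^ g.
  move=> dl0; rewrite powRM ?sqr_ge0 // -(powR_mulrn 2 (ltW dl0)) -powRrM.
  by congr (_ * _ `^ _); field.
case: hu => _ [[_ [C C0 HC]]|[/andP[g1 _] [_ df [C C0 HC]]]].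
- exists (C * d%:R `^ (g / 2)), g; split => // [|dl y /andP[dl0 _] xy]; first by rewrite mulr_ge0 ?powR_ge0 ?ltW.
  apply: le_trans (HC _ _ _ _ ((OmE y t).2 tT) ((OmE x t).2 tT)) _.
  rewrite -mulrA ler_wpM2l ?(ltW C0) // subrr normr0 addr0 -pw //.
  apply: ge0_ler_powR; rewrite ?nnegrE ?sqnorm_ge0 ?mulr_ge0 ?sqr_ge0 ?divr_ge0 ?(ltW g0) ?(ltW dl0) //.
  exact: sqnorm_cube.
- pose S := \sum_i `|grad (u^~ t) x 0 i|.
  have S0 : 0 <= S by apply: sumr_ge0.
  exists (S + d%:R * C * d%:R `^ (g / 2)), 1; split => // [|dl y /andP[dl0 dl1] xy].
    by rewrite addr_ge0 // !mulr_ge0 ?powR_ge0 ?(ltW C0).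
  rewrite powRr1 ?(ltW dl0) //.
  have := @holder_taylor R d (u^~ t) x (y - x) g C g1 (ltW C0)
    (fun y i => df y t i ((OmE y t).2 tT)) (fun y => HC y x t ((OmE y t).2 tT) ((OmE x t).2 tT)).
  rewrite [x + _]addrC subrK => T.
  have le1 : `|\sum_i grad (u^~ t) x 0 i * (y - x) 0 i| <= S * dl.
    apply: le_trans (ler_norm_sum _ _ _) _; rewrite /S mulr_suml; apply: ler_sum => i _.
    rewrite normrM ler_wpM2l // !mxE.
    by have /andP[h1 h2] := xy i; rewrite ler_norml; apply/andP; split; lra.
  have le2 : sqnorm (y - x) `^ (g / 2) <= d%:R `^ (g / 2) * dl.
    apply: (@le_trans _ _ (d%:R `^ (g / 2) * dl `^ g)).
      rewrite -pw //; apply: ge0_ler_powR;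
        rewrite ?nnegrE ?sqnorm_ge0 ?mulr_ge0 ?sqr_ge0 ?divr_ge0 ?(ltW g0) ?(ltW dl0) //.
      exact: sqnorm_cube.
    by rewrite ler_wpM2l ?powR_ge0 // ge1r_powR ?dl0 // ltW.
  have dC : 0 <= d%:R * C by rewrite mulr_ge0 ?(ltW C0).
  have := ler_wpM2l dC le2; rewrite mulrA => le3.
  rewrite -[u y t - u x t](subrK (\sum_i grad (u^~ t) x 0 i * (y - x) 0 i)).
  apply: le_trans (ler_normD _ _) _; rewrite mulrDl addrC; apply: lerD => //.
  exact: le_trans T le3.
Qed.

Let small (K k : R) : 0 <= K -> 0 < k -> forall e, 0 < e -> exists2 dl, 0 < dl <= 1 & K * dl `^ k <= e.
Proof.
move=> K0 k0 e e0; pose b := e / (K + 1).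
have b0 : 0 < b by rewrite divr_gt0 // ltr_wpDl.
exists (Num.min 1 (b `^ k^-1)); first by rewrite lt_min ltr01 powR_gt0 //= ge_min lexx.
apply: (@le_trans _ _ (K * b)).
  rewrite ler_wpM2l //; apply: (@le_trans _ _ ((b `^ k^-1) `^ k)).
    by apply: ge0_ler_powR; rewrite ?nnegrE ?(ltW k0) ?powR_ge0 ?le_min ?ler01 ?powR_ge0 ?ge_min ?lexx ?orbT.
  by rewrite -powRrM mulVf ?gt_eqF // powRr1 // ltW.
by rewrite /b mulrA ler_pdivrMr ?ltr_wpDl // mulrC ler_wpM2l ?(ltW e0) // lerDl.
Qed.

(** The space [Linfty] bounds [u] only almost everywhere in space-time. Continuity in time extends
    the bound to all times for almost every [x], and continuity in space then carries it from such
    points to every [x]. *)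
Lemma holder_bounded : exists M, forall x t, - TF < t -> `|u x t| <= M.
Proof.
pose m12 := [the {measure set _ -> \bar R} of product_measure1 (mu d) leb].
have [M HM] : exists M, \forall P \ae m12, - TF < P.2 -> `|u P.1 P.2| <= M.
  have m0 : (0 < m12 setT)%E.
    have -> : m12 setT = (mu d setT * leb setT)%E.
      by rewrite -setXTT; apply: product_measure1E.
    apply: mule_gt0.
      by apply: lt_le_trans (lebesgue_cube_gt0 0 ltr01) _; apply: le_measure; rewrite ?inE //; exact: measurable_cube.
    apply: (@lt_le_trans _ _ (leb `]0%R, 1%R[%classic)).
      exact: lebesgue_itv_gt0.
    by apply: le_measure; rewrite ?inE //; exact: measurable_itv.
  have [[_ ]] := hu; rewrite Lnorm.unlock /= m0 => L _.
  have := ess_sup_ge m12 (abse \o (EFin \o ((fun P : 'rV[R]_d * R => u P.1 P.2) \_ Om))).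
  move: L; set E := ess_sup _ _; move: E => [r| |] // _ ae.
    exists r; apply: filterS ae => -[x t] /= le tT; move: le.
    by rewrite patchE mem_set ?lee_fin //; exact: (OmE x t).2.
  by exists 0; apply: filterS ae => -[x t] /=.
exists M => x t tT.
have aet := ae_slice HM.
have good : \forall y \ae mu d, forall t, - TF < t -> `|u y t| <= M.
  have [C C0 HC] := time_holder.
  apply: filterS aet => y ay r rT; apply/ler_addgt0Pr => e e0.
  have g20 : 0 < g / 2 by rewrite divr_gt0.
  have [dl /andP[dl0 _] le] := small C0 g20 e0.
  have [r' /andP[r1 r2] /= Hr'] := ae_itv r dl0 ay.
  have r'T : - TF < r' by exact: lt_trans r1.
  apply: le_trans (lerD (Hr' r'T) le); rewrite -lerBlDl.
  apply: le_trans (lerB_dist _ _) _; apply: le_trans (HC y r r' rT r'T) _.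
  rewrite ler_wpM2l //; apply: ge0_ler_powR; rewrite ?nnegrE ?(ltW g20) ?(ltW dl0) //.
  by rewrite distrC ger0_norm; lra.
apply/ler_addgt0Pr => e e0; have [K [k [K0 k0 HK]]] := @space_continuous x t tT.
have [dl dl01 le] := small K0 k0 e0.
have dl0 : 0 < dl by case/andP: dl01.
have [y xy Hy] := ae_cube x dl0 good.
apply: le_trans (lerD (Hy t tT) le); rewrite -lerBlDl.
apply: le_trans (lerB_dist _ _) _; rewrite distrC; exact: HK dl01 xy.
Qed.

(** For order above 1 the regularity in space and in time is given separately. The path therefore
    goes in time from [(x, t)] to [(x, t + tau)] and then in space, which is why the linear part is
    the gradient at the later time. *)
Lemma holder_increment : exists2 C, 0 <= C & forall x t, - TF < t -> exists lin : R -> 'rV[R]_d,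
  forall tau z, 0 < tau ->
    `|u (x + z) (t + tau) - u x t - \sum_i lin tau 0 i * z 0 i| <= C * (sqnorm z + tau) `^ (g / 2).
Proof.
have g20 : 0 <= g / 2 by rewrite divr_ge0 // ltW.
case: hu => _ [[_ [C C0 HC]]|[/andP[g1 _] [[C1 C10 HC1] df [C2 C20 HC2]]]].
- exists C; rewrite ?ltW // => x t tT; exists (fun=> 0) => tau z t0.
  rewrite big1 ?subr0 => [|i _]; last by rewrite mxE mul0r.
  have tT' : - TF < t + tau by rewrite (lt_trans tT) // ltrDl.
  have := HC (x + z) (t + tau) x t ((OmE _ _).2 tT') ((OmE _ _).2 tT).
  by rewrite [x + z]addrC addrK [t + tau]addrC addrK (gtr0_norm t0).
- exists (d%:R * C2 + C1) => [|x t tT]; first by rewrite addr_ge0 ?mulr_ge0 ?(ltW C20) ?(ltW C10).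
  exists (fun tau => grad (u^~ (t + tau)) x) => tau z t0.
  have tT' : - TF < t + tau by rewrite (lt_trans tT) // ltrDl.
  have T := @holder_taylor R d (u^~ (t + tau)) x z g C2 g1 (ltW C20)
    (fun y i => df y (t + tau) i ((OmE y _).2 tT')) (fun y => HC2 y x _ ((OmE y _).2 tT') ((OmE x _).2 tT')).
  have T2 := HC1 x (t + tau) t ((OmE _ _).2 tT') ((OmE _ _).2 tT).
  rewrite [t + tau]addrC addrK (gtr0_norm t0) [tau + t]addrC in T2.
  have e1 : u (x + z) (t + tau) - u x t - \sum_i grad (u^~ (t + tau)) x 0 i * z 0 i =
    (u (x + z) (t + tau) - u x (t + tau) - \sum_i grad (u^~ (t + tau)) x 0 i * z 0 i) +
    (u x (t + tau) - u x t) by ring.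
  rewrite e1; apply: le_trans (ler_normD _ _) _; rewrite mulrDl; apply: lerD.
    apply: le_trans T _; rewrite ler_wpM2l ?mulr_ge0 ?(ltW C20) //.
    by apply: ge0_ler_powR; rewrite ?nnegrE ?sqnorm_ge0 ?addr_ge0 ?sqnorm_ge0 ?(ltW t0) ?lerDl ?(ltW t0).
  apply: le_trans T2 _; rewrite ler_wpM2l ?(ltW C10) //.
  by apply: ge0_ler_powR; rewrite ?nnegrE ?addr_ge0 ?sqnorm_ge0 ?(ltW t0) // lerDr sqnorm_ge0.
Qed.

End bounded_representative.

(** * The extension equation and its flux *)

Section extension_equation.
Context {R : realType}.
Local Notation leb := (@lebesgue_measure R).
Variables (d : nat) (s TF : R) (u : 'rV[R]_d -> R -> R) (eps : R).
Hypothesis s01 : 0 < s < 1.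
Hypothesis eps0 : 0 < eps.
Hypothesis hu : parabolic_holder (2 * s + eps) (setT `*` [set` `]- TF, +oo[]) u.
Let s0 : 0 < s. Proof. by case/andP: s01. Qed.
Local Notation U := (extension s u).
Local Notation H := (@halfspace R d).
Let m : R := d%:R / 2 + 1 + s.
Let um := holder_measurable hu.

Let is_derive_unique (V : normedModType R) (f : V -> R) (x v : V) a b :
  is_derive x v f a -> is_derive x v f b -> a = b.
Proof. by move=> [_ <-] [_ <-]. Qed.

Let near_H X : H X -> \forall Y \near X, H Y.
Proof. by move=> X0; apply: open_nbhs_nbhs; split => //; exact: open_halfspace. Qed.

(** The extension is a multiple of [X_0^(2s)] times a potential that satisfies the equation with
    coefficient [1 + 2s]; multiplication by [X_0^(2s)] changes this coefficient into [1 - 2s]. The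
    given derivatives agree with those of the formula by uniqueness. *)
Lemma extension_pde (dU ddU : 'I_d.+1 -> 'rV[R]_d.+1 -> R) (Ut t : R) (X : 'rV[R]_d.+1) :
  - TF < t -> H X ->
  (forall i Y, H Y -> is_derive Y 'e_i (U^~ t) (dU i Y)) ->
  (forall i, is_derive X 'e_i (dU i) (ddU i X)) ->
  is_derive t (1 : R) (U X) Ut ->
  Ut = - (\sum_i ddU i X + (1 - 2 * s) / X 0 ord0 * dU ord0 X).
Proof.
move=> tT X0 hdU hddU hUt; have x0 : 0 < X 0 ord0 by [].
have [M uM] := holder_bounded hu.
have mp := measurable_past um; have pM := past_le uM.
pose K := poisson_cst d s; pose g := past TF u.
pose h Y := hpot g (hker m Y t); pose h1 i Y := hpot g (hker1 m i Y t).
have powder (k : R) i (Y : 'rV[R]_d.+1) : H Y ->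
    is_derive Y 'e_i (fun X => X 0 ord0 `^ k) ((i == ord0)%:R * (k * Y 0 ord0 `^ (k - 1))).
  move=> Y0; have := is_derive_comp1 (is_derive_coord Y i ord0) (is_derive1_powR k Y0).
  by rewrite mulrC.
have EU : {in H, U^~ t =1 fun Y => K * (Y 0 ord0 `^ (2 * s) * h Y)}.
  by move=> Y; rewrite inE => Y0; rewrite (extensionE s0 um uM) // mulrA.
pose F (i : 'I_d.+1) (Y : 'rV[R]_d.+1) := K * ((i == ord0)%:R * (2 * s * Y 0 ord0 `^ (2 * s - 1)) * h Y + Y 0 ord0 `^ (2 * s) * h1 i Y).
have dF i Y : H Y -> dU i Y = F i Y.
  move=> Y0; apply: is_derive_unique (hdU i Y Y0) _.
  have := is_derive_scalel K (is_derive_mul (powder (2 * s) i Y Y0) (is_derive_hpot1 s0 mp pM i t Y0)).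
  apply: near_eq_is_derive; have := near_H Y0; apply: filterS => Z Z0.
  by rewrite EU ?inE.
have ddF i : ddU i X = K * ((i == ord0)%:R * (2 * s * ((2 * s - 1) * X 0 ord0 `^ (2 * s - 1 - 1)) * h X +
    2 * (2 * s * X 0 ord0 `^ (2 * s - 1) * h1 i X)) + X 0 ord0 `^ (2 * s) * hpot g (hker2 m i X t)).
  apply: is_derive_unique (hddU i) _.
  have e1 := is_derive_scalel (2 * s) (powder (2 * s - 1) i X X0).
  have e2 := is_derive_mul (is_derive_scalel (i == ord0)%:R e1) (is_derive_hpot1 s0 mp pM i t X0).
  have e3 := is_derive_mul (powder (2 * s) i X X0) (is_derive_hpot2 s0 mp pM i t X0).
  have e4 := is_derive_scalel K (is_derive_add e2 e3).
  have {}e4 := near_eq_is_derive _ e4.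
  have {e4} := e4 (dU i).
  set V1 := K * _; set V2 := K * _; have -> : V1 = V2.
    rewrite /V1 /V2 -/(h X) -/(h1 i X); case: (i == ord0) => /=; ring.
  by apply; have := near_H X0; apply: filterS => Z Z0; rewrite dF.
have Ht : Ut = K * (X 0 ord0 `^ (2 * s) * hpot g (hkert m X t)).
  apply: is_derive_unique hUt _.
  have := is_derive_scalel K (is_derive_scalel (X 0 ord0 `^ (2 * s)) (is_derive_hpot_time s0 mp pM t X0)).
  apply: near_eq_is_derive; near=> r.
  rewrite (extensionE s0 um uM) ?mulrA //; near: r; exact: lt_nbhsr.
rewrite Ht (eq_bigr _ (fun i _ => ddF i)) dF // /F.
have pde := hpot_pde s0 mp pM t X0.
rewrite -mulr_sumr big_split /= -mulr_sumr.
have delta (E : 'I_d.+1 -> R) : \sum_i (i == ord0)%:R * E i = E ord0.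
  rewrite (bigD1 ord0) //= mul1r big1 ?addr0 // => i /negbTE ->.
  by rewrite mul0r.
rewrite delta !mul1r.
have -> : hpot g (hkert m X t) = - (\sum_i hpot g (hker2 m i X t) + (1 + 2 * s) / X 0 ord0 * h1 ord0 X).
  by apply/eqP; rewrite -addr_eq0 addrC; apply/eqP; exact: pde.
have P1 : X 0 ord0 `^ (2 * s) = X 0 ord0 `^ (2 * s - 1 - 1) * X 0 ord0 * X 0 ord0.
  by rewrite -!powRS // !subrK.
have P2 : X 0 ord0 `^ (2 * s - 1) = X 0 ord0 `^ (2 * s - 1 - 1) * X 0 ord0.
  by rewrite -powRS // subrK.
rewrite P1 P2; move: (_ `^ _) (\sum_i _) (h X) (h1 ord0 X) => p S hX h1X.
by field; rewrite gt_eqF.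
Unshelve. all: by end_near. Qed.

(** Both sides are multiples of the integral of [pinc], and the constants match through
    [2 s poisson_cst = eta heat_cst]. *)
Lemma extension_flux (W : R) (dU : R -> R) (x : 'rV[R]_d) (t : R) : - TF < t ->
  (forall r : R, 0 < r -> is_derive r (1 : R) (fun r => U (consrv r x) t) (dU r)) ->
  (r `^ (1 - 2 * s) * dU r @[r --> (0 : R)^'+] --> W) ->
  W = - Defs.eta s * backward_heat s u x t.
Proof.
move=> tT dU' cW; have [M uM] := holder_bounded hu.
have [C C0 HC] := holder_increment hu; have [lin Hl] := HC x t tT.
(* Here the Hölder order above [2s] enters: it makes [pinc] integrable near elapsed time 0. *)
have kaps : s < (2 * s + eps) / 2 by rewrite ltr_pdivlMr // mulrC ltrDl; exact: eps0.
have q := extension_boundary_quotient s01 um uM kaps C0 tT Hl.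
rewrite (flux_of_quotient s0 dU' cW q) (backward_heatE s01 um uM kaps C0 tT Hl).
set I := Rintegral _ _ _.
have G0 := Gamma_gt0 s0; have G1 := normr_GammaN_gt0 s01.
have pp : 0 < pi `^ (d%:R / 2) :> R by rewrite powR_gt0 ?pi_gt0.
have p1 : 0 < 4 `^ (d%:R / 2) :> R by rewrite powR_gt0.
have p2 : 0 < 4 `^ s :> R by rewrite powR_gt0.
rewrite /Defs.eta /poisson_cst /heat_cst.
have -> : (4 * pi) `^ (d%:R / 2) = 4 `^ (d%:R / 2) * pi `^ (d%:R / 2) :> R.
  by rewrite powRM ?(ltW (pi_gt0 R)).
rewrite [_ `^ (d%:R / 2 + s)]powRD; last by apply/implyP.
move: G0 G1 pp p1 p2; move: (Gamma s) `|Gamma _| (pi `^ _) (4 `^ (_ / _)) (4 `^ s) => G G' P A B.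
by move=> G0 G1 P0 A0 B0; field; rewrite !gt_eqF.
Qed.

End extension_equation.

(** * Self-similar variables *)

Section regularity.
Context {R : realType}.

(** At an interior time the constraint that [t + h] lies in the interval holds for all small [h], so
    the restricted punctured filter is the full one. *)
Lemma derivable_in_interior (T t : R) (f : R -> R) : 0 < t < T ->
  derivable_in `[0, T] f t -> is_derive t (1 : R) f (derive_in `[0, T] f t).
Proof.
move=> /andP[t0 tT] df.
have E : within [set h | `[0, T]%classic (t + h)] (0 : R)^' = (0 : R)^'.
  rewrite eqEsubset; split => P; last exact: cvg_within.
  rewrite /within /= => PI.
  have n0 : \forall h \near (0 : R)^', `[0, T]%classic (t + h).
    apply: cvg_within; near=> h; rewrite /= in_itv /=; apply/andP; split.
      by rewrite -lerBlDl sub0r ltW //; near: h; apply: lt_nbhsr; rewrite oppr_lt0.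
    by rewrite -lerBrDl ltW //; near: h; apply: lt_nbhsl; rewrite subr_gt0.
  by apply: filterS2 n0 PI => h h1; apply.
have Q : (fun h : R => h^-1 *: ((f \o shift t) (h *: (1 : R)) - f t)) = fun h => h^-1 * (f (t + h) - f t).
  by apply/funext => h /=; rewrite [h%:A]mulr1 [h + t]addrC.
by move: df; rewrite /derive_in /derivable_in /diff_quot_in E => df; split; rewrite /derivable /derive Q.
Unshelve. all: by end_near. Qed.

Lemma continuous_on_cvg n (I : set R) (D : set 'rV[R]_n) (F : 'rV[R]_n -> R -> R) X t
    (S : Type) (G : set_system S) {FG : Filter G} (g : S -> 'rV[R]_n) (h : S -> R) :
  continuous_on I D F -> D X -> I t -> g s @[s --> G] --> X -> h s @[s --> G] --> t ->
  (\forall s \near G, D (g s) /\ I (h s)) -> F (g s) (h s) @[s --> G] --> F X t.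
Proof.
move=> cF DX It gX ht DI.
exact: (@within_cvg _ _ _ (fun P : 'rV[R]_n * R => F P.1 P.2) (X, t) S G _ (fun s => (g s, h s)) cF (conj DX It) (cvg_pair gX ht) DI).
Qed.

Lemma near_open_itv (T t : R) : 0 < t < T -> \forall r \near t, 0 < r < T.
Proof.
move=> /andP[t0 tT]; near=> r; apply/andP; split; near: r; [exact: lt_nbhsr|exact: lt_nbhsl].
Unshelve. all: by end_near. Qed.

Lemma continuous_on_interior (Z : topologicalType) n (D : set 'rV[R]_n) (T : R)
    (F : 'rV[R]_n -> R -> R) (g : Z -> 'rV[R]_n) (h : Z -> R) z :
  open D -> continuous_on `[0, T] D F -> D (g z) -> 0 < h z < T ->
  {for z, continuous g} -> {for z, continuous h} ->
  {for z, continuous (fun z => F (g z) (h z))}.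
Proof.
move=> oD cF Dz hz cg ch.
apply: (continuous_on_cvg cF Dz _ cg ch).
  by move/andP : hz => [h0 h1]; rewrite /= in_itv /= (ltW h0) (ltW h1).
have nD : \forall s \near z, D (g s) by apply: cg; exact: open_nbhs_nbhs.
have nI : \forall s \near z, 0 < h s < T by exact: (ch _ (near_open_itv hz)).
apply: filterS2 nD nI => s ? /andP[h0 h1]; split => //.
by rewrite /= in_itv /= (ltW h0) (ltW h1).
Qed.

End regularity.

Section self_similar.
Context {R : realType}.
Variables (n : nat) (T : R).
Local Notation H := (@halfspace R n).
Implicit Types (F : 'rV[R]_n.+1 -> R -> R) (t k : R) (X Y : 'rV[R]_n.+1).

Definition rescale k F t Y : R := t `^ k * F (Num.sqrt t *: Y) t.

Lemma halfspaceZ (c : R) X : 0 < c -> halfspace n (c *: X) <-> halfspace n X.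
Proof. by move=> c0; rewrite /halfspace /= mxE pmulr_rgt0. Qed.

Lemma cont_sqrt_scale (Z : topologicalType) (h : Z -> R) (g : Z -> 'rV[R]_n.+1) z :
  {for z, continuous h} -> {for z, continuous g} ->
  {for z, continuous (fun z => Num.sqrt (h z) *: g z)}.
Proof.
move=> ch cg; apply: continuous_rVP => i.
rewrite (_ : (fun _ => _) = fun z => Num.sqrt (h z) * g z 0 i); last by apply/funext => y; rewrite mxE.
apply: contM.
  by apply: (@cont_comp _ _ h Num.sqrt) => //; exact: sqrt_continuous.
apply: (@continuous_comp _ _ _ g (fun Y : 'rV[R]_n.+1 => Y 0 i)) => //; exact: continuous_coord.
Qed.

Lemma cont_rescale_joint k F (Z : 'rV[R]_n.+2) : continuous_on `[0, T] H F ->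
  0 < Z 0 ord0 < T -> H (behrv Z) ->
  {for Z, continuous (fun Z : 'rV[R]_n.+2 => rescale k F (Z 0 ord0) (behrv Z))}.
Proof.
move=> cF ZT HZ; have [Z0 _] := andP ZT.
have cc : {for Z, continuous (fun Z : 'rV[R]_n.+2 => Z 0 ord0)} by exact: continuous_coord.
apply: contM.
  by apply: (@cont_comp _ _ (fun Z : 'rV[R]_n.+2 => Z 0 ord0) (fun r => r `^ k)) => //; exact: cont_powR.
have HsZ : H (Num.sqrt (Z 0 ord0) *: behrv Z) by apply/halfspaceZ => //; rewrite sqrtr_gt0.
have cs : {for Z, continuous (fun Z : 'rV[R]_n.+2 => Num.sqrt (Z 0 ord0) *: behrv Z)}.
  by apply: cont_sqrt_scale => //; exact: continuous_behrv.
exact: (continuous_on_interior (g := fun Z : 'rV[R]_n.+2 => Num.sqrt (Z 0 ord0) *: behrv Z)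
  (@open_halfspace R n) cF HsZ ZT cs cc).
Qed.

Lemma cont_rescale k F t X : continuous_on `[0, T] H F -> 0 < t < T -> H X ->
  {for X, continuous (rescale k F t)}.
Proof.
move=> cF tT HX.
have tE : (fun X => rescale k F t X) =
    (fun Z : 'rV[R]_n.+2 => rescale k F (Z 0 ord0) (behrv Z)) \o (fun X => consrv t X).
  by apply/funext => Y /=; rewrite consrv0 behrv_consrv.
change {for X, continuous (fun X => rescale k F t X)}; rewrite tE.
apply: continuous_comp; first exact: continuous_consrv2.
by apply: cont_rescale_joint => //; rewrite ?consrv0 ?behrv_consrv.
Qed.

Lemma cont_rescale_closed k F t : continuous_on `[0, T] (closed_halfspace n) F -> 0 < t < T ->
  {within closed_halfspace n, continuous (rescale k F t)}.
Proof.
move=> cF /andP[t0 tT]; have s0 : 0 < Num.sqrt t by rewrite sqrtr_gt0.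
have It : `[0, T]%classic t by rewrite /= in_itv /= (ltW t0) (ltW tT).
apply/subspace_continuousP => X DX; apply: cvgM; first exact: cvg_cst.
apply: (continuous_on_cvg cF _ It).
- by move: DX; rewrite /closed_halfspace /= mxE pmulr_rge0.
- apply: cvg_within_filter; apply: cont_sqrt_scale; [exact: cont_cst|exact: cvg_id].
- exact: cvg_cst.
- rewrite near_withinE; apply: nearW => Y DY; split => //.
  by move: DY; rewrite /closed_halfspace /= mxE pmulr_rge0.
Qed.

Lemma is_derive_rescale k F dF t i X : 0 < t ->
  is_derive (Num.sqrt t *: X) 'e_i (F^~ t) (dF (Num.sqrt t *: X) t) ->
  is_derive X 'e_i (rescale k F t) (rescale (k + 2^-1) dF t X).
Proof.
move=> t0 hF; have s0 : 0 < Num.sqrt t by rewrite sqrtr_gt0.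
rewrite /rescale powRD; last by apply/implyP => _; rewrite gt_eqF.
rewrite powR12_sqrt ?(ltW t0) // -mulrA; apply: is_derive_scalel.
suff : is_derive (X + (0 : R) *: 'e_i) 'e_i (fun Y => F (Num.sqrt t *: Y) t)
  (Num.sqrt t * dF (Num.sqrt t *: X) t) by rewrite scale0r addr0.
apply/is_derive_line.
have := hF; rewrite -[X in is_derive X]addr0 -(scale0r 'e_i) => /is_derive_line h1.
have h1' : is_derive (Num.sqrt t * 0) (1 : R) (fun h => F (Num.sqrt t *: X + h *: 'e_i) t) (dF (Num.sqrt t *: X) t) by rewrite mulr0.
have h2 : is_derive (0 : R) (1 : R) (fun h : R => Num.sqrt t * h) (Num.sqrt t * 1).
  exact: is_derive_scalel.
have := is_derive_comp1 h2 h1'; rewrite mulr1 [_ * Num.sqrt t]mulrC.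
rewrite (_ : (fun h => _) = fun h => F (Num.sqrt t *: (X + h *: 'e_i)) t) //.
by apply/funext => h; rewrite scalerDr scalerA.
Qed.

(** The time derivative of [rescale], up to rescaling. For the extension and [k = s / (p - 1)] it is
    the expression that is squared in the dissipation. *)
Definition dilation k F Ft (dF : 'I_n.+1 -> 'rV[R]_n.+1 -> R -> R) X t : R :=
  Ft X t + (2 * t)^-1 * (\sum_i X 0 i * dF i X t) + k / t * F X t.

Lemma is_derive_rescale_time k F Ft dF t X : 0 < t < T -> H X ->
  continuous_on `[0, T] H Ft -> (forall i, continuous_on `[0, T] H (dF i)) ->
  (forall r Y, 0 < r < T -> H Y -> is_derive r (1 : R) (F Y) (Ft Y r)) ->
  (forall r Y i, 0 < r < T -> H Y -> is_derive Y 'e_i (F^~ r) (dF i Y r)) ->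
  is_derive t (1 : R) (fun r => rescale k F r X) (rescale k (dilation k F Ft dF) t X).
Proof.
move=> tT HX cFt cdF hFt hdF; have [t0 _] := andP tT.
have s0 : 0 < Num.sqrt t by rewrite sqrtr_gt0.
have nz : t != 0 by rewrite gt_eqF.
(* Time becomes coordinate 0 of a vector of dimension [n + 2], so that [is_derive_chain] applies
   along the curve [r |-> (r, sqrt(r) X)]. *)
pose f (Z : 'rV[R]_n.+2) := F (behrv Z) (Z 0 ord0).
pose df (i : 'I_n.+2) (Z : 'rV[R]_n.+2) :=
  oapp (fun j => dF j (behrv Z) (Z 0 ord0)) (Ft (behrv Z) (Z 0 ord0)) (unlift ord0 i).
pose c (r : R) := consrv r (Num.sqrt r *: X).
pose c' := consrv 1 ((2 * Num.sqrt t)^-1 *: X).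
have Hc : H (behrv (c t)) by rewrite behrv_consrv; apply/halfspaceZ.
have cc0 : {for c t, continuous (fun Z : 'rV[R]_n.+2 => Z 0 ord0)} by exact: continuous_coord.
have h1 : is_derive t (1 : R) (fun r => f (c r)) (\sum_i df i (c t) * c' 0 i).
  apply: is_derive_chain.
  - have n1 : \forall Z \near c t, H (behrv Z).
      by apply: continuous_behrv; apply: open_nbhs_nbhs; split => //; exact: open_halfspace.
    have n2 : \forall Z \near c t, 0 < (Z : 'rV[R]_n.+2) 0 ord0 < T.
      by apply: (cc0 [set r | 0 < r < T]); apply: near_open_itv; rewrite consrv0.
    apply: filterS2 n1 n2 => Z HZ ZT i; rewrite -[Z]consrv_behrv /df behrv_consrv consrv0.
    case: (unliftP ord0 i) => [j|] -> /=.
      apply/is_derive_consrvS; rewrite /f.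
      rewrite (_ : (fun z => _) = (F^~ (Z 0 ord0))); first exact: hdF.
      by apply/funext => z; rewrite behrv_consrv consrv0.
    apply/is_derive_consrv0; rewrite /f.
    rewrite (_ : (fun z => _) = F (behrv Z)); first exact: hFt.
    by apply/funext => z; rewrite behrv_consrv consrv0.
  - move=> i; rewrite /df; case: (unliftP ord0 i) => [j|] _ /=.
      by apply: (@continuous_on_interior R _ n.+1 H T (dF j) (@behrv R n.+1) (fun Z => Z 0 ord0) (c t) (@open_halfspace R n));
        rewrite ?consrv0 //; exact: continuous_behrv.
    by apply: (@continuous_on_interior R _ n.+1 H T Ft (@behrv R n.+1) (fun Z => Z 0 ord0) (c t) (@open_halfspace R n));
      rewrite ?consrv0 //; exact: continuous_behrv.
  - move=> i; rewrite /c /c'; case: (unliftP ord0 i) => [j|] ->.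
      rewrite consrvS mxE (_ : (fun r => _) = fun r => X 0 j * Num.sqrt r); last first.
        by apply/funext => r; rewrite consrvS mxE mulrC.
      rewrite [_ * X 0 j]mulrC; apply: is_derive_scalel.
      exact: is_derive1_sqrt.
    rewrite consrv0 (_ : (fun r => _) = id); first exact: is_derive_id.
    by apply/funext => r; rewrite consrv0.
have h2 := is_derive_mul (is_derive1_powR k t0) h1.
rewrite (_ : (fun r => rescale k F r X) = fun r => r `^ k * f (c r)); last first.
  by apply/funext => r; rewrite /rescale /f behrv_consrv consrv0.
apply: is_derive_eq h2 _.
rewrite /rescale /dilation /f big_ord_recl /df /c /c' unlift_none /= !consrv0 behrv_consrv mulr1.
under eq_bigr => i _ do rewrite liftK /= consrvS mxE mulrCA.
under [in RHS]eq_bigr => i _ do rewrite mxE -mulrA.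
rewrite -!mulr_sumr (_ : t `^ k = t `^ (k - 1) * t); last by rewrite -powRS // subrK.
have -> : (2 * t)^-1 * (Num.sqrt t * \sum_i X 0 i * dF i (Num.sqrt t *: X) t) =
  (2 * Num.sqrt t)^-1 * \sum_i X 0 i * dF i (Num.sqrt t *: X) t.
  rewrite -[in (2 * t)^-1](sqr_sqrtr (ltW t0)) mulrA; congr (_ * _).
  by field; rewrite gt_eqF.
under eq_bigr => i _ do rewrite mulrC.
move: (\sum_i _) (F _ t) (Ft _ t) (t `^ _) (2 * _)^-1 => A B C P Q.
by field.
Qed.

End self_similar.

(** * Families depending continuously on time in weighted L^2 *)

Section family_ipw.
Context {R : realType} {dsp : measure_display} {T : measurableType dsp}.
Variables (mu : {measure set T -> \bar R}) (D : set T) (w : T -> R).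
Hypothesis mD : measurable D.
Hypothesis w0 : forall x, D x -> 0 <= w x.
Hypothesis mw : measurable_fun D w.
Local Notation L2 := (L2w mu D w).
Local Notation ip := (ipw mu D w).
Variables (A : pred R) (t : R).
Hypothesis At : A t.
Hypothesis nA : \forall r \near t, A r.

Definition cont_L2 (f : R -> T -> R) := (forall r, A r -> L2 (f r)) /\
  ip (fun x => f r x - f t x) (fun x => f r x - f t x) @[r --> t] --> (0 : R).

Lemma cont_L2_ipw (f g : R -> T -> R) : cont_L2 f -> cont_L2 g ->
  ip (f r) (g r) @[r --> t] --> ip (f t) (g t).
Proof.
move=> [Lf cf] [Lg cg].
(* Freezing the family at [f t] outside [A] makes every member square integrable without changing it
   near [t]. *)
pose tr (f : R -> T -> R) r := if A r then f r else f t.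
have Ltr f1 : (forall r, A r -> L2 (f1 r)) -> forall r, L2 (tr f1 r).
  by move=> L1 r; rewrite /tr; case: ifPn => Ar; exact: L1.
have trE f1 : \forall r \near t, f1 r = tr f1 r.
  by apply: filterS nA => r Ar; rewrite /tr Ar.
have str f1 : ip (fun x => f1 r x - f1 t x) (fun x => f1 r x - f1 t x) @[r --> t] --> (0 : R) ->
    sconv mu D w (nbhs t) (tr f1) (f1 t).
  rewrite /sconv => c1; apply: cvg_trans c1; apply: near_eq_cvg.
  by apply: filterS (trE f1) => r ->.
apply: cvg_trans (sconv_ipw mD w0 mw (Ltr f Lf) (Lf t At) (Ltr g Lg) (Lg t At) (str f cf) (str g cg)).
by apply: near_eq_cvg; apply: filterS2 (trE f) (trE g) => r <- <-.
Qed.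

(** Meant for the three terms of [dilation]: time derivative, radial derivative and the function
    itself, the last two with coefficients that depend on time. Expanding the square leaves finitely
    many pairings, each of which converges. *)
Lemma cont_L2_comb_ipw (f g h : R -> T -> R) (b c : R -> R) :
  cont_L2 f -> cont_L2 g -> cont_L2 h ->
  b r @[r --> t] --> b t -> c r @[r --> t] --> c t ->
  let k r x := f r x + b r * g r x + c r * h r x in
  ip (k r) (k r) @[r --> t] --> ip (k t) (k t).
Proof.
move=> cf cg ch cb cc k.
have [[Lf _] [Lg _] [Lh _]] := And3 cf cg ch.
pose e r := ip (f r) (f r) + b r * b r * ip (g r) (g r) + c r * c r * ip (h r) (h r) +
  2 * (b r * ip (f r) (g r) + c r * ip (f r) (h r) + b r * c r * ip (g r) (h r)).
have kE r : A r -> ip (k r) (k r) = e r.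
  move=> Ar; have [F G K] := And3 (Lf r Ar) (Lg r Ar) (Lh r Ar).
  have bG := L2wZ mD (b r) G; have cK := L2wZ mD (c r) K.
  have FG := L2wD mD w0 mw F bG.
  have FGK := L2wD mD w0 mw FG cK.
  rewrite /k /e !(ipwDl mD w0 mw) // !(ipwDr mD w0 mw) // !(ipwZl mD w0 mw) //.
  rewrite !(ipwZr mD w0 mw) //.
  rewrite (ipwC mu D w (g r) (f r)) (ipwC mu D w (h r) (f r)) (ipwC mu D w (h r) (g r)).
  ring.
rewrite kE //; apply: (@cvg_trans _ (e r @[r --> t])).
  by apply: near_eq_cvg; apply: filterS nA => r Ar; rewrite kE.
have I1 := cont_L2_ipw cf cf; have I2 := cont_L2_ipw cg cg; have I3 := cont_L2_ipw ch ch.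
have I4 := cont_L2_ipw cf cg; have I5 := cont_L2_ipw cf ch; have I6 := cont_L2_ipw cg ch.
have c2 : (fun _ : R => 2 : R) r @[r --> t] --> (2 : R) by exact: cvg_cst.
have M f1 g1 (x y : R) : f1 r @[r --> t] --> x -> g1 r @[r --> t] --> y ->
  (f1 r * g1 r : R) @[r --> t] --> x * y by exact: cvgM.
have P f1 g1 (x y : R) : f1 r @[r --> t] --> x -> g1 r @[r --> t] --> y ->
  (f1 r + g1 r : R) @[r --> t] --> x + y by exact: cvgD.
have J := M _ _ _ _ c2 (P _ _ _ _ (P _ _ _ _ (M _ _ _ _ cb I4) (M _ _ _ _ cc I5)) (M _ _ _ _ (M _ _ _ _ cb cc) I6)).
exact: (P _ _ _ _ (P _ _ _ _ (P _ _ _ _ I1 (M _ _ _ _ (M _ _ _ _ cb cb) I2)) (M _ _ _ _ (M _ _ _ _ cc cc) I3)) J).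
Qed.

End family_ipw.

(** * Change to self-similar variables in the integrals *)

Section rescaled_integrals.
Context {R : realType}.
Local Notation mu := (@lebesgue_rV R).
Variables (n : nat) (a : R).
Local Notation H := (@halfspace R n).
Implicit Types (F : 'rV[R]_n.+1 -> R -> R) (t k : R) (X Y : 'rV[R]_n.+1).

Definition normal_weight X : R := X 0 ord0 `^ a.
(** The form in which [class_U] controls a function: squaring doubles the exponent and yields the
    weight [e^(-|X|^2/(4t))] of the functional. *)
Definition gauss8 F t X : R := expR (- sqnorm X / (8 * t)) * F X t.

Let mH : measurable H. Proof. exact: measurable_halfspace. Qed.

Lemma normal_weight_ge0 X : 0 <= normal_weight X. Proof. exact: powR_ge0. Qed.

Lemma measurable_normal_weight D : measurable_fun D normal_weight.
Proof.
apply: (@measurable_funTS _ _ _ _ D).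
rewrite (_ : normal_weight = (fun r : measurableTypeR R => r `^ a) \o (fun X => X 0 ord0)) //.
by apply: measurableT_comp; [exact: (measurable_powR a)|exact: measurable_coord].
Qed.

Lemma measurable_gaussian c t D :
  measurable_fun D (fun X : 'rV[R]_n.+1 => expR (- sqnorm X / (c * t))).
Proof.
apply: (@measurable_funTS _ _ _ _ D).
by apply: measurableT_comp => //; apply: measurable_funM => //; apply: measurableT_comp => //; exact: measurable_sqnorm.
Qed.

Lemma measurable_halfspaceZ (c : R) (f : 'rV[R]_n.+1 -> R) : 0 < c -> measurable_fun H f ->
  measurable_fun H (fun Y => f (c *: Y)).
Proof.
move=> c0 mf; apply: (measurable_comp (F := H)) => //.
- by move=> _ [Y HY <-]; apply/halfspaceZ.
- apply: (@measurable_funTS _ _ _ _ H); have := measurable_affine_rV c (0 : 'rV[R]_n.+1).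
  by under eq_fun do rewrite addr0.
Qed.

(** With [X = sqrt(t) Y] the Gaussian no longer depends on [t]. The Jacobian contributes
    [t^((n+1)/2)] and the power [X_0^a] contributes [t^(a/2)]. *)
Lemma ge0_integral_rescale t (f : 'rV[R]_n.+1 -> R) : 0 < t -> measurable_fun H f ->
  (forall X, H X -> 0 <= f X) ->
  (\int[mu n.+1]_(X in H) (normal_weight X * (f X * expR (- sqnorm X / (4 * t))))%:E =
   (t `^ ((n.+1%:R + a) / 2))%:E * \int[mu n.+1]_(Y in H) (gwt a Y * f (Num.sqrt t *: Y))%:E)%E.
Proof.
move=> t0 mf f0; have s0 : 0 < Num.sqrt t by rewrite sqrtr_gt0.
have mfs := measurable_halfspaceZ s0 mf.
have mg : measurable_fun H (fun X => normal_weight X * (f X * expR (- sqnorm X / (4 * t)))).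
  apply: measurable_funM; first exact: measurable_normal_weight.
  by apply: measurable_funM => //; exact: measurable_gaussian.
have mk : measurable_fun H (fun Y => gwt a Y * f (Num.sqrt t *: Y)).
  by apply: measurable_funM => //; exact: measurable_gwt_halfspace.
rewrite integral_mkcond (ge0_integral_affine_rV 0 (lt0r_neq0 s0)); first last.
- move=> X; rewrite patchE; case: ifPn => // /set_mem HX.
  by rewrite lee_fin mulr_ge0 ?normal_weight_ge0 // mulr_ge0 ?f0 ?expR_ge0.
- by apply/measurable_restrict => //; rewrite setTI; exact/measurable_EFinP.
have sa : `|Num.sqrt t| ^+ n.+1 = t `^ (n.+1%:R / 2).
  rewrite ger0_norm ?(ltW s0) // -powR12_sqrt ?(ltW t0) // -powR_mulrn ?powR_ge0 //.
  by rewrite -powRrM mulrC.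
have -> : t `^ ((n.+1%:R + a) / 2) = t `^ (n.+1%:R / 2) * t `^ (a / 2).
  by rewrite mulrDl powRD //; apply/implyP => _; rewrite gt_eqF.
rewrite sa.
rewrite EFinM -muleA; congr (_ * _)%E.
rewrite -ge0_integralZl //; first last.
- by rewrite lee_fin powR_ge0.
- by move=> Y HY; rewrite lee_fin mulr_ge0 ?gwt_ge0 // f0 //; apply/halfspaceZ.
- exact/measurable_EFinP.
rewrite [RHS]integral_mkcond; apply: eq_integral => Y _; rewrite !patchE addr0.
have -> : (Num.sqrt t *: Y \in H) = (Y \in H).
  by apply/idP/idP => /set_mem/halfspaceZ h; apply/mem_set; exact: h.
case: ifPn => // /set_mem HY; rewrite -EFinM; congr EFin.
rewrite /normal_weight /gwt sqnormZ sqr_sqrtr ?(ltW t0) // mxE.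
have -> : - (t * sqnorm Y) / (4 * t) = - (sqnorm Y / 4) by field; rewrite gt_eqF.
have -> : (Num.sqrt t * Y 0 ord0) `^ a = t `^ (a / 2) * Y 0 ord0 `^ a.
  rewrite powRM ?(ltW s0) ?(ltW HY) // -powR12_sqrt ?(ltW t0) // -powRrM.
  by rewrite (mulrC 2^-1).
ring.
Qed.

Lemma sqr_gauss8 F t X : 0 < t -> gauss8 F t X ^+ 2 = F X t ^+ 2 * expR (- sqnorm X / (4 * t)).
Proof.
move=> t0; rewrite /gauss8 exprMn mulrC [expR _ ^+ 2]expr2 -expRD; congr (_ * expR _).
by field; rewrite gt_eqF.
Qed.

Lemma measurable_gauss8 F t : 0 < t -> measurable_fun H (gauss8 F t) -> measurable_fun H (F^~ t).
Proof.
move=> t0 mF; rewrite (_ : F^~ t = fun X => (expR (- sqnorm X / (8 * t)))^-1 * gauss8 F t X).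
  apply: measurable_funM => //; under eq_fun do rewrite -expRN.
  apply: (@measurable_funTS _ _ _ _ H).
  apply: measurableT_comp => //; apply: measurableT_comp => //.
  by apply: measurable_funM => //; apply: measurableT_comp => //; exact: measurable_sqnorm.
by apply/funext => X; rewrite /gauss8 mulKf // gt_eqF // expR_gt0.
Qed.

Lemma integral_gwt_rescale F t : 0 < t -> L2w (mu n.+1) H normal_weight (gauss8 F t) ->
  (\int[mu n.+1]_(Y in H) (gwt a Y * F (Num.sqrt t *: Y) t ^+ 2)%:E =
   ((t `^ ((n.+1%:R + a) / 2))^-1 * ipw (mu n.+1) H normal_weight (gauss8 F t) (gauss8 F t))%:E)%E.
Proof.
move=> t0 LF; have mF := measurable_gauss8 t0 (measurable_L2w LF).
have q0 : 0 < t `^ ((n.+1%:R + a) / 2) by rewrite powR_gt0.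
rewrite EFinM (ipwE mH LF); under [in RHS]eq_integral => X _ do rewrite sqr_gauss8 //.
rewrite (@ge0_integral_rescale t (fun X => F X t ^+ 2)) //.
- by rewrite muleA -EFinM mulVf ?mul1e // gt_eqF.
- by apply: measurable_funX.
- by move=> X _; exact: sqr_ge0.
Qed.

Lemma L2w_rescale k F t : 0 < t -> L2w (mu n.+1) H normal_weight (gauss8 F t) ->
  L2w (mu n.+1) H (gwt a) (rescale k F t).
Proof.
move=> t0 LF; have mF := measurable_gauss8 t0 (measurable_L2w LF).
have s0 : 0 < Num.sqrt t by rewrite sqrtr_gt0.
apply: L2wZ => //; split; first exact: measurable_halfspaceZ mF.
apply/integrableP; split.
  apply/measurable_EFinP; apply: measurable_funM; first exact: measurable_gwt_halfspace.
  by apply: measurable_funX; exact: measurable_halfspaceZ mF.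
rewrite (_ : (\int[_]_(x in H) _ = \int[mu n.+1]_(Y in H) (gwt a Y * F (Num.sqrt t *: Y) t ^+ 2)%:E)%E).
  by rewrite integral_gwt_rescale // ltry.
by apply: eq_integral => Y _; rewrite /= ger0_norm // mulr_ge0 ?gwt_ge0 // sqr_ge0.
Qed.

Lemma ipw_rescale k F t : 0 < t -> L2w (mu n.+1) H normal_weight (gauss8 F t) ->
  ipw (mu n.+1) H (gwt a) (rescale k F t) (rescale k F t) =
  t `^ (2 * k) / t `^ ((n.+1%:R + a) / 2) *
    ipw (mu n.+1) H normal_weight (gauss8 F t) (gauss8 F t).
Proof.
move=> t0 LF; apply: EFin_inj; rewrite (ipwE mH (L2w_rescale k t0 LF)) /rescale.
rewrite -mulrA [RHS]EFinM -(integral_gwt_rescale t0 LF) -ge0_integralZl //; first last.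
- by rewrite lee_fin powR_ge0.
- by move=> Y HY; rewrite lee_fin mulr_ge0 ?gwt_ge0 // sqr_ge0.
- apply/measurable_EFinP; apply: measurable_funM; first exact: measurable_gwt_halfspace.
  apply: measurable_funX; apply: (@measurable_halfspaceZ _ (F^~ t)); first by rewrite sqrtr_gt0.
  exact: measurable_gauss8 (measurable_L2w LF).
apply: eq_integral => Y _; rewrite -EFinM; congr EFin.
by rewrite exprMn mulrCA; congr (_ * _); rewrite -powR_mulrn ?powR_ge0 // -powRrM mulrC.
Qed.

Lemma measurable_rV_coord m (f : 'rV[R]_n.+1 -> 'rV[R]_m) (i : 'I_m) (mf : measurable_fun H f) :
  measurable_fun H (fun X => f X 0 i).
Proof. exact: (measurableT_comp (measurable_coord i) mf). Qed.

Lemma wint_coord_le m (f : 'rV[R]_n.+1 -> 'rV[R]_m) i : (forall j, measurable_fun H (fun X => f X 0 j)) ->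
  (\int[mu n.+1]_(X in H) (normal_weight X * f X 0 i ^+ 2)%:E <= wint a (fun X => sqnorm (f X)))%E.
Proof.
move=> mf; apply: ge0_le_integral => //.
- by move=> X _; rewrite lee_fin mulr_ge0 ?normal_weight_ge0 // sqr_ge0.
- apply/measurable_EFinP; apply: measurable_funM; first exact: measurable_normal_weight.
  exact: measurable_funX.
- apply/measurable_EFinP; apply: measurable_funM; first exact: measurable_normal_weight.
  by apply: measurable_sum => j; exact: measurable_funX.
- by move=> X HX; rewrite lee_fin ler_wpM2l ?normal_weight_ge0 // sqr_coord_le.
Qed.

Lemma wint_coord_L2w m (f : 'rV[R]_n.+1 -> 'rV[R]_m) i : measurable_fun H f ->
  (wint a (fun X => sqnorm (f X)) < +oo)%E -> L2w (mu n.+1) H normal_weight (fun X => f X 0 i).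
Proof.
move=> mf fi; have mfi := measurable_rV_coord i mf.
split=> //; apply/integrableP; split.
  apply/measurable_EFinP; apply: measurable_funM; first exact: measurable_normal_weight.
  exact: measurable_funX.
apply: le_lt_trans fi; apply: le_trans (wint_coord_le i (fun j => measurable_rV_coord j mf)).
rewrite le_eqVlt; apply/orP; left; apply/eqP; apply: eq_integral => X _.
by rewrite /= ger0_norm // mulr_ge0 ?normal_weight_ge0 // sqr_ge0.
Qed.

(** The convergence in [bounded_continuous_wL2] is one of extended reals. Near [t] these are finite,
    and a single coordinate is bounded by the whole vector. *)
Lemma bounded_continuous_wL2_coord T m (f : 'rV[R]_n.+1 -> R -> 'rV[R]_m) i t : 0 < t < T ->
  bounded_continuous_wL2 a T f ->
  cont_L2 (mu n.+1) H normal_weight [pred r | 0 < r < T] t (fun r X => f X r 0 i).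
Proof.
move=> tT [fL fc _]; split=> [r rT|].
  by have [mf fi] := fL r rT; exact: wint_coord_L2w.
have mfr r : 0 < r < T -> measurable_fun H (f^~ r) by move=> rT; have [] := fL r rT.
have Lf r : 0 < r < T -> L2w (mu n.+1) H normal_weight (fun X => f X r 0 i).
  by move=> rT; have [mf fi] := fL r rT; exact: wint_coord_L2w.
have mB r : 0 < r < T -> forall j, measurable_fun H (fun X => (f X r - f X t) 0 j).
  move=> rT j; under eq_fun do rewrite !mxE.
  by apply: measurable_funB; apply: measurable_rV_coord; exact: mfr.
have /fine_cvgP[nfin fcv] := fc t tT.
apply: (squeeze_cvgr _ (cvg_cst 0) fcv).
apply: filterS2 (near_open_itv tT) nfin => r rT rfin.
rewrite ipw_ge0 => [|X _]; last exact: normal_weight_ge0.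
have Ld := L2wB mH (fun X _ => normal_weight_ge0 X) (@measurable_normal_weight H) (Lf r rT) (Lf t tT).
rewrite /= -lee_fin [leRHS]fineK // (ipwE mH Ld).
have := wint_coord_le i (mB r rT); apply: le_trans.
rewrite le_eqVlt; apply/orP; left; apply/eqP; apply: eq_integral => X _.
by rewrite !mxE.
Qed.

End rescaled_integrals.

Lemma fpow_scale {R : realType} (p c v : R) : 0 < c -> fpow p (c * v) = c `^ p * fpow p v.
Proof.
move=> c0; rewrite /fpow normrM (ger0_norm (ltW c0)) powRM ?normr_ge0 ?(ltW c0) //.
have -> : c `^ p = c `^ (p - 1) * c by rewrite -powRS // subrK.
ring.
Qed.

(** * The rescaled extension and its energy *)

Section self_similar_extension.
Context {R : realType}.
Local Notation mu := (@lebesgue_rV R).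
Variables (d : nat) (s p TF T eps : R) (u : 'rV[R]_d -> R -> R).
Hypothesis s01 : 0 < s < 1.
Hypothesis p1 : 1 < p.
Hypothesis eps0 : 0 < eps.
Hypothesis hu : parabolic_holder (2 * s + eps) (setT `*` [set` `]- TF, +oo[]) u.
Hypothesis equ : forall x t, 0 < t < T -> backward_heat s u x t = fpow p (u x t).
Hypothesis TF0 : - TF < 0.
Hypothesis hU : class_U (1 - 2 * s) T (extension s u).
Local Notation H := (@halfspace R d).
Local Notation U := (extension s u).
Local Notation a := (1 - 2 * s).
Local Notation I := (`[0, T]%classic).
Let be := 2 * s / (p - 1).
(** The scaling exponent, characterised by [k p = k + s]: with it the rescaled boundary condition
    and the energy contain no power of [t]. *)
Let k := be / 2.
Let Ut := pderive I None U.
Let dU i := pderive I (Some i) U.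
Let ddU i := pderive I (Some i) (dU i).
Let D := dilation k U Ut dU.
Let V := rescale k U.
Let Vd := rescale k D.
Let dV t i := rescale (k + 2^-1) (dU i) t.
Let ddV t i := rescale (k + 2^-1 + 2^-1) (ddU i) t.

Let s0 : 0 < s. Proof. by case/andP: s01. Qed.
Let p10 : 0 < p - 1. Proof. by rewrite subr_gt0. Qed.
Let be0 : 0 <= be. Proof. by rewrite divr_ge0 ?(ltW p10) // mulr_ge0 ?(ltW s0). Qed.
Let TFt t : 0 < t < T -> - TF < t. Proof. by case/andP => t0 _; exact: lt_trans t0. Qed.
Let It t : 0 < t < T -> I t. Proof. by case/andP => t0 tT; rewrite /= in_itv /= (ltW t0) (ltW tT). Qed.

Let C1U : C1_on I H U. Proof. by case: hU => -[[]]. Qed.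
Let C1dU v : C1_on I H (pderive I v U). Proof. by case: hU => -[[_ h] _] _ _ _; exact: h. Qed.
Let cU : continuous_on I H U. Proof. by case: C1U. Qed.
Let cU0 : continuous_on I (closed_halfspace d) U. Proof. by case: hU => -[]. Qed.
Let cUt : continuous_on I H Ut. Proof. by have [_ h] := C1U; exact: (h None).2. Qed.
Let cdU i : continuous_on I H (dU i). Proof. by have [_ h] := C1U; exact: (h (Some i)).2. Qed.
Let cddU i : continuous_on I H (ddU i).
Proof. by have [_ h] := C1dU (Some i); exact: (h (Some i)).2. Qed.

Let isUt t X : 0 < t < T -> H X -> is_derive t (1 : R) (U X) (Ut X t).
Proof.
move=> tT HX; apply: derivable_in_interior => //.
by have [_ h] := C1U; apply: (h None).1 => //; exact: It.
Qed.

Let isdU t i X : 0 < t < T -> H X -> is_derive X 'e_i (U^~ t) (dU i X t).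
Proof.
move=> tT HX; apply: DeriveDef => //.
by have [_ h] := C1U; apply: (h (Some i)).1 => //; exact: It.
Qed.

Let isddU t i X : 0 < t < T -> H X -> is_derive X 'e_i (dU i ^~ t) (ddU i X t).
Proof.
move=> tT HX; apply: DeriveDef => //.
by have [_ h] := C1dU (Some i); apply: (h (Some i)).1 => //; exact: It.
Qed.

Let HZ t X : 0 < t < T -> H X -> H (Num.sqrt t *: X).
Proof. by case/andP => t0 _ HX; apply/halfspaceZ => //; rewrite sqrtr_gt0. Qed.

Let pdeU t X : 0 < t < T -> H X ->
  Ut X t = - (\sum_i ddU i X t + a / X 0 ord0 * dU ord0 X t).
Proof.
move=> tT HX.
apply: (extension_pde s01 hu (dU := fun i Y => dU i Y t) (ddU := fun i Y => ddU i Y t) (TFt tT) HX).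
- by move=> i Y HY; exact: isdU.
- by move=> i; exact: isddU.
- exact: isUt.
Qed.

(** The drift and the zero-order term are the scaling part of [t Vd]; what is left is the equation
    of the extension at [sqrt(t) X]. *)
Let pdeV t X : 0 < t < T -> H X ->
  \sum_i ddV t i X + a / X 0 ord0 * dV t ord0 X - \sum_i X 0 i / 2 * dV t i X =
  be / 2 * V t X - t * Vd t X.
Proof.
move=> tT HX; have [t0 _] := andP tT.
have q0 : 0 < Num.sqrt t by rewrite sqrtr_gt0.
have P r : t `^ (r + 2^-1) = t `^ r * Num.sqrt t.
  by rewrite powRD ?powR12_sqrt ?(ltW t0) //; apply/implyP => _; rewrite gt_eqF.
rewrite /ddV /dV /V /Vd /rescale /D /dilation !P (pdeU tT (HZ tT HX)).
rewrite -!mulr_sumr mxE -/k.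
have -> : \sum_i X 0 i / 2 * (t `^ k * Num.sqrt t * dU i (Num.sqrt t *: X) t) =
    t `^ k / 2 * \sum_i (Num.sqrt t *: X) 0 i * dU i (Num.sqrt t *: X) t.
  by rewrite mulr_sumr; apply: eq_bigr => i _; rewrite mxE; field.
have X0 : X 0 ord0 != 0 by rewrite gt_eqF.
have tq : t = Num.sqrt t * Num.sqrt t by rewrite -expr2 sqr_sqrtr // ltW.
move: X0 tq (lt0r_neq0 q0) (lt0r_neq0 t0) => {P}.
move: (\sum_i ddU i (Num.sqrt t *: X) t) (dU ord0 _ t) => A B.
move: (\sum_i (Num.sqrt t *: X) 0 i * dU i (Num.sqrt t *: X) t) => C.
move: (extension s u _ t) => F.
move: (t `^ k) (Num.sqrt t) (X 0 ord0) => P q x.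
by move=> x0 tq qn tn; rewrite tq; field; rewrite x0 qn.
Qed.

Variable W : 'rV[R]_d.+1 -> R -> R.
Hypothesis cW : continuous_on I (closed_halfspace d) W.
Hypothesis WE : forall X t, H X -> t \in `[0, T] -> W X t = X 0 ord0 `^ a * 'D_('e_ord0) (U^~ t) X.
(** The exponent is forced by [t^(k+s) sqrt(t)^a = t^(k+1/2)], the scaling factor of the gradient
    [dV]. *)
Let N := rescale (k + s) W.

Let extension0 x t : U (consrv 0 x) t = u x t.
Proof. by rewrite /extension consrv0 ltxx behrv_consrv. Qed.

Let fluxU x t : 0 < t < T -> W (consrv 0 x) t = - Defs.eta s * fpow p (u x t).
Proof.
move=> tT; rewrite -equ //.
apply: (extension_flux s01 eps0 hu (dU := fun r => dU ord0 (consrv r x) t) (TFt tT)).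
  move=> r r0; apply/(is_derive_consrv0 (fun X => U X t)); apply: isdU => //.
  by rewrite /halfspace /= consrv0.
have nz : \forall r \near (0 : R)^'+, 0 < r by exact: nbhs_right_gt.
have h : W (consrv r x) t @[r --> (0 : R)^'+] --> W (consrv 0 x) t.
  apply: (continuous_on_cvg (g := fun r => consrv r x) (h := fun=> t) cW _ (It tT)).
  - by rewrite /closed_halfspace /= consrv0.
  - by apply: cvg_at_right_filter; exact: continuous_consrv1.
  - exact: cvg_cst.
  - apply: filterS nz => r r0; split; last exact: It.
    by rewrite /closed_halfspace /= consrv0 ltW.
apply: cvg_trans h; apply: near_eq_cvg; apply: filterS nz => r r0.
rewrite WE; [by rewrite consrv0|by rewrite /halfspace /= consrv0|].
by have := It tT.
Qed.

Let fluxV t y : 0 < t < T -> N t (consrv 0 y) = - Defs.eta s * fpow p (V t (consrv 0 y)).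
Proof.
move=> tT; have [t0 _] := andP tT.
rewrite /N /V /rescale !consrvZ !mulr0 fluxU // extension0 fpow_scale ?powR_gt0 //.
rewrite -powRrM (_ : k * p = k + s); first by ring.
by rewrite /k /be; field; rewrite gt_eqF.
Qed.

Let NE t X : 0 < t < T -> H X -> N t X = X 0 ord0 `^ a * dV t ord0 X.
Proof.
move=> tT HX; have [t0 _] := andP tT; have q0 : 0 < Num.sqrt t by rewrite sqrtr_gt0.
rewrite /N /dV /rescale WE; [|exact: HZ|by have := It tT].
have e : t `^ (k + s) * Num.sqrt t `^ a = t `^ (k + 2^-1).
  rewrite -powR12_sqrt ?(ltW t0) // -powRrM -powRD; last by apply/implyP => _; rewrite gt_eqF.
  by congr (_ `^ _); field.
by rewrite mxE powRM ?(ltW q0) ?(ltW HX) // !mulrA e /dU /pderive; ring.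
Qed.

Let gaussL2 (F : 'rV[R]_d.+1 -> R -> R) t : 0 < t < T ->
  bounded_continuous_wL2 a T (fun X t => (expR (- sqnorm X / (8 * t)) * F X t)%:M : 'rV_1) ->
  cont_L2 (mu d.+1) H (normal_weight a) [pred r | 0 < r < T] t (gauss8 F).
Proof.
move=> tT /(bounded_continuous_wL2_coord ord0 tT).
rewrite (_ : (fun r X => _) = gauss8 F) //.
by apply/funext => r; apply/funext => X; rewrite mxE eqxx mulr1n.
Qed.

Let DU X t := dotrv X (grad (U^~ t) X).

Let L2U t : 0 < t < T -> cont_L2 (mu d.+1) H (normal_weight a) [pred r | 0 < r < T] t (gauss8 U).
Proof. by move=> tT; have [_ _ [h1 h2 h3 h4] _] := hU; exact: gaussL2 tT h2. Qed.

Let L2DU t : 0 < t < T -> cont_L2 (mu d.+1) H (normal_weight a) [pred r | 0 < r < T] t (gauss8 DU).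
Proof. by move=> tT; have [_ _ [h1 h2 h3 h4] _] := hU; exact: gaussL2 tT h3. Qed.

Let L2Ut t : 0 < t < T -> cont_L2 (mu d.+1) H (normal_weight a) [pred r | 0 < r < T] t (gauss8 Ut).
Proof. by move=> tT; have [_ _ [h1 h2 h3 h4] _] := hU; exact: gaussL2 tT h4. Qed.

Let L2dU t i : 0 < t < T -> L2w (mu d.+1) H (normal_weight a) (gauss8 (dU i) t).
Proof.
move=> tT; have [_ _ [h _ _ _] _] := hU.
have [/(_ t tT)] := bounded_continuous_wL2_coord i tT h.
by under eq_fun do rewrite mxE mxE.
Qed.

Let gauss8D r X : gauss8 D r X = gauss8 Ut r X + (2 * r)^-1 * gauss8 DU r X + k / r * gauss8 U r X.
Proof.
rewrite /gauss8 /D /dilation /DU /dotrv.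
have -> : \sum_(i < d.+1) X 0 i * grad (U^~ r) X 0 i = \sum_i X 0 i * dU i X r.
  by apply: eq_bigr => i _; rewrite mxE.
ring.
Qed.

Let mH : measurable H. Proof. exact: measurable_halfspace. Qed.
Let w0 (X : 'rV[R]_d.+1) : H X -> 0 <= normal_weight a X.
Proof. by move=> _; exact: normal_weight_ge0. Qed.
Let mw : measurable_fun H (normal_weight (n := d) a). Proof. exact: measurable_normal_weight. Qed.

Let L2D t : 0 < t < T -> L2w (mu d.+1) H (normal_weight a) (gauss8 D t).
Proof.
move=> tT; rewrite (_ : gauss8 D t = fun X => gauss8 Ut t X + (2 * t)^-1 * gauss8 DU t X + k / t * gauss8 U t X).
  apply: L2wD => //; last by apply: L2wZ => //; exact: (L2U tT).1.
  by apply: L2wD => //; [exact: (L2Ut tT).1|apply: L2wZ => //; exact: (L2DU tT).1].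
by apply/funext => X; exact: gauss8D.
Qed.

(** Strong continuity in the original variables does not pass directly to [Vd], because the dilation
    moves the points. The norm only picks up a power of [t], so its continuity survives; pointwise
    convergence restores strong convergence in [sconv_Vd]. *)
Let norm_Vd (t : R) : 0 < t < T ->
  ipw (mu d.+1) H (gwt a) (Vd r) (Vd r) @[r --> t] --> ipw (mu d.+1) H (gwt a) (Vd t) (Vd t).
Proof.
move=> tT; have [t0 _] := andP tT.
pose e r := r `^ (2 * k) / r `^ ((d.+1%:R + a) / 2) *
  ipw (mu d.+1) H (normal_weight a) (gauss8 D r) (gauss8 D r).
have eE r : 0 < r < T -> ipw (mu d.+1) H (gwt a) (Vd r) (Vd r) = e r.
  by move=> rT; have [r0 _] := andP rT; rewrite /Vd ipw_rescale //; exact: L2D.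
rewrite eE //; apply: (@cvg_trans _ (e r @[r --> t])).
  by apply: near_eq_cvg; apply: filterS (near_open_itv tT) => r rT; rewrite eE.
apply: (@contM _ _ (fun r => r `^ (2 * k) / r `^ ((d.+1%:R + a) / 2))
  (fun r => ipw (mu d.+1) H (normal_weight a) (gauss8 D r) (gauss8 D r)) t).
  apply: contM; first exact: cont_powR.
  by apply: contV; [rewrite gt_eqF // powR_gt0|exact: cont_powR].
have tV : (fun r : R => r^-1) r @[r --> t] --> t^-1 by apply: cvgV; [rewrite gt_eqF|exact: cvg_id].
have := cont_L2_comb_ipw mH w0 mw (A := [pred r | 0 < r < T]) tT (near_open_itv tT)
  (L2Ut tT) (L2DU tT) (L2U tT) (b := fun r => (2 * r)^-1) (c := fun r => k / r) _ _.
rewrite /=; set K := (fun (r : R) (x : 'rV[R]_d.+1) => gauss8 Ut r x + (2 * r)^-1 * gauss8 DU r x + k / r * gauss8 U r x) => h.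
rewrite (_ : (fun r => ipw _ _ _ (gauss8 D r) _) = fun r => ipw (mu d.+1) H (normal_weight a) (K r) (K r)).
  apply: h; last by apply: cvgM => //; exact: cvg_cst.
  by apply: cvgV; [rewrite gt_eqF // mulr_gt0|apply: cvgM; [exact: cvg_cst|exact: cvg_id]].
by apply/funext => r; congr ipw; apply/funext => X; exact: gauss8D.
Qed.

Let cVd (Z : 'rV[R]_d.+2) : 0 < Z 0 ord0 < T -> H (behrv Z) ->
  {for Z, continuous (fun Z : 'rV[R]_d.+2 => Vd (Z 0 ord0) (behrv Z))}.
Proof.
move=> ZT HZ'; have [Z0 _] := andP ZT.
have cc : {for Z, continuous (fun Z : 'rV[R]_d.+2 => Z 0 ord0)} by exact: continuous_coord.
have cV' : {for Z, continuous (fun Z : 'rV[R]_d.+2 => (Z 0 ord0)^-1)} by apply: contV; rewrite ?gt_eqF.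
rewrite (_ : (fun _ => _) = fun Z : 'rV[R]_d.+2 => rescale k Ut (Z 0 ord0) (behrv Z) +
  (2^-1 * (Z 0 ord0)^-1) * (\sum_i (Num.sqrt (Z 0 ord0) *: behrv Z) 0 i * rescale k (dU i) (Z 0 ord0) (behrv Z)) +
  k * (Z 0 ord0)^-1 * rescale k U (Z 0 ord0) (behrv Z)).
  apply: contD; first apply: contD.
  - exact: cont_rescale_joint cUt ZT HZ'.
  - apply: contM; first by apply: contM => //; exact: cont_cst.
    apply: cont_sum => i.
    apply: (@contM _ _ (fun Z : 'rV[R]_d.+2 => (Num.sqrt (Z 0 ord0) *: behrv Z) 0 i)
      (fun Z : 'rV[R]_d.+2 => rescale k (dU i) (Z 0 ord0) (behrv Z))); last exact: cont_rescale_joint (@cdU i) ZT HZ'.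
    apply: (@continuous_comp _ _ _ (fun Z : 'rV[R]_d.+2 => Num.sqrt (Z 0 ord0) *: behrv Z)
      (fun Y : 'rV[R]_d.+1 => Y 0 i)); last exact: continuous_coord.
    by apply: cont_sqrt_scale => //; exact: continuous_behrv.
  - apply: contM; first by apply: contM => //; exact: cont_cst.
    exact: cont_rescale_joint cU ZT HZ'.
apply/funext => Y; rewrite /Vd /rescale /D /dilation invfM.
under [in RHS]eq_bigr => i _ do rewrite mulrCA.
rewrite -mulr_sumr; ring.
Qed.

Lemma is_derive_self_similar_energy t : 0 < t < T ->
  is_derive t (1 : R) (energy a be (Defs.eta s) p V dV) (t * ipw (mu d.+1) H (gwt a) (Vd t) (Vd t)).
Proof.
have [M uM] := holder_bounded hu.
have eta0 : 0 <= Defs.eta s.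
  have ? := Gamma_gt0 s0.
  by rewrite /Defs.eta; apply: divr_ge0; apply: mulr_ge0; rewrite ?powR_ge0 ?normr_ge0 //; [exact: mulr_ge0 (ltW s0)|exact: ltW].
have a1 : a < 1 by rewrite ltrBlDr ltrDl mulr_gt0.
have pt t' : 0 < t' < T -> 0 < t' by case/andP.
(* Since [k >= 0], the factor [t^k] is at most [T^k] on the interval, and [T^k M] bounds the trace
   of [V] at all times. *)
apply: (@is_derive_energy _ d a be (Defs.eta s) p (T `^ k * M) T V Vd N dV ddV) => //.
- by move=> t' i X tT HX; apply: is_derive_rescale; [exact: pt tT|apply: isdU => //; exact: HZ].
- by move=> t' i X tT HX; apply: is_derive_rescale; [exact: pt tT|apply: isddU => //; exact: HZ].
- by move=> t' X tT HX; exact: cont_rescale cU tT HX.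
- by move=> t' i X tT HX; exact: cont_rescale (@cdU i) tT HX.
- by move=> t' i X tT HX; exact: cont_rescale (@cddU i) tT HX.
- by move=> t' X tT HX; exact: (is_derive_rescale_time k tT HX cUt (fun i => @cdU i) isUt (fun r Y i h1 h2 => isdU i h1 h2)).
- by move=> t' tT; exact: cont_rescale_closed cU0 tT.
- by move=> t' tT; exact: cont_rescale_closed cW tT.
- move=> t' y tT; have [t0 tT'] := andP tT.
  rewrite /V /rescale consrvZ mulr0 extension0 normrM ger0_norm ?powR_ge0 //.
  apply: ler_pM; rewrite ?powR_ge0 ?normr_ge0 //; last by apply: uM; exact: TFt.
  by apply: ge0_ler_powR; rewrite ?nnegrE ?(ltW t0) ?(ltW tT') ?(ltW (lt_trans t0 tT')) // divr_ge0.
- by move=> t' tT; apply: L2w_rescale; [exact: pt tT|exact: (L2U tT).1].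
- by move=> t' i tT; apply: L2w_rescale; [exact: pt tT|exact: L2dU].
- by move=> t' tT; apply: L2w_rescale; [exact: pt tT|exact: L2D].
Qed.

Let c0 := ((4 * pi) `^ (d%:R / 2) * Gamma s)^-1 : R.
(** The exponent of [t] in [calG] equals the one produced by [ge0_integral_rescale]. This
    coincidence is what makes the kernel normalise the functional. *)
Let q := (d.+1%:R + a) / 2 : R.
Let C (t : R) := c0 * (t `^ (be + 1) / t `^ q).

Let qE : d%:R / 2 + 1 - s = q. Proof. by rewrite /q -natr1; field. Qed.

Let calGsE (X : 'rV[R]_d.+1) t : calGs s p X t = C t * expR (- sqnorm X / (4 * t)).
Proof. by rewrite /calGs /calG /C -/be -/c0 qE; ring. Qed.

Let integrand (F : 'rV[R]_d.+1 -> R -> R) (X : 'rV[R]_d.+1) t : 0 < t ->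
  X 0 ord0 `^ a * F X t ^+ 2 * calGs s p X t = C t * (normal_weight a X * gauss8 F t X ^+ 2).
Proof. by move=> t0; rewrite calGsE sqr_gauss8 // /normal_weight; ring. Qed.

Let integrable_integrand F t : 0 < t -> L2w (mu d.+1) H (normal_weight a) (gauss8 F t) ->
  (mu d.+1).-integrable H (EFin \o (fun X : 'rV[R]_d.+1 => X 0 ord0 `^ a * F X t ^+ 2 * calGs s p X t)).
Proof.
move=> t0 [_ LF]; rewrite (_ : (fun X => _) = fun X => C t * (normal_weight a X * gauss8 F t X ^+ 2)).
  exact: integrableZR.
by apply/funext => X; exact: integrand.
Qed.

(** [k'] is left free because gradients are rescaled with exponent [k + 1/2], while the extension
    and its dilation are rescaled with [k]. *)
Let Rintegral_integrand k' F t : 0 < t -> L2w (mu d.+1) H (normal_weight a) (gauss8 F t) ->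
  \int[mu d.+1]_(X in H) (X 0 ord0 `^ a * F X t ^+ 2 * calGs s p X t) =
  c0 * (t `^ (be + 1) / t `^ (2 * k')) * ipw (mu d.+1) H (gwt a) (rescale k' F t) (rescale k' F t).
Proof.
move=> t0 LF; rewrite (ipw_rescale k' t0 LF) -/q.
have k0 : t `^ (2 * k') != 0 by rewrite gt_eqF // powR_gt0.
have -> : c0 * (t `^ (be + 1) / t `^ (2 * k')) * (t `^ (2 * k') / t `^ q *
    ipw (mu d.+1) H (normal_weight a) (gauss8 F t) (gauss8 F t)) =
    C t * ipw (mu d.+1) H (normal_weight a) (gauss8 F t) (gauss8 F t).
  rewrite /C; move: (ipw _ _ _ _ _) ((t `^ q)^-1) => A B; by field.
rewrite /ipw -RintegralZl //; last exact: L2w_mul.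
by apply: eq_Rintegral => X _; rewrite integrand // expr2.
Qed.

Let calJ_gradient t : 0 < t < T ->
  \int[mu d.+1]_(X in H) (X 0 ord0 `^ a * (sqnorm (grad (U^~ t) X) / 2) * calGs s p X t) =
  c0 * (2^-1 * \sum_i ipw (mu d.+1) H (gwt a) (dV t i) (dV t i)).
Proof.
move=> tT; have [t0 _] := andP tT.
transitivity (\int[mu d.+1]_(X in H) (\sum_i 2^-1 * (X 0 ord0 `^ a * dU i X t ^+ 2 * calGs s p X t))).
  apply: eq_Rintegral => X _; rewrite /sqnorm -mulr_sumr -mulr_suml -mulr_sumr.
  under eq_bigr => i _ do rewrite mxE.
  by rewrite /dU /=; ring.
rewrite Rintegral_sumR //; last first.
  by move=> i; apply: integrableZR => //; apply: integrable_integrand => //; exact: L2dU.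
rewrite mulrCA !mulr_sumr; apply: eq_bigr => i _.
rewrite RintegralZl //; last by apply: integrable_integrand => //; exact: L2dU.
rewrite (Rintegral_integrand (k + 2^-1)) //; last exact: L2dU.
rewrite (_ : 2 * (k + 2^-1) = be + 1); last by rewrite /k; field.
by rewrite divff ?mulr1 // gt_eqF // powR_gt0.
Qed.

Let calJ_mass t : 0 < t < T ->
  s / (p - 1) * \int[mu d.+1]_(X in H) (X 0 ord0 `^ a * (U X t ^+ 2 / (2 * t)) * calGs s p X t) =
  c0 * (be / 4 * ipw (mu d.+1) H (gwt a) (V t) (V t)).
Proof.
move=> tT; have [t0 _] := andP tT; have LU := (L2U tT).1 t tT.
transitivity (s / (p - 1) * \int[mu d.+1]_(X in H)
    ((2 * t)^-1 * (X 0 ord0 `^ a * U X t ^+ 2 * calGs s p X t))).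
  by congr (_ * _); apply: eq_Rintegral => X _; ring.
rewrite RintegralZl //; last exact: integrable_integrand.
rewrite (Rintegral_integrand k) // (_ : 2 * k = be); last by rewrite /k; field.
rewrite powRS // /V /be; have b0 : t `^ (2 * s / (p - 1)) != 0 by rewrite gt_eqF // powR_gt0.
have nt : t != 0 by rewrite gt_eqF.
have np : p - 1 != 0 by rewrite gt_eqF.
move: (ipw _ _ _ _ _) (t `^ _) b0 => A B b0; field.
by rewrite np nt b0.
Qed.

Let trace_measurable t : 0 < t < T -> measurable_fun setT (u^~ t).
Proof.
move=> tT; apply: continuous_measurable_rV; first exact: openT.
move=> y _; rewrite (_ : u^~ t = fun y => U (consrv 0 y) t); last by apply/funext => z; rewrite extension0.
apply: (@continuous_on_cvg R d.+1 I _ U (consrv 0 y) t _ (nbhs y) (nbhs_filter y) (fun y => consrv 0 y) (fun=> t) cU0 _ (It tT)).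
- by rewrite /closed_halfspace /= consrv0.
- exact: continuous_consrv2.
- exact: cvg_cst.
- by apply: nearW => z; split; [rewrite /closed_halfspace /= consrv0|exact: It].
Qed.

Let calJ_boundary t : 0 < t < T ->
  Defs.eta s / (p + 1) * \int[mu d]_x (`|u x t| `^ (p + 1) * calGs_tilde s p x t) =
  c0 * (Defs.eta s * \int[mu d]_y (expR (- (sqnorm y / 4)) * Fpow p (V t (consrv 0 y)))).
Proof.
move=> tT; have [t0 _] := andP tT; have [M uM] := holder_bounded hu.
have q0 : 0 < Num.sqrt t by rewrite sqrtr_gt0.
have pp : 0 < p + 1 by rewrite addr_gt0 // (lt_trans ltr01).
have mu' := trace_measurable tT.
have GE (x : 'rV[R]_d) : calGs_tilde s p x t = C t * expR (- (sqnorm x / (4 * t))).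
  by have := calGsE (consrv 0 x) t; rewrite sqnorm_consrv expr0n add0r mulNr.
have VE y : Fpow p (V t (consrv 0 y)) = t `^ (k * (p + 1)) / (p + 1) * `|u (Num.sqrt t *: y) t| `^ (p + 1).
  rewrite /Fpow /V /rescale consrvZ mulr0 extension0 normrM ger0_norm ?powR_ge0 //.
  by rewrite powRM ?powR_ge0 ?normr_ge0 // -powRrM; ring.
rewrite (Rintegral_affine_rV 0 (lt0r_neq0 q0)); last first.
  apply: measurable_funM.
    exact: (measurableT_comp (measurable_powR _) (measurableT_comp (@normr_measurable R setT) mu')).
  under eq_fun do rewrite GE.
  apply: measurable_funM => //; apply: measurableT_comp => //; apply: measurable_funN.
  by apply: measurable_funM => //; exact: measurable_sqnorm.
pose K := C t * (p + 1) / t `^ (k * (p + 1)).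
have kn : t `^ (k * (p + 1)) != 0 by rewrite gt_eqF // powR_gt0.
under eq_Rintegral => y _.
  rewrite (_ : _ * _ = K * (expR (- (sqnorm y / 4)) * Fpow p (V t (consrv 0 y)))); last first.
    rewrite addr0 GE VE sqnormZ sqr_sqrtr ?(ltW t0) // /K.
    have -> : t * sqnorm y / (4 * t) = sqnorm y / 4 by field; rewrite gt_eqF.
    move: (expR _) (`|u _ t| `^ _) => E F; field.
    by rewrite kn gt_eqF.
  over.
rewrite RintegralZl //; last first.
  apply: (le_integrableR measurableT (g := fun y => M `^ (p + 1) / (p + 1) * t `^ (k * (p + 1)) * expR (- 4^-1 * sqnorm y))).
  - apply: measurable_funM.
      apply: measurableT_comp => //; apply: measurable_funN.
      by apply: measurable_funM => //; exact: measurable_sqnorm.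
    under eq_fun do rewrite VE.
    apply: measurable_funM => //.
    have := measurable_affine_rV (Num.sqrt t) (0 : 'rV[R]_d).
    under eq_fun do rewrite addr0.
    move=> mA; exact: (measurableT_comp (measurable_powR _) (measurableT_comp (@normr_measurable R setT) (measurableT_comp mu' mA))).
  - move=> y _; rewrite normrM ger0_norm ?expR_ge0 // mulrC.
    have -> : expR (- (sqnorm y / 4)) = expR (- 4^-1 * sqnorm y) by congr expR; ring.
    rewrite ler_wpM2r ?expR_ge0 // VE normrM ger0_norm ?divr_ge0 ?powR_ge0 ?(ltW pp) //.
    rewrite ger0_norm ?powR_ge0 // mulrC mulrA [in leRHS]mulrAC ler_wpM2r ?invr_ge0 ?(ltW pp) //.
    rewrite ler_wpM2r ?powR_ge0 // ge0_ler_powR ?nnegrE ?(ltW pp) ?normr_ge0 //.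
      exact: le_trans (normr_ge0 _) (uM (Num.sqrt t *: y) t (TFt tT)).
    exact: uM (TFt tT).
  - by apply: integrableZR => //; apply: integrable_gauss_rV; rewrite invr_gt0.
rewrite ger0_norm ?(ltW q0) //.
have -> : Num.sqrt t ^+ d = t `^ (d%:R / 2).
  by rewrite -powR12_sqrt ?(ltW t0) // -powR_mulrn ?powR_ge0 // -powRrM mulrC.
have KE : t `^ (d%:R / 2) * K = c0 * (p + 1).
  (* A comparison of exponents: it amounts to [be + s = k (p + 1)], the boundary counterpart of the
     choice of [k]. *)
  have e : t `^ (d%:R / 2) * (t `^ (be + 1) / t `^ q) = t `^ (k * (p + 1)).
    rewrite -powRN -!powRD; try by apply/implyP => _; rewrite gt_eqF.
    congr (_ `^ _); rewrite -qE /k /be; field; by rewrite gt_eqF.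
  rewrite /K /C; set E := t `^ (be + 1) / t `^ q in e *.
  have -> : t `^ (d%:R / 2) * (c0 * E * (p + 1) / t `^ (k * (p + 1))) =
    c0 * (p + 1) * ((t `^ (d%:R / 2) * E) / t `^ (k * (p + 1))) by ring.
  by rewrite e divff // mulr1.
rewrite [t `^ _ * _]mulrA KE; move: (Rintegral _ _ _) => A.
by field; rewrite gt_eqF.
Qed.

Let calJE t : 0 < t < T -> calJ s p u t = c0 * energy a be (Defs.eta s) p V dV t.
Proof.
move=> tT; rewrite /calJ calJ_gradient // calJ_boundary // calJ_mass // /energy.
move: (\sum_i _) (Rintegral _ _ _) (ipw _ _ _ _ _) => A B E; ring.
Qed.

Lemma is_derive_calJ (t : R) : 0 < t < T ->
  is_derive t (1 : R) (calJ s p u) (c0 * (t * ipw (mu d.+1) H (gwt a) (Vd t) (Vd t))).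
Proof.
move=> tT; apply: near_eq_is_derive (is_derive_scalel c0 (is_derive_self_similar_energy tT)).
by apply: filterS (near_open_itv tT) => r rT; rewrite calJE.
Qed.

(** Undoes the scaling: the expression in the square is [D], and [t^(be+1) / t^be] accounts for the
    factor [t]. Being an equality in the extended reals, it also says that the dissipation is
    finite. *)
Lemma calJ_dissipation t : 0 < t < T ->
  (c0 * (t * ipw (mu d.+1) H (gwt a) (Vd t) (Vd t)))%:E =
  (\int[mu d.+1]_(X in H)
    (X 0 ord0 `^ a *
     (derive1 (U X) t + dotrv ((2 * t)^-1 *: X) (grad (U^~ t) X)
        + 2 * s / (p - 1) * (U X t / (2 * t))) ^+ 2 * calGs s p X t)%:E)%E.
Proof.
move=> tT; have [t0 _] := andP tT; have LD := L2D tT.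
transitivity (\int[mu d.+1]_(X in H) (X 0 ord0 `^ a * D X t ^+ 2 * calGs s p X t)%:E)%E; last first.
  apply: eq_integral => X /set_mem HX; congr EFin; congr (_ * _ ^+ 2 * _).
  rewrite /D /dilation derive1E; have [_ ->] := isUt tT HX.
  congr (_ + _ + _); last by rewrite /k /be; field; rewrite !gt_eqF.
  by rewrite /dotrv mulr_sumr; apply: eq_bigr => i _; rewrite !mxE mulrA.
have := Rintegral_integrand k t0 LD; rewrite (_ : 2 * k = be); last by rewrite /k; field.
move=> h; rewrite -(EFin_Rintegral mH (integrable_integrand t0 LD)) h.
rewrite powRS // -/Vd; congr EFin; move: (ipw _ _ _ _ _) => A; field.
by rewrite gt_eqF // powR_gt0.
Qed.

End self_similar_extension.

Theorem theorem5p3 (R : realType) (d : nat) (s p TF TI T : R)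
    (u : 'rV[R]_d -> R -> R) :
  (1 <= d)%N -> 0 < s < 1 -> 1 < p -> 0 < TF -> 0 < TI ->
  (exists2 eps : R, 0 < eps &
    parabolic_holder (2 * s + eps) (setT `*` [set` `]- TF, +oo[]) u) ->
  (forall x t, t \in `]- TF, TI[ ->
    backward_heat s u x t = `|u x t| `^ (p - 1) * u x t) ->
  [set` `[0, T]] `<=` [set` `]- TF, TI[] -> 0 < T ->
  class_U (1 - 2 * s) T (extension s u) ->
  let U := extension s u in
  {in `]0, T[ &, {homo calJ s p u : t1 t2 / t1 <= t2}} /\
  (forall t, t \in `]0, T[ ->
    derivable (calJ s p u) t 1 /\
    (derive1 (calJ s p u) t)%:E =
    (\int[lebesgue_rV d.+1]_(X in halfspace d)
      (X 0 ord0 `^ (1 - 2 * s) *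
       (derive1 (U X) t + dotrv ((2 * t)^-1 *: X) (grad (U^~ t) X)
          + 2 * s / (p - 1) * (U X t / (2 * t))) ^+ 2 *
       calGs s p X t)%:E)%E).
Proof.
move=> _ s01 p1 TF0 _ [eps eps0 hu] equ IT T0 hU U.
have TFn : - TF < 0 by rewrite oppr_lt0.
have equ' x t : 0 < t < T -> backward_heat s u x t = fpow p (u x t).
  move=> /andP[t0 tT]; apply: equ; have /= := IT t; apply.
  by rewrite in_itv /= (ltW t0) (ltW tT).
have [_ [_ [W cW WE]] _ _] := hU.
have dJ := is_derive_calJ s01 p1 eps0 hu equ' TFn hU cW WE.
have sJ := calJ_dissipation p1 hU.
have main t : 0 < t < T -> derivable (calJ s p u) t 1 /\
    (derive1 (calJ s p u) t)%:E =
    (\int[lebesgue_rV d.+1]_(X in halfspace d)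
      (X 0 ord0 `^ (1 - 2 * s) *
       (derive1 (U X) t + dotrv ((2 * t)^-1 *: X) (grad (U^~ t) X)
          + 2 * s / (p - 1) * (U X t / (2 * t))) ^+ 2 *
       calGs s p X t)%:E)%E.
  by move=> tT; have [e1 e2] := dJ t tT; split => //; rewrite derive1E e2 sJ.
split; last by move=> t; rewrite in_itv /=; exact: main.
have G0 : 0 <= ((4 * pi) `^ (d%:R / 2) * Gamma s)^-1 :> R.
  have [s0 _] := andP s01.
  by rewrite invr_ge0 mulr_ge0 ?powR_ge0 // ltW // Gamma_gt0.
move=> x y xT yT; apply: (@ger0_derive1_le_oo R (calJ s p u) 0 T) => //.
- by move=> t; rewrite in_itv /= => /main[].
- move=> t; rewrite in_itv /= => tT; have [e1 e2] := dJ t tT; rewrite derive1E e2.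
  rewrite mulr_ge0 // mulr_ge0 //; first by case/andP: tT => /ltW.
  by apply: ipw_ge0 => X _; exact: gwt_ge0.
- move=> t; rewrite inE /= in_itv /= => tT; have := dJ t tT; exact: derivable_cont.
Qed.
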